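(* Consider the single index model, the regularized M-estimator $\hat\beta$ and the observable quantities $\hat v,\hat r,\hat t^2$ defined in the context, with $\Sigma=\frac1nI_p$. Let $\delta>0$, $\kappa\ge1$, $\tau>0$ be constants independent of $n,p$. Assume: (a) $\frac{1}{2\delta}\le \frac pn\le\frac1\delta$; the rows of $X$ are iid $N(0,\Sigma)$ with $\|\Sigma\|_{op}\|\Sigma^{-1}\|_{op}\le\kappa$; $w^T\Sigma w=1$; $g$ is convex and, for every $y_0\in\mathcal Y$, $\ell_{y_0}$ is convex and continuously differentiable with $\ell_{y_0}'$ 1-Lipschitz. (b) $g(0)\le g(b)$ for all $b\in\mathbb R^p$; $(b-\tilde b)^T(d-\tilde d)\ge\tau\|\Sigma^{1/2}(b-\tilde b)\|^2$ for all $b,\tilde b\in\mathbb R^p$, $d\in\partial g(b)$, $\tilde d\in\partial g(\tilde b)$; and $\mathbb P(\ell_{y_i}'(0)=0)=0$. Assume that the penalty is separable, $g(b)=\frac1n\sum_{j=1}^pg_j(b_j)$ for convex functions $g_j:\mathbb R\to\mathbb R$. Then there exist $Z_j\sim N(0,1)$, $j=1,\dots,p$, such that $$\frac1p\sum_{j=1}^p\mathbb E\Bigl[\frac{\hat v^2}{\hat r^2}\Bigl|\hat\beta_j-\mathrm{prox}\Bigl[\frac1{\hat v}g_j\Bigr]\Bigl(\frac{\hat r}{\hat v}Z_j+\frac{\pm\hat t}{\hat v}w_j\Bigr)\Bigr|^2\Bigr]\le\frac{C(\delta,\tau,\kappa)}{\sqrt p},$$ where $\pm$ is the sign of $t_*=w^T(\mathrm{Tr}[V]\,\Sigma\hat\beta+X^T\hat\psi)/n$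 and $\hat t=\max(0,\hat t^2)^{1/2}$.
   Context: Model: $(x_i,U_i,y_i)_{i=1,\dots,n}$ are iid, $x_i\sim N(0,\Sigma)$ in $\mathbb R^p$, $U_i$ is a latent variable independent of $x_i$, and $y_i=F(x_i^Tw,U_i)$ for an unknown deterministic function $F:\mathbb R^2\to\mathbb R$ and an unknown nonrandom index $w\in\mathbb R^p$ with $w^T\Sigma w=1$. $\mathcal Y\subset\mathbb R$ is a set with $\mathbb P(y_i\in\mathcal Y)=1$. $X\in\mathbb R^{n\times p}$ has rows $x_i^T$ and entries $x_{ij}$; $y=(y_1,\dots,y_n)$. Estimator: for loss functions $\ell_{y_0}:\mathbb R\to\mathbb R$ ($y_0\in\mathcal Y$) and penalty $g:\mathbb R^p\to\mathbb R$, $\hat\beta=\hat\beta(y,X)=\mathrm{argmin}_{b\in\mathbb R^p}\frac1n\sum_{i=1}^n\ell_{y_i}(x_i^Tb)+g(b)$. Derivatives $\ell_{y_0}',\ell_{y_0}''$ are in the real argument (where they exist). $\partial g(b)$ is the subdifferential. For convex $f:\mathbb R\to\mathbb R$, $\mathrm{prox}[f](u)=\mathrm{argmin}_{v\in\mathbb R}(u-v)^2/2+f(v)$. Notation: $\hat\psi\in\mathbb R^n$ has components $\hat\psi_i=-\ell_{y_i}'(x_i^T\hat\beta)$; $D=\mathrm{diag}(\ell_{y_i}''(x_i^T\hat\beta))_{i\le n}$. Under (a)-(b), for fixed $y$ the map $X\mapsto\hat\beta(y,X)$ is differentiable almost everywhere, and $\hat A\in\mathbb R^{p\times p}$ denotes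 a matrix such that $\frac{\partial}{\partial x_{ij}}\hat\beta(y,X)=\hat A(e_j\hat\psi_i-X^TDe_i\hat\beta_j)$ for all $i,j$, $\|\Sigma^{1/2}\hat A\Sigma^{1/2}\|_{op}\le(n\tau)^{-1}$, and, with $V=D-DX\hat AX^TD$, $\hat{\mathsf{df}}=\mathrm{Tr}[X\hat AX^TD]$ and $\hat c=\frac1{n\tau}\|D^{1/2}X\Sigma^{-1/2}\|_{op}^2$: if $DX\hat\beta\ne\hat\psi$, then $0\le\hat{\mathsf{df}}\le n$ and $\mathrm{Tr}[D]/(1+\hat c)\le\mathrm{Tr}[V]\le\mathrm{Tr}[D]$; if $DX\hat\beta=\hat\psi$, then $-\hat c\le\hat{\mathsf{df}}\le n+\hat c$ and $-4\hat c+\mathrm{Tr}[D]/(1+\hat c)\le\mathrm{Tr}[V]\le\mathrm{Tr}[D]+4\hat c$ (such a matrix exists). Observable adjustments: $\hat v=\frac1n\mathrm{Tr}[V]$, $\hat r=(\frac1n\|\hat\psi\|^2)^{1/2}$, $\hat\gamma=\frac{\hat{\mathsf{df}}}{n\hat v}$, and (the symbol $\hat t^2$ denotes a scalar that may be negative) $$\hat t^2=\tfrac1{n^2}\|\Sigma^{-1/2}X^T\hat\psi\|^2+\tfrac{2\hat v}n\hat\psi^TX\hat\beta+\tfrac{\hat v^2}n\|X\hat\beta-\hat\gamma\hat\psi\|^2-\tfrac pn\hat r^2.$$ $C(\cdot)$ denotes a constant depending only on the listed arguments. *)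

(* Defs.v *)
From HB Require Import structures.
From mathcomp Require Import all_boot all_order all_algebra.
From mathcomp Require Import all_classical all_reals all_analysis.

Set Implicit Arguments.
Unset Strict Implicit.
Unset Printing Implicit Defensive.

Import Order.TTheory GRing.Theory Num.Theory.
Import numFieldNormedType.Exports.

Local Open Scope classical_set_scope.
Local Open Scope ring_scope.

Section LinearAlgebra.
Context {R : realType}.

(* Euclidean norm; the library norm on matrices is the sup norm. *)
Definition enorm m (v : 'cV[R]_m) : R := Num.sqrt (\sum_i v i 0 ^+ 2).

Definition opnorm m k (M : 'M[R]_(m, k)) : R :=
  sup [set enorm (M *m v) | v in [set v : 'cV[R]_k | enorm v <= 1]].

(* The symmetric positive semidefinite square root. *)
Definition sqrtmx m (M : 'M[R]_m) : 'M[R]_m :=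
  xget 0 [set S | [/\ S^T = S,
    (forall v : 'cV[R]_m, 0 <= (v^T *m S *m v) 0 0) & S *m S = M]].

End LinearAlgebra.

Section Convexity.
Context {R : realType}.

(* Value 0 when there is no minimizer. *)
Definition argmin (E : lmodType R) (f : E -> R) : E :=
  xget 0 [set b | forall b', f b <= f b'].

Definition convexT (E : lmodType R) (f : E -> R) : Prop :=
  convex_function [set: E] f.

Definition subdifferential m (g : 'cV[R]_m -> R) (b : 'cV[R]_m) :
    set 'cV[R]_m :=
  [set d | forall b', g b + (d^T *m (b' - b)) 0 0 <= g b'].

(* Only meaningful for convex f; the value is 0 for any other f, which can occur
   below when the curvature v of g_j / v is negative. *)
Definition prox (f : R -> R) (u : R) : R :=
  if `[< convexT (f : R^o -> R) >]
  then argmin (fun v : R^o => (u - v) ^+ 2 / 2 + f v) else 0.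

End Convexity.

Section Probability.
Context {R : realType} {d : measure_display} {Omega : measurableType d}.
Variable P : probability Omega R.

(* Equality of measures is only required on measurable sets. *)
Definition has_law d' (T : measurableType d') (f : Omega -> T)
    (mu : set T -> \bar R) : Prop :=
  forall B, measurable B -> P (f @^-1` B) = mu B.

Definition std_normal (f : Omega -> R) : Prop := has_law f (normal_prob 0 1).

Definition independent2 d1 d2 (T1 : measurableType d1) (T2 : measurableType d2)
    (f1 : Omega -> T1) (f2 : Omega -> T2) : Prop :=
  forall B1 B2, measurable B1 -> measurable B2 ->
    P (f1 @^-1` B1 `&` f2 @^-1` B2) = (P (f1 @^-1` B1) * P (f2 @^-1` B2))%E.

(* Taking some of the sets B i equal to setT gives the product rule for every
   subfamily. *)
Definition mutually_independent (I : finType) d' (T : measurableType d')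
    (f : I -> Omega -> T) : Prop :=
  forall B : I -> set T, (forall i, measurable (B i)) ->
    P (\bigcap_i (f i @^-1` B i)) = (\prod_i P (f i @^-1` B i))%E.

Definition iid (I : finType) d' (T : measurableType d')
    (f : I -> Omega -> T) : Prop :=
  mutually_independent f /\
  forall i i' B, measurable B -> P (f i @^-1` B) = P (f i' @^-1` B).

Definition tuple_col p (t : p.-tuple R) : 'cV[R]_p := \col_j tnth t j.

(* x ~ N(0, Sigma): x = Sigma^{1/2} z with z a standard Gaussian vector. *)
Definition gaussian_vector p (x : Omega -> p.-tuple R) (Sigma : 'M[R]_p) :
    Prop :=
  exists z : 'I_p -> {RV P >-> R},
    [/\ mutually_independent (fun k : 'I_p => z k : Omega -> R),
        (forall k, std_normal (z k)) &
        forall omega, tuple_col (x omega) =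
          sqrtmx Sigma *m (\col_k z k omega)].

(* Measurability of F is what makes y_i a function of the random pair
   (x_i^T w, U_i) as a random variable, and not just pointwise. *)
Record single_index_model n p (x : 'I_n -> {RV P >-> p.-tuple R})
    (U y : 'I_n -> {RV P >-> R}) (F : R -> R -> R) (w : 'cV[R]_p)
    (Sigma : 'M[R]_p) (Y : set R) : Prop := {
  sim_iid : iid (fun (i : 'I_n) omega => (x i omega, U i omega, y i omega)) ;
  sim_gaussian : forall i, gaussian_vector (x i) Sigma ;
  sim_latent : forall i, independent2 (x i) (U i) ;
  sim_link_measurable : measurable_fun setT (fun z : R * R => F z.1 z.2) ;
  sim_response : forall i omega,
    y i omega = F (((tuple_col (x i omega))^T *m w) 0 0) (U i omega) ;
  sim_index : (w^T *m Sigma *m w) 0 0 = 1 ;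
  sim_range_measurable : measurable Y ;
  sim_range : forall i, P (y i @^-1` Y) = 1%E }.

Definition design n p (x : 'I_n -> {RV P >-> p.-tuple R}) (omega : Omega) :
    'M[R]_(n, p) :=
  \matrix_(i, j) tnth (x i omega) j.

Definition response n (y : 'I_n -> {RV P >-> R}) (omega : Omega) : 'cV[R]_n :=
  \col_i y i omega.

End Probability.

Section Estimator.
Context {R : realType} {n p : nat}.
Variables (loss : R -> R -> R) (g : 'cV[R]_p -> R).
Implicit Types (y : 'cV[R]_n) (X : 'M[R]_(n, p)) (A : 'M[R]_p).

Definition betahat y X : 'cV[R]_p :=
  argmin (fun b => n%:R^-1 * \sum_i loss (y i 0) ((X *m b) i 0) + g b).

Definition psihat y X : 'cV[R]_n :=
  \col_i - derive1 (loss (y i 0)) ((X *m betahat y X) i 0).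

(* The library derivative is 0 at a point where there is no derivative, which
   fixes the diagonal entry where the second derivative of the loss does not
   exist. *)
Definition Dhat y X : 'M[R]_n :=
  diag_mx (\row_i derive1 (derive1 (loss (y i 0))) ((X *m betahat y X) i 0)).

Definition Vhat y X A : 'M[R]_n :=
  Dhat y X - Dhat y X *m X *m A *m X^T *m Dhat y X.

Definition dfhat y X A : R := \tr (X *m A *m X^T *m Dhat y X).

Definition chat (Sigma : 'M[R]_p) (tau : R) y X : R :=
  (n%:R * tau)^-1 *
  opnorm (sqrtmx (Dhat y X) *m X *m invmx (sqrtmx Sigma)) ^+ 2.

Record jacobian_matrix (Sigma : 'M[R]_p) (tau : R) y X A : Prop := {
  jac_differentiable : differentiable (betahat y) X ;
  jac_partial : forall i j, 'D_(delta_mx i j) (betahat y) X =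
    A *m (psihat y X i 0 *: delta_mx j 0
          - betahat y X j 0 *: (X^T *m Dhat y X *m delta_mx i 0)) ;
  jac_opnorm :
    opnorm (sqrtmx Sigma *m A *m sqrtmx Sigma) <= (n%:R * tau)^-1 ;
  jac_generic : Dhat y X *m X *m betahat y X != psihat y X ->
    [/\ 0 <= dfhat y X A, dfhat y X A <= n%:R,
        \tr (Dhat y X) / (1 + chat Sigma tau y X) <= \tr (Vhat y X A) &
        \tr (Vhat y X A) <= \tr (Dhat y X)] ;
  jac_degenerate : Dhat y X *m X *m betahat y X = psihat y X ->
    [/\ - chat Sigma tau y X <= dfhat y X A,
        dfhat y X A <= n%:R + chat Sigma tau y X,
        - 4 * chat Sigma tau y X + \tr (Dhat y X) / (1 + chat Sigma tau y X)
          <= \tr (Vhat y X A) &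
        \tr (Vhat y X A) <= \tr (Dhat y X) + 4 * chat Sigma tau y X] }.

Definition vhat y X A : R := n%:R^-1 * \tr (Vhat y X A).

Definition rhat y X : R := Num.sqrt (n%:R^-1 * enorm (psihat y X) ^+ 2).

Definition gammahat y X A : R := dfhat y X A / (n%:R * vhat y X A).

(* The scalar written t^2, which may be negative. *)
Definition that2 (Sigma : 'M[R]_p) y X A : R :=
  n%:R ^- 2 * enorm (invmx (sqrtmx Sigma) *m X^T *m psihat y X) ^+ 2
  + 2 * vhat y X A / n%:R * ((psihat y X)^T *m X *m betahat y X) 0 0
  + vhat y X A ^+ 2 / n%:R *
      enorm (X *m betahat y X - gammahat y X A *: psihat y X) ^+ 2
  - p%:R / n%:R * rhat y X ^+ 2.

Definition that (Sigma : 'M[R]_p) y X A : R :=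
  Num.sqrt (Num.max 0 (that2 Sigma y X A)).

Definition tstar (Sigma : 'M[R]_p) (w : 'cV[R]_p) y X A : R :=
  (w^T *m (\tr (Vhat y X A) *: (Sigma *m betahat y X)
           + X^T *m psihat y X)) 0 0 / n%:R.

(* Measurability in y0 of the loss makes betahat(y, X) a random vector. *)
Record loss_regular (Y : set R) : Prop := {
  loss_measurable : forall u, measurable_fun Y (fun y0 : R => loss y0 u) ;
  loss_convex : forall y0 : R, Y y0 -> convexT (loss y0 : R^o -> R) ;
  loss_derivable : forall y0 : R, Y y0 -> forall u, derivable (loss y0) u 1 ;
  loss_C1 : forall y0 : R, Y y0 -> continuous (derive1 (loss y0)) ;
  loss_lipschitz : forall y0 : R, Y y0 -> 1.-lipschitz (derive1 (loss y0)) }.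

Record penalty_regular (Sigma : 'M[R]_p) (tau : R) : Prop := {
  penalty_convex : convexT g ;
  penalty_min0 : forall b, g 0 <= g b ;
  penalty_strongly_convex : forall b b' dg dg',
    subdifferential g b dg -> subdifferential g b' dg' ->
    tau * enorm (sqrtmx Sigma *m (b - b')) ^+ 2
      <= ((b - b')^T *m (dg - dg')) 0 0 }.

End Estimator.

(* Main.v *)
(* The space is doubled: with w normalized, the design is X = (H Q + zeta w^T) / sqrt n
   where Q is the projection orthogonal to w, H is an n x p Gaussian matrix and
   (zeta, y) is independent of H; the second copy of the sample supplies the
   component of H along w. Shifting the entries of H therefore leaves the
   responses unchanged, and Gaussianity of H enters only as the Cameron-Martin
   formula for these shifts. It yields N(0, 1) laws of linear forms of a column of
   H whose coefficients do not depend on that column, almost everywhere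
   differentiability along entry lines, and a second order Stein inequality.

   Strong convexity makes f = psi / |psi| and theta, the rescaled betahat / |psi|,
   Lipschitz in H. The noise Z_j is the product of column j of H with f computed
   at the design whose column j is zeroed; it differs from entry j of
   sqrt n Q (X^T f + v theta) by errors of bounded total mean square. The optimality
   condition says that prox[g_j / v] sends betahat_j + (X^T psi)_j / v to
   betahat_j, so that for v > 0 nonexpansiveness of prox reduces the theorem to
   comparing that^2 with tstar^2. That difference is an exact combination of remainders R_1, ..., R_6, each
   of which is a Gaussian divergence and of order n^(-1/2) by the Stein inequality.
   When v < 0 the function g_j / v is not convex, prox is 0, and the coordinate
   error equals v^2 n theta_j^2, with v of order 1 / n. All constants are moments of
   a bound K on the operator norms of H / sqrt n and X. *)

Require Import Defs.
From HB Require Import structures.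
From mathcomp Require Import all_boot all_order all_algebra.
From mathcomp Require Import all_classical all_reals all_analysis measurable_realfun.
From mathcomp Require Import ring lra zify.

Set Implicit Arguments.
Unset Strict Implicit.
Unset Printing Implicit Defensive.

Import Order.TTheory GRing.Theory Num.Theory.
Import numFieldNormedType.Exports.

Local Open Scope classical_set_scope.
Local Open Scope ring_scope.

(** * Cameron-Martin flows *)

(** The Stein inequality bounds each remainder in mean only, while the remainders enter the
    difference of that^2 and tstar^2 with coefficients that are powers of K; the Hoelder inequality
    would require higher moments of the divergences. The way out is that K exceeds a constant k0 by
    an amount of order 1/n in mean, even when weighted by powers of K. Where K <= k0 + 1 the
    coefficients are bounded by constants; elsewhere a crude bound K^28 is paid for by the factor K
    - k0 >= 1. This is why the operator norms are bounded through a logarithm divided by n. The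
    noises Z_j are not independent of each other, so the concentration of their sum of squares is
    itself a consequence of the Stein inequality; it yields R_1. The Stein inequality is proved for
    finite shifts and passed to the limit with Fatou's lemma, so that derivatives are evaluated only
    at points where they exist, without integration by parts for Lipschitz maps. *)

Section GaussianFlow.
Context {R : realType}.
Local Notation leb := (@lebesgue_measure R).
Local Notation phi := (normal_pdf 0 1 : R -> R).

Lemma lebesgue_integral_shift (f : R -> \bar R) (a : R) :
  measurable_fun setT f -> (forall x, 0 <= f x)%E ->
  (\int[leb]_x f (x + a)%R = \int[leb]_x f x)%E.
Proof.
move=> mf f0.
have ma : measurable_fun setT ((fun x => x + a) : R -> measurableTypeR R).
  exact: measurable_funD.
transitivity (\int[pushforward leb ((fun x => x + a)%R : R -> measurableTypeR R)]_x f x)%E.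
  by rewrite ge0_integral_pushforward.
apply: eq_measure_integral => A mA _; apply/esym/lebesgue_measure_unique => //=.
move=> _ [[u v]] _ <-; rewrite /pushforward.
rewrite (_ : _ @^-1` _ = `]u - a, v - a]%classic); last first.
  by apply/seteqP; split=> x; rewrite /= !in_itv /= ltrBlDr lerBrDr.
rewrite !lebesgue_measure_itv /= !lte_fin ltrD2r; case: ifP => // _.
by rewrite -!EFinB; congr (_%:E); lra.
Qed.

Lemma normal_pdf01E (x : R) :
  normal_pdf 0 1 x = normal_peak 1 * expR (- (x ^+ 2 / 2)).
Proof.
rewrite normal_pdfE // /normal_fun; congr (_ * expR _).
by rewrite subr0 expr1n mulr2n; lra.
Qed.

Lemma normal_pdf01N (x : R) : phi (- x) = phi x.
Proof. by rewrite !normal_pdf01E sqrrN. Qed.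

Lemma normal_pdf01_shift (x u : R) :
  phi (x - u) = phi x * expR (u * x - u ^+ 2 / 2).
Proof.
rewrite !normal_pdf01E -[RHS]mulrA -expRD; congr (_ * expR _); lra.
Qed.

Context {d : measure_display} {T : measurableType d} (mu : probability T R).

(** The Gaussian law of [Z] is not a field: it follows from the Cameron-Martin formula
    ([gflow_law]), and this formulation is stable under passing to random directions
    ([gfield_direction]). *)
Record gflow (tau : R -> T -> T) (Z : T -> R) : Prop := {
  gflow_meas : measurable_fun setT (fun z : R * T => tau z.1 z.2) ;
  gflow_measZ : measurable_fun setT Z ;
  gflow_Z : forall s t, Z (tau s t) = Z t + s ;
  gflow_0 : forall t, tau 0 t = t ;
  gflow_add : forall s r t, tau s (tau r t) = tau (s + r) t ;
  gflow_CM : forall s (f : T -> \bar R), measurable_fun setT f ->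
    (forall t, 0 <= f t)%E ->
    (\int[mu]_t f (tau s t) =
     \int[mu]_t (f t * (expR (s * Z t - s ^+ 2 / 2)%R)%:E))%E }.

Variables (tau : R -> T -> T) (Z : T -> R).
Hypothesis flow : gflow tau Z.

Let mphi : measurable_fun setT phi.
Proof. exact: measurable_normal_pdf. Qed.

Lemma measurable_flow d' (T' : measurableType d') (u : T' -> R) (f : T' -> T) :
  measurable_fun setT u -> measurable_fun setT f ->
  measurable_fun setT (fun t => tau (u t) (f t)).
Proof.
move=> mu' mf.
exact: (measurableT_comp (gflow_meas flow) (measurable_fun_pair mu' mf)).
Qed.

(* Integrate the Cameron-Martin identity for f * phi(Z) over all shifts s with
   respect to Lebesgue measure, using phi(z) e^{sz - s^2/2} = phi(z - s). *)
Lemma gflow_resample (f : T -> \bar R) :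
  measurable_fun setT f -> (forall t, 0 <= f t)%E ->
  (\int[mu]_t f t =
   \int[mu]_t \int[leb]_x (f (tau (x - Z t)%R t) * (phi x)%:E))%E.
Proof.
move=> mf f0.
have mZ := gflow_measZ flow.
have phi0 x : (0 <= (phi x)%:E)%E by rewrite lee_fin normal_pdf_ge0.
pose F (z : T * R) := (f (tau z.2 z.1) * (phi (Z z.1 + z.2)%R)%:E)%E.
have mF : measurable_fun setT F.
  apply: emeasurable_funM.
    by apply: (measurableT_comp mf); apply: measurable_flow.
  apply/measurable_EFinP; apply: (measurableT_comp mphi).
  by apply: measurable_funD => //; apply: (measurableT_comp mZ).
have F0 z : (0 <= F z)%E by rewrite mule_ge0.
transitivity (\int[mu]_t \int[leb]_s F (t, s))%E; last first.
  apply: eq_integral => t _.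
  have mFt : measurable_fun setT (fun s : R => F (t, s)).
    exact: (measurableT_comp mF (measurable_fun_pair (measurable_cst t) (@measurable_id _ R setT))).
  refine (etrans (esym (lebesgue_integral_shift (- Z t) mFt (fun s => F0 (t, s)))) _).
  by apply: eq_integral => x _; rewrite /F /=; congr (_ * (phi _)%:E)%E; lra.
rewrite (@fubini_tonelli _ _ _ _ _ mu leb F mF F0) /fubini_G.
pose G (z : T * R) := (f z.1 * (phi (Z z.1 - z.2)%R)%:E)%E.
have mG : measurable_fun setT G.
  apply: emeasurable_funM; first by apply: (measurableT_comp mf).
  apply/measurable_EFinP; apply: (measurableT_comp mphi).
  by apply: measurable_funB => //; apply: (measurableT_comp mZ).
have G0 z : (0 <= G z)%E by rewrite mule_ge0.
transitivity (\int[leb]_s \int[mu]_t G (t, s))%E; last first.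
  apply: eq_integral => s _.
  have := @gflow_CM _ _ flow s (fun t => f t * (phi (Z t))%:E)%E.
  rewrite /F /=.
  under [in X in X -> _]eq_integral do rewrite (gflow_Z flow).
  move=> ->.
  - by apply: eq_integral => t _; rewrite -muleA -EFinM /G /= normal_pdf01_shift.
  - apply: emeasurable_funM => //; apply/measurable_EFinP.
    by apply: (measurableT_comp mphi).
  - by move=> t; rewrite mule_ge0.
rewrite -(@fubini_tonelli _ _ _ _ _ mu leb G mG G0) /fubini_F.
apply: eq_integral => t _; rewrite /G /=.
have mshift (a : R) : measurable_fun setT (fun x : R => (phi (a - x)%R)%:E).
  by apply/measurable_EFinP; apply: (measurableT_comp mphi); exact: measurable_funB.
rewrite ge0_integralZl //; last exact: mshift.
suff -> : (\int[leb]_x (phi (Z t - x))%:E = 1)%E by rewrite mule1.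
under eq_integral do rewrite -normal_pdf01N opprB.
have := @lebesgue_integral_shift (fun x => (phi x)%:E) (- Z t).
move=> -> //; first exact: integral_normal_pdf.
  exact/measurable_EFinP.
Qed.

(** Resampling puts the coordinate [Z] at [x], so the indicator of [Z] in [B] becomes that of [x] in
    [B] and no longer depends on [t]. *)
Lemma gflow_law (B : set R) : measurable B ->
  mu (Z @^-1` B) = normal_prob 0 1 B.
Proof.
move=> mB; have mZ := gflow_measZ flow.
have mZB : measurable (Z @^-1` B) by rewrite -[X in measurable X]setTI; exact: mZ.
have mf : measurable_fun setT (fun t => (\1_(Z @^-1` B) t)%:E : \bar R).
  by apply/measurable_EFinP; exact: measurable_indic.
have f0 t : (0 <= (\1_(Z @^-1` B) t : R)%:E)%E by rewrite lee_fin.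
have := gflow_resample mf f0.
rewrite integral_indic // setIT => ->.
transitivity (\int[mu]_t (normal_prob 0 1 B))%E; last first.
  rewrite integral_cst //.
  by rewrite [X in (_ * X)%E]probability_setT mule1.
apply: eq_integral => t _.
rewrite /normal_prob [RHS]integral_mkcond; apply: eq_integral => x _.
rewrite patchE indicE.
rewrite (_ : (_ \in Z @^-1` B) = (x \in B)); last first.
  by apply/idP/idP; rewrite !inE /preimage /= (gflow_Z flow) addrC subrK.
by case: ifP => _; rewrite ?mul1e ?mul0e.
Qed.

(** Resampling writes the measure of [N] as an average of Gaussian masses of its sections by the
    orbits. Statements true almost everywhere on the real line are lifted to the whole space in this
    way. *)
Lemma gflow_null (N : set T) : measurable N ->
  (forall t, leb [set x | N (tau x t)] = 0%E) -> mu N = 0%E.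
Proof.
move=> mN N0.
have mf : measurable_fun setT (fun t => (\1_N t)%:E : \bar R).
  by apply/measurable_EFinP; exact: measurable_indic.
have f0 t : (0 <= (\1_N t : R)%:E)%E by rewrite lee_fin.
have := gflow_resample mf f0.
rewrite integral_indic // setIT => ->.
apply: integral0_eq => t _.
have mt : measurable_fun setT (fun x : R => tau x t) by exact: measurable_flow.
have mNt : measurable [set x | N (tau x t)].
  by rewrite -[X in measurable X]setTI; exact: mt.
rewrite -(@lebesgue_integral_shift (fun x => (\1_N (tau (x - Z t)%R t))%:E * (phi x)%:E)%E (Z t)); last 2 first.
- apply: emeasurable_funM; apply/measurable_EFinP => //.
  have mg : measurable_fun setT (fun x : R => tau (x - Z t) t).
    by apply: measurable_flow => //; exact: measurable_funB.
  exact: (measurableT_comp (measurable_indic mN) mg).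
- by move=> x; rewrite mule_ge0 ?lee_fin ?normal_pdf_ge0.
transitivity (\int[leb]_(x in [set x | N (tau x t)]) (phi (x + Z t)%R)%:E)%E.
  rewrite [RHS]integral_mkcond; apply: eq_integral => x _.
  rewrite patchE indicE addrK (_ : (tau x t \in N) = (x \in [set x | N (tau x t)])).
    by case: ifP => _; rewrite ?mul1e ?mul0e.
  by apply/idP/idP; rewrite !inE.
apply: null_set_integral => //; last exact: N0.
apply/measurable_EFinP; apply: measurable_funTS.
by apply: (measurableT_comp mphi); exact: measurable_funD.
Qed.

(* The shift may be random as long as it is constant along the flow. *)
Lemma gflow_random_shift (u : T -> R) (f : T -> \bar R) :
  measurable_fun setT u -> (forall s t, u (tau s t) = u t) ->
  measurable_fun setT f -> (forall t, 0 <= f t)%E ->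
  (\int[mu]_t f (tau (u t) t) =
   \int[mu]_t (f t * (expR (u t * Z t - u t ^+ 2 / 2)%R)%:E))%E.
Proof.
move=> mu' uinv mf f0; have mZ := gflow_measZ flow.
rewrite gflow_resample //; last first.
  by apply: (measurableT_comp mf); exact: measurable_flow.
set rhs := (X in _ = X); rewrite {}/rhs (gflow_resample (f := fun t => (f t * (expR (u t * Z t - u t ^+ 2 / 2)%R)%:E)%E)) //; last 2 first.
- apply: emeasurable_funM => //; apply/measurable_EFinP.
  apply: measurableT_comp => //; apply: measurable_funB.
    exact: measurable_funM.
  by apply: measurable_funM => //; exact: measurable_funX.
- by move=> t; rewrite mule_ge0 // lee_fin expR_ge0.
apply: eq_integral => t _.
have mg : measurable_fun setT (fun x : R => tau (x - Z t) t).
  by apply: measurable_flow => //; exact: measurable_funB.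
pose k (x : R) := (f (tau (x - Z t)%R t) *
  (expR (u (tau (x - Z t)%R t) * Z (tau (x - Z t)%R t)
         - u (tau (x - Z t)%R t) ^+ 2 / 2)%R)%:E * (phi x)%:E)%E.
have mk : measurable_fun setT k.
  apply: emeasurable_funM; last by apply/measurable_EFinP.
  apply: emeasurable_funM; first exact: (measurableT_comp mf mg).
  have mug := measurableT_comp mu' mg.
  apply/measurable_EFinP; apply: measurableT_comp => //; apply: measurable_funB.
    by apply: measurable_funM => //; exact: (measurableT_comp mZ mg).
  by apply: measurable_funM => //; exact: measurable_funX.
have k0 x : (0 <= k x)%E by rewrite /k !mule_ge0 // lee_fin ?expR_ge0 ?normal_pdf_ge0.
(* Both sides are now integrals over one orbit, where [u] is constant; translating [x] by [u t]
   matches them. *)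
refine (etrans _ (lebesgue_integral_shift (u t) mk k0)).
apply: eq_integral => x _.
rewrite /k !uinv (gflow_Z flow) (gflow_add flow) -muleA -EFinM.
congr (f (tau _ _) * (_%:E))%E; first by lra.
rewrite -[in LHS](addrK (u t) x) normal_pdf01_shift mulrC; congr (expR _ * _).
lra.
Qed.

End GaussianFlow.

(** * Commuting families of flows *)

Section GaussianField.
Context {R : realType} {d : measure_display} {T : measurableType d}.
Variables (mu : probability T R) (I : finType).

Record gfield (th : I -> R -> T -> T) (H : I -> T -> R) : Prop := {
  gfield_flow : forall k, gflow mu (th k) (H k) ;
  gfield_H : forall k l s t, H l (th k s t) = H l t + (l == k)%:R * s ;
  gfield_comm : forall k l s r t, th k s (th l r t) = th l r (th k s t) }.

Variables (th : I -> R -> T -> T) (H : I -> T -> R).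
Hypothesis field : gfield th H.

Definition shiftv (r : seq I) (u : I -> R) (t : T) : T :=
  foldr (fun k => th k (u k)) t r.

Lemma measurable_shiftv d' (T' : measurableType d') (r : seq I)
    (u : I -> T' -> R) (f : T' -> T) :
  (forall k, measurable_fun setT (u k)) -> measurable_fun setT f ->
  measurable_fun setT (fun t => shiftv r (u ^~ t) (f t)).
Proof.
move=> mu' mf; elim: r => [|k r IH] //=.
exact: (measurable_flow (gfield_flow field k)).
Qed.

Lemma shiftv_H (r : seq I) u t l : uniq r ->
  H l (shiftv r u t) = H l t + (l \in r)%:R * u l.
Proof.
elim: r => [|k r IH] /=; first by rewrite mul0r addr0.
move=> /andP[kr ur]; rewrite (gfield_H field) (IH ur) in_cons.
have [->|lk] := eqVneq l k; last by rewrite mul0r addr0.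
by rewrite (negbTE kr) mul0r addr0 mul1r.
Qed.

Lemma shiftv_th (r : seq I) u t k s :
  shiftv r u (th k s t) = th k s (shiftv r u t).
Proof. by elim: r => //= l r ->; rewrite (gfield_comm field). Qed.

Lemma shiftv_add (r : seq I) u v t :
  shiftv r u (shiftv r v t) = shiftv r (fun k => u k + v k) t.
Proof.
elim: r => //= k r IH.
by rewrite shiftv_th IH (gflow_add (gfield_flow field k)).
Qed.

Lemma shiftv_inv (X : Type) (h : T -> X) (r : seq I) u t :
  (forall k s t, k \in r -> h (th k s t) = h t) -> h (shiftv r u t) = h t.
Proof.
elim: r => //= k r IH hinv; rewrite hinv ?mem_head //.
by apply: IH => l s t' lr; apply: hinv; rewrite in_cons lr orbT.
Qed.

(** Induction on [r]: every [u l] is constant along the directions of [r], so the densities of the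
    successive shifts multiply. *)
Lemma gfield_random_shift (r : seq I) (u : I -> T -> R) (f : T -> \bar R) :
  uniq r -> (forall k, measurable_fun setT (u k)) ->
  (forall k l s t, k \in r -> u l (th k s t) = u l t) ->
  measurable_fun setT f -> (forall t, 0 <= f t)%E ->
  (\int[mu]_t f (shiftv r (u ^~ t) t) =
   \int[mu]_t (f t *
     (expR (\sum_(k <- r) (u k t * H k t - u k t ^+ 2 / 2))%R)%:E))%E.
Proof.
move=> + mu'; elim: r f => [|k r IH] f /=.
  by move=> _ _ mf f0; apply: eq_integral => t _; rewrite big_nil expR0 mule1.
move=> /andP[kr ur] uinv mf f0.
have fk := gfield_flow field k.
have uinvr l m s t : l \in r -> u m (th l s t) = u m t.
  by move=> lr; apply: uinv; rewrite in_cons lr orbT.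
pose f1 t := f (th k (u k t) t).
have mf1 : measurable_fun setT f1.
  by apply: (measurableT_comp mf); apply: (measurable_flow fk).
transitivity (\int[mu]_t f1 (shiftv r (u ^~ t) t))%E.
  apply: eq_integral => t _; rewrite /f1 /=.
  by rewrite (@shiftv_inv _ (u k)) // => l s t' lr; apply: uinvr.
refine (etrans (IH f1 ur uinvr mf1 (fun t => f0 _)) _).
pose E t := expR (\sum_(l <- r) (u l t * H l t - u l t ^+ 2 / 2)).
have mE : measurable_fun setT E.
  apply: measurableT_comp => //; apply: measurable_sum => l.
  apply: measurable_funB; first apply: measurable_funM => //.
    exact: (gflow_measZ (gfield_flow field l)).
  by apply: measurable_funM => //; exact: measurable_funX.
have mfE : measurable_fun setT (fun t => f t * (E t)%:E)%E.
  by apply: emeasurable_funM => //; exact/measurable_EFinP.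
have fE0 t : (0 <= f t * (E t)%:E)%E by rewrite mule_ge0 // lee_fin expR_ge0.
transitivity (\int[mu]_t (fun t => f t * (E t)%:E)%E (th k (u k t) t))%E.
  apply: eq_integral => t _; rewrite /f1 /E; congr (_ * (expR _)%:E)%E.
  apply: eq_big_seq => l lr; rewrite !uinv ?mem_head // (gfield_H field).
  by case: eqP => [lk|_]; [move: kr; rewrite -lk lr | rewrite mul0r addr0].
have uinvk s t : u k (th k s t) = u k t by apply: uinv; rewrite mem_head.
refine (etrans (gflow_random_shift fk (mu' k) uinvk mfE fE0) _).
apply: eq_integral => t _; rewrite big_cons -muleA -EFinM.
by rewrite /E -expRD addrC.
Qed.

(** Because [a] is constant along the orbit, the exponents add up to those of a single flow: the
    linear terms give [s] times the linear form, and the unit norm turns the quadratic terms into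
    s^2/2. *)
Lemma gfield_direction (r : seq I) (a : I -> T -> R) :
  uniq r -> (forall k, measurable_fun setT (a k)) ->
  (forall k l s t, k \in r -> a l (th k s t) = a l t) ->
  (forall t, \sum_(k <- r) a k t ^+ 2 = 1) ->
  gflow mu (fun s t => shiftv r (fun k => s * a k t) t)
           (fun t => \sum_(k <- r) a k t * H k t).
Proof.
move=> ur ma ainv a1.
have mH k : measurable_fun setT (H k) := gflow_measZ (gfield_flow field k).
have ainv' l u t : a l (shiftv r u t) = a l t.
  by apply: shiftv_inv => k s t' kr; apply: ainv.
split.
- apply: (@measurable_shiftv _ _ r (fun k (z : R * T) => z.1 * a k z.2)) => //.
  by move=> k; apply: measurable_funM => //; exact: (measurableT_comp (ma k)).
- by apply: measurable_sum => k; exact: measurable_funM.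
- move=> s t; under eq_big_seq => k kr do
    rewrite ainv' shiftv_H // kr mul1r mulrDr mulrCA -expr2.
  by rewrite big_split /= -mulr_sumr a1 mulr1.
- move=> t; have : forall k, k \in r -> 0 * a k t = 0 by move=> k _; rewrite mul0r.
  elim: (r) => //= k r' IH a0; rewrite a0 ?mem_head //.
  rewrite (gflow_0 (gfield_flow field k)) IH // => l lr.
  by apply: a0; rewrite in_cons lr orbT.
- move=> s r' t; transitivity (shiftv r (fun k => s * a k t)
    (shiftv r (fun k => r' * a k t) t)).
    by congr (shiftv r _ _); apply/funext => k; rewrite ainv'.
  by rewrite shiftv_add; congr (shiftv r _ _); apply/funext => k; rewrite mulrDl.
- move=> s f mf f0.
  refine (etrans (@gfield_random_shift r (fun k t => s * a k t) f ur _ _ mf f0) _).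
  + by move=> k; exact: measurable_funM.
  + by move=> k l s' t kr; rewrite ainv.
  apply: eq_integral => t _; congr (_ * (expR _)%:E)%E.
  under eq_bigr do rewrite exprMn -mulrA -[_ * _ / _]mulrA.
  rewrite sumrB -mulr_sumr -mulr_sumr -mulr_suml a1.
  by congr (_ - _); rewrite mul1r.
Qed.

End GaussianField.

(** * The second order Stein inequality *)

Section SquareIntegrable.
Context {R : realType} {d : measure_display} {T : measurableType d}.
Variable mu : probability T R.

Definition sqint (f : T -> R) : Prop :=
  measurable_fun setT f /\ (\int[mu]_t (f t ^+ 2)%:E < +oo)%E.

Definition ip (f g : T -> R) : R := fine (\int[mu]_t (f t * g t)%:E)%E.

Lemma sqint_integrable_sqr f : sqint f ->
  mu.-integrable setT (fun t => (f t ^+ 2)%:E).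
Proof.
move=> [mf fi]; apply/integrableP; split.
  by apply/measurable_EFinP; exact: measurable_funX.
rewrite (eq_integral (fun t => (f t ^+ 2)%:E)) // => t _.
by rewrite /= ger0_norm // sqr_ge0.
Qed.

Lemma sqint_integrable f g : sqint f -> sqint g ->
  mu.-integrable setT (fun t => (f t * g t)%:E).
Proof.
move=> sf sg.
have := integrableD measurableT (sqint_integrable_sqr sf) (sqint_integrable_sqr sg).
apply: le_integrable => //.
  by apply/measurable_EFinP; apply: measurable_funM; [case: sf|case: sg].
move=> t _; rewrite /= lee_fin normrM [leRHS]ger0_norm ?addr_ge0 ?sqr_ge0 //.
rewrite -(real_normK (num_real (f t))) -(real_normK (num_real (g t))).
have := sqr_ge0 (`|f t| - `|g t|); have := normr_ge0 (f t); have := normr_ge0 (g t).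
nra.
Qed.

Lemma sqintD f g : sqint f -> sqint g -> sqint (fun t => f t + g t).
Proof.
move=> sf sg; split; first by apply: measurable_funD; [case: sf|case: sg].
have := integrableD measurableT (integrableD measurableT (sqint_integrable_sqr sf)
  (sqint_integrable_sqr sf))
  (integrableD measurableT (sqint_integrable_sqr sg) (sqint_integrable_sqr sg)).
move=> h; apply: (@integrable_lty _ _ _ mu setT) => //.
apply: le_integrable h => //.
  apply/measurable_EFinP; apply: measurable_funX.
  by apply: measurable_funD; [case: sf|case: sg].
move=> t _; rewrite /= lee_fin !ger0_norm ?addr_ge0 ?sqr_ge0 //.
by have := sqr_ge0 (f t - g t); nra.
Qed.

Lemma sqintN f : sqint f -> sqint (fun t => - f t).
Proof.
move=> [mf fi]; split; first exact: measurableT_comp.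
by under eq_integral do rewrite sqrrN.
Qed.

Lemma sqintB f g : sqint f -> sqint g -> sqint (fun t => f t - g t).
Proof. by move=> sf sg; apply: sqintD => //; exact: sqintN. Qed.

Lemma sqint_sum (I : eqType) (r : seq I) (f : I -> T -> R) :
  (forall k, k \in r -> sqint (f k)) -> sqint (fun t => \sum_(k <- r) f k t).
Proof.
elim: r => [|k r IH] sf.
  rewrite (_ : (fun _ => _) = cst 0); last by apply/funext => t; rewrite big_nil.
  by split => //; under eq_integral do rewrite expr0n; rewrite integral0 ltry.
rewrite (_ : (fun _ => _) = (fun t => f k t + \sum_(k <- r) f k t)).
  apply: sqintD; first by apply: sf; rewrite mem_head.
  by apply: IH => l lr; apply: sf; rewrite in_cons lr orbT.
by apply/funext => t; rewrite big_cons.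
Qed.

Lemma ipC f g : ip f g = ip g f.
Proof. by rewrite /ip; under eq_integral do rewrite mulrC. Qed.

Lemma ipDl f g h : sqint f -> sqint g -> sqint h ->
  ip (fun t => f t + g t) h = ip f h + ip g h.
Proof.
move=> sf sg sh; rewrite /ip -fineD; last 2 first.
- by apply: integrable_fin_num => //; exact: sqint_integrable.
- by apply: integrable_fin_num => //; exact: sqint_integrable.
rewrite -integralD_EFin //; last 2 first.
- exact: sqint_integrable.
- exact: sqint_integrable.
by congr fine; apply: eq_integral => t _; rewrite /= -EFinD mulrDl.
Qed.

Lemma ipNl f h : sqint f -> sqint h -> ip (fun t => - f t) h = - ip f h.
Proof.
move=> sf sh; apply/eqP; rewrite -addr_eq0 -ipDl //; last exact: sqintN.
rewrite /ip; under eq_integral do rewrite addNr mul0r.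
by rewrite integral0.
Qed.

Lemma ipBl f g h : sqint f -> sqint g -> sqint h ->
  ip (fun t => f t - g t) h = ip f h - ip g h.
Proof. by move=> sf sg sh; rewrite ipDl ?ipNl //; exact: sqintN. Qed.

Lemma ipBr f g h : sqint f -> sqint g -> sqint h ->
  ip h (fun t => f t - g t) = ip h f - ip h g.
Proof. by move=> sf sg sh; rewrite ipC ipBl // ![ip _ h]ipC. Qed.

Lemma ipBB f g h k : sqint f -> sqint g -> sqint h -> sqint k ->
  ip (fun t => f t - g t) (fun t => h t - k t) =
  ip f h - ip f k - ip g h + ip g k.
Proof.
move=> sf sg sh sk; rewrite ipBl //; last exact: sqintB.
rewrite !ipBr //; ring.
Qed.

Lemma ip_suml (I : eqType) (r : seq I) (f : I -> T -> R) h :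
  (forall k, k \in r -> sqint (f k)) -> sqint h ->
  ip (fun t => \sum_(k <- r) f k t) h = \sum_(k <- r) ip (f k) h.
Proof.
move=> + sh; elim: r => [|k r IH] sf.
  rewrite big_nil /ip; under eq_integral do rewrite big_nil mul0r.
  by rewrite integral0.
have sk : sqint (f k) by apply: sf; rewrite mem_head.
have sr l : l \in r -> sqint (f l) by move=> lr; apply: sf; rewrite in_cons lr orbT.
rewrite big_cons -IH // -ipDl //; last exact: sqint_sum.
by rewrite /ip; under eq_integral do rewrite big_cons.
Qed.

Lemma ip_ge0 f : 0 <= ip f f.
Proof.
by apply/fine_ge0/integral_ge0 => t _; rewrite lee_fin -expr2 sqr_ge0.
Qed.

Lemma ip_mean f g : sqint f -> sqint g -> ip f g <= (ip f f + ip g g) / 2.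
Proof.
move=> sf sg; have sfg := sqintB sf sg; have := ip_ge0 (fun t => f t - g t).
rewrite ipBl // !ipBr // (ipC g f); lra.
Qed.

Lemma EFin_ip f : sqint f -> ((ip f f)%:E = \int[mu]_t (f t ^+ 2)%:E)%E.
Proof.
move=> sf; rewrite /ip fineK //.
apply: integrable_fin_num => //; exact: sqint_integrable.
Qed.

End SquareIntegrable.

(** * The Stein inequality for finite shifts *)

Section SteinDifference.
Context {R : realType} {d : measure_display} {T : measurableType d}.
Variables (mu : probability T R) (I : finType).
Variables (th : I -> R -> T -> T) (H : I -> T -> R).
Hypothesis field : gfield mu th H.

Let mth k s : measurable_fun setT (th k s).
Proof. exact: (measurable_flow (gfield_flow field k)). Qed.

Definition cmweight k s t : R := expR (s * H k t - s ^+ 2 / 2).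

Lemma measurable_cmweight k s : measurable_fun setT (cmweight k s).
Proof.
apply: measurableT_comp => //; apply: measurable_funB => //.
by apply: measurable_funM => //; exact: (gflow_measZ (gfield_flow field k)).
Qed.

Lemma gfield_CM k s (f : T -> R) : measurable_fun setT f ->
  (\int[mu]_t (f (th k s t))%:E = \int[mu]_t (f t * cmweight k s t)%:E)%E.
Proof.
move=> mf.
have w0 t : 0 <= cmweight k s t by exact: expR_ge0.
have mEf : measurable_fun setT (EFin \o f) by exact/measurable_EFinP.
rewrite integralE [RHS]integralE; congr (_ - _)%E.
- transitivity (\int[mu]_t (EFin \o f)^\+ (th k s t))%E.
    by apply: eq_integral => t _; rewrite !funepos.unlock.
  refine (etrans (gflow_CM (gfield_flow field k) s
    (measurable_funepos mEf) (fun t => funepos_ge0 _ _)) _).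
  apply: eq_integral => t _; rewrite !funepos.unlock /= EFinM.
  by rewrite -!EFin_max -EFinM maxr_pMl ?mul0r //; exact: w0.
- transitivity (\int[mu]_t (EFin \o f)^\- (th k s t))%E.
    by apply: eq_integral => t _; rewrite !funeneg.unlock.
  refine (etrans (gflow_CM (gfield_flow field k) s
    (measurable_funeneg mEf) (fun t => funeneg_ge0 _ _)) _).
  apply: eq_integral => t _; rewrite !funeneg.unlock /=.
  by rewrite -!EFin_max -EFinM maxr_pMl ?mul0r ?mulNr //; exact: w0.
Qed.

(* The Gaussian adjoint of f |-> f \o th k s. *)
Definition cmadj k s (f : T -> R) t : R := f (th k (- s) t) * cmweight k s t.

Lemma measurable_cmadj k s f : measurable_fun setT f ->
  measurable_fun setT (cmadj k s f).
Proof.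
move=> mf; apply: measurable_funM; last exact: measurable_cmweight.
exact: (measurableT_comp mf (mth k (- s))).
Qed.

Let thK k s t : th k (- s) (th k s t) = th k 0 t.
Proof. by rewrite (gflow_add (gfield_flow field k)) addNr. Qed.

Let th0 k t : th k 0 t = t.
Proof. exact: (gflow_0 (gfield_flow field k)). Qed.

Lemma cmadj_ip k s f g : measurable_fun setT f -> measurable_fun setT g ->
  ip mu (cmadj k s f) g = ip mu f (g \o th k s).
Proof.
move=> mf mg; rewrite /ip /cmadj.
have mfg : measurable_fun setT (fun t => f (th k (- s) t) * g t).
  by apply: measurable_funM => //; exact: (measurableT_comp mf (mth k (- s))).
under eq_integral do rewrite mulrAC.
rewrite -(gfield_CM _ _ mfg); congr fine; apply: eq_integral => t _ /=.
by rewrite thK th0.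
Qed.

Lemma cmweight_th k s t : cmweight k s (th k s t) = expR (s ^+ 2) * cmweight k s t.
Proof.
rewrite /cmweight (gfield_H field) eqxx mul1r -expRD; congr expR; lra.
Qed.

Lemma cmadj_sqr k s f : measurable_fun setT f ->
  (\int[mu]_t (cmadj k s f t ^+ 2)%:E =
   (expR (s ^+ 2))%:E * \int[mu]_t (f (th k s t) ^+ 2)%:E)%E.
Proof.
move=> mf.
have mf2 : measurable_fun setT (fun t => f (th k (- s) t) ^+ 2 * cmweight k s t).
  apply: measurable_funM; last exact: measurable_cmweight.
  by apply: measurable_funX; exact: (measurableT_comp mf (mth k (- s))).
transitivity (\int[mu]_t (f (th k (- s) t) ^+ 2 * cmweight k s t * cmweight k s t)%:E)%E.
  by apply: eq_integral => t _; rewrite /cmadj exprMn -mulrA -expr2.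
rewrite -(gfield_CM k s mf2).
transitivity (\int[mu]_t ((expR (s ^+ 2))%:E * (f t ^+ 2 * cmweight k s t)%:E))%E.
  by apply: eq_integral => t _; rewrite thK th0 cmweight_th -EFinM; congr (_%:E); ring.
have mf2' : measurable_fun setT (fun t => f t ^+ 2) by exact: measurable_funX.
rewrite ge0_integralZl //.
- by rewrite (gfield_CM k s mf2').
- by apply/measurable_EFinP; apply: measurable_funM => //; exact: measurable_cmweight.
- by move=> t _; rewrite lee_fin mulr_ge0 ?sqr_ge0 ?expR_ge0.
Qed.

Let cmadj_sqint k s f : sqint mu f -> sqint mu (f \o th k s) ->
  sqint mu (cmadj k s f).
Proof.
move=> [mf fi] [_ fti]; split; first exact: measurable_cmadj.
by rewrite cmadj_sqr // lte_mul_pinfty // lee_fin expR_ge0.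
Qed.

(** The weight of direction [k] does not move under a shift along [l], so each adjoint can be passed
    to the opposite factor. *)
Lemma cmadj_cross k l s f g : k != l -> measurable_fun setT f ->
  measurable_fun setT g ->
  ip mu (cmadj k s f) (cmadj l s g) = ip mu (f \o th l s) (g \o th k s).
Proof.
move=> kl mf mg; rewrite cmadj_ip //; last exact: measurable_cmadj.
rewrite [RHS]ipC -(cmadj_ip l s (measurableT_comp mg (mth k s)) mf) ipC.
rewrite /ip; congr fine; apply: eq_integral => t _; congr (_ * _)%:E.
rewrite /cmadj /= (gfield_comm field) /cmweight (gfield_H field).
by rewrite eq_sym (negbTE kl) mul0r addr0.
Qed.

(** Write T_k for composition with the shift along k. Off the diagonal, the inner product of the
    adjoint differences of f_k and f_l equals that of T_l f_k - f_k and T_k f_l - f_l; on the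
    diagonal there is the additional term (exp(s^2) - 1) |T_k f_k|^2. Divided by s^2 this is the
    finite form of E (div f)^2 = E |f|^2 + E tr((Df)^2), with the trace bounded by the sum of all
    squared increments. *)
Lemma stein_difference (r : seq I) s (f : I -> T -> R) :
  uniq r -> (forall k, k \in r -> sqint mu (f k)) ->
  (forall k l, k \in r -> l \in r -> sqint mu (f k \o th l s)) ->
  (\int[mu]_t ((\sum_(k <- r) (cmadj k s (f k) t - f k t)) ^+ 2)%:E <=
   (expR (s ^+ 2) - 1)%:E * \sum_(k <- r) \int[mu]_t (f k (th k s t) ^+ 2)%:E +
   \sum_(k <- r) \sum_(l <- r)
     \int[mu]_t ((f k (th l s t) - f k t) ^+ 2)%:E)%E.
Proof.
move=> ur sf sft.
have mf k : k \in r -> measurable_fun setT (f k) by move=> /sf[].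
have sa k : k \in r -> sqint mu (cmadj k s (f k)).
  by move=> kr; apply: cmadj_sqint; [exact: sf | exact: sft].
pose D k t := cmadj k s (f k) t - f k t.
have sD k : k \in r -> sqint mu (D k) by move=> kr; apply: sqintB; [exact: sa | exact: sf].
pose E k l t := f k (th l s t) - f k t.
have sE k l : k \in r -> l \in r -> sqint mu (E k l).
  by move=> kr lr; exact: (sqintB (sft k l kr lr) (sf k kr)).
have sS := sqint_sum sD.
rewrite -[leLHS](EFin_ip sS) ip_suml //.
have EI k : k \in r -> (\int[mu]_t (f k (th k s t) ^+ 2)%:E =
    (ip mu (f k \o th k s) (f k \o th k s))%:E)%E.
  by move=> kr; rewrite EFin_ip //; exact: sft.
have EJ k l : k \in r -> l \in r -> (\int[mu]_t ((f k (th l s t) - f k t) ^+ 2)%:E =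
    (ip mu (E k l) (E k l))%:E)%E.
  by move=> kr lr; rewrite EFin_ip //; exact: sE.
under [in leRHS]eq_big_seq => k kr do rewrite EI //.
under [X in (_ <= _ + X)%E]eq_big_seq => k kr do
  (under eq_big_seq => l lr do rewrite EJ //; rewrite sumEFin).
rewrite !sumEFin -EFinM -EFinD lee_fin.
have key k l : k \in r -> l \in r -> ip mu (D k) (D l) =
    (k == l)%:R * ((expR (s ^+ 2) - 1) * ip mu (f k \o th k s) (f k \o th k s))
    + ip mu (E k l) (E l k).
  move=> kr lr; have [mk ml] := (mf k kr, mf l lr).
  rewrite /D (ipBB (sa k kr) (sf k kr) (sa l lr) (sf l lr)).
  rewrite /E (ipBB (sft k l kr lr) (sf k kr) (sft l k lr kr) (sf l lr)).
  rewrite (ipC mu (f k) (cmadj l s (f l))).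
  rewrite (cmadj_ip k s mk ml) (cmadj_ip l s ml mk).
  rewrite (ipC mu (f l) (f k \o th l s)).
  have [kl|kl] := eqVneq k l; last by rewrite cmadj_cross // mul0r; lra.
  rewrite kl in kr mk *.
  suff -> : ip mu (cmadj l s (f l)) (cmadj l s (f l)) =
      expR (s ^+ 2) * ip mu (f l \o th l s) (f l \o th l s).
    by rewrite mul1r (ipC mu (f l) (f l \o th l s)); lra.
  by apply: EFin_inj; rewrite EFin_ip ?cmadj_sqr // ?EFinM ?EFin_ip //; [exact: sft | exact: sa].
under eq_big_seq => k kr do rewrite ipC (ip_suml sD (sD k kr)).
under eq_big_seq => k kr.
  under eq_big_seq => l lr do rewrite key //.
  rewrite big_split /=; over.
rewrite big_split /= lerD //.
  rewrite mulr_sumr big_seq [leRHS]big_seq; apply: ler_sum => k kr.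
  rewrite (bigD1_seq k) //= eqxx mul1r big1 ?addr0 // => l lk.
  by rewrite (negbTE lk) mul0r.
apply: (@le_trans _ _ (\sum_(k <- r) \sum_(l <- r)
    ((ip mu (E k l) (E k l) + ip mu (E l k) (E l k)) / 2))).
  rewrite big_seq [leRHS]big_seq; apply: ler_sum => k kr.
  rewrite big_seq [leRHS]big_seq; apply: ler_sum => l lr.
  by rewrite (le_trans (ip_mean _ _)) // 1?addrC //; exact: sE.
have half (X : I -> I -> R) :
    \sum_(k <- r) \sum_(l <- r) (X k l + X l k) / 2 =
    \sum_(k <- r) \sum_(l <- r) X k l.
  transitivity ((\sum_(k <- r) \sum_(l <- r) X k l +
                 \sum_(k <- r) \sum_(l <- r) X l k) / 2).
    rewrite -big_split mulr_suml /=; apply: eq_bigr => k _.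
    by rewrite -big_split mulr_suml.
  by rewrite [X in _ + X]exchange_big /=; lra.
by rewrite half.
Qed.

End SteinDifference.

(** * Bounds in mean *)

Section Ele.
Context {R : realType} {d : measure_display} {T : measurableType d}.
Variable mu : probability T R.
Implicit Types (f g : T -> R) (c a : R).

Definition Ele (f : T -> R) (c : R) : Prop :=
  [/\ measurable_fun setT f, (forall t, 0 <= f t) &
      (\int[mu]_t (f t)%:E <= c%:E)%E].

Lemma Ele_ge0 f c : Ele f c -> 0 <= c.
Proof.
move=> [_ f0 fc]; rewrite -lee_fin (le_trans _ fc) //.
by apply: integral_ge0 => t _; rewrite lee_fin.
Qed.

Lemma Ele_le f g c : measurable_fun setT f -> (forall t, 0 <= f t <= g t) ->
  Ele g c -> Ele f c.
Proof.
move=> mf fg [mg g0 gc]; split => //; first by move=> t; case/andP: (fg t).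
apply: le_trans gc; apply: ge0_le_integral => //.
- by move=> t _; rewrite lee_fin; case/andP: (fg t).
- exact/measurable_EFinP.
- exact/measurable_EFinP.
- by move=> t _; rewrite lee_fin; case/andP: (fg t).
Qed.

Lemma Ele_wk f c c' : c <= c' -> Ele f c -> Ele f c'.
Proof. by move=> cc [mf f0 fc]; split => //; rewrite (le_trans fc) ?lee_fin. Qed.

Lemma EleD f g c c' : Ele f c -> Ele g c' -> Ele (fun t => f t + g t) (c + c').
Proof.
move=> [mf f0 fc] [mg g0 gc]; split.
- exact: measurable_funD.
- by move=> t; rewrite addr_ge0.
under eq_integral do rewrite EFinD.
rewrite ge0_integralD //; last 4 first.
- by move=> t _; rewrite lee_fin.
- exact/measurable_EFinP.
- by move=> t _; rewrite lee_fin.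
- exact/measurable_EFinP.
by rewrite EFinD leeD.
Qed.

Lemma Ele0 : Ele (fun=> 0) 0.
Proof. by split => //; rewrite integral0. Qed.

Lemma Ele_cst c : 0 <= c -> Ele (fun=> c) c.
Proof.
by move=> c0; split => //; rewrite integral_cst // [X in (_ * X)%E]probability_setT mule1.
Qed.

Lemma EleZ a f c : 0 <= a -> Ele f c -> Ele (fun t => a * f t) (a * c).
Proof.
move=> a0 [mf f0 fc]; split.
- exact: measurable_funM.
- by move=> t; rewrite mulr_ge0.
under eq_integral do rewrite EFinM.
rewrite ge0_integralZl //; last 2 first.
- exact/measurable_EFinP.
- by move=> t _; rewrite lee_fin.
by rewrite EFinM lee_wpmul2l // lee_fin.
Qed.

Lemma Ele_sum (J : Type) (r : seq J) (f : J -> T -> R) (c : J -> R) :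
  (forall k, Ele (f k) (c k)) ->
  Ele (fun t => \sum_(k <- r) f k t) (\sum_(k <- r) c k).
Proof.
move=> fc; elim: r => [|k r IH].
  rewrite big_nil; apply: Ele_le Ele0; last by move=> t; rewrite big_nil lexx.
  by apply: measurable_sum => k; case: (fc k).
rewrite big_cons; apply: Ele_le (EleD (fc k) IH).
  by apply: measurable_sum => l; case: (fc l).
move=> t; rewrite big_cons lexx andbT addr_ge0 //; first by case: (fc k).
by case: IH.
Qed.

Lemma Ele_sqint f c : measurable_fun setT f -> Ele (fun t => f t ^+ 2) c ->
  sqint mu f.
Proof. by move=> mf [_ _ fc]; split => //; rewrite (le_lt_trans fc) // ltry. Qed.

Lemma Ele_fine (f : T -> \bar R) c : measurable_fun setT f ->
  (forall t, 0 <= f t)%E -> (\int[mu]_t f t <= c%:E)%E ->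
  Ele (fun t => fine (f t)) c.
Proof.
move=> mf f0 fc; split.
- exact: (measurableT_comp (fine_measurable measurableT) mf).
- by move=> t; rewrite fine_ge0.
apply: le_trans fc; apply: ge0_le_integral => //.
- by move=> t _; rewrite lee_fin fine_ge0.
- apply/measurable_EFinP; exact: (measurableT_comp (fine_measurable measurableT) mf).
- by move=> t _; case: (f t) (f0 t) => [r||] //= _; rewrite ?lee_fin.
Qed.

End Ele.

(** * Passage to the limit in the Stein inequality *)

Section SteinLimit.
Context {R : realType} {d : measure_display} {T : measurableType d}.
Variables (mu : probability T R) (I : finType).
Variables (th : I -> R -> T -> T) (H : I -> T -> R).
Hypothesis field : gfield mu th H.

Definition step m : R := m.+1%:R^-1.

Lemma step_gt0 m : 0 < step m. Proof. by rewrite invr_gt0. Qed.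

Lemma step_le1 m : step m <= 1.
Proof. by rewrite invf_le1 // ler1n. Qed.

Lemma cvg_step : step @ \oo --> 0.
Proof. exact: cvg_harmonic. Qed.

Lemma is_derive_seq (h : R -> R) (c : R) (x : nat -> R) :
  is_derive (0 : R) 1 h c -> (forall m, x m != 0) -> x @ \oo --> 0 ->
  (fun m => (h (x m) - h 0) / x m) @ \oo --> c.
Proof.
move=> [hd <-] x0 xc.
have := hd; rewrite /derivable => hd'.
have hc : (fun s => s^-1 *: (h (s *: 1 + 0) - h 0)) @ (0 : R)^' --> 'D_1 h 0.
  exact: hd'.
have xc' : x @ \oo --> (0 : R)^'.
  move=> A A0; have : \forall m \near \oo, x m != 0 -> A (x m) := xc _ A0.
  by apply: filterS => m /=; apply.
have := cvg_comp _ _ xc' hc; apply: cvg_trans.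
apply: near_eq_cvg; apply: nearW => m /=.
by rewrite /= addr0 [x m *: 1]mulr1 [RHS]mulrC.
Qed.

Lemma cvg_sum_seq (J : eqType) (r : seq J) (u : J -> nat -> R) (l : J -> R) :
  (forall k, k \in r -> u k @ \oo --> l k) ->
  (fun m => \sum_(k <- r) u k m) @ \oo --> \sum_(k <- r) l k.
Proof.
elim: r => [|k r IH] ul.
  by rewrite big_nil; under eq_fun do rewrite big_nil; exact: cvg_cst.
rewrite big_cons; under eq_fun do rewrite big_cons.
apply: cvgD; first by apply: ul; rewrite mem_head.
by apply: IH => j jr; apply: ul; rewrite in_cons jr orbT.
Qed.

Lemma is_derive_cmweight (h : R) :
  is_derive (0 : R) 1 (fun s => expR (s * h - s ^+ 2 / 2)) h.
Proof.
have h1 : is_derive (0 : R) 1 (fun s : R => s * h - s ^+ 2 / 2) h.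
  rewrite (_ : (fun s => _) = (h \*: (id : R -> R)) - (2^-1 \*: ((id : R -> R) ^+ 2))).
    apply: is_derive_eq; rewrite /= /GRing.scale /= expr1 ?mulr0n ?mul0r ?mulr0 ?mulr1 ?mul0rn ?mulr0 ?subr0.
    by [].
  apply/funext => s; rewrite !fctE /GRing.scale /=.
  by rewrite mulrC [_ / 2]mulrC.
have h2 := is_derive_expR ((fun s : R => s * h - s ^+ 2 / 2) 0).
have := @is_derive1_comp _ _ (fun s : R => s * h - s ^+ 2 / 2) _ _ _ h2 h1.
by rewrite /= mul0r expr0n /= mul0r subr0 expR0 mul1r.
Qed.

Lemma expR_sub1_le (u : R) : 0 <= u <= 1 -> expR u - 1 <= expR 1 * u.
Proof.
move=> /andP[u0 u1]; have h := expR_ge1Dx (- u).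
have e0 := expR_gt0 u; have := expRxMexpNx_1 u; have : expR u <= expR 1 by rewrite ler_expR.
by have := expR_gt0 (- u); nra.
Qed.

(** [Xi] is the lower limit, along s = 1/(m + 1), of the square of the finite-shift divergence
    divided by s, so Fatou's lemma bounds its mean without any differentiability. It is identified
    only at points where the difference quotients converge. The quotients have negative steps
    because the adjoint evaluates the field at the shift by -s. *)
Lemma stein_bound (r : seq I) (f : I -> T -> R) (F : T -> R) (L : R -> T -> R) (CF CL : R) :
  uniq r -> (forall k, measurable_fun setT (f k)) ->
  Ele mu F CF -> (forall s, 0 < s <= 1 -> Ele mu (L s) CL) ->
  (forall t, \sum_(k <- r) f k t ^+ 2 <= F t) ->
  (forall t s, 0 < s <= 1 ->
    \sum_(k <- r) \sum_(l <- r) (f k (th l s t) - f k t) ^+ 2 <= s ^+ 2 * L s t) ->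
  exists2 Xi, Ele mu Xi (expR 1 * (2 * CF + 2 * CL) + CL) &
    forall t (f' : I -> R),
    (forall k, k \in r ->
      (fun m => (f k (th k (- step m) t) - f k t) / - step m) @ \oo --> f' k) ->
    Xi t = (\sum_(k <- r) (H k t * f k t - f' k)) ^+ 2.
Proof.
move=> ur mf EF EL fF fL.
have L0 s t : 0 < s <= 1 -> 0 <= L s t by move=> /EL[].
have mth k s : measurable_fun setT (th k s).
  exact: (measurable_flow (gfield_flow field k)).
have f2F k t : k \in r -> f k t ^+ 2 <= F t.
  move=> kr; rewrite (le_trans _ (fF t)) // (bigD1_seq k) //= lerDl.
  by rewrite sumr_ge0 // => l _; exact: sqr_ge0.
have sf k : k \in r -> sqint mu (f k).
  move=> kr; apply: (@Ele_sqint _ _ _ mu _ CF) => //; apply: Ele_le EF.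
    exact: measurable_funX.
  by move=> t; rewrite sqr_ge0 f2F.
have fL1 t s k l : 0 < s <= 1 -> k \in r -> l \in r ->
    (f k (th l s t) - f k t) ^+ 2 <= s ^+ 2 * L s t.
  move=> s01 kr lr; rewrite (le_trans _ (fL t s s01)) // (bigD1_seq k) //=.
  rewrite (bigD1_seq l) //= -addrA lerDl addr_ge0 //.
    by rewrite sumr_ge0 // => m _; exact: sqr_ge0.
  by rewrite sumr_ge0 // => m _; rewrite sumr_ge0 // => m' _; exact: sqr_ge0.
have dbl (x y : R) : x ^+ 2 <= 2 * y ^+ 2 + 2 * (x - y) ^+ 2.
  by have := sqr_ge0 (x - y - y); nra.
have s2L s t : 0 < s <= 1 -> s ^+ 2 * L s t <= L s t.
  by move=> s01; have L0' := L0 s t s01; case/andP: s01 => s0 s1; rewrite ler_piMl // expr_le1 // ltW.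
have EFL s (s01 : 0 < s <= 1) := EleD (EleZ (ler0n R 2) EF) (EleZ (ler0n R 2) (EL s s01)).
have mft k l s : measurable_fun setT (f k \o th l s).
  exact: (measurableT_comp (mf k) (mth l s)).
have sft s k l : 0 < s <= 1 -> k \in r -> l \in r -> sqint mu (f k \o th l s).
  move=> s01 kr lr; apply: (@Ele_sqint _ _ _ mu _ _ (mft k l s)).
  apply: Ele_le (EFL s s01); first exact: measurable_funX.
  move=> t; rewrite sqr_ge0 (le_trans (dbl _ (f k t))) // lerD //.
    by rewrite ler_pM2l // f2F.
  by rewrite ler_pM2l // (le_trans (fL1 t s k l s01 kr lr)) // s2L.
pose W m t := \sum_(k <- r) (cmadj th H k (step m) (f k) t - f k t).
have mW m : measurable_fun setT (W m).
  apply: measurable_sum => k; apply: measurable_funB => //.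
  exact: (measurable_cmadj field).
pose X m t := ((W m t / step m) ^+ 2)%:E.
have mX m : measurable_fun setT (X m).
  by apply/measurable_EFinP; apply: measurable_funX; exact: measurable_funM.
have X0 m t : (0 <= X m t)%E by rewrite lee_fin sqr_ge0.
have XE m : (\int[mu]_t X m t <= (expR 1 * (2 * CF + 2 * CL) + CL)%:E)%E.
  pose s := step m; have s01 : 0 < s <= 1 by rewrite step_gt0 step_le1.
  have s0 : 0 < s by case/andP: s01.
  have s2 : 0 < s ^+ 2 by rewrite exprn_gt0.
  have -> : (\int[mu]_t X m t =
      ((s ^+ 2)^-1)%:E * \int[mu]_t (W m t ^+ 2)%:E)%E.
    rewrite -ge0_integralZl //.
    - apply: eq_integral => t _; rewrite /X -EFinM expr_div_n mulrC.
      by rewrite /s.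
    - by apply/measurable_EFinP; exact: measurable_funX.
    - by move=> t _; rewrite lee_fin sqr_ge0.
    - by rewrite lee_fin invr_ge0 ltW.
  (* Origin of the factor [expR 1] in the final constant. *)
  have e1 : 0 <= expR (s ^+ 2) - 1 <= expR 1 * s ^+ 2.
    rewrite expR_sub1_le ?(ltW s2) ?expr_le1 ?(ltW s0) ?step_le1 // andbT.
    by rewrite subr_ge0 -expR0 ler_expR ltW.
  have A : (\sum_(k <- r) \int[mu]_t (f k (th k s t) ^+ 2)%:E <=
      (2 * CF + 2 * CL)%:E)%E.
    rewrite -ge0_integral_sum //; last 2 first.
    - by move=> k; apply/measurable_EFinP; apply: measurable_funX; exact: mft.
    - by move=> k t _; rewrite lee_fin sqr_ge0.
    under eq_integral do rewrite sumEFin.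
    have [] // := @Ele_le _ _ _ mu (fun t => \sum_(k <- r) f k (th k s t) ^+ 2) _ _ _ _ (EFL s s01).
      by apply: measurable_sum => k; apply: measurable_funX; exact: mft.
    move=> t; rewrite sumr_ge0 /=; last by move=> k _; exact: sqr_ge0.
    apply: (@le_trans _ _ (\sum_(k <- r) (2 * f k t ^+ 2 +
        2 * (f k (th k s t) - f k t) ^+ 2))).
      by apply: ler_sum => k _; exact: dbl.
    rewrite big_split /= -!mulr_sumr lerD // ler_pM2l //.
    rewrite (le_trans _ (s2L s t s01)) // (le_trans _ (fL t s s01)) //.
    rewrite big_seq [leRHS]big_seq; apply: ler_sum => k kr.
    by rewrite (bigD1_seq k) //= lerDl sumr_ge0 // => l _; exact: sqr_ge0.
  have B : (\sum_(k <- r) \sum_(l <- r)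
      \int[mu]_t ((f k (th l s t) - f k t) ^+ 2)%:E <= (s ^+ 2 * CL)%:E)%E.
    have mfd k l : measurable_fun setT (fun t => (f k (th l s t) - f k t) ^+ 2).
      by apply: measurable_funX; apply: measurable_funB => //; exact: mft.
    under eq_bigr => k _.
      rewrite -ge0_integral_sum //; last 2 first.
      - by move=> l; apply/measurable_EFinP.
      - by move=> l t _; rewrite lee_fin sqr_ge0.
      under eq_integral do rewrite sumEFin.
      over.
    rewrite -ge0_integral_sum //; last 2 first.
    - by move=> k; apply/measurable_EFinP; apply: measurable_sum => l.
    - by move=> k t _; rewrite lee_fin sumr_ge0 // => l _; exact: sqr_ge0.
    under eq_integral do rewrite sumEFin.
    have [] // := @Ele_le _ _ _ mu (fun t => \sum_(k <- r) \sum_(l <- r)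
      (f k (th l s t) - f k t) ^+ 2) _ _ _ _ (EleZ (ltW s2) (EL s s01)).
      by apply: measurable_sum => k; apply: measurable_sum => l.
    move=> t; rewrite fL // andbT sumr_ge0 // => k _.
    by rewrite sumr_ge0 // => l _; exact: sqr_ge0.
  have D := stein_difference field ur sf (fun k l => sft s k l s01).
  rewrite -[leRHS]mul1e -[X in (_ <= X * _)%E](_ : (((s ^+ 2)^-1)%:E * (s ^+ 2)%:E)%E = _); last first.
    by rewrite -EFinM mulVf // gt_eqF.
  rewrite -muleA lee_wpmul2l ?lee_fin ?invr_ge0 ?(ltW s2) //.
  refine (le_trans D _); rewrite -EFinM.
  have -> : s ^+ 2 * (expR 1 * (2 * CF + 2 * CL) + CL) =
    (expR 1 * s ^+ 2) * (2 * CF + 2 * CL) + s ^+ 2 * CL by ring.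
  rewrite [leRHS]EFinD leeD // [leRHS]EFinM.
  apply: (@le_trans _ _ ((expR (s ^+ 2) - 1)%:E * (2 * CF + 2 * CL)%:E)%E).
    by rewrite lee_wpmul2l // lee_fin; case/andP: e1.
  by apply: lee_wpmul2r; rewrite lee_fin; [exact: Ele_ge0 (EFL s s01) | case/andP: e1].
pose Xi t := limn_einf (X ^~ t).
have mXi : measurable_fun setT Xi.
  rewrite /Xi /limn_einf; apply: measurableT_comp => //.
  by apply: measurable_fun_limn_esup => n; exact: measurableT_comp.
have Xi0 t : (0 <= Xi t)%E.
  rewrite /Xi limn_einf_lim; apply: lime_ge; first exact: is_cvg_einfs.
  by apply: nearW => n; apply: le_ereal_inf_tmp => _ [m _ <-].
(* The lower limit has a finite integral, so it is infinite, and [fine] returns its default 0, on a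
   null set at most. *)
exists (fun t => fine (Xi t)).
  apply: Ele_fine => //.
  apply: le_trans (fatou mu measurableT mX (fun m t _ => X0 m t)) _.
  rewrite limn_einf_lim; apply: lime_le; first exact: is_cvg_einfs.
  by apply: nearW => n; apply: le_trans (XE n); apply: ereal_inf_lbound; exists n => /=.
move=> t f' f'E.
suff Xc : X ^~ t @ \oo --> ((\sum_(k <- r) (H k t * f k t - f' k)) ^+ 2)%:E.
  by rewrite /Xi (cvg_limn_einf_sup Xc).1.
suff Wc : (fun m => W m t / step m) @ \oo --> \sum_(k <- r) (H k t * f k t - f' k).
  by apply: cvg_EFin; [exact: nearW | apply: cvgM].
have -> : (fun m => W m t / step m) = (fun m => \sum_(k <- r)
    ((cmadj th H k (step m) (f k) t - f k t) / step m)).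
  by apply/funext => m; rewrite /W mulr_suml.
apply: cvg_sum_seq => k kr.
have wd := is_derive_cmweight (H k t).
have sn m : step m != 0 by rewrite gt_eqF // step_gt0.
have wc := is_derive_seq wd sn cvg_step.
have w1 : (fun m => cmweight H k (step m) t) @ \oo --> (1 : R).
  have : (fun m => (cmweight H k (step m) t - 1) / step m * step m + 1) @ \oo --> H k t * 0 + 1.
    apply: cvgD; last exact: cvg_cst.
    apply: cvgM; last exact: cvg_step.
    by move: wc; rewrite mul0r expr0n /= mul0r subr0 expR0.
  rewrite mulr0 add0r; apply: cvg_trans; apply: near_eq_cvg; apply: nearW => m.
  by rewrite divfK // subrK.
(* Discrete product rule: the quotient of the weight tends to [H k t], and the quotient of [f k] is
   multiplied by a weight that tends to 1. *)
rewrite (_ : (fun m => _) = (fun m =>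
   f k t * ((cmweight H k (step m) t - 1) / step m) -
   (f k (th k (- step m) t) - f k t) / - step m * cmweight H k (step m) t)); last first.
  by apply/funext => m; rewrite /cmadj; move: (sn m) => smn; field.
rewrite mulrC -[X in _ --> _ - X]mulr1; apply: cvgB; last by apply: cvgM => //; exact: f'E.
apply: cvgM; first exact: cvg_cst.
by move: wc; rewrite mul0r expr0n /= mul0r subr0 expR0.
Qed.

End SteinLimit.

(** * Euclidean vectors *)

Section Vectors.
Context {R : realType}.

Definition dot m (u v : 'cV[R]_m) : R := \sum_i u i 0 * v i 0.

Lemma dotE m (u v : 'cV[R]_m) : (u^T *m v) 0 0 = dot u v.
Proof. by rewrite mxE; apply: eq_bigr => i _; rewrite mxE. Qed.

Lemma dotC m (u v : 'cV[R]_m) : dot u v = dot v u.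
Proof. by apply: eq_bigr => i _; rewrite mulrC. Qed.

Lemma dotDl m (u v w : 'cV[R]_m) : dot (u + v) w = dot u w + dot v w.
Proof. by rewrite /dot -big_split; apply: eq_bigr => i _; rewrite mxE mulrDl. Qed.

Lemma dotDr m (u v w : 'cV[R]_m) : dot w (u + v) = dot w u + dot w v.
Proof. by rewrite dotC dotDl ![dot _ w]dotC. Qed.

Lemma dotZl m a (u v : 'cV[R]_m) : dot (a *: u) v = a * dot u v.
Proof. by rewrite /dot mulr_sumr; apply: eq_bigr => i _; rewrite mxE mulrA. Qed.

Lemma dotZr m a (u v : 'cV[R]_m) : dot u (a *: v) = a * dot u v.
Proof. by rewrite dotC dotZl dotC. Qed.

Lemma dotNl m (u v : 'cV[R]_m) : dot (- u) v = - dot u v.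
Proof. by rewrite -scaleN1r dotZl mulN1r. Qed.

Lemma dotNr m (u v : 'cV[R]_m) : dot u (- v) = - dot u v.
Proof. by rewrite dotC dotNl dotC. Qed.

Lemma dotBl m (u v w : 'cV[R]_m) : dot (u - v) w = dot u w - dot v w.
Proof. by rewrite dotDl dotNl. Qed.

Lemma dotBr m (u v w : 'cV[R]_m) : dot w (u - v) = dot w u - dot w v.
Proof. by rewrite dotDr dotNr. Qed.

Lemma dot0l m (u : 'cV[R]_m) : dot 0 u = 0.
Proof. by rewrite -(scale0r 0) dotZl mul0r. Qed.

Lemma dot0r m (u : 'cV[R]_m) : dot u 0 = 0.
Proof. by rewrite dotC dot0l. Qed.

Lemma dot_mulmx m k (u : 'cV[R]_m) (M : 'M[R]_(m, k)) (v : 'cV[R]_k) :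
  dot u (M *m v) = dot (M^T *m u) v.
Proof. by rewrite -!dotE trmx_mul trmxK mulmxA. Qed.

Lemma dot_ge0 m (u : 'cV[R]_m) : 0 <= dot u u.
Proof. by apply: sumr_ge0 => i _; rewrite -expr2 sqr_ge0. Qed.

Lemma dot_eq0 m (u : 'cV[R]_m) : (dot u u == 0) = (u == 0).
Proof.
apply/idP/eqP => [|->]; last by rewrite dot0l.
rewrite psumr_eq0 => [/allP u0|i _]; last by rewrite -expr2 sqr_ge0.
apply/matrixP => i j; rewrite ord1 mxE.
by have := u0 i; rewrite mem_index_enum => /(_ isT); rewrite mulf_eq0 orbb => /eqP.
Qed.

Lemma enormE m (u : 'cV[R]_m) : enorm u = Num.sqrt (dot u u).
Proof. by congr Num.sqrt; apply: eq_bigr => i _; rewrite expr2. Qed.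

Lemma enorm_ge0 m (u : 'cV[R]_m) : 0 <= enorm u.
Proof. exact: sqrtr_ge0. Qed.

Lemma enorm_sqr m (u : 'cV[R]_m) : enorm u ^+ 2 = dot u u.
Proof. by rewrite enormE sqr_sqrtr // dot_ge0. Qed.

Lemma enorm_eq0 m (u : 'cV[R]_m) : (enorm u == 0) = (u == 0).
Proof. by rewrite -(sqrf_eq0 (enorm u)) enorm_sqr dot_eq0. Qed.

Lemma enorm0 m : enorm (0 : 'cV[R]_m) = 0.
Proof. by apply/eqP; rewrite enorm_eq0. Qed.

Lemma enorm_gt0 m (u : 'cV[R]_m) : (0 < enorm u) = (u != 0).
Proof. by rewrite lt_def enorm_eq0 enorm_ge0 andbT. Qed.

Lemma cauchy_schwarz m (u v : 'cV[R]_m) : dot u v ^+ 2 <= dot u u * dot v v.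
Proof.
have [->|v0] := eqVneq v 0; first by rewrite !dot0r expr0n mulr0.
have vv : 0 < dot v v by rewrite lt_def dot_eq0 v0 dot_ge0.
have := dot_ge0 (dot v v *: u - dot u v *: v).
rewrite !(dotBl, dotBr, dotZl, dotZr) (dotC v u) => h.
have : 0 <= dot v v * (dot u u * dot v v - dot u v ^+ 2) by lra.
by rewrite pmulr_rge0 // subr_ge0.
Qed.

Lemma dot_le_enorm m (u v : 'cV[R]_m) : `|dot u v| <= enorm u * enorm v.
Proof.
rewrite -ler_sqr ?nnegrE ?mulr_ge0 ?enorm_ge0 // real_normK ?num_real //.
by rewrite exprMn !enorm_sqr cauchy_schwarz.
Qed.

Lemma ler_dot m (u v : 'cV[R]_m) : dot u v <= enorm u * enorm v.
Proof. exact: le_trans (ler_norm _) (dot_le_enorm u v). Qed.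

Lemma enormZ m a (u : 'cV[R]_m) : enorm (a *: u) = `|a| * enorm u.
Proof.
by rewrite !enormE dotZl dotZr mulrA -expr2 sqrtrM ?sqr_ge0 // sqrtr_sqr.
Qed.

Lemma enormN m (u : 'cV[R]_m) : enorm (- u) = enorm u.
Proof. by rewrite -scaleN1r enormZ normrN1 mul1r. Qed.

Lemma enormD m (u v : 'cV[R]_m) : enorm (u + v) <= enorm u + enorm v.
Proof.
rewrite -ler_sqr ?nnegrE ?addr_ge0 ?enorm_ge0 // sqrrD !enorm_sqr.
rewrite !(dotDl, dotDr) (dotC v u); have := ler_dot u v; lra.
Qed.

Lemma enormB m (u v : 'cV[R]_m) : enorm (u - v) <= enorm u + enorm v.
Proof. by rewrite -(enormN v) enormD. Qed.

Lemma enorm_sum m (J : Type) (r : seq J) (u : J -> 'cV[R]_m) :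
  enorm (\sum_(j <- r) u j) <= \sum_(j <- r) enorm (u j).
Proof.
elim: r => [|j r IH]; rewrite ?big_nil ?enorm0 // !big_cons.
by rewrite (le_trans (enormD _ _)) // lerD2l.
Qed.

Lemma enorm_coord m (u : 'cV[R]_m) i : `|u i 0| <= enorm u.
Proof.
rewrite -ler_sqr ?nnegrE ?enorm_ge0 // enorm_sqr real_normK ?num_real //.
rewrite /dot (bigD1 i) //= -expr2 lerDl.
by apply: sumr_ge0 => k _; rewrite -expr2 sqr_ge0.
Qed.

Lemma enorm_le_coord m (u : 'cV[R]_m) : enorm u <= \sum_i `|u i 0|.
Proof.
rewrite {1}(_ : u = \sum_i u i 0 *: delta_mx i 0).
  rewrite (le_trans (enorm_sum _ _)) //; apply: ler_sum => i _.
  rewrite enormZ ler_piMr // -ler_sqr ?nnegrE ?enorm_ge0 // enorm_sqr expr1n.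
  rewrite /dot (bigD1 i) //= mxE !eqxx mulr1 big1 ?addr0 // => k /negbTE ki.
  by rewrite mxE ki mul0r.
apply/matrixP => i j; rewrite ord1 summxE (bigD1 i) //= !mxE !eqxx mulr1.
by rewrite big1 ?addr0 // => k ki; rewrite !mxE eq_sym (negbTE ki) mulr0.
Qed.

Lemma enorm_le_bound m k (M : 'M[R]_(m, k)) (c : R) : 0 <= c ->
  (forall v u, enorm v <= 1 -> enorm u <= 1 -> dot v (M *m u) <= c) ->
  forall u, enorm (M *m u) <= c * enorm u.
Proof.
move=> c0 h u; have [->|u0] := eqVneq u 0.
  by rewrite mulmx0 !enorm0 mulr0.
have [Mu0|Mu0] := eqVneq (M *m u) 0.
  by rewrite Mu0 enorm0 mulr_ge0 ?enorm_ge0.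
have un := u0; rewrite -enorm_gt0 in un.
have Mn := Mu0; rewrite -enorm_gt0 in Mn.
have := h ((enorm (M *m u))^-1 *: (M *m u)) ((enorm u)^-1 *: u).
rewrite !enormZ !ger0_norm ?invr_ge0 ?enorm_ge0 // !mulVf ?gt_eqF //.
move=> /(_ (lexx _) (lexx _)).
rewrite -scalemxAr dotZl dotZr -enorm_sqr expr2 mulrCA mulKf ?gt_eqF //.
by rewrite mulrC ler_pdivrMr.
Qed.

End Vectors.

(** * Moments of operator norms of Gaussian matrices *)

Section OperatorNormNet.
Context {R : realType}.

(** A lattice of mesh 1/(4 sqrt m), each coordinate being stored as a sign and a modulus, so that
    the net is a finite type. *)
Definition netval (m : nat) (b : bool * 'I_(4 * m).+1) : R :=
  (-1) ^+ b.1 * b.2%:R / (4 * Num.sqrt m%:R).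

Definition netvec (m : nat) (f : {ffun 'I_m -> bool * 'I_(4 * m).+1}) : 'cV[R]_m :=
  \col_i netval (f i).

Definition netl1 (m : nat) (f : {ffun 'I_m -> bool * 'I_(4 * m).+1}) : R :=
  \sum_i (f i).2%:R.

(** Weighting a lattice point by the exponential of minus its l1 norm makes the sum factor over
    coordinates; each factor is at most 2 for the sign times 2 for the geometric sum. This replaces
    counting the lattice points in the unit ball. *)
Lemma net_weight_sum (m : nat) :
  \sum_(f : {ffun 'I_m -> bool * 'I_(4 * m).+1}) expR (- netl1 f) <= 4 ^+ m.
Proof.
have geo L : \sum_(k < L.+1) expR (- (k%:R : R)) <= 2.
  have half : expR (-1) <= (2^-1 : R).
    have e2 : 2 <= expR (1 : R) by have := expR_ge1Dx (1 : R); lra.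
    by rewrite expRN lef_pV2 // posrE ?expR_gt0 // ltr0n.
  suff : \sum_(k < L.+1) expR (- (k%:R : R)) <= 2 - 2^-1 ^+ L.
    by move=> /le_trans; apply; rewrite gerBl exprn_ge0.
  elim: L => [|L IH].
    by rewrite big_ord_recl big_ord0 oppr0 expR0 expr0; lra.
  rewrite big_ord_recr /=.
  have : expR (- (L.+1%:R : R)) <= 2^-1 ^+ L.+1.
    have -> : - (L.+1%:R : R) = L.+1%:R * - 1 by rewrite mulrN1.
    by rewrite expRM_natl lerXn2r ?nnegrE ?expR_ge0 ?invr_ge0.
  by move: IH; rewrite exprS; lra.
have -> : \sum_(f : {ffun 'I_m -> bool * 'I_(4 * m).+1}) expR (- netl1 f) =
    \sum_(f : {ffun 'I_m -> bool * 'I_(4 * m).+1})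
      \prod_i expR (- ((f i).2%:R : R)).
  apply: eq_bigr => f _; rewrite /netl1 -sumrN.
  by rewrite (big_morph expR (@expRD R) (@expR0 R)).
rewrite -(bigA_distr_bigA (fun _ (b : bool * 'I_(4 * m).+1) => expR (- (b.2%:R : R)))).
rewrite -[X in _ <= _ ^+ X]card_ord -prodr_const; apply: ler_prod => i _.
apply/andP; split; first by apply: sumr_ge0 => b _; exact: expR_ge0.
rewrite -(pair_big xpredT xpredT (fun _ (k : 'I_(4 * m).+1) => expR (- (k%:R : R)))) /=.
by rewrite big_bool /=; have := geo (4 * m)%N; lra.
Qed.

(** Rounding the modulus of each coordinate down keeps the vector in the ball and moves it by at
    most sqrt m times the mesh; the bound on the l1 norm is Cauchy-Schwarz. *)
Lemma net_approx (m : nat) (v : 'cV[R]_m) : (0 < m)%N -> enorm v <= 1 ->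
  exists f, [/\ enorm (netvec f) <= 1, enorm (v - netvec f) <= 4^-1 &
                netl1 f <= 4 * m%:R].
Proof.
move=> m0 v1.
pose s : R := Num.sqrt m%:R.
have sm : 1 <= s by rewrite -sqrtr1 ler_sqrt // ler1n.
have s0 : 0 < s by lra.
have ssq : s * s = m%:R by rewrite -expr2 sqr_sqrtr // ler0n.
have c1 i : `|v i 0| <= 1 := le_trans (enorm_coord v i) v1.
pose N i := Num.truncn (4 * s * `|v i 0|).
have NP i : (N i)%:R <= 4 * s * `|v i 0| < (N i).+1%:R.
  by apply: truncn_itv; rewrite !mulr_ge0 // ltW.
have NL i : (N i < (4 * m).+1)%N.
  rewrite ltnS -(ler_nat R); case/andP: (NP i) => h _; apply: le_trans h _.
  rewrite natrM -ssq; have := c1 i; have := normr_ge0 (v i 0); nra.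
pose f := [ffun i => (v i 0 < 0, Ordinal (NL i))].
exists f.
have fE i : netvec f i 0 = (-1) ^+ (v i 0 < 0)%R * (N i)%:R / (4 * s).
  by rewrite mxE /netval ffunE.
have vE i : v i 0 = (-1) ^+ (v i 0 < 0)%R * `|v i 0| by rewrite -realEsign ?num_real.
have sgn2 (b : bool) : ((-1) ^+ b : R) * (-1) ^+ b = 1.
  by case: b; rewrite ?expr1 ?expr0; lra.
have le0 i : 0 <= `|v i 0| - (N i)%:R / (4 * s) <= (4 * s)^-1.
  have /andP[h1 h2] := NP i; have s4 : 0 < 4 * s by lra.
  rewrite subr_ge0 ler_pdivrMr // mulrC h1 /= lerBlDr -[X in X + _]mul1r -mulrDl.
  by rewrite ler_pdivlMr // mulrC ltW // (lt_le_trans h2) // -natr1 addrC.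
have N0 i : 0 <= (N i)%:R / (4 * s) by rewrite divr_ge0 // mulr_ge0 // ltW.
split.
- rewrite (le_trans _ v1) // -ler_sqr ?nnegrE ?enorm_ge0 // !enorm_sqr.
  apply: ler_sum => i _; rewrite -!expr2 fE [in leRHS]vE -mulrA !exprMn.
  rewrite ler_pM2l; last by rewrite exprn_even_gt0 //= signr_eq0.
  by rewrite -exprMn ler_sqr ?nnegrE // -subr_ge0; case/andP: (le0 i).
- rewrite -ler_sqr ?nnegrE ?enorm_ge0 ?invr_ge0 // enorm_sqr.
  apply: (@le_trans _ _ (\sum_(i < m) ((4 * s)^-1) ^+ 2)).
    apply: ler_sum => i _; rewrite mxE [(- netvec f) _ _]mxE -expr2 fE.
    rewrite {1}vE -mulrA -mulrBr exprMn sqrr_sign mul1r.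
    have /andP[h1 h2] := le0 i.
    by rewrite ler_sqr ?nnegrE // invr_ge0 mulr_ge0 // ltW.
  rewrite sumr_const card_ord -[_ *+ m]mulr_natl -ssq.
  have -> : s * s * (4 * s)^-1 ^+ 2 = 4^-1 ^+ 2.
    by rewrite invfM exprMn mulrCA -expr2 -exprMn mulfV ?gt_eqF // expr1n mulr1.
  by [].
- rewrite /netl1.
  pose av : 'cV[R]_m := \col_i `|v i 0|.
  pose one : 'cV[R]_m := \col_i 1.
  have dav : dot av av <= 1.
    have -> : dot av av = dot v v.
      by apply: eq_bigr => i _; rewrite !mxE -!expr2 real_normK ?num_real.
    by rewrite -enorm_sqr expr_le1 // enorm_ge0.
  have done1 : dot one one = m%:R.
    rewrite /dot; under eq_bigr do rewrite mxE mulr1.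
    by rewrite sumr_const card_ord.
  have := cauchy_schwarz one av; rewrite done1 => cs.
  have dE : dot one av = \sum_i `|v i 0| by apply: eq_bigr => i _; rewrite !mxE mul1r.
  have dle : dot one av <= s.
    have d0 : 0 <= dot one av by rewrite dE sumr_ge0.
    rewrite -ler_sqr ?nnegrE ?(ltW s0) // (le_trans cs) // expr2 ssq.
    by rewrite ler_piMr // ler0n.
  apply: (@le_trans _ _ (4 * s * dot one av)).
    rewrite dE mulr_sumr; apply: ler_sum => i _; rewrite ffunE /=.
    by case/andP: (NP i).
  by rewrite -ssq mulrA ler_wpM2l // mulr_ge0 // ltW.
Qed.

(** Replacing each of the two vectors by a net point costs a quarter of the supremum of the bilinear
    form, hence sup <= c + sup/2. The entries of [M] show that the supremum is finite. *)
Lemma net_opnorm (n p : nat) (M : 'M[R]_(n, p)) (c : R) : (0 < n)%N -> (0 < p)%N ->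
  (forall f g, netl1 f <= 4 * n%:R -> netl1 g <= 4 * p%:R ->
    enorm (netvec f) <= 1 -> enorm (netvec g) <= 1 ->
    dot (netvec f) (M *m netvec g) <= c) ->
  forall u, enorm (M *m u) <= 2 * c * enorm u.
Proof.
move=> n0 p0 hc.
pose S := [set x | exists v u, [/\ enorm v <= 1, enorm u <= 1 & x = dot v (M *m u)]].
have S0 : S 0 by exists 0, 0; rewrite !enorm0 dot0l.
have hS : has_sup S.
  split; first by exists 0.
  exists (\sum_i \sum_j `|M i j|) => _ [v [u [v1 u1 ->]]].
  rewrite (le_trans (ler_dot _ _)) //.
  rewrite (le_trans (ler_wpM2r (enorm_ge0 _) v1)) // mul1r.
  rewrite (le_trans (enorm_le_coord _)) //; apply: ler_sum => i _.
  rewrite mxE (le_trans (ler_norm_sum _ _ _)) //; apply: ler_sum => j _.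
  by rewrite normrM ler_piMr // (le_trans (enorm_coord u j)).
have ub v u : enorm v <= 1 -> enorm u <= 1 -> dot v (M *m u) <= sup S.
  by move=> v1 u1; apply: ub_le_sup; [case: hS | exists v, u].
have s0 : 0 <= sup S by have := ub 0 0; rewrite !enorm0 dot0l; apply.
have key v u : enorm v <= 1 -> enorm u <= 1 -> dot v (M *m u) <= c + sup S / 2.
  move=> v1 u1.
  have [f [f1 vf fl]] := net_approx n0 v1; have [g [g1 ug gl]] := net_approx p0 u1.
  have -> : dot v (M *m u) = dot (netvec f) (M *m netvec g) +
     4^-1 * dot (netvec f) (M *m (4 *: (u - netvec g))) +
     4^-1 * dot (4 *: (v - netvec f)) (M *m u).
    rewrite -scalemxAr dotZl dotZr !mulrA mulVf ?mul1r // mulmxBr dotBr dotBl; ring.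
  have n4 k (z : 'cV[R]_k) : enorm z <= 4^-1 -> enorm (4 *: z) <= 1.
    by rewrite enormZ ger0_norm //; lra.
  have := hc f g fl gl f1 g1.
  have := ub _ _ f1 (n4 _ _ ug); have := ub _ _ (n4 _ _ vf) u1; lra.
have sc : sup S <= 2 * c.
  suff : sup S <= c + sup S / 2 by lra.
  by apply: ge_sup; [exists 0 | move=> _ [v [u [v1 u1 ->]]]; exact: key].
apply: enorm_le_bound; first lra.
by move=> v u v1 u1; apply: le_trans sc; exact: ub.
Qed.

(** One term of the exponential series evaluated at ln(1 + x). All moments of the logarithm are
    thereby controlled by the first moment of its argument. *)
Lemma lnD1_pow (N : nat) (x : R) : 0 <= x ->
  ln (1 + x) ^+ N <= N`!%:R * (1 + x).
Proof.
move=> x0; have x1 : 0 < 1 + x by lra.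
have l0 : 0 <= ln (1 + x) by rewrite ln_ge0 // lerDl.
case: N => [|N]; first by rewrite expr0 fact0 mul1r; lra.
have := expR_ge1Dxn N l0; rewrite lnK ?posrE // => h.
by rewrite -ler_pdivrMl ?ltr0n ?fact_gt0 // mulrC; lra.
Qed.

End OperatorNormNet.

(** * Moments of a random bound on the operator norm *)

Section OperatorNormMoments.
Context {R : realType} {d : measure_display} {T : measurableType d}.
Variables (mu : probability T R) (n p : nat) (G : T -> 'M[R]_(n, p)).
Hypothesis mG : forall i j, measurable_fun setT (fun t => G t i j).
Hypothesis laplace : forall u : 'M[R]_(n, p),
  (\int[mu]_t (expR (\sum_i \sum_j u i j * G t i j))%:E <=
   (expR (\sum_i \sum_j u i j ^+ 2 / 2))%:E)%E.

Definition netterm (f : {ffun 'I_n -> bool * 'I_(4 * n).+1})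
    (g : {ffun 'I_p -> bool * 'I_(4 * p).+1}) (t : T) : R :=
  expR (- netl1 f - netl1 g
        + Num.sqrt n%:R * dot (netvec f) (G t *m netvec g)
        - n%:R * dot (netvec f) (netvec f) * dot (netvec g) (netvec g) / 2).

(** The factor exp(-2(n + p)) dominates the total weight 4^(n + p) of the two nets, which brings the
    mean down to at most 1. *)
Definition netsum (t : T) : R :=
  expR (- (2 * (n + p)%:R)) * \sum_f \sum_g netterm f g t.

Lemma Ele_netsum : Ele mu netsum 1.
Proof.
have dE f g t : Num.sqrt n%:R * dot (netvec f) (G t *m netvec g) =
    \sum_i \sum_j (Num.sqrt n%:R * netvec f i 0 * netvec g j 0) * G t i j.
  rewrite mulr_sumr; apply: eq_bigr => i _; rewrite [(G t *m _) _ _]mxE mulr_sumr mulr_sumr.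
  by apply: eq_bigr => j _; ring.
have sE (f : {ffun 'I_n -> bool * 'I_(4 * n).+1}) (g : {ffun 'I_p -> bool * 'I_(4 * p).+1}) : \sum_i \sum_j
    (Num.sqrt n%:R * netvec f i 0 * netvec g j 0) ^+ 2 / 2 =
    n%:R * dot (netvec f) (netvec f) * dot (netvec g) (netvec g) / 2 :> R.
  rewrite {1}/dot mulr_sumr !mulr_suml; apply: eq_bigr => i _.
  rewrite /dot mulr_sumr mulr_suml; apply: eq_bigr => j _.
  by rewrite !exprMn sqr_sqrtr ?ler0n //; ring.
have mdot u : measurable_fun setT (fun t => \sum_i \sum_j (u i j : R) * G t i j).
  by apply: measurable_sum => i; apply: measurable_sum => j; exact: measurable_funM.
have Et f g : Ele mu (netterm f g) (expR (- netl1 f) * expR (- netl1 g)).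
  pose u : 'M[R]_(n, p) := \matrix_(i, j) (Num.sqrt n%:R * netvec f i 0 * netvec g j 0).
  pose q : R := n%:R * dot (netvec f) (netvec f) * dot (netvec g) (netvec g) / 2.
  have E1 : Ele mu (fun t => expR (\sum_i \sum_j u i j * G t i j)) (expR q).
    split.
    - exact: measurableT_comp.
    - by move=> t; exact: expR_ge0.
    apply: le_trans (laplace u) _; rewrite lee_fin ler_expR /q -sE.
    by apply: ler_sum => i _; apply: ler_sum => j _; rewrite mxE.
  have := EleZ (expR_ge0 (- netl1 f - netl1 g - q)) E1.
  rewrite -!expRD subrK expRD; congr Ele; apply/funext => t.
  rewrite -expRD /netterm dE -/q; congr expR.
  rewrite addrAC; congr (_ + _ - _).
  by apply: eq_bigr => i _; apply: eq_bigr => j _; rewrite mxE.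
have := Ele_sum (index_enum _) (fun f => Ele_sum (index_enum _) (Et f)).
move=> /(EleZ (expR_ge0 (- (2 * (n + p)%:R))))/(Ele_wk _); apply.
under eq_bigr do rewrite -mulr_sumr.
rewrite -mulr_suml expRN mulrC ler_pdivrMr ?expR_gt0 // mul1r.
apply: (@le_trans _ _ (4 ^+ n * 4 ^+ p)).
  apply: ler_pM; try exact: net_weight_sum; apply: sumr_ge0 => f _; exact: expR_ge0.
rewrite -exprD; have -> : 2 * (n + p)%:R = (n + p)%:R * 2 :> R by rewrite mulrC.
rewrite expRM_natl lerXn2r ?nnegrE ?expR_ge0 //.
have := expR_ge1Dx (1 : R); have -> : (2 : R) = 1 + 1 by lra.
rewrite expRD => h; nra.
Qed.

(** A single summand is at most the whole sum. Its logarithm bounds sqrt n times the bilinear form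
    at net points by n/2 + 6(n + p) + ln(1 + netsum), where n/2 is the quadratic term and 6 = 4 + 2
    comes from the l1 norms and the normalization; [net_opnorm] doubles the bound. *)
Lemma netsum_opnorm t u : (0 < n)%N -> (0 < p)%N ->
  enorm (G t *m u) <= Num.sqrt n%:R *
    (1 + 12 * (1 + p%:R / n%:R) + 2 / n%:R * ln (1 + netsum t)) * enorm u.
Proof.
move=> n0 p0; have n0' : 0 < n%:R :> R by rewrite ltr0n.
pose s : R := Num.sqrt n%:R.
have s0 : 0 < s by rewrite sqrtr_gt0.
have ssq : s * s = n%:R by rewrite -expr2 sqr_sqrtr // ltW.
pose c := (n%:R / 2 + 6 * (n + p)%:R + ln (1 + netsum t)) / s.
have -> : s * (1 + 12 * (1 + p%:R / n%:R) + 2 / n%:R * ln (1 + netsum t)) = 2 * c.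
  rewrite /c -ssq natrD -ssq; field.
  by rewrite gt_eqF.
apply: net_opnorm => // f g fl gl f1 g1.
rewrite /c ler_pdivlMr // mulrC.
suff : expR (s * dot (netvec f) (G t *m netvec g) - n%:R / 2 - 6 * (n + p)%:R)
    <= 1 + netsum t.
  have n1 : 0 < 1 + netsum t by case: Ele_netsum => _ h _; have := h t; lra.
  by rewrite -{1}[1 + netsum t]lnK ?posrE // ler_expR; lra.
apply: (@le_trans _ _ (netsum t)); last lra.
have nt0 f' g' : 0 <= netterm f' g' t by exact: expR_ge0.
apply: (@le_trans _ _ (expR (- (2 * (n + p)%:R)) * netterm f g t)).
  rewrite /netterm -expRD ler_expR natrD -/s.
  have ff : dot (netvec f) (netvec f) <= 1 :> R by rewrite -enorm_sqr expr_le1 // enorm_ge0.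
  have gg : dot (netvec g) (netvec g) <= 1 :> R by rewrite -enorm_sqr expr_le1 // enorm_ge0.
  have : n%:R * dot (netvec f) (netvec f) * dot (netvec g) (netvec g) <= n%:R :> R.
    rewrite -mulrA ler_piMr ?(ltW n0') // mulr_ile1 // dot_ge0 //.
  lra.
rewrite ler_wpM2l ?expR_ge0 // (bigD1 f) //= (bigD1 g) //= -addrA lerDl.
rewrite addr_ge0 // sumr_ge0 // => f' _; rewrite sumr_ge0 // => g' _.
Qed.

(** The random part is a logarithm divided by n, so that the excess over [kap] is of order 1/n in
    mean. *)
Definition opbound (kap : R) (t : T) : R := kap + 2 / n%:R * ln (1 + netsum t).

(** The factorial is that of [lnD1_pow], and the powers of 2 come mostly from [exprD_le2]. *)
Definition momc (kap : R) (N : nat) : R :=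
  2 ^+ N.+2 * (kap ^+ N + 2 ^+ N * N.+1`!%:R).

Let netsum_ge0 t : 0 <= netsum t.
Proof. by case: Ele_netsum. Qed.

Let ln0 t : 0 <= ln (1 + netsum t).
Proof. by rewrite ln_ge0 // lerDl. Qed.

Lemma opbound_ge kap t : kap <= opbound kap t.
Proof. by rewrite lerDl mulr_ge0 // divr_ge0. Qed.

Lemma measurable_opbound kap : measurable_fun setT (opbound kap).
Proof.
apply: measurable_funD => //; apply: measurable_funM => //.
apply: measurableT_comp; first exact: measurable_ln.
by apply: measurable_funD => //; case: Ele_netsum.
Qed.

Lemma exprD_le2 (a b : R) N : 0 <= a -> 0 <= b ->
  (a + b) ^+ N <= 2 ^+ N * (a ^+ N + b ^+ N).
Proof.
move=> a0 b0; wlog ab : a b a0 b0 / a <= b.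
  by move=> h; case: (lerP a b) => [|/ltW] ab; [|rewrite addrC [X in _ * X]addrC]; exact: h.
apply: (@le_trans _ _ ((2 * b) ^+ N)).
  by rewrite lerXn2r ?nnegrE ?addr_ge0 ?mulr_ge0 //; lra.
by rewrite exprMn ler_wpM2l ?exprn_ge0 // lerDr exprn_ge0.
Qed.

(** It makes the event that the bound exceeds [kap] + 1 cost only 1/n, even against powers of the
    bound. *)
Lemma Ele_opbound_tail kap N : (0 < n)%N -> 1 <= kap ->
  Ele mu (fun t => opbound kap t ^+ N * (opbound kap t - kap)) (momc kap N / n%:R).
Proof.
move=> n0 k1; have n1 : 1 <= n%:R :> R by rewrite ler1n.
have c0 : 0 <= momc kap N / 2 / n%:R.
  rewrite !divr_ge0 // ?ler0n // mulr_ge0 ?exprn_ge0 // addr_ge0 ?mulr_ge0 ?exprn_ge0 //; lra.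
have E := EleZ c0 (EleD (Ele_cst mu ler01) Ele_netsum).
apply: Ele_wk; last apply: Ele_le E.
- by have -> : momc kap N / 2 / n%:R * (1 + 1) = momc kap N / n%:R by lra.
- apply: measurable_funM; first by apply: measurable_funX; exact: measurable_opbound.
  by apply: measurable_funB => //; exact: measurable_opbound.
move=> t; have := opbound_ge kap t => kt.
rewrite mulr_ge0 ?exprn_ge0 ?subr_ge0 //=; last by apply: le_trans kt; lra.
rewrite /opbound [kap + _]addrC addrK addrC; set x := ln _.
have x0 : 0 <= x by exact: ln0.
have ni : 0 <= (n%:R^-1 : R) <= 1 by rewrite invr_ge0 ler0n invf_le1 ?ltr0n.
have xn : 0 <= 2 / n%:R * x <= 2 * x.
  by rewrite mulr_ge0 ?divr_ge0 //= ler_wpM2r // ler_piMr //; case/andP: ni.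
apply: (@le_trans _ _ (2 ^+ N * (kap ^+ N + (2 * x) ^+ N) * (2 / n%:R * x))).
  rewrite ler_wpM2r ?(proj1 (andP xn)) // (le_trans (exprD_le2 _ _ _)) //; [lra|lra|].
  rewrite ler_wpM2l ?exprn_ge0 // lerD2l lerXn2r ?nnegrE; lra.
have x1 : x <= 1 + netsum t.
  by have := lnD1_pow 1 (netsum_ge0 t); rewrite expr1 mul1r.
have xN : x ^+ N * x <= N.+1`!%:R * (1 + netsum t).
  by rewrite -exprSr; exact: lnD1_pow.
have -> : 2 ^+ N * (kap ^+ N + (2 * x) ^+ N) * (2 / n%:R * x) =
   2 ^+ N.+1 / n%:R * (kap ^+ N * x + 2 ^+ N * (x ^+ N * x)).
  by rewrite exprMn [2 ^+ N.+1]exprS; ring.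
have -> : momc kap N / 2 / n%:R * (1 + netsum t) = 2 ^+ N.+1 / n%:R *
   (kap ^+ N * (1 + netsum t) + 2 ^+ N * (N.+1`!%:R * (1 + netsum t))).
  by rewrite /momc ![2 ^+ N.+2]exprS [2 ^+ N.+1]exprS; field; rewrite gt_eqF // ltr0n.
rewrite ler_wpM2l ?divr_ge0 ?exprn_ge0 // lerD // ler_wpM2l ?exprn_ge0 //; lra.
Qed.

Lemma Ele_opbound kap N : (0 < n)%N -> 1 <= kap ->
  Ele mu (fun t => opbound kap t ^+ N) (momc kap N).
Proof.
move=> n0 k1; have n1 : 1 <= n%:R :> R by rewrite ler1n.
have c0 : 0 <= momc kap N / 2.
  rewrite !divr_ge0 // mulr_ge0 ?exprn_ge0 // addr_ge0 ?mulr_ge0 ?exprn_ge0 //; lra.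
have E := EleZ c0 (EleD (Ele_cst mu ler01) Ele_netsum).
apply: Ele_wk; last apply: Ele_le E.
- by have -> : momc kap N / 2 * (1 + 1) = momc kap N by lra.
- by apply: measurable_funX; exact: measurable_opbound.
move=> t; have := opbound_ge kap t => kt.
rewrite exprn_ge0 //=; last by apply: le_trans kt; lra.
rewrite /opbound; set x := ln _.
have x0 : 0 <= x by exact: ln0.
have ni : 0 <= (n%:R^-1 : R) <= 1 by rewrite invr_ge0 ler0n invf_le1 ?ltr0n.
have xn : 0 <= 2 / n%:R * x <= 2 * x.
  by rewrite mulr_ge0 ?divr_ge0 //= ler_wpM2r // ler_piMr //; case/andP: ni.
apply: (@le_trans _ _ (2 ^+ N * (kap ^+ N + (2 * x) ^+ N))).
  rewrite (le_trans (exprD_le2 _ _ _)) //; [lra|lra|].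
  rewrite ler_wpM2l ?exprn_ge0 // lerD2l lerXn2r ?nnegrE; lra.
have xN : x ^+ N <= N`!%:R * (1 + netsum t) by exact: lnD1_pow.
have -> : momc kap N / 2 * (1 + netsum t) = 2 ^+ N.+1 *
   (kap ^+ N * (1 + netsum t) + 2 ^+ N * (N.+1`!%:R * (1 + netsum t))).
  by rewrite /momc ![2 ^+ N.+2]exprS; lra.
have fN : N`!%:R <= N.+1`!%:R :> R by rewrite ler_nat factS leq_pmull.
have nt := netsum_ge0 t.
apply: ler_pM.
- by rewrite exprn_ge0.
- by rewrite addr_ge0 ?exprn_ge0 //; lra.
- by rewrite ler_eXn2l //; lra.
rewrite lerD //.
  by rewrite ler_peMr ?exprn_ge0 //; lra.
rewrite exprMn ler_wpM2l ?exprn_ge0 // (le_trans xN) // ler_wpM2r //; lra.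
Qed.

Lemma opbound_opnorm kap t u : (0 < n)%N -> (0 < p)%N ->
  1 + 12 * (1 + p%:R / n%:R) <= kap ->
  enorm (G t *m u) <= Num.sqrt n%:R * opbound kap t * enorm u.
Proof.
move=> n0 p0 kp; apply: le_trans (netsum_opnorm t u n0 p0) _.
by rewrite ler_wpM2r ?enorm_ge0 // ler_wpM2l ?sqrtr_ge0 // lerD2r.
Qed.

End OperatorNormMoments.

(** * Differentiability almost everywhere of Lipschitz functions *)

Section LipschitzDerivable.
Context {R : realType}.
Local Notation leb := (@lebesgue_measure R).

Section Cumulative.
Variables (phi : R -> R) (L : R).
Hypothesis L0 : 0 < L.
Hypothesis lip : forall x y, `|phi x - phi y| <= L * `|x - y|.

Let lip_continuous : continuous phi.
Proof.
move=> x; apply/cvgrPdist_le => e e0; near=> y.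
rewrite (le_trans (lip x y)) // -ler_pdivlMl // mulrC.
near: y; apply: cvgr_dist_le => //; rewrite divr_gt0 //.
Unshelve. all: by end_near. Qed.

Definition lip_up x := L * x + phi x.
Definition lip_down x := L * x - phi x.

Let nd_up : {homo lip_up : x y / x <= y}.
Proof.
move=> x y xy; have := lip x y; rewrite (distrC x) (ger0_norm (_ : 0 <= y - x)) ?subr_ge0 //.
by move/ler_normlP => [_]; rewrite /lip_up; lra.
Qed.

Let nd_down : {homo lip_down : x y / x <= y}.
Proof.
move=> x y xy; have := lip x y; rewrite (distrC x) (ger0_norm (_ : 0 <= y - x)) ?subr_ge0 //.
by move/ler_normlP => []; rewrite /lip_down; lra.
Qed.

Let continuous_up : continuous lip_up.
Proof.
by move=> x; apply: cvgD; [apply: cvgM; [exact: cvg_cst|exact: cvg_id]|exact: lip_continuous].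
Qed.

Let continuous_down : continuous lip_down.
Proof.
by move=> x; apply: cvgB; [apply: cvgM; [exact: cvg_cst|exact: cvg_id]|exact: lip_continuous].
Qed.

#[local] HB.instance Definition _ :=
  isCumulative.Build R _ R lip_up nd_up (right_continuousW continuous_up).
#[local] HB.instance Definition _ :=
  isCumulative.Build R _ R lip_down nd_down (right_continuousW continuous_down).

Let muU := lebesgue_stieltjes_measure lip_up.
Let muD := lebesgue_stieltjes_measure lip_down.

Let stieltjes_itv (F : cumulative R R) (a b : R) : a <= b ->
  lebesgue_stieltjes_measure F `]a, b]%classic = (F b - F a)%:E.
Proof.
move=> ab; rewrite /lebesgue_stieltjes_measure /measure_extension.
rewrite measurable_mu_extE /=; last exact: is_ocitv.
by rewrite wlength_itv_bnd.
Qed.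

(** The Stieltjes measures of Lx + phi and Lx - phi add up to 2L times Lebesgue measure, so each of
    them is absolutely continuous. *)
Lemma lip_up_dominated : muU `<< leb.
Proof.
apply/null_content_dominatesP => A mA A0.
have L20 : 0 <= (2 * L)^-1 by rewrite invr_ge0 mulr_ge0 // ltW.
pose m := mscale (NngNum L20) (measure_add muU muD).
have mE B : m B = (((2 * L)^-1)%:E * (muU B + muD B))%E.
  by rewrite /m /mscale /=; congr (_ * _)%E; exact: measure_addE.
have : m A = 0%E.
  rewrite -A0; apply/esym/lebesgue_measure_unique => //= _ [[a b]] _ <- /=.
  rewrite -/m.
  have [ab|ba] := leP a b; last first.
    by rewrite set_itv_ge ?bnd_simp -?leNgt ?ltW // !measure0.
  rewrite lebesgue_measure_itv /= lte_fin mE /muU /muD.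
  rewrite !stieltjes_itv // -EFinD -EFinM /lip_up /lip_down.
  have -> : (2 * L)^-1 * (L * b + phi b - (L * a + phi a) + (L * b - phi b - (L * a - phi a))) = b - a.
    by field; rewrite gt_eqF.
  case: ltP => // ba; congr (_%:E); have -> : a = b by apply/eqP; rewrite eq_le ab ba.
  by rewrite subrr.
rewrite mE => hm.
have L2 : 0 < (2 * L)^-1 by rewrite invr_gt0 mulr_gt0.
have s0 : (muU A + muD A <= 0)%E.
  move/eqP: hm; rewrite mule_eq0 eqe gt_eqF //= => /eqP hm.
  by rewrite -[leLHS]/((muU A + muD A)%E) hm.
apply/eqP; rewrite eq_le measure_ge0 andbT (le_trans _ s0) //.
by rewrite leeDl // measure_ge0.
Qed.

(** The Radon-Nikodym density of the Stieltjes measure on a bounded interval writes Lx + phi as an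
    indefinite integral up to a constant, which is derivable almost everywhere. *)
Lemma global_lipschitz_ae_derivable_itv (M : R) :
  {ae leb, forall x, - M < x < M -> derivable phi x 1}.
Proof.
have [M0|M0] := leP M 0.
  by apply: aeW => x /andP[h1 h2]; exfalso; lra.
pose D : set (measurableTypeR R) := `]- M, M]%classic.
have mD : measurable D by exact: measurable_itv.
have NM : - M <= M by lra.
have Doo : (muU D < +oo)%E by rewrite /muU stieltjes_itv // ltry.
pose nu := mfrestr mD Doo.
have nulam : nu `<< leb.
  apply/null_content_dominatesP => A mA A0.
  apply/eqP; rewrite eq_le measure_ge0 andbT.
  have /null_content_dominatesP h := lip_up_dominated.
  rewrite /nu /mfrestr /mrestr -(h A mA A0).
  by apply: le_measure => //; rewrite inE //; exact: measurableI.
have [f [f0 ffin fint fE]] := radon_nikodym_sigma_finite nulam.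
pose g x := fine (f x).
have gE : EFin \o g = f by apply/funext => x; rewrite /= fineK.
have gint y : leb.-integrable `]-oo, y] (EFin \o g).
  by rewrite gE; exact: (integrableS measurableT).
have gloc : locally_integrable [set: R] g.
  by apply: open_integrable_locally => //; [exact: openT | rewrite gE].
have := FTC1Ny gint gloc.
apply: filterS; first exact: (ae_filter_ringOfSetsType leb).
move=> x [gd _] /andP[xM1 xM2].
have phiE : \forall y \near x,
    phi y = (\int[leb]_(t in `]-oo, y]) g t)%R - L * y + lip_up (- M).
  near=> y.
  have yM : - M < y < M.
    by apply/andP; split; near: y; [exact: lt_nbhsr|exact: lt_nbhsl].
  have /andP[y1 y2] := yM.
  have -> : (\int[leb]_(t in `]-oo, y]) g t)%R = lip_up y - lip_up (- M).
    rewrite /Rintegral.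
    have -> : (\int[leb]_(t in `]-oo, y]) (g t)%:E)%E = nu `]-oo, y]%classic.
      have -> : nu `]-oo, y]%classic = (\int[leb]_(t in `]-oo, y]) f t)%E by exact: fE.
      by apply: eq_integral => t _; rewrite -gE.
    rewrite /nu /mfrestr /mrestr.
    have -> : `]-oo, y]%classic `&` D = `]- M, y]%classic.
      apply/seteqP; split => t; rewrite /D /= !in_itv /=.
        by move=> [ty /andP[-> _]].
      by move=> /andP[-> ty]; rewrite ty (le_trans ty) // ltW.
    by rewrite /muU stieltjes_itv // ltW.
  by rewrite /lip_up; lra.
have dd : derivable ((fun y => (\int[leb]_(t in `]-oo, y]) g t)%R) - (L \*: id) + cst (lip_up (- M))) x 1.
  apply: derivableD; last exact: derivable_cst.
  by apply: derivableB; [exact: gd | apply: derivableZ; exact: derivable_id].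
apply: near_eq_derivable dd; near=> y.
rewrite [RHS](_ : _ = (\int[leb]_(t in `]-oo, y]) g t)%R - L * y + lip_up (- M)) //.
by near: y.
Unshelve. all: by end_near. Qed.

End Cumulative.

Lemma locally_lipschitz_ae_derivable (phi : R -> R) :
  (forall M, 0 < M -> exists2 L, 0 < L & forall x y,
     `|x| <= M -> `|y| <= M -> `|phi x - phi y| <= L * `|x - y|) ->
  {ae leb, forall x, derivable phi x 1}.
Proof.
move=> loc.
suff main (k : nat) : {ae leb, forall x, - k%:R < x < k%:R -> derivable phi x 1}.
  apply: negligibleS (negligible_bigcup main) => x /= xnd.
  exists (Num.truncn `|x|).+1 => //= h; apply: xnd; apply: h.
  by rewrite -ltr_norml truncnS_gt.
have [k0|k0] := leqP k 0.
  move: k0; rewrite leqn0 => /eqP ->.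
  by apply: aeW => x /andP[h1 h2]; exfalso; lra.
have [L L0 lip] := loc k%:R (ltac:(by rewrite ltr0n)).
(* Composition with the clamp onto [-k, k] is globally Lipschitz and agrees with [phi] near every
   interior point. *)
pose cl (x : R) := Num.max (- k%:R) (Num.min x k%:R).
have clb x : `|cl x| <= k%:R.
  rewrite ler_norml /cl le_max lexx /= ge_max ge_min lexx orbT andbT.
  by have := ler0n R k; lra.
have cl1' x y : x <= y -> 0 <= cl y - cl x <= y - x.
  move=> xy; have k0' := ler0n R k; rewrite /cl /Num.max /Num.min.
  by case: (ltP x k%:R) => hx; case: (ltP y k%:R) => hy;
    case: ltP => hx'; case: ltP => hy'; apply/andP; split; lra.
have cl1 x y : `|cl x - cl y| <= `|x - y|.
  have [xy|/ltW yx] := leP x y.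
    have /andP[h1 h2] := cl1' x y xy.
    by rewrite distrC (distrC x) !ger0_norm // subr_ge0.
  have /andP[h1 h2] := cl1' y x yx.
  by rewrite !ger0_norm // subr_ge0.
have lipc x y : `|phi (cl x) - phi (cl y)| <= L * `|x - y|.
  by rewrite (le_trans (lip _ _ (clb x) (clb y))) // ler_pM2l.
have := global_lipschitz_ae_derivable_itv L0 lipc k%:R.
apply: filterS; first exact: (ae_filter_ringOfSetsType leb).
move=> x h xk; have /andP[xk1 xk2] := xk.
have := h xk; apply: near_eq_derivable; near=> y.
have : - k%:R < y < k%:R.
  by apply/andP; split; near: y; [exact: lt_nbhsr|exact: lt_nbhsl].
move=> /andP[y1 y2]; rewrite /cl; congr phi.
rewrite (min_idPl (ltW y2)); exact: (max_idPr (ltW y1)).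
Unshelve. all: by end_near. Qed.
End LipschitzDerivable.

(** * Derivatives through estimates of increments *)

Section EpsilonDerivative.
Context {R : realType}.
Implicit Types (f h q : R -> R) (x c : R).

Lemma is_derive_epsP f x c : is_derive x 1 f c <->
  forall e, 0 < e -> exists2 d, 0 < d & forall s, `|s| < d ->
    `|f (x + s) - f x - c * s| <= e * `|s|.
Proof.
split=> [[fd fc] e e0|h].
  have : (fun s => s^-1 *: (f (s *: 1 + x) - f x)) @ (0 : R)^' --> c.
    by rewrite -fc; exact: fd.
  move=> /cvgrPdist_le /(_ e e0); rewrite /prop_near1 /= => /nbhs_ballP[d d0 hd].
  exists d => // s sd; have [->|s0] := eqVneq s 0.
    by rewrite addr0 subrr mulr0 subr0 normr0 mulr0.
  have := hd s; rewrite /ball /= sub0r normrN => /(_ sd s0).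
  have -> : f (x + s) - f x - c * s =
      - ((c - s^-1 *: (f (s *: 1 + x) - f x)) * s).
    by rewrite [s *: 1]mulr1 (addrC s) /GRing.scale /=; field.
  by rewrite normrN normrM ler_pM2r ?normr_gt0.
have hc : (fun s => s^-1 *: (f (s *: 1 + x) - f x)) @ (0 : R)^' --> c.
  apply/cvgrPdist_le => e e0; have [d d0 hd] := h e e0.
  apply/nbhs_ballP; exists d => //= s; rewrite /ball /= sub0r normrN => sd s0.
  rewrite -(ler_pM2r (_ : 0 < `|s|)) ?normr_gt0 // -normrM -normrN.
  have <- : f (x + s) - f x - c * s =
      - ((c - s^-1 *: (f (s *: 1 + x) - f x)) * s).
    by rewrite [s *: 1]mulr1 (addrC s) /GRing.scale /=; field.
  exact: hd.
by split; [apply/cvg_ex; exists c | apply/cvg_lim].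
Qed.

(** The chain rule read backwards. As [a] is positive, the intermediate value theorem presents every
    point near [h 0] as [h s] with |s| comparable to the distance, so the increments of [q] can be
    computed along [h]. *)
Lemma derive_comp_inv q h c a (r : R) : 0 < r -> 0 < a ->
  (forall s, `|s| < r -> {for s, continuous h}) ->
  is_derive (0 : R) 1 h a -> is_derive (0 : R) 1 (q \o h) c ->
  is_derive (h 0) 1 q (c / a).
Proof.
move=> r0 h0 ch /is_derive_epsP dh /is_derive_epsP dqh.
apply/is_derive_epsP => e e0; set A := `|c / a|.
have A0 : 0 <= A by exact: normr_ge0.
(* The first bound keeps the increment of [h] at least a|s|/2; the second makes the total error at
   most e a|s|/2. *)
pose eta := Num.min (a / 2) (e * a / (2 * (1 + A))).
have eta0 : 0 < eta by rewrite lt_min !divr_gt0 ?mulr_gt0 //; lra.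
have etah : eta <= a / 2 by rewrite ge_min lexx.
have etae : eta * (1 + A) <= e * a / 2.
  have : eta <= e * a / (2 * (1 + A)) by rewrite ge_min lexx orbT.
  rewrite ler_pdivlMr; last lra.
  by rewrite mulrCA; lra.
have [d d0 hd] := dh _ eta0; have [d' d'0 hd'] := dqh _ eta0.
pose D := Num.min (Num.min d d') r / 2.
have mD : 0 < Num.min (Num.min d d') r by rewrite !lt_min d0 d'0.
have D0 : 0 < D by rewrite divr_gt0.
have DE : D < Num.min (Num.min d d') r by rewrite /D; lra.
have [Dd Dd' Dr] : [/\ D < d, D < d' & D < r].
  by move: DE; rewrite !lt_min => /andP[/andP[-> ->] ->].
exists (a * D / 2) => [|v vD]; first by rewrite divr_gt0 // mulr_gt0.
have [s sD hs] : exists2 s, s \in `[- D, D] & h s = h 0 + v.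
  apply: IVT; first lra.
    apply: continuous_in_subspaceT => s; rewrite inE /= in_itv /= => sD.
    by apply: ch; rewrite (le_lt_trans _ Dr) // ler_norml.
  have := hd D; have := hd (- D); rewrite !add0r normrN !(gtr0_norm D0).
  move=> /(_ Dd) + /(_ Dd); rewrite !ler_norml => /andP[h1 h2] /andP[h3 h4].
  have : eta * D <= a / 2 * D by rewrite ler_pM2r.
  move: vD; rewrite ltr_norml => /andP[v1 v2] eD.
  by rewrite ge_min le_max; apply/andP; split; apply/orP; [left|right]; lra.
have sn : `|s| <= D by move: sD; rewrite in_itv /= -ler_norml.
have := hd s (le_lt_trans sn Dd); rewrite add0r hs => h1.
have := hd' s (le_lt_trans sn Dd'); rewrite add0r /= hs => h2.
have sv : a / 2 * `|s| <= `|v|.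
  have : a * `|s| <= `|v| + eta * `|s|.
    rewrite -(gtr0_norm h0) -normrM.
    have -> : a * s = v - (h 0 + v - h 0 - a * s) by lra.
    by rewrite (le_trans (ler_normB _ _)) // lerD2l.
  have : eta * `|s| <= a / 2 * `|s| by rewrite ler_wpM2r.
  lra.
have -> : q (h 0 + v) - q (h 0) - c / a * v =
   (q (h 0 + v) - q (h 0) - c * s) - c / a * (h 0 + v - h 0 - a * s).
  by field; rewrite gt_eqF.
rewrite (le_trans (ler_normB _ _)) // normrM -/A.
apply: (@le_trans _ _ (eta * (1 + A) * `|s|)).
  by have := ler_wpM2l A0 h1; lra.
apply: (@le_trans _ _ (e * (a / 2 * `|s|))).
  by rewrite mulrA ler_wpM2r // mulrA.
by rewrite ler_wpM2l // ltW.
Qed.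

(* The derivative of q may fail to exist at h 0 only when a = 0, and then both
   sides vanish, whatever value derive1 q takes there. *)
Lemma chain_rule_lipschitz q h c a (r : R) : 0 < r ->
  (forall u v, `|q u - q v| <= `|u - v|) ->
  (forall s, `|s| < r -> {for s, continuous h}) ->
  is_derive (0 : R) 1 h a -> is_derive (0 : R) 1 (q \o h) c ->
  c = derive1 q (h 0) * a.
Proof.
move=> r0 lipq ch dh dqh.
have [h0|h0|h0] := ltgtP a 0.
- have dN (f : R -> R) k : is_derive (0 : R) 1 f k -> is_derive (0 : R) 1 (f \o -%R) (- k).
    move=> /is_derive_epsP H; apply/is_derive_epsP => e e0; have [d d0 hd] := H _ e0.
    exists d => // s sd; have := hd (- s); rewrite normrN !add0r => /(_ sd).
    by rewrite /= oppr0 mulrN mulNr.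
  have na : 0 < - a by rewrite oppr_gt0.
  have chN s : `|s| < r -> {for s, continuous (h \o -%R)}.
    move=> sr; apply: continuous_comp; first exact: opp_continuous.
    by apply: ch; rewrite normrN.
  have := derive_comp_inv r0 na chN (dN _ _ dh) (dN _ _ dqh).
  rewrite /= oppr0 invrN mulrNN => dq.
  by rewrite derive1E derive_val divfK // lt_eqF.
- have dq := derive_comp_inv r0 h0 ch dh dqh.
  by rewrite derive1E derive_val divfK // gt_eqF.
rewrite h0 mulr0; apply/eqP; rewrite -normr_eq0; apply/eqP.
apply: le_anti; rewrite normr_ge0 andbT; apply/ler_addgt0Pl => e e0.
rewrite addr0; have e2 : 0 < e / 2 by lra.
have /is_derive_epsP/(_ _ e2)[d d0 hd] := dh.
have /is_derive_epsP/(_ _ e2)[d' d'0 hd'] := dqh.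
pose s := Num.min d d' / 2.
have md : 0 < Num.min d d' by rewrite lt_min d0.
have s0 : 0 < s by rewrite divr_gt0.
have [sd sd'] : s < d /\ s < d'.
  by have : s < Num.min d d' by [rewrite /s; lra]; rewrite lt_min => /andP[].
have := hd s; have := hd' s; rewrite !add0r gtr0_norm // => /(_ sd') h1 /(_ sd).
rewrite h0 mul0r subr0 => h2.
rewrite -(ler_pM2r s0) -{1}(gtr0_norm s0) -normrM.
have -> : c * s = (q (h s) - q (h 0)) - (q (h s) - q (h 0) - c * s) by lra.
rewrite (le_trans (ler_normB _ _)) //.
have := lipq (h s) (h 0); move: h1 => /= h1; lra.
Qed.

(** One sequence through all 1/k and -1/k, so that its quotients control both sides of 0. *)
Definition altstep (m : nat) : R := (-1) ^+ odd m * (m./2.+1)%:R^-1.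

Lemma altstep_neq0 m : altstep m != 0.
Proof. by rewrite mulf_neq0 ?signr_eq0 // invr_neq0 // pnatr_eq0. Qed.

(** Every small s is within |s|/k of a point of the sequence, with k close to 1/|s|, so for a
    Lipschitz function the quotients along the sequence determine the derivative. Derivability thus
    becomes a countable condition, hence a measurable one. *)
Lemma lipschitz_altstep_derive f L c : 0 <= L ->
  (forall s r, `|s| <= 1 -> `|r| <= 1 -> `|f s - f r| <= L * `|s - r|) ->
  (fun m => (f (altstep m) - f 0) / altstep m) @ \oo --> c ->
  is_derive (0 : R) 1 f c.
Proof.
move=> L0 lip; rewrite cvgrPdist_le /= => hc.
apply/is_derive_epsP => e e0.
have e2 : 0 < e / 2 by lra.
have [N _ hN] := hc _ e2.
pose LC := L + `|c|.
have LC0 : 0 <= LC by rewrite addr_ge0.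
pose M := maxn N (Num.truncn (LC / (e / 2))).+1.
have ML : LC <= e / 2 * M%:R.
  rewrite mulrC -ler_pdivrMr // (le_trans (ltW (truncnS_gt _))) //.
  by rewrite ler_nat leq_maxr.
exists (M.+1%:R^-1) => [|s sM]; first by rewrite invr_gt0.
have [->|s0] := eqVneq s 0.
  by rewrite addr0 subrr mulr0 subr0 normr0 mulr0.
have sn : 0 < `|s| by rewrite normr_gt0.
pose k := Num.truncn (`|s|^-1).
have /andP[k1 k2] : k%:R <= `|s|^-1 < k.+1%:R.
  by apply: truncn_itv; rewrite invr_ge0.
have kM : (M < k)%N.
  rewrite -ltnS -(ltr_nat R) (lt_trans _ k2) // -[ltLHS]invrK ltf_pV2 ?posrE ?invr_gt0 //.
have k0 : 0 < k%:R :> R by rewrite ltr0n (leq_ltn_trans _ kM).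
pose b := s < 0.
pose m := (k.*2 + b)%N.
have am : altstep m = (-1) ^+ b * k.+1%:R^-1.
  rewrite /altstep /m oddD odd_double /= halfD odd_double /= doubleK.
  by rewrite /b; case: (s < 0); rewrite /= ?add0n ?addn0.
have sE : s = (-1) ^+ b * `|s| by rewrite -realEsign ?num_real.
have an : `|altstep m| = k.+1%:R^-1.
  by rewrite am normrM normr_sign mul1r ger0_norm // invr_ge0.
have k1' : 0 < k.+1%:R :> R by rewrite ltr0n.
have as1 : k.+1%:R^-1 <= `|s|.
  by rewrite -[leRHS]invrK lef_pV2 ?posrE ?invr_gt0 // ltW.
have sk : `|s| <= k%:R^-1.
  by rewrite -[leLHS]invrK lef_pV2 ?posrE ?invr_gt0.
have sa : `|s - altstep m| <= `|s| / k%:R.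
  rewrite {1}sE am -mulrBr normrM normr_sign mul1r ger0_norm ?subr_ge0 //.
  have kk : k%:R^-1 - k.+1%:R^-1 = k.+1%:R^-1 / k%:R :> R.
    by rewrite -natr1; field; rewrite natr1 !gt_eqF.
  by rewrite (le_trans (lerB sk (lexx _))) // kk ler_wpM2r // invr_ge0 ltW.
have Nm : (N <= m)%N.
  rewrite (leq_trans (leq_maxl N (Num.truncn (LC / (e / 2))).+1)) // -/M.
  by rewrite (leq_trans (ltnW kM)) // /m -addnn -addnA leq_addr.
have := hN m Nm => /= h1.
have s1 : `|s| <= 1.
  by rewrite (le_trans (ltW sM)) // invf_le1 // ler1n.
have a1 : `|altstep m| <= 1 by rewrite an (le_trans as1).
have h2 : `|f (altstep m) - f 0 - c * altstep m| <= e / 2 * `|altstep m|.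
  have -> : f (altstep m) - f 0 - c * altstep m =
    - ((c - (f (altstep m) - f 0) / altstep m) * altstep m).
    by field; exact: altstep_neq0.
  by rewrite normrN normrM ler_wpM2r.
rewrite add0r.
have -> : f s - f 0 - c * s = (f s - f (altstep m)) +
  (f (altstep m) - f 0 - c * altstep m) - c * (s - altstep m) by lra.
rewrite (le_trans (ler_normB _ _)) // normrM.
rewrite (le_trans (lerD (ler_normD _ _) (lexx _))) //.
have := lip s (altstep m) s1 a1 => h3.
have h4 : LC * `|s - altstep m| <= e / 2 * `|s|.
  apply: (@le_trans _ _ (LC * (`|s| / k%:R))); first by rewrite ler_wpM2l.
  rewrite mulrA ler_pdivrMr // mulrAC ler_wpM2r // (le_trans ML) //.
  by rewrite ler_pM2l // ler_nat ltnW.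
have h5 : e / 2 * `|altstep m| <= e / 2 * `|s| by rewrite ler_pM2l // an.
move: h4; rewrite /LC mulrDl; lra.
Qed.
End EpsilonDerivative.

Section AlternatingSteps.
Context {R : realType}.

Lemma cvg_altstep : (altstep : nat -> R) @ \oo --> (0 : R).
Proof.
apply/cvgrPdist_le => e e0; have [k ke] : exists k, step k < e / 2 :> R.
  have := @cvg_step R; move=> /cvgrPdist_lt /(_ (e / 2)); rewrite divr_gt0 // => /(_ erefl).
  by case=> M _ /(_ M (leqnn M)) /=; rewrite sub0r normrN ger0_norm ?(ltW (step_gt0 _)) //; exists M.
exists k => // m km; rewrite /= sub0r normrN normrM normrX normrN1 expr1n mul1r.
rewrite ger0_norm ?invr_ge0 ?ler0n //; apply: le_trans (_ : 2 * step k <= e); last by lra.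
rewrite /step mulrC ler_pdivlMl ?ltr0n // ler_pdivrMr ?ltr0n // -natrM ler_nat.
by move: km => /= km; have := odd_double_half m; rewrite -mul2n; case: odd; clear -km; lia.
Qed.

End AlternatingSteps.

(** * Convex functions and the estimator *)

Section ConvexLine.
Context {R : realType}.
Implicit Types (f l : R -> R) (a b u v x y : R).

Lemma convexT_le f a b t : convexT (f : R^o -> R) -> 0 <= t <= 1 ->
  f (t * a + (1 - t) * b) <= t * f a + (1 - t) * f b.
Proof.
move=> cf /andP[t0 t1]; have := cf (Itv01 t0 t1) a b.
by rewrite !inE; exact.
Qed.

Definition subgrad f x u : Prop := forall y, f x + u * (y - x) <= f y.

(** The supremum of the left slopes is a subgradient, since convexity places every left slope below
    every right slope. *)
Lemma subgrad_exists f x : convexT (f : R^o -> R) -> exists u, subgrad f x u.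
Proof.
move=> cf.
pose E := [set (f x - f z) / (x - z) | z in [set z | z < x]].
have key z y : z < x -> x < y -> (f x - f z) / (x - z) <= (f y - f x) / (y - x).
  move=> zx xy; rewrite ler_pdivrMr ?subr_gt0 // mulrAC ler_pdivlMr ?subr_gt0 //.
  have yz : 0 < y - z by lra.
  have t01 : 0 <= (y - x) / (y - z) <= 1.
    by rewrite divr_ge0 ?ler_pdivrMr //=; lra.
  have := convexT_le z y cf t01.
  have -> : (y - x) / (y - z) * z + (1 - (y - x) / (y - z)) * y = x.
    by field; rewrite gt_eqF.
  have -> : (y - x) / (y - z) * f z + (1 - (y - x) / (y - z)) * f y =
     ((y - x) * f z + (x - z) * f y) / (y - z) by field; rewrite gt_eqF.
  by rewrite ler_pdivlMr //; lra.
have sE : has_sup E.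
  split; first by exists ((f x - f (x - 1)) / (x - (x - 1))), (x - 1) => //=; lra.
  by exists ((f (x + 1) - f x) / (x + 1 - x)) => _ [z zx <-]; apply: key => //; lra.
exists (sup E) => y; have [yx|xy|->] := ltgtP y x.
- have : (f x - f y) / (x - y) <= sup E by apply: ub_le_sup; [case: sE|exists y].
  by rewrite ler_pdivrMr ?subr_gt0 //; lra.
- have : sup E <= (f y - f x) / (y - x).
    by apply: ge_sup; [case: sE|move=> _ [z zx <-]; exact: key].
  by rewrite ler_pdivlMr ?subr_gt0 //; lra.
- lra.
Qed.

Lemma convexT_continuous f : convexT (f : R^o -> R) -> continuous f.
Proof.
move=> cf x; have [u hu] := subgrad_exists x cf.
have [u1 hu1] := subgrad_exists (x - 1) cf.
have [u2 hu2] := subgrad_exists (x + 1) cf.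
(* Subgradients are monotone, so those at x - 1 and x + 1 bound all subgradients in between. *)
pose L := `|u| + `|u1| + `|u2| + 1.
have L0 : 0 < L by rewrite /L; have := normr_ge0 u; have := normr_ge0 u1; have := normr_ge0 u2; lra.
apply/cvgrPdist_le => e e0; apply/nbhs_ballP; exists (Num.min 1 (e / L)) => /=.
  by rewrite lt_min ltr01 divr_gt0.
move=> y; rewrite /ball /= lt_min => /andP[h1 h2].
have h2' : L * `|x - y| <= e by rewrite mulrC -ler_pdivlMr // ltW.
apply: le_trans h2'; have [v hv] := subgrad_exists y cf.
have := hu y; have := hv x; have := hv (x + 1); have := hv (x - 1).
have := hu1 y; have := hu2 y.
move: h1; rewrite ltr_norml => /andP[h1 h1'] a1 a2 a3 a4 a5 a6.
have v1 : v <= u2 by nra.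
have v2 : u1 <= v by nra.
have vL : `|v| <= L.
  rewrite /L; have := ler_norm u2; have := ler_norm (- u1); rewrite normrN.
  have := normr_ge0 u; have := normr_ge0 u1; have := normr_ge0 u2.
  by move=> *; rewrite ler_norml; apply/andP; split; lra.
have uL : `|u| <= L by rewrite /L; have := normr_ge0 u1; have := normr_ge0 u2; lra.
have e1 : u * (y - x) >= - (L * `|x - y|).
  rewrite -[leRHS]opprK lerN2 -mulrN opprB; apply: le_trans (ler_norm _) _.
  by rewrite normrM ler_wpM2r.
have e2 : v * (x - y) >= - (L * `|x - y|).
  rewrite lerNl -mulNr; apply: le_trans (ler_norm _) _.
  by rewrite normrM normrN ler_wpM2r.
by rewrite ler_norml; apply/andP; split; lra.
Qed.

Lemma subgrad_derive1 f x u : derivable f x 1 -> subgrad f x u -> u = derive1 f x.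
Proof.
move=> df hu; apply/eqP; rewrite -subr_eq0; apply/negPn/negP => ne.
have fd : is_derive x 1 f (derive1 f x) by rewrite derive1E; exact: DeriveDef.
have e0 : 0 < `|u - derive1 f x| / 2 by rewrite divr_gt0 ?normr_gt0.
have [d d0 hd] := (is_derive_epsP f x _).1 fd _ e0.
set c := derive1 f x in ne hd e0 *.
have side (s : R) : `|s| = d / 2 -> (u - c) * s <= `|u - c| / 2 * (d / 2).
  move=> sE; have := hd s; rewrite sE => /(_ _) hs.
  have {}hs : f (x + s) - f x - c * s <= `|u - c| / 2 * (d / 2).
    by apply: le_trans (ler_norm _) (hs _); lra.
  by have := hu (x + s); rewrite addrAC subrr add0r; lra.
have d2 : 0 < d / 2 by lra.
have := side (d / 2) (gtr0_norm d2); have := side (- (d / 2)).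
rewrite normrN gtr0_norm // => /(_ erefl) h1 h2.
have : `|u - c| * (d / 2) <= `|u - c| / 2 * (d / 2).
  by have [h|h] := lerP 0 (u - c); move: h1 h2; [rewrite ger0_norm // | rewrite ltr0_norm //]; lra.
by move: e0; set z := `|_|; nra.
Qed.

Lemma convex_tangent f x : convexT (f : R^o -> R) -> derivable f x 1 ->
  subgrad f x (derive1 f x).
Proof.
move=> cf df; have [u hu] := subgrad_exists x cf.
by rewrite -(subgrad_derive1 df hu).
Qed.

Lemma subgrad_mono f x y u v : subgrad f x u -> subgrad f y v ->
  0 <= (u - v) * (x - y).
Proof. by move=> /(_ y) h1 /(_ x) h2; nra. Qed.

(* Strong monotonicity at the midpoint gives quadratic growth. *)
Lemma subgrad_growth f tau a b u : convexT (f : R^o -> R) ->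
  (forall x y v w, subgrad f x v -> subgrad f y w ->
    tau * (x - y) ^+ 2 <= (v - w) * (x - y)) ->
  subgrad f a u -> f a + u * (b - a) + tau / 4 * (b - a) ^+ 2 <= f b.
Proof.
move=> cf sm ua; pose m := (a + b) / 2.
have [v vm] := subgrad_exists m cf.
have h1 := vm b; have h2 := ua m; have h3 := sm _ _ _ _ vm ua.
have E1 : b - m = (b - a) / 2 by rewrite /m; lra.
have E2 : m - a = (b - a) / 2 by rewrite /m; lra.
by rewrite E1 in h1; rewrite E2 in h2 h3; nra.
Qed.

Lemma prox_spec f tau v c u : convexT (f : R^o -> R) -> 0 < tau -> 0 < v ->
  (forall x y s w, subgrad f x s -> subgrad f y w ->
    tau * (x - y) ^+ 2 <= (s - w) * (x - y)) ->
  subgrad f 0 0 -> subgrad f c u ->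
  forall x, `|c - prox (fun s => v^-1 * f s) x| <= `|c + u / v - x|.
Proof.
move=> cf tau0 v0 sm f0 uc x.
have cvf : convexT ((fun s => v^-1 * f s) : R^o -> R).
  move=> t a b ha hb; have := cf t a b ha hb => /= h.
  have -> : conv t (v^-1 * f a : R^o) (v^-1 * f b : R^o) = v^-1 * (conv t (f a : R^o) (f b : R^o)).
    change (t%:inum * (v^-1 * f a) + (1 - t%:inum) * (v^-1 * f b) =
            v^-1 * (t%:inum * f a + (1 - t%:inum) * f b)); ring.
  by rewrite ler_pM2l // invr_gt0.
rewrite /prox asboolT //.
set h := fun w : R => (x - w) ^+ 2 / 2 + v^-1 * f w.
have hc : continuous h.
  move=> w; apply: cvgD.
    rewrite -[X in _ --> X]/((fun z : R => (x - z) ^+ 2 / 2) w).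
    apply: (@differentiable_continuous _ R R); exact/derivable1_diffP.
  by apply: cvgMr; exact: (convexT_continuous cf).
(* Since [f] is minimal at 0, both terms of [h] outside [-2|x|, 2|x|] are at least their values at
   0; a minimizer on this interval is global. *)
have [z zmin] : exists z, forall w, h z <= h w.
  pose M := 2 * `|x|.
  have M0 : 0 <= M by rewrite mulr_ge0.
  have MM : - M <= M by lra.
  have [z zM hz] := @EVT_min R h (- M) M MM (continuous_subspaceT hc).
  exists z => w; have [wM|wM] := boolP (w \in `[- M, M]); first exact: hz.
  have : h z <= h 0 by apply: hz; rewrite in_itv /=; apply/andP; split; lra.
  move=> /le_trans; apply; rewrite /h subr0.
  have := f0 w; rewrite mul0r addr0 => f0w.
  have : v^-1 * f 0 <= v^-1 * f w by rewrite ler_pM2l // invr_gt0.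
  have : x ^+ 2 <= (x - w) ^+ 2.
    move: wM; rewrite in_itv /= negb_and -!ltNge /M => /orP[]; have := ler_norm x;
    have := ler_norm (- x); rewrite normrN; nra.
  by lra.
rewrite /argmin; case: xgetP => [z' _ z'min|/(_ z)]; last by move/(_ zmin).
move=> {z zmin}.
(* Comparing z' with z' + t(y - z') and letting t tend to 0 turns minimality into a subgradient; [t]
   is chosen so that the quadratic term stays below [e]. *)
have sg : subgrad f z' (v * (x - z')).
  move=> y; apply/ler_addgt0Pr => e e0.
  pose D := (y - z') ^+ 2 * v.
  have D0 : 0 <= D by rewrite mulr_ge0 ?sqr_ge0 // ltW.
  pose t := Num.min 1 (e / (D + 1)).
  have t0 : 0 < t by rewrite lt_min ltr01 divr_gt0 //; lra.
  have t1 : t <= 1 by rewrite ge_min lexx.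
  have tD : t * D <= e.
    have te : t <= e / (D + 1) by rewrite ge_min lexx orbT.
    have : t * (D + 1) <= e by rewrite -ler_pdivlMr //; lra.
    by nra.
  have := z'min (t * y + (1 - t) * z'); rewrite /h.
  have := convexT_le y z' cf (t := t); rewrite t1 ltW //= => /(_ erefl) cft.
  have := ler_wpM2l (ltW (_ : 0 < v^-1)) cft; rewrite invr_gt0 => /(_ v0) cft' hm.
  have E : x - (t * y + (1 - t) * z') = (x - z') - t * (y - z') by ring.
  rewrite E in hm.
  have : 0 <= v^-1 * (t * (f y - f z')) - t * (y - z') * (x - z') + t ^+ 2 * (y - z') ^+ 2 / 2 by lra.
  have -> : v^-1 * (t * (f y - f z')) - t * (y - z') * (x - z') + t ^+ 2 * (y - z') ^+ 2 / 2
    = t / v * (f y - f z' - v * (x - z') * (y - z') + t * D / 2).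
    by rewrite /D; field; rewrite gt_eqF.
  rewrite pmulr_rge0 ?divr_gt0 //; lra.
have := sm _ _ _ _ uc sg.
set s := c + u / v - x; have -> : u = v * (s + x - c) by rewrite /s; field; rewrite gt_eqF.
have -> : (v * (s + x - c) - v * (x - z')) * (c - z') = v * ((s - (c - z')) * (c - z')) by ring.
move=> hh; have : 0 <= v * ((s - (c - z')) * (c - z')).
  by apply: le_trans hh; rewrite mulr_ge0 ?sqr_ge0 // ltW.
rewrite pmulr_rge0 // => hp; rewrite -ler_sqr ?nnegrE // !real_normK ?num_real //; nra.
Qed.

(** By quadratic growth the mean of f(1) and f(-1) exceeds f(0) strictly, which contradicts midpoint
    convexity of f/v for negative v. *)
Lemma prox_neg f tau v x : 0 < tau -> v < 0 -> convexT (f : R^o -> R) ->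
  (forall x y s w, subgrad f x s -> subgrad f y w ->
    tau * (x - y) ^+ 2 <= (s - w) * (x - y)) ->
  prox (fun s => v^-1 * f s) x = 0.
Proof.
move=> tau0 v0 cf sm; rewrite /prox asboolF // => cvf.
have [u hu] := subgrad_exists 0 cf.
have := subgrad_growth 1 cf sm hu; have := subgrad_growth (- 1) cf sm hu.
have h01 : 0 <= (2^-1 : R) <= 1 by apply/andP; split; lra.
have := convexT_le 1 (- 1) cvf h01.
have -> : 2^-1 * 1 + (1 - 2^-1) * - 1 = 0 :> R by lra.
have -> : 2^-1 * (v^-1 * f 1) + (1 - 2^-1) * (v^-1 * f (- 1)) =
  v^-1 * (2^-1 * f 1 + (1 - 2^-1) * f (- 1)) by ring.
by rewrite ler_nM2l ?invr_lt0 //; lra.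
Qed.

Variable l : R -> R.
Hypotheses (cl : convexT (l : R^o -> R)) (dl : forall u, derivable l u 1).
Hypothesis lipl : forall u v, `|derive1 l u - derive1 l v| <= `|u - v|.

(** Special to one variable: the increments of the derivative and of the argument have the same
    sign, so the Lipschitz bound can be multiplied by the former. *)
Lemma derive1_cocoercive u v :
  (derive1 l u - derive1 l v) ^+ 2 <= (derive1 l u - derive1 l v) * (u - v).
Proof.
have := subgrad_mono (convex_tangent cl (@dl u)) (convex_tangent cl (@dl v)).
have := lipl u v; set a := _ - _; set b := u - v => ab ab0.
rewrite -(ger0_norm ab0) normrM -real_normK ?num_real // expr2.
by rewrite ler_wpM2l.
Qed.

Lemma convex_increment u s : l (u + s) - l u <= derive1 l u * s + s ^+ 2.
Proof.
have := convex_tangent cl (@dl (u + s)) u.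
have -> : u - (u + s) = - s by lra.
have h : (derive1 l (u + s) - derive1 l u) * s <= s ^+ 2.
  apply: le_trans (ler_norm _) _; rewrite normrM -[s ^+ 2]real_normK ?num_real // expr2.
  by rewrite ler_wpM2r //; apply: le_trans (lipl _ _) _; rewrite addrAC subrr add0r.
by lra.
Qed.

(** Where the second derivative does not exist [derive1] has the value 0, so the bounds hold at
    every point. *)
Lemma derive1_derive1_01 u : 0 <= derive1 (derive1 l) u <= 1.
Proof.
have [d1|d1] := pselect (derivable (derive1 l) u 1); last first.
  rewrite derive1E /derive (_ : lim _ = 0) ?lexx ?ler01 //.
  by rewrite /lim /lim_in /=; case: xgetP => // y _ hy; case: d1; apply/cvg_ex; exists y.
have fd : is_derive u 1 (derive1 l) (derive1 (derive1 l) u).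
  by rewrite derive1E; exact: DeriveDef.
have seqc := (is_derive_epsP _ _ _).1 fd; set c := derive1 (derive1 l) u in fd seqc *.
have b e : 0 < e -> - e <= c <= 1 + e.
  move=> e0; have [d d0 hd] := seqc e e0.
  have d2 : 0 < d / 2 by lra.
  have := hd (d / 2); rewrite gtr0_norm // => /(_ _) hh.
  have {}hh : `|derive1 l (u + d / 2) - derive1 l u - c * (d / 2)| <= e * (d / 2) by apply: hh; lra.
  have h1 := subgrad_mono (convex_tangent cl (@dl (u + d / 2))) (convex_tangent cl (@dl u)).
  have h2 := lipl (u + d / 2) u; move: h1 h2.
  rewrite addrAC subrr add0r (gtr0_norm d2) pmulr_lge0 // => h1.
  rewrite (ger0_norm h1) => h2; move: hh; rewrite ler_norml => /andP[g1 g2].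
  by apply/andP; split; nra.
by apply/andP; split; apply/ler_addgt0Pr => e /b /andP[]; lra.
Qed.

End ConvexLine.

(** * Operator norm and square root of matrices *)

Section OperatorNorm.
Context {R : realType}.

Lemma opnorm_has_sup m k (M : 'M[R]_(m, k)) :
  has_sup [set enorm (M *m v) | v in [set v : 'cV[R]_k | enorm v <= 1]].
Proof.
split; first by exists (enorm (M *m 0)), 0 => //=; rewrite enorm0.
exists (\sum_i \sum_j `|M i j|) => _ [v v1 <-].
apply: le_trans (enorm_le_coord _) _; apply: ler_sum => i _.
rewrite mxE; apply: le_trans (ler_norm_sum _ _ _) _; apply: ler_sum => j _.
rewrite normrM ler_piMr //; exact: le_trans (enorm_coord _ _) v1.
Qed.

Lemma opnorm_ge0 m k (M : 'M[R]_(m, k)) : 0 <= opnorm M.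
Proof.
apply: le_trans (_ : enorm (M *m (0 : 'cV[R]_k)) <= _); first exact: enorm_ge0.
apply: ub_le_sup; first by case: (opnorm_has_sup M).
by exists 0 => //=; rewrite enorm0.
Qed.

Lemma le_opnorm m k (M : 'M[R]_(m, k)) (v : 'cV[R]_k) :
  enorm (M *m v) <= opnorm M * enorm v.
Proof.
have [->|v0] := eqVneq v 0; first by rewrite mulmx0 !enorm0 mulr0.
have n0 : 0 < enorm v by rewrite enorm_gt0.
rewrite -ler_pdivrMr // mulrC -[(enorm v)^-1]ger0_norm ?invr_ge0 ?enorm_ge0 //.
rewrite -enormZ scalemxAr; apply: ub_le_sup; first by case: (opnorm_has_sup M).
exists ((enorm v)^-1 *: v) => //=.
by rewrite enormZ ger0_norm ?invr_ge0 ?enorm_ge0 // mulVf // gt_eqF.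
Qed.

Lemma opnorm_le m k (M : 'M[R]_(m, k)) c : 0 <= c ->
  (forall v, enorm (M *m v) <= c * enorm v) -> opnorm M <= c.
Proof.
move=> c0 h; apply: ge_sup; first by case: (opnorm_has_sup M).
move=> _ [v v1 <-]; apply: le_trans (h v) _; exact: ler_piMr.
Qed.

(** Uniqueness of the root: if S is nonnegative with S^2 = s^2 I, the vector u = Sv - sv satisfies
    Su = -su, and nonnegativity forces u = 0. *)
Lemma sqrtmx_scalar m (c : R) : 0 < c -> sqrtmx (c%:M : 'M[R]_m) = (Num.sqrt c)%:M.
Proof.
move=> c0; rewrite /sqrtmx; set s := Num.sqrt c.
have s0 : 0 < s by rewrite sqrtr_gt0.
have ss : s ^+ 2 = c by rewrite sqr_sqrtr // ltW.
have uniqS (S : 'M[R]_m) : (forall v : 'cV[R]_m, 0 <= (v^T *m S *m v) 0 0) ->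
    S *m S = c%:M -> S = s%:M.
  move=> pS SS; have z (v : 'cV[R]_m) : S *m v - s *: v = 0.
    set u := _ - _; have h : S *m u = - (s *: u).
      rewrite /u mulmxBr mulmxA SS mul_scalar_mx -scalemxAr -ss scalerBr scalerA opprB.
      by rewrite -expr2.
    have := pS u; rewrite -mulmxA h mulmxN -scalemxAr.
    have -> : (- (s *: (u^T *m u))) 0 0 = - (s * dot u u) by rewrite 2!mxE dotE.
    rewrite oppr_ge0 pmulr_rle0 // => hu; apply/eqP.
    by rewrite -dot_eq0 eq_le hu dot_ge0.
  apply/matrixP => i j; have := z (delta_mx j 0) => /(congr1 (fun M : 'cV_m => M i 0)).
  by rewrite -colE !mxE eqxx andbT => /eqP; rewrite subr_eq0 => /eqP ->; rewrite mulr_natr.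
have ok : [/\ (s%:M : 'M[R]_m)^T = s%:M,
    (forall v : 'cV[R]_m, 0 <= (v^T *m s%:M *m v) 0 0) & s%:M *m s%:M = (c%:M : 'M[R]_m)].
  split; first by rewrite tr_scalar_mx.
    by move=> v; rewrite -mulmxA mul_scalar_mx dotE dotZr mulr_ge0 ?dot_ge0 // ltW.
  by rewrite -scalar_mxM -expr2 ss.
case: xgetP => [S _ [_ pS SS]|/(_ _ ok)//]; exact: uniqS.
Qed.

(** |Sv|^2 is the inner product of v and Dv. If no square root exists, [sqrtmx] is 0 and the bound
    still holds. *)
Lemma sqrtmx_le1 m (D : 'M[R]_m) : (forall v, enorm (D *m v) <= enorm v) ->
  forall v, enorm (sqrtmx D *m v) <= enorm v.
Proof.
move=> hD v; rewrite /sqrtmx; case: xgetP => [S _ [ST pS SS]|_]; last first.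
  by rewrite mul0mx enorm0 enorm_ge0.
rewrite -ler_sqr ?nnegrE ?enorm_ge0 // [leLHS]enorm_sqr dot_mulmx ST mulmxA SS dotC.
apply: le_trans (ler_dot _ _) _; rewrite expr2.
by rewrite ler_wpM2l ?enorm_ge0.
Qed.

End OperatorNorm.

(** * Optimality conditions and stability of the estimator *)

Section Estimator.
Context {R : realType} {n p : nat}.
Variables (loss : R -> R -> R) (g : 'cV[R]_p -> R) (gs : 'I_p -> R -> R) (tau : R).
Hypothesis n0 : (0 < n)%N.
Hypothesis tau0 : 0 < tau.
Hypothesis lossR : loss_regular loss setT.
Hypothesis cgs : forall j, convexT (gs j : R^o -> R).
Hypothesis gE : forall b, g b = n%:R^-1 * \sum_j gs j (b j 0).
Hypothesis penR : penalty_regular g ((n%:R^-1)%:M) tau.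

Let nR0 : 0 < n%:R :> R. Proof. by rewrite ltr0n. Qed.

Definition dloss (y0 u : R) : R := derive1 (loss y0) u.

Lemma loss_lip y0 u v : `|dloss y0 u - dloss y0 v| <= `|u - v|.
Proof. by have := loss_lipschitz lossR (y0 := y0) I (x := (u, v)) (conj I I); rewrite /= mul1r. Qed.

Let lossC y0 : convexT (loss y0 : R^o -> R). Proof. exact: (loss_convex lossR). Qed.
Let lossD y0 u : derivable (loss y0) u 1. Proof. exact: (loss_derivable lossR). Qed.

Lemma gs_min j : subgrad (gs j) 0 0.
Proof.
move=> h; rewrite mul0r addr0; have := penalty_min0 penR (h *: delta_mx j 0).
rewrite !gE ler_pM2l ?invr_gt0 // (bigD1 j) //= [leRHS](bigD1 j) //=.
rewrite !mxE !eqxx mulr1 (eq_bigr (fun k => gs k ((h *: delta_mx j 0 : 'cV[R]_p) k 0))).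
  by rewrite lerD2r.
by move=> k /negPf kj; rewrite !mxE kj mulr0.
Qed.

(** With Sigma = I/n the weight 1/n of the penalty cancels, so each [gs j] inherits the constant
    [tau]. On the j-th axis a subgradient of [gs j], divided by n, is one of [g], because the other
    coordinates sit at their minimum 0. *)
Lemma gs_mono j x y v w : subgrad (gs j) x v -> subgrad (gs j) y w ->
  tau * (x - y) ^+ 2 <= (v - w) * (x - y).
Proof.
have sub (z s : R) : subgrad (gs j) z s ->
    subdifferential g (z *: delta_mx j 0) ((s / n%:R) *: delta_mx j 0).
  move=> hs b; rewrite dotE dotZl {1}/dot (bigD1 j) //= big1 ?addr0; last first.
    by move=> k /negPf kj; rewrite !mxE kj mul0r.
  rewrite !mxE !eqxx mul1r mulr1 !gE mulrAC [s * _ / _]mulrC -mulrDr ler_pM2l ?invr_gt0 //.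
  rewrite (bigD1 j) //= [leRHS](bigD1 j) //= !mxE !eqxx mulr1 addrAC.
  apply: lerD; first exact: hs.
  apply: ler_sum => k /negPf kj; rewrite !mxE kj mulr0.
  by have := gs_min k (b k 0); rewrite mul0r addr0.
move=> /sub hx /sub hy; have := penalty_strongly_convex penR hx hy.
rewrite sqrtmx_scalar ?invr_gt0 // mul_scalar_mx -!scalerBl dotE dotZl dotZr !enormZ.
have -> : dot (delta_mx j 0) (delta_mx j 0 : 'cV[R]_p) = 1.
  rewrite /dot (bigD1 j) //= big1 ?addr0 ?mxE ?eqxx ?mulr1 //.
  by move=> k /negPf kj; rewrite !mxE kj mul0r.
have -> : enorm (delta_mx j 0 : 'cV[R]_p) = 1.
  apply/eqP; rewrite -(@eqrXn2 _ 2) ?enorm_ge0 // expr1n enorm_sqr; apply/eqP.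
  rewrite /dot (bigD1 j) //= big1 ?addr0 ?mxE ?eqxx ?mulr1 //.
  by move=> k /negPf kj; rewrite !mxE kj mul0r.
rewrite !mulr1 ger0_norm ?sqrtr_ge0 // exprMn sqr_sqrtr ?invr_ge0 ?ler0n //.
rewrite real_normK ?num_real // /GRing.scale /= => h.
have := ler_wpM2l (ltW nR0) h.
have -> : n%:R * (tau * (n%:R^-1 * (x - y) ^+ 2)) = tau * (x - y) ^+ 2 by field; rewrite gt_eqF.
by have -> : n%:R * ((x - y) * ((v - w) / n%:R)) = (v - w) * (x - y) by field; rewrite gt_eqF.
Qed.

Implicit Types (y : 'cV[R]_n) (X : 'M[R]_(n, p)) (b : 'cV[R]_p).

(* n times the objective minimized by [betahat]. *)
Definition risk y X b : R :=
  \sum_i loss (y i 0) ((X *m b) i 0) + \sum_j gs j (b j 0).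

Definition score y X b : 'cV[R]_n := \col_i - dloss (y i 0) ((X *m b) i 0).

Lemma betahatE y X : betahat loss g y X = argmin (risk y X).
Proof.
rewrite /betahat /argmin; congr (xget _ _); apply/seteqP.
by split => b /= hb b'; have := hb b'; rewrite /= !gE -!mulrDr ler_pM2l ?invr_gt0.
Qed.

(** Tangent lines of the losses plus quadratic growth of the penalties. At b = 0 with zero
    subgradients it confines minimizers to a box; with the optimality condition the linear term
    drops out, giving [betahat_growth]. *)
Lemma risk_lower y X b (u : 'I_p -> R) b' :
  (forall j, subgrad (gs j) (b j 0) (u j)) ->
  risk y X b + \sum_j (u j - (X^T *m score y X b) j 0) * (b' - b) j 0
    + tau / 4 * dot (b' - b) (b' - b) <= risk y X b'.
Proof.
move=> hu.
have e1 : \sum_i loss (y i 0) ((X *m b) i 0) - dot (score y X b) (X *m (b' - b))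
    <= \sum_i loss (y i 0) ((X *m b') i 0).
  rewrite -sumrB; apply: ler_sum => i _.
  have := convex_tangent (@lossC (y i 0)) (@lossD (y i 0) ((X *m b) i 0)) ((X *m b') i 0).
  by rewrite mulmxBr !mxE /dloss; lra.
have e2 : \sum_j gs j (b j 0) + \sum_j u j * (b' - b) j 0 + tau / 4 * dot (b' - b) (b' - b)
    <= \sum_j gs j (b' j 0).
  rewrite mulr_sumr -!big_split /=; apply: ler_sum => j _.
  have := subgrad_growth (b' j 0) (@cgs j) (@gs_mono j) (hu j).
  by rewrite !mxE expr2.
have -> : \sum_j (u j - (X^T *m score y X b) j 0) * (b' - b) j 0 =
    \sum_j u j * (b' - b) j 0 - dot (score y X b) (X *m (b' - b)).
  by rewrite dot_mulmx -sumrB; apply: eq_bigr => j _; rewrite mulrBl.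
by rewrite /risk; lra.
Qed.

Lemma continuous_risk y X : continuous (fun v : 'rV[R]_p => risk y X v^T).
Proof.
have csum (J : finType) (h : J -> 'rV[R]_p -> R) :
    (forall j, continuous (h j)) -> continuous (fun v => \sum_j h j v).
  move=> ch; have -> : (fun v => \sum_j h j v) = \sum_j h j.
    by apply/funext => v; rewrite fct_sumE.
  apply: (big_ind (fun f : 'rV[R]_p -> R => continuous f)) => // [v|f1 f2 c1 c2 v].
    exact: cst_continuous.
  exact: cvgD (c1 v) (c2 v).
have c1 : continuous (fun v : 'rV[R]_p => \sum_i loss (y i 0) ((X *m v^T) i 0)).
  apply: (@csum) => i v.
  apply: (@continuous_comp _ _ _ (fun v : 'rV[R]_p => (X *m v^T) i 0)).
    have -> : (fun v : 'rV[R]_p => (X *m v^T) i 0) = (fun v => \sum_j X i j * v 0 j).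
      by apply/funext => w; rewrite mxE; apply: eq_bigr => j _; rewrite mxE.
    apply: (@csum _ (fun j (w : 'rV[R]_p) => X i j * w 0 j)) => j w.
    exact: (cvgM (cvg_cst (X i j)) (@coord_continuous R 1 p 0 j w)).
  by apply: convexT_continuous; exact: lossC.
have c2 : continuous (fun v : 'rV[R]_p => \sum_j gs j (v^T j 0)).
  apply: (@csum) => j v.
  apply: (@continuous_comp _ _ _ (fun v : 'rV[R]_p => v^T j 0)).
    have -> : (fun v : 'rV[R]_p => v^T j 0) = (fun v => v 0 j) by apply/funext => w; rewrite mxE.
    exact: coord_continuous.
  exact: convexT_continuous.
by move=> v; exact: (cvgD (c1 v) (c2 v)).
Qed.

Lemma risk_min_exists y X : exists b, forall b', risk y X b <= risk y X b'.
Proof.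
set c := X^T *m score y X 0.
have sg0 j : subgrad (gs j) ((0 : 'cV[R]_p) j 0) 0 by rewrite mxE; exact: gs_min.
have low b : risk y X 0 - dot c b + tau / 4 * dot b b <= risk y X b.
  have := risk_lower y X b sg0; rewrite subr0.
  under eq_bigr do rewrite sub0r mulNr.
  by rewrite sumrN.
(* Beyond this radius the quadratic term of [low] beats the linear one. *)
pose M := 4 * enorm c / tau.
have M0 : 0 <= M by rewrite divr_ge0 ?(ltW tau0) // mulr_ge0 ?enorm_ge0.
pose A := [set v : 'rV[R]_p | forall j, `[- M, M]%classic (v ord0 j)].
have A0 : A 0 by move=> j /=; rewrite mxE in_itv /=; apply/andP; split; lra.
have cA : compact A by apply: (@rV_compact R p (fun=> `[- M, M]%classic)) => j; exact: segment_compact.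
have [v vA hv] := EVT_min_rV (ex_intro _ 0 A0) cA (continuous_subspaceT (@continuous_risk y X)).
exists v^T => b; have [bA|bA] := pselect (A b^T).
  by have := hv b^T; rewrite trmxK; apply; rewrite inE.
have h0 : risk y X v^T <= risk y X 0.
  by have := hv 0; rewrite trmx0; apply; rewrite inE.
apply: (le_trans h0); have := low b.
have bM : M < enorm b.
  rewrite ltNge; apply/negP => bM; apply: bA => j /=; rewrite mxE in_itv /= -ler_norml.
  exact: le_trans (enorm_coord _ _) bM.
rewrite -enorm_sqr; have := ler_dot c b.
have : 4 * enorm c <= tau * enorm b.
  by rewrite mulrC [leRHS]mulrC -ler_pdivrMr // mulrC; apply: ltW; move: bM; rewrite /M mulrC.
have := enorm_ge0 b; have := enorm_ge0 c; nra.
Qed.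

Lemma betahat_min y X b : risk y X (betahat loss g y X) <= risk y X b.
Proof.
rewrite betahatE /argmin; have [b0 hb0] := risk_min_exists y X.
by case: xgetP => [b1 _|/(_ b0)]; [exact|move/(_ hb0)].
Qed.

(** Move coordinate j towards [z] by a fraction t. The penalty is controlled by convexity, and the
    losses are linear up to t^2 h^2 times the squared norm of column j; then t tends to 0. *)
Lemma risk_min_kkt y X b : (forall b', risk y X b <= risk y X b') ->
  forall j, subgrad (gs j) (b j 0) ((X^T *m score y X b) j 0).
Proof.
move=> bmin j z; pose h := z - b j 0.
pose s2 := \sum_i X i j ^+ 2.
have s20 : 0 <= s2 by apply: sumr_ge0 => i _; exact: sqr_ge0.
apply/ler_addgt0Pr => e e0.
pose t := Num.min 1 (e / (h ^+ 2 * s2 + 1)).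
have hs0 : 0 <= h ^+ 2 * s2 by rewrite mulr_ge0 ?sqr_ge0.
have t0 : 0 < t by rewrite lt_min ltr01 divr_gt0 //; lra.
have t1 : t <= 1 by rewrite ge_min lexx.
have te : t * (h ^+ 2 * s2) <= e.
  have h1 : t <= e / (h ^+ 2 * s2 + 1) by rewrite ge_min lexx orbT.
  have : t * (h ^+ 2 * s2 + 1) <= e by rewrite -ler_pdivlMr //; lra.
  by nra.
have := bmin (b + (t * h) *: delta_mx j 0); rewrite /risk.
have -> : \sum_k gs k ((b + (t * h) *: delta_mx j 0) k 0) =
   \sum_k gs k (b k 0) + (gs j (b j 0 + t * h) - gs j (b j 0)).
  rewrite (bigD1 j) //= [in RHS](bigD1 j) //= !mxE !eqxx mulr1.
  rewrite (eq_bigr (fun k => gs k (b k 0))); first by lra.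
  by move=> k /negPf kj; rewrite !mxE kj mulr0 addr0.
have e1 : \sum_i loss (y i 0) ((X *m (b + (t * h) *: delta_mx j 0)) i 0) <=
   \sum_i loss (y i 0) ((X *m b) i 0) - (t * h) * (X^T *m score y X b) j 0 + (t * h) ^+ 2 * s2.
  rewrite [(X^T *m _) j 0]mxE /s2 !mulr_sumr -sumrB -big_split /=; apply: ler_sum => i _.
  have -> : (X *m (b + (t * h) *: delta_mx j 0)) i 0 = (X *m b) i 0 + t * h * X i j.
    by rewrite mulmxDr -scalemxAr -colE !mxE.
  have := convex_increment (@lossC (y i 0)) (@lossD (y i 0)) (@loss_lip (y i 0)) ((X *m b) i 0) (t * h * X i j).
  by rewrite !mxE /dloss exprMn; lra.
have := convexT_le z (b j 0) (@cgs j) (t := t); rewrite t1 ltW //= => /(_ erefl).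
have -> : t * z + (1 - t) * b j 0 = b j 0 + t * h by rewrite /h; ring.
move=> e2 e3.
have : 0 <= t * (gs j z - gs j (b j 0) - h * (X^T *m score y X b) j 0 + t * (h ^+ 2 * s2)).
  by rewrite exprMn in e1; lra.
by rewrite pmulr_rge0 // -/h; lra.
Qed.

Lemma psihatE y X : psihat loss g y X = score y X (betahat loss g y X).
Proof. by []. Qed.

Lemma betahat_kkt y X j :
  subgrad (gs j) (betahat loss g y X j 0) ((X^T *m psihat loss g y X) j 0).
Proof. by rewrite psihatE; apply: risk_min_kkt => b; exact: betahat_min. Qed.

Lemma betahat_growth y X b :
  risk y X (betahat loss g y X) +
    tau / 4 * dot (b - betahat loss g y X) (b - betahat loss g y X) <= risk y X b.
Proof.
have := risk_lower y X b (@betahat_kkt y X).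
by rewrite -psihatE; under eq_bigr do rewrite subrr mul0r; rewrite big1_eq addr0.
Qed.

(** Separability gives a bound for each coordinate and not only for the norm: a small column of the
    design forces a small coordinate. The leave-one-out estimate depends on this. *)
Lemma betahat_coord y X j :
  tau * `|betahat loss g y X j 0| <= `|(X^T *m psihat loss g y X) j 0|.
Proof.
have := gs_mono (betahat_kkt y X j) (gs_min j); rewrite !subr0.
set b := betahat _ _ _ _ _ _; set a := _ j 0 => h.
have [->|b0] := eqVneq b 0; first by rewrite normr0 mulr0.
rewrite -(ler_pM2r (_ : 0 < `|b|)) ?normr_gt0 // -mulrA -expr2 real_normK ?num_real //.
by apply: le_trans h _; rewrite -normrM ler_norm.
Qed.

Lemma betahat_norm y X :
  tau * enorm (betahat loss g y X) <= enorm (X^T *m psihat loss g y X).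
Proof.
rewrite -ler_sqr ?nnegrE ?mulr_ge0 ?enorm_ge0 ?(ltW tau0) // exprMn !enorm_sqr mulr_sumr.
apply: ler_sum => j _; rewrite -!expr2 -exprMn.
rewrite -[leLHS]real_normK ?num_real // -[leRHS]real_normK ?num_real //.
by rewrite ler_sqr ?nnegrE // normrM gtr0_norm // betahat_coord.
Qed.

Lemma psihat_neq0 y X i : dloss (y i 0) 0 != 0 -> psihat loss g y X != 0.
Proof.
apply: contra => /eqP psi0; have := betahat_norm y X.
rewrite psi0 mulmx0 enorm0 pmulr_rle0 // => b0.
have {}b0 : betahat loss g y X = 0.
  by apply/eqP; rewrite -enorm_eq0 eq_le b0 enorm_ge0.
move/matrixP: psi0 => /(_ i 0); rewrite psihatE /score mxE b0 mulmx0 !mxE => /eqP.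
by rewrite oppr_eq0.
Qed.

(* Subtracting the optimality conditions at X and X': only the change of the
   design, tested against the solution at X', survives. *)
Lemma stability y X X' :
  let b := betahat loss g y X in let b' := betahat loss g y X' in
  let psi := psihat loss g y X in let psi' := psihat loss g y X' in
  tau * dot (b - b') (b - b') + dot (psi - psi') (psi - psi') <=
    dot ((X - X') *m (b - b')) psi' - dot (psi - psi') ((X - X') *m b').
Proof.
cbv zeta; set b := betahat loss g y X; set b' := betahat loss g y X'.
set psi := psihat loss g y X; set psi' := psihat loss g y X'.
have cB k (u v : 'cV[R]_k) j : (u - v) j 0 = u j 0 - v j 0 by rewrite !mxE.
have alg k m (M M' : 'M[R]_(k, m)) (u u' : 'cV[R]_m) :
    M *m u - M' *m u' = M *m (u - u') + (M - M') *m u'.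
  by rewrite mulmxBr mulmxBl addrA subrK.
have h1 : tau * dot (b - b') (b - b') <= dot (b - b') (X^T *m psi - X'^T *m psi').
  rewrite mulr_sumr; apply: ler_sum => j _.
  have := gs_mono (betahat_kkt y X j) (betahat_kkt y X' j).
  by rewrite -/b -/b' -/psi -/psi' -expr2 !cB [leRHS]mulrC.
have h2 : dot (psi - psi') (psi - psi') <= - dot (psi - psi') (X *m b - X' *m b').
  rewrite -dotNr; apply: ler_sum => i _.
  have := derive1_cocoercive (@lossC (y i 0)) (@lossD (y i 0)) (@loss_lip (y i 0))
    ((X *m b) i 0) ((X' *m b') i 0).
  rewrite /psi /psi' !psihatE !mxE /dloss -expr2 -/b -/b'.
  by set u := \sum_j _; set u' := \sum_j _; set a := derive1 _ u; set a' := derive1 _ u'; lra.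
apply: le_trans (lerD h1 h2) _.
have e1 : X^T *m psi - X'^T *m psi' = X^T *m (psi - psi') + (X - X')^T *m psi'.
  by rewrite alg [(X - X')^T]linearB.
have e2 : X *m b - X' *m b' = X *m (b - b') + (X - X') *m b'.
  exact: alg.
rewrite e1 e2 !dotDr; have t1 : dot (b - b') (X^T *m (psi - psi')) = dot (psi - psi') (X *m (b - b')).
  by rewrite [RHS]dot_mulmx dotC.
have t2 : dot (b - b') ((X - X')^T *m psi') = dot ((X - X') *m (b - b')) psi'.
  by rewrite [RHS]dotC [RHS]dot_mulmx dotC.
by rewrite t1 t2; lra.
Qed.

Lemma stability_bound y X X' (x z : R) : 0 <= x -> 0 <= z ->
  let b := betahat loss g y X in let b' := betahat loss g y X' in
  let psi := psihat loss g y X in let psi' := psihat loss g y X' in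
  dot ((X - X') *m (b - b')) psi' <= enorm (b - b') * x ->
  enorm ((X - X') *m b') <= z ->
  tau * dot (b - b') (b - b') + dot (psi - psi') (psi - psi') <= x ^+ 2 / tau + z ^+ 2.
Proof.
move=> x0 z0 b b' psi psi' hx hz; have := stability y X X'; cbv zeta; rewrite -/b -/b' -/psi -/psi'.
rewrite -!enorm_sqr => h.
have hz' : - dot (psi - psi') ((X - X') *m b') <= enorm (psi - psi') * z.
  rewrite -dotNr; apply: le_trans (ler_dot _ _) _; rewrite enormN.
  by rewrite ler_wpM2l ?enorm_ge0.
have e1 : enorm (b - b') * x <= tau / 2 * enorm (b - b') ^+ 2 + x ^+ 2 / tau / 2.
  have : 0 <= (tau * enorm (b - b') - x) ^+ 2 / tau / 2 by rewrite !divr_ge0 ?sqr_ge0 ?(ltW tau0).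
  have -> : (tau * enorm (b - b') - x) ^+ 2 / tau / 2 =
    tau / 2 * enorm (b - b') ^+ 2 - enorm (b - b') * x + x ^+ 2 / tau / 2 by field; rewrite gt_eqF.
  by lra.
have e2 : enorm (psi - psi') * z <= (enorm (psi - psi') ^+ 2 + z ^+ 2) / 2.
  by have := sqr_ge0 (enorm (psi - psi') - z); nra.
by lra.
Qed.

End Estimator.

(** * Measurability of the estimator *)

Section MeasurableCountable.
Context {R : realType} {d : measure_display} {T : measurableType d}.

Lemma measurable_exists_count (Q : countType) (A : Q -> set T) :
  (forall q, measurable (A q)) -> measurable [set t | exists q, A q t].
Proof.
move=> mA; rewrite (_ : [set t | _] = \bigcup_n (if unpickle n is Some q then A q else set0)).
  by apply: bigcupT_measurable => n; case: unpickle.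
apply/seteqP; split => [t [q Aq]|t [n _]]; first by exists (pickle q) => //; rewrite pickleK.
by case: unpickle => // q Aq; exists q.
Qed.

Lemma measurable_forall_count (Q : countType) (A : Q -> set T) :
  (forall q, measurable (A q)) -> measurable [set t | forall q, A q t].
Proof.
move=> mA; have := @measurable_exists_count Q (fun q => ~` A q) (fun q => measurableC (mA q)).
move/measurableC; congr measurable; apply/seteqP; split => t /=.
  by move=> h q; apply: contrapT => nA; apply: h; exists q.
by move=> h [q]; apply; exact: h.
Qed.

Lemma measurable_superlevel (f : T -> R) :
  (forall c, measurable [set t | c < f t]) -> measurable_fun setT f.
Proof.
move=> mf; apply: (measurability _ (RGenOInfty.measurableE R)) => //.
by move=> /= _ [_ [c ->] <-]; rewrite preimage_itvoy setTI; exact: mf.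
Qed.

Lemma measurable_le_set (f g : T -> R) : measurable_fun setT f ->
  measurable_fun setT g -> measurable [set t | f t <= g t].
Proof. by move=> mf mg; rewrite -[X in measurable X]setTI; exact: measurable_fun_le. Qed.

Lemma measurable_gt_set (f : T -> R) c : measurable_fun setT f ->
  measurable [set t | c < f t].
Proof.
move=> mf; rewrite (_ : [set t | _] = ~` [set t | f t <= c]).
  by apply: measurableC; exact: (measurable_le_set mf (measurable_cst _)).
by apply/seteqP; split => t /=; rewrite ltNge; [move/negP|move=> h; apply/negP].
Qed.

End MeasurableCountable.

Section MeasurableEstimator.
Context {R : realType} {n p : nat} {d : measure_display} {T : measurableType d}.
Variables (loss : R -> R -> R) (g : 'cV[R]_p -> R) (gs : 'I_p -> R -> R) (tau : R).
Hypothesis n0 : (0 < n)%N.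
Hypothesis tau0 : 0 < tau.
Hypothesis lossR : loss_regular loss setT.
Hypothesis cgs : forall j, convexT (gs j : R^o -> R).
Hypothesis gE : forall b, g b = n%:R^-1 * \sum_j gs j (b j 0).
Hypothesis penR : penalty_regular g ((n%:R^-1)%:M) tau.

Let lossC y0 : convexT (loss y0 : R^o -> R). Proof. exact: (loss_convex lossR). Qed.
Let lossD y0 u : derivable (loss y0) u 1. Proof. exact: (loss_derivable lossR). Qed.

Let dloss_cvg y0 u :
  (fun m => (loss y0 (u + step m) - loss y0 u) / step m) @ \oo --> dloss loss y0 u.
Proof.
have := @is_derive_seq R (fun s => loss y0 (u + s)) (dloss loss y0 u) (@step R).
rewrite addr0; apply; last exact: cvg_step.
  apply/is_derive_epsP => e e0.
  have fd : is_derive u 1 (loss y0) (dloss loss y0 u).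
    by rewrite /dloss derive1E; apply: DeriveDef; [exact: lossD|].
  have [r r0 hr] := (is_derive_epsP (loss y0) u _).1 fd e e0.
  by exists r => // s; rewrite add0r addr0; exact: hr.
by move=> m; rewrite gt_eqF // step_gt0.
Qed.

Let mloss_cst (y : T -> R) q : measurable_fun setT y ->
  measurable_fun setT (fun t => loss (y t) q).
Proof. by move=> my; exact: (measurableT_comp (loss_measurable lossR q) my). Qed.

Let mdloss_cst (y : T -> R) q : measurable_fun setT y ->
  measurable_fun setT (fun t => dloss loss (y t) q).
Proof.
move=> my; apply: (@measurable_fun_cvg _ _ _ _
  (fun m t => (loss (y t) (q + step m) - loss (y t) q) / step m)).
  by move=> m; apply: measurable_funM => //; apply: measurable_funB; exact: mloss_cst.
by move=> t _; exact: dloss_cvg.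
Qed.

(* A convex function is the supremum of its tangents at the rational points. *)
Lemma measurable_loss (y u : T -> R) : measurable_fun setT y -> measurable_fun setT u ->
  measurable_fun setT (fun t => loss (y t) (u t)).
Proof.
move=> my mu; apply: measurable_superlevel => c.
have := @measurable_exists_count d T rat (fun q => [set t |
  c < loss (y t) (ratr q) + dloss loss (y t) (ratr q) * (u t - ratr q)]).
have E : [set t | c < loss (y t) (u t)] = [set t | exists q : rat,
  c < loss (y t) (ratr q) + dloss loss (y t) (ratr q) * (u t - ratr q)].
  apply/seteqP; split => t /=; last first.
    by move=> [q] /lt_le_trans; apply; exact: (convex_tangent (@lossC _) (@lossD _ _)).
  move=> cl; pose e := Num.min 1 (loss (y t) (u t) - c).
  have e0 : 0 < e by rewrite lt_min ltr01 subr_gt0.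
  have e1 : e <= 1 by rewrite ge_min lexx.
  have e2 : e <= loss (y t) (u t) - c by rewrite ge_min lexx orbT.
  have : u t < u t + e by rewrite ltrDl.
  move=> /rat_in_itvoo[q]; rewrite in_itv /= => /andP[q1 q2]; exists q.
  have := convex_increment (@lossC (y t)) (@lossD (y t)) (loss_lip lossR (y t)) (ratr q) (u t - ratr q).
  by rewrite [ratr q + _]addrC subrK -/(dloss loss (y t) (ratr q)); nra.
rewrite E; apply => q; apply: measurable_gt_set; apply: measurable_funD; first exact: mloss_cst.
by apply: measurable_funM; [exact: mdloss_cst|exact: measurable_funB].
Qed.

Lemma measurable_dloss (y u : T -> R) : measurable_fun setT y -> measurable_fun setT u ->
  measurable_fun setT (fun t => dloss loss (y t) (u t)).
Proof.
move=> my mu; apply: (@measurable_fun_cvg _ _ _ _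
  (fun m t => (loss (y t) (u t + step m) - loss (y t) (u t)) / step m)).
  move=> m; apply: measurable_funM => //; apply: measurable_funB; apply: measurable_loss => //.
  exact: measurable_funD.
by move=> t _; exact: dloss_cvg.
Qed.

Variables (y : T -> 'cV[R]_n) (X : T -> 'M[R]_(n, p)).
Hypothesis my : forall i, measurable_fun setT (fun t => y t i 0).
Hypothesis mX : forall i j, measurable_fun setT (fun t => X t i j).

Let mXb (b : T -> 'cV[R]_p) i : (forall j, measurable_fun setT (fun t => b t j 0)) ->
  measurable_fun setT (fun t => (X t *m b t) i 0).
Proof.
move=> mb; under eq_fun do rewrite mxE.
by apply: measurable_sum => j; exact: measurable_funM.
Qed.

Lemma measurable_risk (b : 'cV[R]_p) :
  measurable_fun setT (fun t => risk loss gs (y t) (X t) b).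
Proof.
apply: measurable_funD => //; apply: measurable_sum => i; apply: measurable_loss => //.
exact: (mXb (b := fun=> b)).
Qed.

(** Near-minimizers are close to [betahat] by quadratic growth. Hence coordinate j is at most [c]
    exactly when, for every tolerance, some rational vector whose coordinate j is at most [c] almost
    minimizes the risk among rational vectors. *)
Lemma measurable_betahat j :
  measurable_fun setT (fun t => betahat loss g (y t) (X t) j 0).
Proof.
pose rv (q : {ffun 'I_p -> rat}) : 'cV[R]_p := \col_j ratr (q j).
apply: measurable_superlevel => c.
rewrite (_ : [set t | _] = ~` [set t | forall k : nat, exists q : {ffun 'I_p -> rat},
   forall q' : {ffun 'I_p -> rat}, rv q j 0 <= c /\
   risk loss gs (y t) (X t) (rv q) <= risk loss gs (y t) (X t) (rv q') + step k]).
  apply: measurableC; apply: measurable_forall_count => k.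
  apply: measurable_exists_count => q; apply: measurable_forall_count => q'.
  have [h|h] := boolP (rv q j 0 <= c); last first.
    by rewrite [X in measurable X](_ : _ = set0) // predeqE => t; split => //= -[].
  rewrite [X in measurable X](_ : _ = [set t |
      risk loss gs (y t) (X t) (rv q) <= risk loss gs (y t) (X t) (rv q') + step k]).
    apply: measurable_le_set; first exact: measurable_risk.
    by apply: measurable_funD => //; exact: measurable_risk.
  by apply/seteqP; split => t /=; [case|].
(* Approximation from below in every coordinate preserves the constraint on coordinate j. *)
have dens t (e : R) : 0 < e -> let b := betahat loss g (y t) (X t) in
    exists2 q, rv q j 0 <= b j 0 & risk loss gs (y t) (X t) (rv q) <= risk loss gs (y t) (X t) b + e.
  move=> e0 b; have := @continuous_risk R n p loss gs lossR cgs (y t) (X t) b^T.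
  move=> /cvgrPdist_le /(_ e e0) /nbhs_ballP[r r0 hr].
  have ex l : exists q : rat, b l 0 - r < ratr q < b l 0.
    have /rat_in_itvoo[q] : b l 0 - r < b l 0 by rewrite ltrBlDr ltrDl.
    by rewrite in_itv; exists q.
  have [q hq] := choice ex; pose qf := [ffun l => q l].
  exists qf; first by rewrite mxE ffunE ltW //; case/andP: (hq j).
  have : ball b^T r (rv qf)^T.
    split => // i l; have := hq l; rewrite ord1 /rv !mxE ffunE /ball /=.
    by case/andP => h1 h2; rewrite ger0_norm; lra.
  by move=> /hr /=; rewrite !trmxK ler_norml => /andP[]; lra.
apply/seteqP; split => t /=; set b := betahat loss g (y t) (X t).
  move=> cb /(_ _)/[dup] h _.
  (* By [betahat_growth] a vector whose coordinate j is at most [c] has a risk at least this much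
     above the minimum. *)
  pose e := tau / 4 * (b j 0 - c) ^+ 2.
  have e0 : 0 < e by rewrite mulr_gt0 ?divr_gt0 // exprn_gt0 // subr_gt0.
  have [k ke] : exists k, step k < e / 2.
    have := @cvg_step R; move=> /cvgrPdist_lt /(_ (e / 2)); rewrite divr_gt0 // => /(_ erefl).
    by case=> N _ /(_ N (leqnn N)) /=; rewrite sub0r normrN ger0_norm ?(ltW (step_gt0 _)) //; exists N.
  have [q hq] := h k.
  have [q' _ h'] := dens t (e / 2) (divr_gt0 e0 (ltr0n R 2)).
  have [qc h1] := hq q'.
  have := betahat_growth n0 tau0 lossR cgs gE penR (y t) (X t) (rv q); rewrite -/b in h' *.
  have : (b j 0 - c) ^+ 2 <= dot (rv q - b) (rv q - b).
    rewrite -enorm_sqr; have h2 := enorm_coord (rv q - b) j.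
    have h3 : b j 0 - c <= enorm (rv q - b).
      by apply: le_trans h2; rewrite -normrN; apply: le_trans (ler_norm _); rewrite [(_ - b) j 0]mxE [(- b) j 0]mxE; lra.
    have h4 : 0 <= b j 0 - c by rewrite subr_ge0 ltW.
    by nra.
  set D := dot _ _ => h3 h4; have h5 : tau / 4 * (b j 0 - c) ^+ 2 <= tau / 4 * D.
    by rewrite ler_pM2l ?divr_gt0.
  by rewrite -/e in h5; lra.
move=> h; rewrite ltNge; apply/negP => bc; apply: h => k.
have [q qb hq] := dens t (step k) (step_gt0 k).
exists q => q'; split; first exact: le_trans bc.
apply: le_trans hq _; rewrite lerD2r.
exact: (betahat_min n0 tau0 lossR cgs gE penR).
Qed.

Lemma measurable_psihat i :
  measurable_fun setT (fun t => psihat loss g (y t) (X t) i 0).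
Proof.
under eq_fun do rewrite mxE.
apply: measurable_funN; apply: measurable_dloss => //.
by apply: mXb; exact: measurable_betahat.
Qed.

End MeasurableEstimator.

(** * Dependence of the estimator on the Gaussian matrix *)

Section Model.
Context {R : realType} {d : measure_display} {T : measurableType d}.
Variables (n p : nat) (mu : probability T R).

Definition wproj (w : 'cV[R]_p) : 'M[R]_p := 1%:M - w *m w^T.

(* The design as a function of a Gaussian matrix H, whose component along the
   index direction is replaced by zeta. *)
Definition model_design (w : 'cV[R]_p) (H : 'M[R]_(n, p)) (zeta : 'cV[R]_n) :
    'M[R]_(n, p) :=
  (Num.sqrt n%:R)^-1 *: (H *m wproj w + zeta *m w^T).

(** Nothing relates [K] at a shifted point to [K t], so estimates at shifted points have to be
    expressed through [K t]. The lower bounds 4 and 1/tau let numerical constants and factors 1/tau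
    be absorbed into one more power of [K]. *)
Record gaussian_design (th : 'I_n * 'I_p -> R -> T -> T) (H : T -> 'M[R]_(n, p))
    (zeta y : T -> 'cV[R]_n) (w : 'cV[R]_p) (K : T -> R) (tau : R) : Prop := {
  gd_n0 : (0 < n)%N ;
  gd_field : gfield mu th (fun k t => H t k.1 k.2) ;
  gd_zeta : forall k s t, zeta (th k s t) = zeta t ;
  gd_y : forall k s t, y (th k s t) = y t ;
  gd_mzeta : forall i, measurable_fun setT (fun t => zeta t i 0) ;
  gd_my : forall i, measurable_fun setT (fun t => y t i 0) ;
  gd_w : dot w w = 1 ;
  gd_mK : measurable_fun setT K ;
  gd_K4 : forall t, 4 <= K t ;
  gd_Ktau : forall t, tau^-1 <= K t ;
  gd_Kp : forall t, p%:R / n%:R <= K t ;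
  gd_KX : forall t u, enorm (model_design w (H t) (zeta t) *m u) <= K t * enorm u ;
  gd_KH : forall t u, enorm (H t *m u) <= Num.sqrt n%:R * K t * enorm u }.

(** The conditions on the loss are imposed at every response, so that psi never vanishes and can be
    normalized everywhere; [regularized] reduces to this case. *)
Record estimator_regular (loss : R -> R -> R) (g : 'cV[R]_p -> R)
    (gs : 'I_p -> R -> R) (tau : R) : Prop := {
  er_tau0 : 0 < tau ;
  er_loss : loss_regular loss setT ;
  er_nondeg : forall y0, dloss loss y0 0 != 0 ;
  er_cgs : forall j, convexT (gs j : R^o -> R) ;
  er_gE : forall b, g b = n%:R^-1 * \sum_j gs j (b j 0) ;
  er_pen : penalty_regular g ((n%:R^-1)%:M) tau }.

End Model.

#[local] Opaque betahat psihat.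

(** * The normalized estimator and its increments *)

Section Normalized.
Context {R : realType} {d : measure_display} {T : measurableType d}.
Variables (n p : nat) (mu : probability T R).
Variables (th : 'I_n * 'I_p -> R -> T -> T) (H : T -> 'M[R]_(n, p)).
Variables (zeta y : T -> 'cV[R]_n) (w : 'cV[R]_p) (K : T -> R) (tau : R).
Variables (loss : R -> R -> R) (g : 'cV[R]_p -> R) (gs : 'I_p -> R -> R).
Hypothesis gd : gaussian_design mu th H zeta y w K tau.
Hypothesis er : estimator_regular n loss g gs tau.

Let n0 := gd_n0 gd.
Let nR0 : 0 < n%:R :> R. Proof. by rewrite ltr0n. Qed.
Let sn0 : 0 < Num.sqrt n%:R :> R. Proof. by rewrite sqrtr_gt0. Qed.
Let sn2 : Num.sqrt n%:R ^+ 2 = n%:R :> R. Proof. by rewrite sqr_sqrtr. Qed.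
Let tau0 := er_tau0 er.

Definition cfgX t := model_design w (H t) (zeta t).
Definition cfgbeta t := betahat loss g (y t) (cfgX t).
Definition cfgpsi t := psihat loss g (y t) (cfgX t).
Definition cfgf t : 'cV[R]_n := (enorm (cfgpsi t))^-1 *: cfgpsi t.
Definition cfgth t : 'cV[R]_p := (enorm (cfgpsi t))^-1 *: cfgbeta t.
(** The direction in which a row of the design moves when an entry of column j of H is shifted
    ([cfgX_th]). *)
Definition cfgq j : 'cV[R]_p := wproj w *m delta_mx j 0.

Lemma cfgK1 t : 1 <= K t. Proof. by have := gd_K4 gd t; lra. Qed.

Lemma cfgK_gt0 t : 0 < K t. Proof. by have := gd_K4 gd t; lra. Qed.

Lemma cfgK_le t a b : (a <= b)%N -> K t ^+ a <= K t ^+ b.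
Proof. by move=> ab; rewrite ler_weXn2l // cfgK1. Qed.

Lemma cfgK_ge1 t a : 1 <= K t ^+ a. Proof. by rewrite exprn_ege1 // cfgK1. Qed.

Lemma cfgK_num t (c : R) a b : c <= 4 -> (a < b)%N -> c * K t ^+ a <= K t ^+ b.
Proof.
move=> c4 ab; apply: le_trans (cfgK_le t ab); rewrite exprS ler_wpM2r ?exprn_ge0 ?(ltW (cfgK_gt0 t)) //.
by have := gd_K4 gd t; lra.
Qed.

Lemma wproj_sym : (wproj w)^T = wproj w.
Proof. by rewrite linearB /= trmx1 trmx_mul trmxK. Qed.

Lemma wproj_w : wproj w *m w = 0.
Proof.
rewrite mulmxBl mul1mx -mulmxA; have -> : w^T *m w = 1%:M.
  by apply/matrixP => i j; rewrite !ord1 dotE (gd_w gd) mxE.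
by rewrite mulmx1 subrr.
Qed.

Lemma wproj_idem : wproj w *m wproj w = wproj w.
Proof. by rewrite {2}/wproj mulmxBr mulmx1 mulmxA wproj_w mul0mx subr0. Qed.

Lemma wprojE (u : 'cV[R]_p) : wproj w *m u = u - dot w u *: w.
Proof.
rewrite mulmxBl mul1mx -mulmxA; congr (_ - _); apply/matrixP => i j.
by rewrite !ord1 mxE big_ord1 dotE !mxE mulrC.
Qed.

Lemma dot_wproj (u v : 'cV[R]_p) : dot (wproj w *m u) v = dot u (wproj w *m v).
Proof. by rewrite [RHS]dot_mulmx wproj_sym. Qed.

Lemma enorm_wproj (u : 'cV[R]_p) : enorm (wproj w *m u) <= enorm u.
Proof.
rewrite -ler_sqr ?nnegrE ?enorm_ge0 // !enorm_sqr dot_wproj mulmxA wproj_idem wprojE.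
by rewrite dotBr dotZr gerBl dotC -expr2 sqr_ge0.
Qed.

Lemma dot_delta m (u : 'cV[R]_m) i : dot (delta_mx i 0) u = u i 0.
Proof.
rewrite /dot (bigD1 i) //= big1 ?addr0 ?mxE ?eqxx ?mul1r //.
by move=> k /negPf ki; rewrite !mxE ki mul0r.
Qed.

Lemma dot_cfgq j (u : 'cV[R]_p) : dot (cfgq j) u = (wproj w *m u) j 0.
Proof. by rewrite /cfgq dot_wproj dot_delta. Qed.

Lemma enorm_delta m (i : 'I_m) : enorm (delta_mx i 0 : 'cV[R]_m) = 1.
Proof.
apply/eqP; rewrite -(@eqrXn2 _ 2) ?enorm_ge0 // expr1n enorm_sqr dot_delta mxE !eqxx.
by [].
Qed.

Lemma enorm_cfgq j : enorm (cfgq j) <= 1.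
Proof. by apply: le_trans (enorm_wproj _) _; rewrite enorm_delta. Qed.

Lemma cfgX_tr t (v : 'cV[R]_n) : enorm ((cfgX t)^T *m v) <= K t * enorm v.
Proof.
have [->|z] := eqVneq ((cfgX t)^T *m v) 0.
  by rewrite enorm0 mulr_ge0 ?enorm_ge0 // (ltW (cfgK_gt0 t)).
have zp : 0 < enorm ((cfgX t)^T *m v) by rewrite enorm_gt0.
rewrite -(ler_pM2r zp) -expr2 enorm_sqr -dot_mulmx; apply: le_trans (ler_dot _ _) _.
rewrite [K t * _]mulrC -mulrA ler_wpM2l ?enorm_ge0 //.
exact: (gd_KX gd t ((cfgX t)^T *m v)).
Qed.

Lemma cfgpsi_neq0 t : cfgpsi t != 0.
Proof.
exact: (psihat_neq0 n0 tau0 (er_loss er) (er_cgs er) (er_gE er) (er_pen er)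
  (i := Ordinal n0) _ (er_nondeg er _)).
Qed.

Lemma enorm_cfgpsi_gt0 t : 0 < enorm (cfgpsi t).
Proof. by rewrite enorm_gt0 cfgpsi_neq0. Qed.

Lemma enorm_cfgf t : enorm (cfgf t) = 1.
Proof.
rewrite enormZ ger0_norm ?invr_ge0 ?enorm_ge0 // mulVf // gt_eqF //.
exact: enorm_cfgpsi_gt0.
Qed.

Lemma dot_cfgf t : dot (cfgf t) (cfgf t) = 1.
Proof. by rewrite -enorm_sqr enorm_cfgf expr1n. Qed.

Lemma cfgpsiE t : cfgpsi t = enorm (cfgpsi t) *: cfgf t.
Proof. by rewrite scalerA divff ?scale1r // gt_eqF // enorm_cfgpsi_gt0. Qed.

Lemma cfgbetaE t : cfgbeta t = enorm (cfgpsi t) *: cfgth t.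
Proof. by rewrite scalerA divff ?scale1r // gt_eqF // enorm_cfgpsi_gt0. Qed.

Lemma cfgth_coord t j : tau * `|cfgth t j 0| <= `|((cfgX t)^T *m cfgf t) j 0|.
Proof.
have z := enorm_cfgpsi_gt0 t.
rewrite -scalemxAr [(cfgth t) j 0]mxE [(_ *: (_ *m _)) j 0]mxE !normrM mulrCA.
rewrite ler_wpM2l //.
exact: (betahat_coord n0 tau0 (er_loss er) (er_cgs er) (er_gE er) (er_pen er)).
Qed.

Lemma enorm_cfgth_X t : enorm (cfgth t) <= enorm ((cfgX t)^T *m cfgf t) / tau.
Proof.
rewrite ler_pdivlMr // mulrC -scalemxAr !enormZ mulrCA ler_wpM2l //.
exact: (betahat_norm n0 tau0 (er_loss er) (er_cgs er) (er_gE er) (er_pen er)).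
Qed.

Lemma div_tau t x : 0 <= x -> x / tau <= x * K t.
Proof. by move=> x0; rewrite ler_wpM2l //; exact: (gd_Ktau gd t). Qed.

Lemma enorm_cfgth t : enorm (cfgth t) <= K t ^+ 2.
Proof.
apply: le_trans (enorm_cfgth_X t) _; apply: le_trans (div_tau t (enorm_ge0 _)) _.
rewrite expr2 ler_wpM2r ?(ltW (cfgK_gt0 t)) //.
by apply: le_trans (cfgX_tr t _) _; rewrite enorm_cfgf mulr1.
Qed.

(** The new norm |u'| appears only inside the new quotient, so a bound on the latter replaces a
    lower bound on |u'|. *)
Lemma quotient_diff m k (a a' : 'cV[R]_m) (u u' : 'cV[R]_k) : u != 0 -> u' != 0 ->
  enorm ((enorm u')^-1 *: a' - (enorm u)^-1 *: a) <=
    (enorm (a' - a) + enorm ((enorm u')^-1 *: a') * enorm (u' - u)) / enorm u.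
Proof.
move=> u0 u'0; have p1 : 0 < enorm u by rewrite enorm_gt0.
have p2 : 0 < enorm u' by rewrite enorm_gt0.
have -> : (enorm u')^-1 *: a' - (enorm u)^-1 *: a =
    (enorm u)^-1 *: (a' - a) + ((enorm u - enorm u') / enorm u) *: ((enorm u')^-1 *: a').
  rewrite scalerA; apply/matrixP => i j; rewrite !mxE; field.
  by rewrite !gt_eqF.
apply: le_trans (enormD _ _) _; rewrite [leRHS]mulrDl; apply: lerD.
  by rewrite enormZ ger0_norm ?invr_ge0 ?enorm_ge0 // mulrC.
rewrite enormZ mulrC -mulrA ler_wpM2l ?enorm_ge0 // normrM [X in _ * X]ger0_norm ?invr_ge0 ?enorm_ge0 //.
rewrite ler_wpM2r ?invr_ge0 ?enorm_ge0 // ler_norml; apply/andP; split.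
  by have := enormD u (u' - u); rewrite addrC subrK addrC; lra.
have := enormB u' (u' - u); rewrite opprB addrC subrK; lra.
Qed.

Lemma rank_one_raw t t' a (dl : 'cV[R]_n) (q : 'cV[R]_p) : y t' = y t ->
  cfgX t' = cfgX t + a *: (dl *m q^T) ->
  tau * enorm (cfgbeta t' - cfgbeta t) ^+ 2 + enorm (cfgpsi t' - cfgpsi t) ^+ 2 <=
    a ^+ 2 * (dot q q * dot dl (cfgpsi t) ^+ 2 / tau + dot dl dl * dot q (cfgbeta t) ^+ 2).
Proof.
move=> yE XE.
have opE (v : 'cV[R]_p) : (cfgX t' - cfgX t) *m v = (a * dot q v) *: dl.
  rewrite XE addrAC subrr add0r -scalemxAl -mulmxA -scalerA; congr (_ *: _).
  by apply/matrixP => i j; rewrite !ord1 mxE big_ord1 dotE mxE mulrC.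
have bE : cfgbeta t' = betahat loss g (y t) (cfgX t') by rewrite /cfgbeta yE.
have pE : cfgpsi t' = psihat loss g (y t) (cfgX t') by rewrite /cfgpsi yE.
have x0 : 0 <= `|a| * enorm q * `|dot dl (cfgpsi t)| by rewrite !mulr_ge0 ?enorm_ge0.
have x1 : 0 <= `|a| * enorm dl * `|dot q (cfgbeta t)| by rewrite !mulr_ge0 ?enorm_ge0.
have := stability_bound n0 tau0 (er_loss er) (er_cgs er) (er_gE er) (er_pen er)
  (y := y t) (X := cfgX t') (X' := cfgX t) x0 x1.
cbv zeta; rewrite -bE -pE -/(cfgbeta t) -/(cfgpsi t) !opE !dotZl !enormZ.
have h1 : a * dot q (cfgbeta t' - cfgbeta t) * dot dl (cfgpsi t) <=
   enorm (cfgbeta t' - cfgbeta t) * (`|a| * enorm q * `|dot dl (cfgpsi t)|).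
  apply: le_trans (ler_norm _) _; rewrite !normrM.
  have -> : enorm (cfgbeta t' - cfgbeta t) * (`|a| * enorm q * `|dot dl (cfgpsi t)|) =
    `|a| * (enorm q * enorm (cfgbeta t' - cfgbeta t)) * `|dot dl (cfgpsi t)| by ring.
  by rewrite ler_wpM2r // ler_wpM2l // dot_le_enorm.
have h2 : `|a * dot q (cfgbeta t)| * enorm dl <= `|a| * enorm dl * `|dot q (cfgbeta t)|.
  by rewrite normrM mulrAC.
move=> /(_ h1 h2).
move=> h; rewrite !enorm_sqr; apply: le_trans h _.
by rewrite !exprMn !real_normK ?num_real // (enorm_sqr q) (enorm_sqr dl) mulrDr !mulrA.
Qed.

Lemma rank_one_shift t t' a (dl : 'cV[R]_n) (q : 'cV[R]_p) : y t' = y t ->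
  cfgX t' = cfgX t + a *: (dl *m q^T) ->
  let e := a ^+ 2 * (dot q q * dot dl (cfgf t) ^+ 2 / tau + dot dl dl * dot q (cfgth t) ^+ 2) in
  enorm (cfgbeta t' - cfgbeta t) ^+ 2 <= enorm (cfgpsi t) ^+ 2 * (e * K t) /\
  enorm (cfgpsi t' - cfgpsi t) ^+ 2 <= enorm (cfgpsi t) ^+ 2 * e.
Proof.
move=> yE XE e; set z := enorm (cfgpsi t).
have z0 : 0 < z by exact: enorm_cfgpsi_gt0.
have := rank_one_raw yE XE.
have d1 : dot dl (cfgpsi t) = z * dot dl (cfgf t) by rewrite {1}cfgpsiE dotZr.
have d2 : dot q (cfgbeta t) = z * dot q (cfgth t) by rewrite {1}cfgbetaE dotZr.
have -> : a ^+ 2 * (dot q q * dot dl (cfgpsi t) ^+ 2 / tau + dot dl dl * dot q (cfgbeta t) ^+ 2) = z ^+ 2 * e.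
  by rewrite /e d1 d2; clearbody z; ring.
set B := enorm (cfgbeta _ - _); set S := enorm (cfgpsi _ - _) => h.
have B0 : 0 <= B ^+ 2 by exact: sqr_ge0.
have S0 : 0 <= S ^+ 2 by exact: sqr_ge0.
have tB : 0 <= tau * B ^+ 2 by rewrite mulr_ge0 // ltW.
split; last by lra.
have : B ^+ 2 <= z ^+ 2 * e / tau by rewrite ler_pdivlMr // mulrC; lra.
move=> /le_trans; apply; rewrite mulrA; apply: div_tau; lra.
Qed.

Lemma cfgf_shift t t' a (dl : 'cV[R]_n) (q : 'cV[R]_p) : y t' = y t ->
  cfgX t' = cfgX t + a *: (dl *m q^T) ->
  enorm (cfgf t' - cfgf t) ^+ 2 <=
    4 * (a ^+ 2 * (dot q q * dot dl (cfgf t) ^+ 2 / tau + dot dl dl * dot q (cfgth t) ^+ 2)).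
Proof.
move=> yE XE; have [_] := rank_one_shift yE XE; set e := a ^+ 2 * _ => h.
have z0 := enorm_cfgpsi_gt0 t.
have h' : enorm (cfgf t' - cfgf t) <= (enorm (cfgpsi t' - cfgpsi t) +
    enorm (cfgf t') * enorm (cfgpsi t' - cfgpsi t)) / enorm (cfgpsi t).
  exact: (@quotient_diff n n (cfgpsi t) (cfgpsi t') (cfgpsi t) (cfgpsi t')
    (cfgpsi_neq0 t) (cfgpsi_neq0 t')).
rewrite enorm_cfgf mul1r in h'.
have : enorm (cfgf t' - cfgf t) * enorm (cfgpsi t) <= 2 * enorm (cfgpsi t' - cfgpsi t).
  by rewrite -ler_pdivlMr //; lra.
have := enorm_ge0 (cfgf t' - cfgf t); have := enorm_ge0 (cfgpsi t' - cfgpsi t).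
set x := enorm (cfgf t' - _); set u := enorm (cfgpsi t' - _) in h *; set z := enorm (cfgpsi t) in z0 h *.
move=> u0 x0 xz; have : (x * z) ^+ 2 <= (2 * u) ^+ 2.
  by rewrite ler_sqr ?nnegrE ?mulr_ge0 // ltW.
rewrite !exprMn => hx; have : z ^+ 2 * x ^+ 2 <= z ^+ 2 * (4 * e) by lra.
by rewrite ler_pM2l // exprn_gt0.
Qed.

(** In contrast to the unit vector [cfgf], the size of [cfgth] at the new point enters the estimate
    and has to be known in terms of [K t]. *)
Lemma cfgth_shift t t' a (dl : 'cV[R]_n) (q : 'cV[R]_p) N : y t' = y t ->
  cfgX t' = cfgX t + a *: (dl *m q^T) -> enorm (cfgth t') <= K t ^+ N.+1 ->
  enorm (cfgth t' - cfgth t) ^+ 2 <= 4 * K t ^+ N.+1 ^+ 2 *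
    (a ^+ 2 * (dot q q * dot dl (cfgf t) ^+ 2 / tau + dot dl dl * dot q (cfgth t) ^+ 2)).
Proof.
move=> yE XE thN; have [] := rank_one_shift yE XE; set e := a ^+ 2 * _ => hb h.
have z0 := enorm_cfgpsi_gt0 t.
have h' : enorm (cfgth t' - cfgth t) <= (enorm (cfgbeta t' - cfgbeta t) +
    enorm (cfgth t') * enorm (cfgpsi t' - cfgpsi t)) / enorm (cfgpsi t).
  exact: (@quotient_diff p n (cfgbeta t) (cfgbeta t') (cfgpsi t) (cfgpsi t')
    (cfgpsi_neq0 t) (cfgpsi_neq0 t')).
rewrite ler_pdivlMr // in h'.
have := enorm_ge0 (cfgth t' - cfgth t); have := enorm_ge0 (cfgpsi t' - cfgpsi t).
have := enorm_ge0 (cfgbeta t' - cfgbeta t).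
set x := enorm (cfgth t' - _) in h' *; set u := enorm (cfgpsi t' - _) in h h' *.
set b := enorm (cfgbeta t' - _) in hb h' *; set z := enorm (cfgpsi t) in z0 h hb h' *.
set k := K t ^+ N.+1 in thN *; move=> b0 u0 x0.
have e0 : 0 <= e.
  rewrite -(pmulr_rge0 _ (_ : 0 < z ^+ 2)) ?exprn_gt0 //; apply: le_trans h; exact: sqr_ge0.
have kK : K t <= k ^+ 2.
  by rewrite /k -exprM -{1}[K t]expr1 cfgK_le // muln2 doubleS.
have xz : x * z <= b + k * u by apply: le_trans h' _; rewrite lerD2l ler_wpM2r.
have k0 : 0 <= k by rewrite exprn_ge0 // ltW // cfgK_gt0.
have : (x * z) ^+ 2 <= (b + k * u) ^+ 2.
  by rewrite ler_sqr ?nnegrE ?mulr_ge0 ?addr_ge0 ?mulr_ge0 // ltW.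
have : (b + k * u) ^+ 2 <= 2 * b ^+ 2 + 2 * (k ^+ 2 * u ^+ 2).
  by have := sqr_ge0 (b - k * u); rewrite -exprMn; nra.
have : k ^+ 2 * u ^+ 2 <= k ^+ 2 * (z ^+ 2 * e) by rewrite ler_wpM2l // sqr_ge0.
have : z ^+ 2 * (e * K t) <= k ^+ 2 * (z ^+ 2 * e).
  by rewrite [e * _]mulrC mulrCA ler_wpM2r // mulr_ge0 // sqr_ge0.
rewrite exprMn => *; have : z ^+ 2 * x ^+ 2 <= z ^+ 2 * (4 * k ^+ 2 * e) by lra.
by rewrite ler_pM2l // exprn_gt0.
Qed.

Lemma cfgH_th k s t : H (th k s t) = H t + s *: delta_mx k.1 k.2.
Proof.
apply/matrixP => i j; rewrite [LHS](gfield_H (gd_field gd) k (i, j)) !mxE /=.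
by rewrite mulrC -pair_eqE /= /pair_eq.
Qed.

Lemma design_shift (H1 : 'M[R]_(n, p)) z (dl : 'cV[R]_n) j s :
  model_design w (H1 + s *: (dl *m (delta_mx j 0 : 'cV_p)^T)) z =
  model_design w H1 z + (s / Num.sqrt n%:R) *: (dl *m (cfgq j)^T).
Proof.
rewrite /model_design mulmxDl addrAC scalerDr; congr (_ + _).
by rewrite -scalemxAl -mulmxA scalerA mulrC /cfgq trmx_mul wproj_sym.
Qed.

Lemma cfgX_th i j s t :
  cfgX (th (i, j) s t) = cfgX t + (s / Num.sqrt n%:R) *: ((delta_mx i 0 : 'cV_n) *m (cfgq j)^T).
Proof.
rewrite /cfgX cfgH_th (gd_zeta gd) -design_shift; congr (model_design _ (_ + _ *: _) _).
apply/matrixP => i' j'; rewrite !mxE big_ord1 !mxE !eqxx /= !andbT.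
by rewrite -natrM mulnb.
Qed.

Lemma sum_pair (F : 'I_n * 'I_p -> R) : \sum_k F k = \sum_i \sum_j F (i, j).
Proof. by rewrite pair_big /=; apply: eq_bigr => -[]. Qed.

Lemma sum_cfgq_sqr (u : 'cV[R]_p) : \sum_j dot (cfgq j) u ^+ 2 = dot (wproj w *m u) (wproj w *m u).
Proof. by apply: eq_bigr => j _; rewrite dot_cfgq expr2. Qed.

(** The factor 1/n in (s / sqrt n)^2 is spent on the p columns in one term and on the n rows in the
    other, so the sum over all np entries is of order s^2. *)
Lemma sum_shift_le t (s : R) :
  \sum_i \sum_j (s / Num.sqrt n%:R) ^+ 2 *
    (dot (cfgq j) (cfgq j) * dot (delta_mx i 0) (cfgf t) ^+ 2 / tau +
     dot (delta_mx i 0) (delta_mx i 0 : 'cV[R]_n) * dot (cfgq j) (cfgth t) ^+ 2) <=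
  s ^+ 2 * (p%:R / n%:R / tau + dot (wproj w *m cfgth t) (wproj w *m cfgth t)).
Proof.
have ti : 0 <= tau^-1 by rewrite invr_ge0 ltW.
under eq_bigr do rewrite -mulr_sumr.
rewrite -mulr_sumr exprMn exprVn sn2 -[s ^+ 2 / n%:R * _]mulrA.
rewrite ler_wpM2l ?sqr_ge0 //.
apply: (@le_trans _ _ (n%:R^-1 * \sum_i \sum_j (cfgf t i 0 ^+ 2 / tau + dot (cfgq j) (cfgth t) ^+ 2))).
  rewrite ler_wpM2l ?invr_ge0 ?ler0n //; apply: ler_sum => i _; apply: ler_sum => j _.
  rewrite -[dot (delta_mx i 0) (delta_mx i 0)]enorm_sqr enorm_delta expr1n mul1r lerD2r dot_delta.
  rewrite ler_wpM2r // ler_piMl ?sqr_ge0 // -enorm_sqr expr_le1 ?enorm_ge0 //.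
  exact: enorm_cfgq.
under eq_bigr do rewrite big_split /= sumr_const card_ord -mulr_natl.
rewrite big_split /= sumr_const card_ord sum_cfgq_sqr -mulr_sumr -mulr_suml.
have -> : \sum_i cfgf t i 0 ^+ 2 = 1 by rewrite -[RHS](dot_cfgf t); apply: eq_bigr => i _; rewrite expr2.
set D := dot _ _; rewrite -[D *+ n]mulr_natl mulrDr mulKf ?gt_eqF // mul1r [p%:R / n%:R]mulrC mulrA.
exact: lexx.
Qed.

Lemma sum_shift t s : 0 < s <= 1 ->
  \sum_i \sum_j (s / Num.sqrt n%:R) ^+ 2 *
    (dot (cfgq j) (cfgq j) * dot (delta_mx i 0) (cfgf t) ^+ 2 / tau +
     dot (delta_mx i 0) (delta_mx i 0 : 'cV[R]_n) * dot (cfgq j) (cfgth t) ^+ 2) <=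
  s ^+ 2 * K t ^+ 5.
Proof.
move=> _; have K0 := cfgK_gt0 t; apply: le_trans (sum_shift_le t s) _; rewrite ler_wpM2l ?sqr_ge0 //.
have h0 : p%:R / n%:R / tau <= p%:R / n%:R * K t by apply: div_tau; rewrite divr_ge0.
have h1 : p%:R / n%:R * K t <= K t ^+ 2 by rewrite expr2 ler_wpM2r ?(ltW K0) // (gd_Kp gd).
have h2 : dot (wproj w *m cfgth t) (wproj w *m cfgth t) <= K t ^+ 4.
  rewrite -enorm_sqr (_ : 4 = 2 * 2)%N // exprM ler_sqr ?nnegrE ?enorm_ge0 ?exprn_ge0 ?(ltW K0) //.
  exact: le_trans (enorm_wproj _) (enorm_cfgth t).
have h3 : K t ^+ 2 <= K t ^+ 4 by exact: cfgK_le.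
have h4 : 2 * K t ^+ 4 <= K t ^+ 5 by apply: cfgK_num => //; lra.
by move: h0 h1 h2 h3 h4; move: (dot _ _) (_ / _ / _) (_ * K t) (K t ^+ 5) (K t ^+ 4) (K t ^+ 2) => *; lra.
Qed.

(** The third condition is a finite-shift form of a bound on the Hilbert-Schmidt norm of the
    derivative with respect to H. The class is stable under [wproj], the design and its transpose,
    which produces all the fields used for the remainders. *)
Definition enlip m (u : T -> 'cV[R]_m) (N : nat) : Prop :=
  [/\ forall i, measurable_fun setT (fun t => u t i 0),
      forall t, enorm (u t) <= K t ^+ N &
      forall t s, 0 < s <= 1 ->
        \sum_k enorm (u (th k s t) - u t) ^+ 2 <= s ^+ 2 * K t ^+ N].

Lemma measurable_dot m (u v : T -> 'cV[R]_m) :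
  (forall i, measurable_fun setT (fun t => u t i 0)) ->
  (forall i, measurable_fun setT (fun t => v t i 0)) ->
  measurable_fun setT (fun t => dot (u t) (v t)).
Proof.
by move=> mu' mv; apply: measurable_sum => i; exact: measurable_funM.
Qed.

Lemma measurable_enorm m (u : T -> 'cV[R]_m) :
  (forall i, measurable_fun setT (fun t => u t i 0)) ->
  measurable_fun setT (fun t => enorm (u t)).
Proof.
move=> mu'; under eq_fun do rewrite enormE.
apply: measurableT_comp; last exact: measurable_dot.
by apply: continuous_measurable_fun; exact: sqrt_continuous.
Qed.

Lemma measurable_cfgH i j : measurable_fun setT (fun t => H t i j).
Proof. exact: (gflow_measZ (gfield_flow (gd_field gd) (i, j))). Qed.

Lemma measurable_cfgX i j : measurable_fun setT (fun t => cfgX t i j).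
Proof.
under eq_fun do rewrite mxE [X in _ * X]mxE !mxE.
apply: measurable_funM => //; apply: measurable_funD.
  by apply: measurable_sum => l; apply: measurable_funM => //; exact: measurable_cfgH.
apply: measurable_sum => l; apply: measurable_funM => //; rewrite ord1.
exact: (gd_mzeta gd).
Qed.

Lemma measurable_cfgbeta j : measurable_fun setT (fun t => cfgbeta t j 0).
Proof.
exact: (measurable_betahat n0 tau0 (er_loss er) (er_cgs er) (er_gE er) (er_pen er)
  (gd_my gd) measurable_cfgX).
Qed.

Lemma measurable_cfgpsi i : measurable_fun setT (fun t => cfgpsi t i 0).
Proof.
exact: (measurable_psihat n0 tau0 (er_loss er) (er_cgs er) (er_gE er) (er_pen er)
  (gd_my gd) measurable_cfgX).
Qed.

Let measurable_psiV : measurable_fun setT (fun t => (enorm (cfgpsi t))^-1).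
Proof.
under eq_fun do rewrite -powR_inv1 ?enorm_ge0 //.
apply: (measurableT_comp (measurable_powR _)).
exact: (measurable_enorm measurable_cfgpsi).
Qed.

Lemma measurable_cfgf i : measurable_fun setT (fun t => cfgf t i 0).
Proof.
under eq_fun do rewrite mxE.
exact: (measurable_funM measurable_psiV (measurable_cfgpsi i)).
Qed.

Lemma measurable_cfgth j : measurable_fun setT (fun t => cfgth t j 0).
Proof.
under eq_fun do rewrite mxE.
exact: (measurable_funM measurable_psiV (measurable_cfgbeta j)).
Qed.

Lemma enlip_f : enlip cfgf 6.
Proof.
split; first exact: measurable_cfgf.
  by move=> t; rewrite enorm_cfgf cfgK_ge1.
move=> t s s01; rewrite sum_pair.
apply: (@le_trans _ _ (4 * (s ^+ 2 * K t ^+ 5))).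
  refine (le_trans _ (ler_wpM2l (ler0n R 4) (sum_shift t s01))).
  rewrite mulr_sumr; apply: ler_sum => i _; rewrite mulr_sumr; apply: ler_sum => j _.
  by apply: cfgf_shift; [exact: (gd_y gd)|exact: cfgX_th].
by rewrite mulrCA ler_wpM2l ?sqr_ge0 //; apply: cfgK_num.
Qed.

Lemma enlip_th : enlip cfgth 12.
Proof.
split; first exact: measurable_cfgth.
  by move=> t; apply: le_trans (enorm_cfgth t) _; exact: cfgK_le.
move=> t s s01; rewrite sum_pair; have K0 := cfgK_gt0 t.
apply: (@le_trans _ _ (4 * K t ^+ 3 ^+ 2 * (s ^+ 2 * K t ^+ 5))).
  have c0 : 0 <= 4 * K t ^+ 3 ^+ 2 by rewrite mulr_ge0 // sqr_ge0.
  refine (le_trans _ (ler_wpM2l c0 (sum_shift t s01))).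
  rewrite mulr_sumr; apply: ler_sum => i _; rewrite mulr_sumr; apply: ler_sum => j _.
  apply: cfgth_shift; [exact: (gd_y gd)|exact: cfgX_th|].
  (* [K] is not controlled at the shifted point; the shifted design is written as the design at [t]
     plus a rank-one matrix of norm at most 1. *)
  apply: le_trans (enorm_cfgth_X _) _; apply: le_trans (div_tau t (enorm_ge0 _)) _.
  have -> : K t ^+ 3 = K t ^+ 2 * K t by rewrite -exprSr.
  rewrite ler_wpM2r ?(ltW K0) //; set v := cfgf _.
  have v1 : enorm v = 1 by exact: enorm_cfgf.
  have -> : (cfgX (th (i, j) s t))^T = (cfgX t)^T +
      (s / Num.sqrt n%:R) *: (cfgq j *m (delta_mx i 0 : 'cV[R]_n)^T).
    rewrite cfgX_th [LHS]linearD [X in _ + X = _]linearZ /=; congr (_ + _ *: _).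
    by rewrite trmx_mul trmxK.
  rewrite mulmxDl.
  apply: le_trans (enormD _ _) _.
  have h1 := cfgX_tr t v; rewrite v1 mulr1 in h1.
  have h2 : enorm ((s / Num.sqrt n%:R) *: (cfgq j *m (delta_mx i 0 : 'cV[R]_n)^T) *m v) <= 1.
    rewrite -scalemxAl -mulmxA enormZ.
    have -> : (delta_mx i 0 : 'cV[R]_n)^T *m v = (v i 0)%:M.
      by apply/matrixP => i' j'; rewrite !ord1 dotE dot_delta !mxE.
    rewrite mul_mx_scalar enormZ; case/andP: s01 => s0 s1.
    have a1 : `|s / Num.sqrt n%:R| <= 1.
      rewrite ger0_norm ?divr_ge0 ?sqrtr_ge0 ?(ltW s0) // ler_pdivrMr // mul1r (le_trans s1) //.
      have n1 : 1 <= n%:R :> R by rewrite ler1n.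
      by move: sn0 sn2 n1; set z := Num.sqrt _; nra.
    have a2 : `|v i 0| <= 1 by rewrite -v1 enorm_coord.
    by rewrite mulr_ile1 ?mulr_ge0 ?enorm_ge0 ?normr_ge0 // mulr_ile1 ?enorm_ge0 ?normr_ge0 // enorm_cfgq.
  by have := gd_K4 gd t; rewrite expr2; nra.
have -> : 4 * K t ^+ 3 ^+ 2 * (s ^+ 2 * K t ^+ 5) = s ^+ 2 * (4 * K t ^+ 11) by ring.
by rewrite ler_wpM2l ?sqr_ge0 //; apply: cfgK_num.
Qed.

End Normalized.

#[local] Opaque betahat psihat.

(** * Products of Lipschitz fields and their divergence *)

Section Products.
Context {R : realType} {d : measure_display} {T : measurableType d}.
Variables (n p : nat) (mu : probability T R).
Variables (th : 'I_n * 'I_p -> R -> T -> T) (H : T -> 'M[R]_(n, p)).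
Variables (zeta y : T -> 'cV[R]_n) (w : 'cV[R]_p) (K : T -> R) (tau : R).
Variables (loss : R -> R -> R) (g : 'cV[R]_p -> R) (gs : 'I_p -> R -> R).
Hypothesis gd : gaussian_design mu th H zeta y w K tau.
Hypothesis er : estimator_regular n loss g gs tau.

Let n0 := gd_n0 gd.
Let nR0 : 0 < n%:R :> R. Proof. by rewrite ltr0n. Qed.
Let sn0 : 0 < Num.sqrt n%:R :> R. Proof. by rewrite sqrtr_gt0. Qed.
Let sn2 : Num.sqrt n%:R ^+ 2 = n%:R :> R. Proof. by rewrite sqr_sqrtr. Qed.
Let tau0 := er_tau0 er.
Local Notation X := (cfgX H zeta w).
Local Notation psi := (cfgpsi H zeta y w loss g).
Local Notation beta := (cfgbeta H zeta y w loss g).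
Local Notation f := (cfgf H zeta y w loss g).
Local Notation theta := (cfgth H zeta y w loss g).
Local Notation Q := (wproj w).

Let K0 t : 0 < K t. Proof. exact: (cfgK_gt0 gd). Qed.
Let Kle t a b : (a <= b)%N -> K t ^+ a <= K t ^+ b. Proof. exact: (cfgK_le gd). Qed.
Let Kge0 t a : 0 <= K t ^+ a. Proof. by rewrite exprn_ge0 // ltW. Qed.

Lemma enorm3_sqr m (a b c : 'cV[R]_m) :
  enorm (a + b + c) ^+ 2 <= 3 * (enorm a ^+ 2 + enorm b ^+ 2 + enorm c ^+ 2).
Proof.
rewrite !enorm_sqr /dot -!big_split /= mulr_sumr; apply: ler_sum => i _.
rewrite -!expr2 !mxE; set u := a i 0; set v := b i 0; set z := c i 0.
have := sqr_ge0 (u - v); have := sqr_ge0 (u - z); have := sqr_ge0 (v - z); nra.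
Qed.

Lemma enlip_measurable_mul m k (M : T -> 'M[R]_(m, k)) (u : T -> 'cV[R]_k) i :
  (forall i j, measurable_fun setT (fun t => M t i j)) ->
  (forall j, measurable_fun setT (fun t => u t j 0)) ->
  measurable_fun setT (fun t => (M t *m u t) i 0).
Proof.
move=> mM mu'; under eq_fun do rewrite mxE.
by apply: measurable_sum => j; exact: measurable_funM.
Qed.

Lemma enlip_proj (u : T -> 'cV[R]_p) N : enlip th K u N ->
  enlip th K (fun t => Q *m u t) N.
Proof.
move=> [mu' bu lu]; split.
- by move=> i; apply: (@enlip_measurable_mul _ _ (fun=> Q)) => // *.
- by move=> t; apply: le_trans (enorm_wproj gd _) (bu t).
- move=> t s s01; apply: le_trans (lu t s s01); apply: ler_sum => k _.
  by rewrite -mulmxBr ler_sqr ?nnegrE ?enorm_ge0 // (enorm_wproj gd).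
Qed.

Lemma enlip_cst m (u : 'cV[R]_m) : enorm u <= 1 -> enlip th K (fun=> u) 0.
Proof.
move=> u1; split=> // [t s s01].
rewrite big1 => [|k _]; last by rewrite subrr enorm0 expr0n.
by rewrite mulr_ge0 ?sqr_ge0.
Qed.

Lemma cfgX_w t : X t *m w = (Num.sqrt n%:R)^-1 *: zeta t.
Proof.
rewrite /cfgX /model_design -scalemxAl mulmxDl -!mulmxA (wproj_w gd) mulmx0 add0r.
congr (_ *: _); have -> : w^T *m w = 1%:M.
  by apply/matrixP => i j; rewrite !ord1 dotE (gd_w gd) mxE.
by rewrite mulmx1.
Qed.

(** X w = zeta / sqrt n does not move under the shifts. *)
Lemma enlip_phi : enlip th K (fun t => X t *m w) 1.
Proof.
split.
- by move=> i; apply: enlip_measurable_mul => [i' j|j]; [exact: measurable_cfgX gd _ _|].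
- move=> t; apply: le_trans (gd_KX gd t w) _; rewrite expr1.
  have -> : enorm w = 1.
    by apply/eqP; rewrite -(@eqrXn2 _ 2) ?enorm_ge0 // enorm_sqr (gd_w gd) expr1n.
  by rewrite mulr1.
- move=> t s s01; rewrite big1 => [|k _]; last by rewrite !cfgX_w (gd_zeta gd) subrr enorm0 expr0n.
  by rewrite mulr_ge0 ?sqr_ge0.
Qed.

Let step_le (s : R) : (s / Num.sqrt n%:R) ^+ 2 = s ^+ 2 / n%:R.
Proof. by rewrite expr_div_n sn2. Qed.

Let n1 : 1 <= n%:R :> R. Proof. by rewrite ler1n. Qed.

Let sumn_le m (u : 'cV[R]_m) : \sum_i u i 0 ^+ 2 = enorm u ^+ 2.
Proof. by rewrite enorm_sqr; apply: eq_bigr => i _; rewrite expr2. Qed.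

(** Product rule with three terms: the increment of [u], the rank-one increment of [M] applied to
    [u], and their product. The hypothesis on the [b l] says that the 1/n of the shifts pays for the
    number of entries. *)
Lemma enlip_mul m m' (M : T -> 'M[R]_(m, m')) (a : 'I_n * 'I_p -> 'cV[R]_m)
    (b : 'I_n * 'I_p -> 'cV[R]_m') (u : T -> 'cV[R]_m') N :
  (forall i j, measurable_fun setT (fun t => M t i j)) ->
  (forall t v, enorm (M t *m v) <= K t * enorm v) ->
  (forall l s t, M (th l s t) = M t + (s / Num.sqrt n%:R) *: (a l *m (b l)^T)) ->
  (forall l, enorm (a l) <= 1) -> (forall l, enorm (b l) <= 1) ->
  (forall t v, n%:R^-1 * \sum_l dot (b l) v ^+ 2 <= K t * enorm v ^+ 2) ->
  enlip th K u N -> enlip th K (fun t => M t *m u t) (2 * N + 4).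
Proof.
move=> mM MK Mth a1 b1 bK [mu' bu lu]; split.
- by move=> i; exact: enlip_measurable_mul.
- move=> t; apply: le_trans (MK t _) _.
  apply: (@le_trans _ _ (K t ^+ N.+1)); first by rewrite exprS ler_wpM2l // ltW.
  by apply: Kle; clear; lia.
- move=> t s s01; have [s0 s1] := andP s01.
  pose D l := enorm (u (th l s t) - u t) ^+ 2.
  have D0 l : 0 <= D l by exact: sqr_ge0.
  have sq0 : 0 <= s ^+ 2 / n%:R by rewrite divr_ge0 ?sqr_ge0 // ltW.
  apply: (@le_trans _ _ (\sum_l 3 * (K t ^+ 2 * D l +
     s ^+ 2 * (n%:R^-1 * dot (b l) (u t) ^+ 2) + D l))).
    apply: ler_sum => l _; set t' := th l s t; pose D' := u t' - u t.
    have e1 : M t' *m u t' - M t *m u t = M t *m D' +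
        (s / Num.sqrt n%:R * dot (b l) (u t)) *: a l + (s / Num.sqrt n%:R * dot (b l) D') *: a l.
      rewrite Mth mulmxDl -scalemxAl -mulmxA.
      have -> : (b l)^T *m u t' = (dot (b l) (u t) + dot (b l) D')%:M.
        apply/matrixP => i' j'; rewrite !ord1 dotE [RHS]mxE eqxx mulr1n -dotDr.
        by rewrite /D' addrC subrK.
      rewrite mul_mx_scalar scalerA mulrDr scalerDl /D' mulmxBr.
      by rewrite [LHS]addrAC !addrA.
    rewrite e1; apply: le_trans (enorm3_sqr _ _ _) _; rewrite ler_pM2l //.
    have q1 : enorm (a l) ^+ 2 <= 1 by rewrite expr_le1 ?enorm_ge0.
    have sq c : enorm (c *: a l) ^+ 2 = c ^+ 2 * enorm (a l) ^+ 2.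
      by rewrite enormZ exprMn real_normK ?num_real.
    have e2 c : (s / Num.sqrt n%:R * c) ^+ 2 = s ^+ 2 / n%:R * c ^+ 2.
      by rewrite exprMn step_le.
    rewrite !sq !e2.
    apply: lerD; [apply: lerD|].
    + rewrite -exprMn ler_sqr ?nnegrE ?enorm_ge0 ?mulr_ge0 ?enorm_ge0 ?(ltW (K0 t)) //.
    + by rewrite [leRHS]mulrA; apply: ler_piMr => //; rewrite mulr_ge0 ?sqr_ge0.
    + have h1 : s ^+ 2 / n%:R <= 1.
        by rewrite ler_pdivrMr // mul1r; apply: le_trans n1; rewrite expr_le1 // ltW.
      have h2 : dot (b l) D' ^+ 2 <= D l.
        rewrite -[leLHS]real_normK ?num_real // ler_sqr ?nnegrE ?enorm_ge0 //.
        apply: le_trans (dot_le_enorm _ _) _; exact: ler_piMl (enorm_ge0 _) (b1 l).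
      have h3 : 0 <= dot (b l) D' ^+ 2 by exact: sqr_ge0.
      apply: le_trans (ler_piMr _ q1) _; first exact: mulr_ge0.
      by apply: le_trans (ler_piMl h3 h1) h2.
  have sD := lu t s s01; rewrite -/(D _) in sD.
  rewrite -mulr_sumr !big_split /= -!mulr_sumr.
  set A := \sum_l D l; set B := n%:R^-1 * _.
  have hA : A <= s ^+ 2 * K t ^+ N by exact: sD.
  have hB : B <= K t * enorm (u t) ^+ 2 by exact: bK.
  have hu : enorm (u t) ^+ 2 <= K t ^+ (2 * N).
    by rewrite mulnC exprM ler_sqr ?nnegrE ?enorm_ge0 // bu.
  set k := K t ^+ (2 * N + 2).
  have k1 : K t ^+ N <= k by apply: Kle; clear; lia.
  have k2 : K t ^+ 2 * K t ^+ N <= k by rewrite -exprD; apply: Kle; clear; lia.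
  have k3 : K t * enorm (u t) ^+ 2 <= k.
    apply: (@le_trans _ _ (K t * K t ^+ (2 * N))); first by rewrite ler_wpM2l // ltW.
    by rewrite -exprS; apply: Kle; clear; lia.
  have -> : K t ^+ (2 * N + 4) = K t ^+ 2 * k by rewrite -exprD; congr (_ ^+ _); clear; lia.
  have s20 := sqr_ge0 s; have k0 : 0 <= k by exact: Kge0.
  have h1 : K t ^+ 2 * A <= s ^+ 2 * k.
    apply: le_trans (ler_wpM2l (Kge0 t 2) hA) _; rewrite mulrCA ler_wpM2l //.
  have h2 : A <= s ^+ 2 * k by apply: le_trans hA _; rewrite ler_wpM2l.
  have h3 : s ^+ 2 * B <= s ^+ 2 * k by rewrite ler_wpM2l // (le_trans hB).
  have K16 : 9 <= K t ^+ 2 by have := gd_K4 gd t; nra.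
  apply: (@le_trans _ _ (9 * (s ^+ 2 * k))); first by lra.
  by rewrite mulrCA ler_wpM2l // ler_wpM2r.
Qed.

Lemma enlip_XT (u : T -> 'cV[R]_n) N : enlip th K u N ->
  enlip th K (fun t => (X t)^T *m u t) (2 * N + 4).
Proof.
apply: (@enlip_mul _ _ (fun t => (X t)^T) (fun l => cfgq w l.2) (fun l => delta_mx l.1 0)).
- by move=> i j; under eq_fun do rewrite mxE; exact: measurable_cfgX gd _ _.
- exact: cfgX_tr gd.
- move=> [i j] s t; rewrite (cfgX_th gd) [LHS]linearD [X in _ + X = _]linearZ /=.
  by congr (_ + _ *: _); rewrite trmx_mul trmxK.
- by move=> l; exact: enorm_cfgq gd _.
- by move=> l; rewrite enorm_delta.
- move=> t v; rewrite sum_pair; under eq_bigr => i _ do under eq_bigr => j _ do rewrite /= dot_delta.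
  under eq_bigr do rewrite sumr_const card_ord -mulr_natl.
  by rewrite -mulr_sumr sumn_le mulrA ler_wpM2r ?sqr_ge0 // mulrC; exact: gd_Kp gd t.
Qed.

Lemma enlip_X (u : T -> 'cV[R]_p) N : enlip th K u N ->
  enlip th K (fun t => X t *m u t) (2 * N + 4).
Proof.
apply: (@enlip_mul _ _ X (fun l => delta_mx l.1 0) (fun l => cfgq w l.2)).
- exact: measurable_cfgX gd.
- exact: gd_KX gd.
- by move=> [i j] s t; rewrite (cfgX_th gd).
- by move=> l; rewrite enorm_delta.
- by move=> l; exact: enorm_cfgq gd _.
- move=> t v; rewrite sum_pair /=; under eq_bigr do rewrite sum_cfgq_sqr.
  rewrite sumr_const card_ord -enorm_sqr.
  set D := enorm _ ^+ 2; have -> : n%:R^-1 * (D *+ n) = D.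
    by clearbody D; rewrite -mulr_natl; field; rewrite gt_eqF.
  rewrite /D.
  apply: (@le_trans _ _ (enorm v ^+ 2)).
    by rewrite ler_sqr ?nnegrE ?enorm_ge0 // (enorm_wproj gd).
  by rewrite ler_peMl ?sqr_ge0 // (cfgK1 gd).
Qed.

Definition dirlim m (u : T -> 'cV[R]_m) l t (a : 'cV[R]_m) : Prop :=
  forall i, (fun k => (u (th l (- step k) t) i 0 - u t i 0) / - step k) @ \oo --> a i 0.

Variable cN : nat -> R.
Hypothesis EK : forall N, Ele mu (fun t => K t ^+ N) (cN N).

Definition steinc (a b : R) : R := expR 1 * (2 * a + 2 * b) + b.

(** The field with entries u_i v_j pairs with H to the bilinear form of u and Hv, so each remainder
    is obtained by a choice of [u] and [v]. The exponents count the powers of [K] in |u|^2 |v|^2 and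
    in its increments. *)
Lemma stein_product (u : T -> 'cV[R]_n) (v : T -> 'cV[R]_p) N M :
  enlip th K u N -> enlip th K v M ->
  exists2 Xi, Ele mu Xi (steinc (cN (2 * N + 2 * M)) (cN (2 * N + 2 * M + 2))) &
    forall t (du : 'I_n * 'I_p -> 'cV[R]_n) (dv : 'I_n * 'I_p -> 'cV[R]_p),
    (forall l, dirlim u l t (du l)) -> (forall l, dirlim v l t (dv l)) ->
    Xi t = (dot (u t) (H t *m v t) -
      \sum_i \sum_j (du (i, j) i 0 * v t j 0 + u t i 0 * dv (i, j) j 0)) ^+ 2.
Proof.
move=> [mu' bu lu] [mv bv lv].
pose F (l : 'I_n * 'I_p) t := u t l.1 0 * v t l.2 0.
have sqE t : \sum_l F l t ^+ 2 = enorm (u t) ^+ 2 * enorm (v t) ^+ 2.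
  rewrite sum_pair -!sumn_le big_distrl /=; apply: eq_bigr => i _.
  by rewrite big_distrr /=; apply: eq_bigr => j _; rewrite /F exprMn.
have b2 t : enorm (u t) ^+ 2 <= K t ^+ (2 * N).
  by rewrite mulnC exprM ler_sqr ?nnegrE ?enorm_ge0 // bu.
have b3 t : enorm (v t) ^+ 2 <= K t ^+ (2 * M).
  by rewrite mulnC exprM ler_sqr ?nnegrE ?enorm_ge0 // bv.
have FE t : \sum_l F l t ^+ 2 <= K t ^+ (2 * N + 2 * M).
  by rewrite sqE exprD; apply: ler_pM => //; exact: sqr_ge0.
have LE t s : 0 < s <= 1 -> \sum_k \sum_l (F k (th l s t) - F k t) ^+ 2 <=
    s ^+ 2 * K t ^+ (2 * N + 2 * M + 2).
  move=> s01; rewrite exchange_big /=.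
  pose Du l := enorm (u (th l s t) - u t) ^+ 2; pose Dv l := enorm (v (th l s t) - v t) ^+ 2.
  have Dv0 l : 0 <= Dv l by exact: sqr_ge0.
  have Du0 l : 0 <= Du l by exact: sqr_ge0.
  apply: (@le_trans _ _ (\sum_l 3 * (Du l * enorm (v t) ^+ 2 + enorm (u t) ^+ 2 * Dv l + Du l * Dv l))).
    apply: ler_sum => l _; rewrite /Du /Dv; set t' := th l s t.
    have prod (a : 'cV[R]_n) (b : 'cV[R]_p) :
        enorm a ^+ 2 * enorm b ^+ 2 = \sum_i \sum_j (a i 0 * b j 0) ^+ 2.
      rewrite -!sumn_le big_distrl /=; apply: eq_bigr => i _.
      by rewrite big_distrr /=; apply: eq_bigr => j _; rewrite exprMn.
    rewrite !prod -!big_split /= mulr_sumr sum_pair; apply: ler_sum => i _.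
    rewrite -!big_split /= mulr_sumr; apply: ler_sum => j _.
    rewrite /F /= [(u t' - _) i 0]mxE [(- u t) i 0]mxE [(v t' - _) j 0]mxE [(- v t) j 0]mxE.
    set a := u t i 0; set a' := u t' i 0; set b := v t j 0; set b' := v t' j 0.
    have -> : a' * b' - a * b = (a' - a) * b + a * (b' - b) + (a' - a) * (b' - b) by ring.
    set z1 := _ * b; set z2 := a * _; set z3 := _ * (b' - b).
    by have := sqr_ge0 (z1 - z2); have := sqr_ge0 (z1 - z3); have := sqr_ge0 (z2 - z3); nra.
  have hu := lu t s s01; have hv := lv t s s01; rewrite -/(Du _) -/(Dv _) in hu hv.
  rewrite -mulr_sumr !big_split /= -mulr_suml -mulr_sumr.
  set A := \sum_l Du l; set B := \sum_l Dv l.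
  have hA : A <= s ^+ 2 * K t ^+ N by exact: hu.
  have hB : B <= s ^+ 2 * K t ^+ M by exact: hv.
  have A0 : 0 <= A by exact: sumr_ge0.
  have hAB : \sum_l Du l * Dv l <= A * B.
    rewrite mulr_suml; apply: ler_sum => l _; rewrite ler_wpM2l //.
    by rewrite /B (bigD1 l) //= lerDl sumr_ge0.
  set k := K t ^+ (2 * N + 2 * M).
  have -> : K t ^+ (2 * N + 2 * M + 2) = K t ^+ 2 * k by rewrite -exprD; congr (_ ^+ _); clear; lia.
  have s20 := sqr_ge0 s.
  have s21 : s ^+ 2 <= 1 by case/andP: s01 => s0 s1; rewrite expr_le1 // ltW.
  have k0 : 0 <= k by exact: Kge0.
  have h1 : A * enorm (v t) ^+ 2 <= s ^+ 2 * k.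
    apply: (@le_trans _ _ (s ^+ 2 * K t ^+ N * K t ^+ (2 * M))).
      by apply: ler_pM => //; exact: sqr_ge0.
    by rewrite -mulrA ler_wpM2l // -exprD; apply: Kle; clear; lia.
  have h2 : enorm (u t) ^+ 2 * B <= s ^+ 2 * k.
    apply: (@le_trans _ _ (K t ^+ (2 * N) * (s ^+ 2 * K t ^+ M))).
      by apply: ler_pM => //; [exact: sqr_ge0|exact: sumr_ge0].
    by rewrite mulrCA ler_wpM2l // -exprD; apply: Kle; clear; lia.
  have h3 : A * B <= s ^+ 2 * k.
    apply: (@le_trans _ _ (s ^+ 2 * K t ^+ N * (1 * K t ^+ M))).
      apply: ler_pM => //; first exact: sumr_ge0.
      by apply: le_trans hB _; rewrite ler_wpM2r.
    by rewrite mul1r -mulrA ler_wpM2l // -exprD; apply: Kle; clear; lia.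
  have K16 : 9 <= K t ^+ 2 by have := gd_K4 gd t; nra.
  apply: (@le_trans _ _ (9 * (s ^+ 2 * k))); first by lra.
  by rewrite mulrCA ler_wpM2l // ler_wpM2r.
have mF l : measurable_fun setT (F l) by exact: measurable_funM.
have [Xi EXi XiE] := stein_bound (gd_field gd) (index_enum_uniq _) mF (EK _) (fun s _ => EK _) FE LE.
exists Xi => // t du dv hu hv.
rewrite (XiE t (fun l => du l l.1 0 * v t l.2 0 + u t l.1 0 * dv l l.2 0)).
  congr (_ ^+ 2); rewrite sumrB; congr (_ - _); last by rewrite sum_pair.
  rewrite sum_pair; apply: eq_bigr => i _; rewrite mxE mulr_sumr; apply: eq_bigr => j _.
  by rewrite /F /= mulrCA.
move=> l _; have h1 := hu l l.1; have h2 := hv l l.2.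
have s0 : (fun m => - (step m : R)) @ \oo --> (0 : R).
  by rewrite -oppr0; apply: cvgN; exact: cvg_step.
have h3 : (fun m => v (th l (- step m) t) l.2 0) @ \oo --> v t l.2 0.
  have : (fun m => (v (th l (- step m) t) l.2 0 - v t l.2 0) / - step m * - step m + v t l.2 0)
      @ \oo --> dv l l.2 0 * 0 + v t l.2 0.
    by apply: cvgD; [exact: cvgM|exact: cvg_cst].
  rewrite mulr0 add0r; apply: cvg_trans; apply: near_eq_cvg; apply: nearW => m.
  by rewrite divfK ?subrK // oppr_eq0 gt_eqF // step_gt0.
have : (fun m => (u (th l (- step m) t) l.1 0 - u t l.1 0) / - step m * v (th l (- step m) t) l.2 0
   + u t l.1 0 * ((v (th l (- step m) t) l.2 0 - v t l.2 0) / - step m)) @ \oo -->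
   du l l.1 0 * v t l.2 0 + u t l.1 0 * dv l l.2 0.
  by apply: cvgD; apply: cvgM => //; exact: cvg_cst.
apply: cvg_trans; apply: near_eq_cvg; apply: nearW => m; rewrite /F.
have sm : (step m : R) != 0 by rewrite gt_eqF // step_gt0.
by move: sm; set z := step m; clearbody z => sm; field.
Qed.

End Products.

#[local] Transparent betahat psihat.
(** * Derivatives along entry directions *)

Section DirectionalSums.
Context {R : realType} (n p : nat).
Variables (w : 'cV[R]_p) (ww : dot w w = 1) (r : R).
Variables (f : 'cV[R]_n) (th : 'cV[R]_p) (ff : dot f f = 1).
Variables (A : 'M[R]_p) (D : 'M[R]_n) (X : 'M[R]_(n, p)).
Local Notation Q := (wproj w).
Local Notation tb := (Q *m th).
Local Notation B := (D *m X *m A).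
Local Notation V := (D - D *m X *m A *m X^T *m D).
Local Notation ei i := (delta_mx i 0).

(* Normalized derivatives of psi and beta along the entry (i, j) of H, and of
   psi / |psi| and beta / |psi|. *)
Definition dirpsi i j : 'cV[R]_n :=
  - r *: (dot (cfgq w j) th *: (V *m ei i) + f i 0 *: (B *m cfgq w j)).
Definition dirbeta i j : 'cV[R]_p :=
  r *: (A *m (f i 0 *: cfgq w j - dot (cfgq w j) th *: (X^T *m D *m ei i))).
Definition dirf i j : 'cV[R]_n := dirpsi i j - dot f (dirpsi i j) *: f.
Definition dirth i j : 'cV[R]_p := dirbeta i j - dot f (dirpsi i j) *: th.

Let addE m (u v : 'cV[R]_m) i : (u + v) i 0 = u i 0 + v i 0. Proof. by rewrite mxE. Qed.
Let subE m (u v : 'cV[R]_m) i : (u - v) i 0 = u i 0 - v i 0. Proof. by rewrite !mxE. Qed.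
Let sclE m a (u : 'cV[R]_m) i : (a *: u) i 0 = a * u i 0. Proof. by rewrite mxE. Qed.

Lemma mulmx_delta m k (M : 'M[R]_(m, k)) i j : (M *m (delta_mx i 0 : 'cV[R]_k)) j 0 = M j i.
Proof. by rewrite -colE mxE. Qed.

Let trQ : (Q)^T = Q. Proof. by rewrite linearB /= trmx1 trmx_mul trmxK. Qed.

Let w1 : w^T *m w = 1%:M.
Proof. by apply/matrixP => i j; rewrite !ord1 dotE ww mxE. Qed.

Let QQ : Q *m Q = Q.
Proof.
rewrite {2}/wproj mulmxBr mulmx1 mulmxA [Q *m w]mulmxBl mul1mx -mulmxA w1 mulmx1 subrr.
by rewrite mul0mx subr0.
Qed.

Lemma mxtrace_wproj : \tr Q = p%:R - 1.
Proof. by rewrite linearB /= mxtrace1 mxtrace_mulC w1 mxtrace1. Qed.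

Lemma mxtrace_mul_wproj (M : 'M[R]_p) : \tr (M *m Q) = \tr M - dot w (M *m w).
Proof.
rewrite mulmxBr mulmx1 linearB /= mulmxA mxtrace_mulC; congr (_ - _).
by rewrite /mxtrace big_ord1 dotE.
Qed.

Let tbE j : dot (cfgq w j) th = tb j 0. Proof. exact: dot_cfgq. Qed.

Let Qtb : Q *m tb = tb. Proof. by rewrite mulmxA QQ. Qed.

Lemma dot_dirpsi (c : 'cV[R]_n) i j : dot c (dirpsi i j) =
  - r * (tb j 0 * (V^T *m c) i 0 + f i 0 * ((B *m Q)^T *m c) j 0).
Proof.
rewrite dotZr dotDr !dotZr tbE [dot c (V *m _)]dot_mulmx [dot c (B *m _)]dot_mulmx.
rewrite /cfgq [dot _ (Q *m _)]dot_mulmx trQ ![dot _ (ei _)]dotC !dot_delta.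
by rewrite [(B *m Q)^T]trmx_mul trQ [Q *m (_ *m c)]mulmxA.
Qed.

(** The correction due to dividing by |psi| enters every sum below through this bilinear
    expression. *)
Lemma sum_dot_dirpsi (u c : 'cV[R]_n) (v : 'cV[R]_p) :
  \sum_i \sum_j u i 0 * v j 0 * dot c (dirpsi i j) =
  - r * (dot tb v * dot c (V *m u) + dot f u * dot c (B *m Q *m v)).
Proof.
rewrite [dot c (V *m u)]dot_mulmx [dot c (_ *m v)]dot_mulmx mulrDr.
transitivity (\sum_i \sum_j (- r * ((u i 0 * (V^T *m c) i 0) * (v j 0 * tb j 0)) +
    - r * ((u i 0 * f i 0) * (v j 0 * ((B *m Q)^T *m c) j 0)))).
  by apply: eq_bigr => i _; apply: eq_bigr => j _; rewrite dot_dirpsi; ring.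
under eq_bigr do rewrite big_split /= -!mulr_sumr.
rewrite big_split /= -!mulr_sumr -!mulr_suml; congr (_ * _ + _ * _).
  by rewrite mulrC [dot (V^T *m c) u]dotC [dot tb v]dotC.
by rewrite [dot f u]dotC [dot _ v]dotC.
Qed.

(** As |f| = 1, the contribution of D X A cancels against the normalization, which leaves tr V and
    one bounded term. *)
Lemma sum_dirf (v : 'cV[R]_p) :
  \sum_i \sum_j dirf i j i 0 * v j 0 = - r * dot tb v * (\tr V - dot f (V *m f)).
Proof.
have E i j : dirf i j i 0 * v j 0 = - r * (V i i * (tb j 0 * v j 0)) -
    r * (f i 0 * ((B *m Q) i j * v j 0)) - f i 0 * v j 0 * dot f (dirpsi i j).
  rewrite /dirf subE sclE; set DD := dot f _.
  rewrite /dirpsi sclE addE !sclE tbE /cfgq mulmxA !mulmx_delta.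
  by ring.
under eq_bigr do under eq_bigr do rewrite E.
under eq_bigr do rewrite !sumrB -!mulr_sumr.
rewrite !sumrB -!mulr_sumr sum_dot_dirpsi ff mul1r.
have -> : \sum_i V i i * (\sum_j tb j 0 * v j 0) = \tr V * dot tb v by rewrite -mulr_suml.
have -> : \sum_i f i 0 * (\sum_j (B *m Q) i j * v j 0) = dot f (B *m Q *m v).
  by apply: eq_bigr => i _; rewrite [(_ *m v) i 0]mxE.
by ring.
Qed.

Lemma sum_dirf_col j :
  \sum_i dirf i j i 0 = - r * tb j 0 * (\tr V - dot f (V *m f)).
Proof.
have := sum_dirf (ei j); rewrite [dot tb _]dotC dot_delta => <-.
apply: eq_bigr => i _; rewrite (bigD1 j) //= big1 ?addr0 => [|k /negPf kj].
  by rewrite [delta_mx _ _ _ _]mxE !eqxx mulr1.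
by rewrite [delta_mx _ _ _ _]mxE kj mulr0.
Qed.

Lemma sum_XT : \sum_i \sum_j f i 0 *
    (Q *m ((r * f i 0) *: cfgq w j + X^T *m dirf i j)) j 0 =
  r * (p%:R - 1 - dot tb (X^T *m V *m f) - \tr (X^T *m B *m Q) +
       dot tb (X^T *m f) * dot f (V *m f) + dot f (B *m Q *m (X^T *m f))).
Proof.
have E i j : f i 0 * (Q *m ((r * f i 0) *: cfgq w j + X^T *m dirf i j)) j 0 =
    r * (f i 0 * f i 0 * Q j j) - r * (tb j 0 * ((Q *m X^T *m V) j i * f i 0)) -
    r * (f i 0 * f i 0 * (Q *m X^T *m B *m Q) j j) -
    f i 0 * (Q *m (X^T *m f)) j 0 * dot f (dirpsi i j).
  rewrite /dirf /dirpsi mulmxDr -scalemxAr /cfgq !mulmxA QQ mulmxBr -!scalemxAr mulmxDr -!scalemxAr !mulmxA.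
  rewrite addE sclE subE !sclE addE !sclE !mulmx_delta -/(cfgq w j) tbE.
  by set DD := dot f _; ring.
under eq_bigr do under eq_bigr do rewrite E.
under eq_bigr do rewrite !sumrB -!mulr_sumr.
rewrite !sumrB -!mulr_sumr sum_dot_dirpsi ff mul1r.
have -> : \sum_i f i 0 * f i 0 * (\sum_j Q j j) = p%:R - 1.
  by rewrite -mulr_suml -/(\tr Q) mxtrace_wproj -[X in X * _ = _]/(dot f f) ff mul1r.
have -> : \sum_i f i 0 * f i 0 * (\sum_j (Q *m X^T *m B *m Q) j j) = \tr (X^T *m B *m Q).
  rewrite -mulr_suml -/(\tr _) -[X in X * _ = _]/(dot f f) ff mul1r.
  by rewrite -3!mulmxA mxtrace_mulC -!mulmxA QQ !mulmxA.
have -> : \sum_i \sum_j tb j 0 * ((Q *m X^T *m V) j i * f i 0) = dot tb (X^T *m V *m f).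
  rewrite exchange_big /= -[in RHS]Qtb [RHS]dotC [RHS]dot_mulmx trQ [RHS]dotC mulmxA.
  by apply: eq_bigr => j _; rewrite -mulr_sumr; congr (_ * _); rewrite [in RHS]mxE !mulmxA.
have -> : dot tb (Q *m (X^T *m f)) = dot tb (X^T *m f) by rewrite dot_mulmx trQ Qtb.
have -> : B *m Q *m (Q *m (X^T *m f)) = B *m Q *m (X^T *m f).
  by rewrite !mulmxA -[_ *m Q *m Q]mulmxA QQ.
by ring.
Qed.

Lemma sum_dirth (u : 'cV[R]_n) : \sum_i \sum_j u i 0 * (Q *m dirth i j) j 0 =
  r * (dot f u * \tr (A *m Q) - dot tb (A *m X^T *m D *m u) +
       dot tb tb * dot f (V *m u) + dot f u * dot f (B *m tb)).
Proof.
have E i j : u i 0 * (Q *m dirth i j) j 0 =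
    r * (u i 0 * f i 0 * (Q *m A *m Q) j j) -
    r * (tb j 0 * ((Q *m A *m X^T *m D) j i * u i 0)) - u i 0 * tb j 0 * dot f (dirpsi i j).
  rewrite /dirth /dirbeta mulmxBr -!scalemxAr mulmxBr mulmxBr -!scalemxAr /cfgq !mulmxA.
  rewrite subE !sclE subE !sclE !mulmx_delta.
  by rewrite -/(cfgq w j) tbE; ring.
under eq_bigr do under eq_bigr do rewrite E.
under eq_bigr do rewrite !sumrB -!mulr_sumr.
rewrite !sumrB -!mulr_sumr sum_dot_dirpsi.
have -> : \sum_i u i 0 * f i 0 * (\sum_j (Q *m A *m Q) j j) = dot f u * \tr (A *m Q).
  rewrite -mulr_suml -/(\tr _) -[X in X * _ = _]/(dot u f) dotC; congr (_ * _).
  by rewrite -mulmxA mxtrace_mulC -mulmxA QQ.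
have -> : \sum_i \sum_j tb j 0 * ((Q *m A *m X^T *m D) j i * u i 0) = dot tb (A *m X^T *m D *m u).
  rewrite exchange_big /= -[in RHS]Qtb [RHS]dotC [RHS]dot_mulmx trQ [RHS]dotC !mulmxA.
  by apply: eq_bigr => j _; rewrite -mulr_sumr; congr (_ * _); rewrite [in RHS]mxE.
have -> : B *m Q *m tb = B *m tb by rewrite -[B *m Q *m tb]mulmxA Qtb.
by ring.
Qed.

Lemma sum_X : \sum_i \sum_j ((r * tb j 0) *: ei i + X *m dirth i j) i 0 * tb j 0 =
  r * (n%:R * dot tb tb + dot f (X *m A *m tb) - dot tb tb * \tr (X *m A *m X^T *m D) +
       dot tb tb * dot f (V *m (X *m th)) + dot f (X *m th) * dot f (B *m tb)).
Proof.
have E i j : ((r * tb j 0) *: ei i + X *m dirth i j) i 0 * tb j 0 =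
    r * (tb j 0 * tb j 0) + r * (f i 0 * ((X *m A *m Q) i j * tb j 0)) -
    r * ((X *m A *m X^T *m D) i i * (tb j 0 * tb j 0)) -
    (X *m th) i 0 * tb j 0 * dot f (dirpsi i j).
  rewrite /dirth /dirbeta mulmxBr -!scalemxAr mulmxBr mulmxBr -!scalemxAr /cfgq !mulmxA.
  rewrite addE sclE subE !sclE subE !sclE !mulmx_delta [delta_mx _ _ _ _]mxE !eqxx /=.
  by rewrite -/(cfgq w j) tbE; ring.
under eq_bigr do under eq_bigr do rewrite E.
under eq_bigr do rewrite !sumrB big_split /= -!mulr_sumr.
rewrite !sumrB big_split /= -!mulr_sumr sum_dot_dirpsi.
have -> : \sum_(i < n) (\sum_j tb j 0 * tb j 0) = n%:R * dot tb tb.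
  by rewrite sumr_const card_ord [RHS]mulr_natl.
have -> : \sum_i f i 0 * (\sum_j (X *m A *m Q) i j * tb j 0) = dot f (X *m A *m tb).
  have -> : X *m A *m tb = X *m A *m Q *m tb by rewrite -[RHS]mulmxA Qtb.
  by apply: eq_bigr => i _; rewrite [(_ *m tb) i 0]mxE.
have -> : \sum_i (X *m A *m X^T *m D) i i * (\sum_j tb j 0 * tb j 0) =
    dot tb tb * \tr (X *m A *m X^T *m D) by rewrite -mulr_suml mulrC.
have -> : B *m Q *m tb = B *m tb by rewrite -[B *m Q *m tb]mulmxA Qtb.
by ring.
Qed.

End DirectionalSums.

#[local] Opaque betahat psihat.

(** * Differentiability along entry lines *)

Section Directional.
Context {R : realType} {d : measure_display} {T : measurableType d}.
Variables (n p : nat) (mu : probability T R).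
Variables (th : 'I_n * 'I_p -> R -> T -> T) (H : T -> 'M[R]_(n, p)).
Variables (zeta y : T -> 'cV[R]_n) (w : 'cV[R]_p) (K : T -> R) (tau : R).
Variables (loss : R -> R -> R) (g : 'cV[R]_p -> R) (gs : 'I_p -> R -> R).
Hypothesis gd : gaussian_design mu th H zeta y w K tau.
Hypothesis er : estimator_regular n loss g gs tau.

Let n0 := gd_n0 gd.
Let nR0 : 0 < n%:R :> R. Proof. by rewrite ltr0n. Qed.
Let sn0 : 0 < Num.sqrt n%:R :> R. Proof. by rewrite sqrtr_gt0. Qed.
Let sn2 : Num.sqrt n%:R ^+ 2 = n%:R :> R. Proof. by rewrite sqr_sqrtr. Qed.
Let tau0 := er_tau0 er.
Local Notation X := (cfgX H zeta w).
Local Notation psi := (cfgpsi H zeta y w loss g).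
Local Notation beta := (cfgbeta H zeta y w loss g).
Local Notation f := (cfgf H zeta y w loss g).
Local Notation theta := (cfgth H zeta y w loss g).
Local Notation Q := (wproj w).

Let K0 t : 0 < K t. Proof. exact: (cfgK_gt0 gd). Qed.

Definition dird m (u : T -> 'cV[R]_m) l t (a : 'cV[R]_m) : Prop :=
  forall i, is_derive (0 : R) 1 (fun s => u (th l s t) i 0) (a i 0).

Let th0 l t : th l 0 t = t.
Proof. exact: (gflow_0 (gfield_flow (gd_field gd) l)). Qed.

Lemma dird_dirlim m (u : T -> 'cV[R]_m) l t a : dird u l t a -> dirlim th u l t a.
Proof.
move=> h i; have := is_derive_seq (h i) (x := fun k => - (step k)).
rewrite th0; apply; first by move=> k; rewrite oppr_eq0 gt_eqF // step_gt0.
by rewrite -oppr0; apply: cvgN; exact: cvg_step.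
Qed.

Lemma is_derive_big (J : finType) (F : J -> R -> R) (c : J -> R) (x : R) :
  (forall j, is_derive x 1 (F j) (c j)) ->
  is_derive x 1 (fun s => \sum_j F j s) (\sum_j c j).
Proof.
move=> h; rewrite (_ : (fun s => _) = \sum_j F j); last first.
  by apply/funext => s; rewrite fct_sumE.
by apply: (big_rec2 (fun F c => is_derive x 1 F c)) => [|j a b _ hb];
  [exact: is_derive_cst|exact: is_deriveD].
Qed.

Lemma is_derive_mul (f1 f2 : R -> R) (a b x : R) :
  is_derive x 1 f1 a -> is_derive x 1 f2 b ->
  is_derive x 1 (fun s => f1 s * f2 s) (a * f2 x + f1 x * b).
Proof.
move=> h1 h2; have h := is_deriveM h1 h2.
by rewrite addrC [a * _]mulrC; exact: h.
Qed.

Lemma dird_mul m m' (M : T -> 'M[R]_(m, m')) (a : 'cV[R]_m) (b : 'cV[R]_m')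
    (u : T -> 'cV[R]_m') l t du :
  (forall s, M (th l s t) = M t + s *: (a *m b^T)) -> dird u l t du ->
  dird (fun t => M t *m u t) l t (dot b (u t) *: a + M t *m du).
Proof.
move=> hM hu i.
have -> : (dot b (u t) *: a + M t *m du) i 0 =
    \sum_j (a i 0 * b j 0 * u t j 0 + M t i j * du j 0).
  rewrite [LHS]mxE [(dot _ _ *: a) i 0]mxE [(M t *m du) i 0]mxE big_split /=; congr (_ + _).
  by rewrite mulrC mulr_sumr; apply: eq_bigr => j _; rewrite mulrA.
have -> : (fun s => (M (th l s t) *m u (th l s t)) i 0) =
    (fun s => \sum_j (M t i j + s * (a i 0 * b j 0)) * u (th l s t) j 0).
  apply/funext => s; rewrite hM mxE; apply: eq_bigr => j _; congr (_ * _).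
  by rewrite !mxE big_ord1 !mxE.
apply: is_derive_big => j; have hj := hu j.
have h1 : is_derive (0 : R) 1 (fun s : R => M t i j + s * (a i 0 * b j 0)) (a i 0 * b j 0).
  apply/is_derive_epsP => e e0; exists 1 => // s _.
  set c := a i 0 * b j 0; have -> : M t i j + (0 + s) * c - (M t i j + 0 * c) - c * s = 0 by ring.
  by rewrite normr0 mulr_ge0 // ltW.
by have := is_derive_mul h1 hj; rewrite th0 mul0r addr0.
Qed.

Lemma dird_cstmul m m' (M : 'M[R]_(m, m')) (u : T -> 'cV[R]_m') l t du :
  dird u l t du -> dird (fun t => M *m u t) l t (M *m du).
Proof.
move=> hu; have := dird_mul (M := fun=> M) (a := 0) (b := 0) _ hu.
by rewrite scaler0 add0r; apply => s; rewrite mul0mx scaler0 addr0.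
Qed.

Lemma cfgX_line i j t s r :
  cfgX H zeta w (th (i, j) s t) = cfgX H zeta w (th (i, j) r t) +
    ((s - r) / Num.sqrt n%:R) *: ((delta_mx i 0 : 'cV_n) *m (cfgq w j)^T).
Proof.
have := gflow_add (gfield_flow (gd_field gd) (i, j)) (s - r) r t.
by rewrite subrK => <-; rewrite (cfgX_th gd).
Qed.

(** The stability constant involves psi and beta at one of the two points; a first comparison with
    [t] itself bounds these on the whole segment. *)
Lemma cfg_line_lipschitz l t (M : R) : 0 < M -> exists2 L, 0 < L & forall s r,
  `|s| <= M -> `|r| <= M ->
  enorm (beta (th l s t) - beta (th l r t)) <= L * `|s - r| /\
  enorm (psi (th l s t) - psi (th l r t)) <= L * `|s - r|.
Proof.
case: l => i j M0.
have raw s r : tau * enorm (beta (th (i, j) s t) - beta (th (i, j) r t)) ^+ 2 +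
    enorm (psi (th (i, j) s t) - psi (th (i, j) r t)) ^+ 2 <=
    (s - r) ^+ 2 * (enorm (psi (th (i, j) r t)) ^+ 2 / tau + enorm (beta (th (i, j) r t)) ^+ 2).
  have yE : y (th (i, j) s t) = y (th (i, j) r t) by rewrite !(gd_y gd).
  apply: le_trans (rank_one_raw gd er yE (cfgX_line i j t s r)) _.
  rewrite expr_div_n sn2; set a := _ ^+ 2.
  have a0 : 0 <= a by exact: sqr_ge0.
  have n1 : n%:R^-1 <= 1 :> R by rewrite invf_le1 // ler1n.
  apply: ler_pM.
  - by rewrite mulr_ge0 // invr_ge0 ltW.
  - apply: addr_ge0; last by rewrite mulr_ge0 ?dot_ge0 ?sqr_ge0.
    by apply: divr_ge0; [rewrite mulr_ge0 ?dot_ge0 ?sqr_ge0|exact: ltW].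
  - by rewrite -[leRHS]mulr1 ler_wpM2l.
  have q1 : dot (cfgq w j) (cfgq w j) <= 1 by rewrite -enorm_sqr expr_le1 ?enorm_ge0 // (enorm_cfgq gd).
  have d1 : dot (delta_mx i 0) (delta_mx i 0 : 'cV[R]_n) = 1 by rewrite -enorm_sqr enorm_delta expr1n.
  have sqd m (u v : 'cV[R]_m) : dot u u <= 1 -> dot u v ^+ 2 <= enorm v ^+ 2.
    move=> u1; apply: le_trans (cauchy_schwarz _ _) _; rewrite enorm_sqr ler_piMl ?dot_ge0 //.
  rewrite d1 mul1r; apply: lerD; last exact: sqd.
  rewrite ler_wpM2r ?invr_ge0 ?(ltW tau0) //.
  apply: le_trans (_ : dot (delta_mx i 0) (psi (th (i, j) r t)) ^+ 2 <= _).
    by rewrite ler_piMl ?sqr_ge0.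
  by apply: sqd; rewrite d1.
pose c0 := enorm (psi t) ^+ 2 / tau + enorm (beta t) ^+ 2.
have ti0 : 0 <= tau^-1 by rewrite invr_ge0 ltW.
have c00 : 0 <= c0 by rewrite addr_ge0 ?sqr_ge0 // mulr_ge0 ?sqr_ge0.
have raw0 r : tau * enorm (beta (th (i, j) r t) - beta t) ^+ 2 +
    enorm (psi (th (i, j) r t) - psi t) ^+ 2 <= r ^+ 2 * c0.
  by have := raw r 0; rewrite th0 subr0.
clearbody c0.
(* |psi|^2 and |beta|^2 at any point of the segment are at most C *)
pose C := 2 * (enorm (psi t) ^+ 2 + M ^+ 2 * c0) + 2 * (enorm (beta t) ^+ 2 + M ^+ 2 * c0 / tau).
have bnd r : `|r| <= M -> enorm (psi (th (i, j) r t)) ^+ 2 <= C /\ enorm (beta (th (i, j) r t)) ^+ 2 <= C.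
  move=> rM; have h := raw0 r.
  have r2 : r ^+ 2 * c0 <= M ^+ 2 * c0.
    by rewrite ler_wpM2r // -[leLHS]real_normK ?num_real // ler_sqr ?nnegrE ?(ltW M0).
  have sq m (u v : 'cV[R]_m) : enorm u ^+ 2 <= 2 * (enorm v ^+ 2 + enorm (u - v) ^+ 2).
    rewrite !enorm_sqr /dot -big_split mulr_sumr /=; apply: ler_sum => k _.
    rewrite -!expr2 [(u - v) k 0]mxE [(- v) k 0]mxE; set a := u k 0; set b := v k 0.
    by have := sqr_ge0 (a - b - b); nra.
  have p1 := sq _ (psi (th (i, j) r t)) (psi t); have p2 := sq _ (beta (th (i, j) r t)) (beta t).
  have x0 : 0 <= enorm (psi (th (i, j) r t) - psi t) ^+ 2 by exact: sqr_ge0.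
  have x1 : 0 <= enorm (beta (th (i, j) r t) - beta t) ^+ 2 by exact: sqr_ge0.
  have x2 : enorm (beta (th (i, j) r t) - beta t) ^+ 2 <= M ^+ 2 * c0 / tau.
    rewrite ler_pdivlMr // mulrC; apply: le_trans r2; apply: le_trans h.
    by rewrite lerDl.
  have x3 : 0 <= M ^+ 2 * c0 by rewrite mulr_ge0 ?sqr_ge0.
  have x4 : 0 <= M ^+ 2 * c0 / tau by rewrite mulr_ge0.
  have x5 : enorm (psi (th (i, j) r t) - psi t) ^+ 2 <= M ^+ 2 * c0.
    apply: le_trans r2; apply: le_trans h; rewrite lerDr.
    by rewrite mulr_ge0 // ltW.
  rewrite /C; split.
    apply: le_trans p1 _; apply: le_trans (_ : 2 * (enorm (psi t) ^+ 2 + M ^+ 2 * c0) <= _).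
      by rewrite ler_pM2l // lerD2l.
    by rewrite lerDl mulr_ge0 // addr_ge0 ?sqr_ge0.
  apply: le_trans p2 _; apply: le_trans (_ : 2 * (enorm (beta t) ^+ 2 + M ^+ 2 * c0 / tau) <= _).
    by rewrite ler_pM2l // lerD2l.
  by rewrite lerDr mulr_ge0 // addr_ge0 ?sqr_ge0.
have C0 : 0 <= C by apply: le_trans (bnd 0 _).1; rewrite ?sqr_ge0 // normr0 ltW.
clearbody C.
pose L2 := (C / tau + C) * (1 + tau^-1) + 1.
have L20 : 0 < L2 by rewrite /L2 ltr_wpDl // mulr_ge0 ?addr_ge0 ?mulr_ge0.
exists (Num.sqrt L2); first by rewrite sqrtr_gt0.
move=> s r sM rM; have := raw s r; have [b1 b2] := bnd r rM.
have E : enorm (psi (th (i, j) r t)) ^+ 2 / tau + enorm (beta (th (i, j) r t)) ^+ 2 <= C / tau + C.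
  by apply: lerD => //; rewrite ler_wpM2r.
have s20 : 0 <= (s - r) ^+ 2 by exact: sqr_ge0.
move=> /le_trans /(_ (ler_wpM2l s20 E)).
have fin m (u : 'cV[R]_m) : enorm u ^+ 2 <= L2 * (s - r) ^+ 2 -> enorm u <= Num.sqrt L2 * `|s - r|.
  move=> hu; rewrite -ler_sqr ?nnegrE ?enorm_ge0 ?mulr_ge0 ?sqrtr_ge0 //.
  by rewrite exprMn (sqr_sqrtr (ltW L20)) -normrX ger0_norm // sqr_ge0.
set D := C / tau + C in L2 L20 fin E *; set z := (s - r) ^+ 2 in s20 fin *.
have D0 : 0 <= D by rewrite addr_ge0 // mulr_ge0.
set B := enorm (beta _ - _); set S := enorm (psi _ - _) => h.
have tB : 0 <= tau * B ^+ 2 by rewrite mulr_ge0 ?sqr_ge0 // ltW.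
have S0 : 0 <= S ^+ 2 by exact: sqr_ge0.
have zD : 0 <= z * D by rewrite mulr_ge0.
have zDt : 0 <= z * D / tau by rewrite mulr_ge0.
have L2z : L2 * z = z * D + z * D / tau + z by rewrite /L2; clearbody D z; ring.
have h1 : B ^+ 2 <= z * D / tau by rewrite ler_pdivlMr // mulrC; clearbody B S D z; lra.
by split; apply: fin; rewrite -/B -/S L2z; clearbody B S D z; lra.
Qed.

Let cB m (u v : 'cV[R]_m) i : (u - v) i 0 = u i 0 - v i 0. Proof. by rewrite !mxE. Qed.

Let tri (c u v e : R) : `|c - u| <= e / 2 -> `|c - v| <= e / 2 -> `|u - v| <= e.
Proof.
move=> h1 h2; have -> : u - v = (c - v) - (c - u) by lra.
by apply: le_trans (ler_normB _ _) _; lra.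
Qed.

Definition smooth_at t : Prop :=
  forall l i, derivable (fun s => psi (th l s t) i 0) 0 1.

(** Derivability of psi does not follow from that of betahat, since psi contains the derivative of
    the loss, which is only Lipschitz. On each entry line psi is locally Lipschitz, hence derivable
    almost everywhere, and [gflow_null] lifts this. The exceptional set is written as failure of the
    Cauchy property along [altstep] to be measurable. *)
Lemma smooth_ae : exists N, [/\ measurable N, mu N = 0%E & forall t, ~ N t -> smooth_at t].
Proof.
pose a l i m t := (psi (th l (altstep m) t) i 0 - psi t i 0) / (altstep m : R).
pose N l i := ~` [set t | forall k : nat, exists M : nat, forall mm : nat * nat,
   (M <= mm.1)%N && (M <= mm.2)%N -> `|a l i mm.1 t - a l i mm.2 t| <= step k].
have mth l s : measurable_fun setT (th l s).
  exact: (measurable_flow (gfield_flow (gd_field gd) l)).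
have ma l i m : measurable_fun setT (a l i m).
  apply: measurable_funM => //; apply: measurable_funB; last exact: measurable_cfgpsi gd er i.
  exact: (measurableT_comp (measurable_cfgpsi gd er i) (mth l _)).
have mN l i : measurable (N l i).
  apply: measurableC; apply: measurable_forall_count => k; apply: measurable_exists_count => M.
  apply: measurable_forall_count => -[m1 m2].
  have [h|h] := boolP ((M <= m1) && (M <= m2))%N; last first.
    by rewrite [X in measurable X](_ : _ = setT) // predeqE.
  rewrite [X in measurable X](_ : _ = [set t | `|a l i m1 t - a l i m2 t| <= step k]).
    apply: measurable_le_set => //; apply: measurableT_comp => //; exact: measurable_funB.
  by rewrite predeqE => t; split => /=; [apply|].
have good l i t : ~ N l i t -> derivable (fun s => psi (th l s t) i 0) 0 1.
  move=> /contrapT /= h.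
  have ca : cauchy (a l i ^~ t @ \oo).
    apply/cauchy_ballP => e e0.
    have [k ke] : exists k, step k < e.
      have := @cvg_step R; move=> /cvgrPdist_lt /(_ e e0).
      by case=> M _ /(_ M (leqnn M)) /=; rewrite sub0r normrN ger0_norm ?(ltW (step_gt0 _)) //; exists M.
    have [M hM] := h k; pose A := (a l i ^~ t) @` [set m | (M <= m)%N].
    exists (A, A); first by split; exists M => // m Mm; exists m.
    move=> [_ _] [/= [m1 h1 <-] [m2 h2 <-]]; rewrite /ball /=.
    by apply: le_lt_trans ke; apply: (hM (m1, m2)) => /=; rewrite h1 h2.
  have [c hc] : exists c : R, a l i ^~ t @ \oo --> c by apply/cvg_ex; exact: cauchy_cvg.
  have [L L0 hL] := cfg_line_lipschitz l t (ltr01 : 0 < (1 : R)).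
  have hd : is_derive (0 : R) 1 (fun s => psi (th l s t) i 0) c.
    apply: (lipschitz_altstep_derive (ltW L0)).
      move=> s r s1 r1; have [_ h2] := hL s r s1 r1; apply: le_trans h2.
      have := enorm_coord (psi (th l s t) - psi (th l r t)) i.
      by rewrite !cB.
    by rewrite /a in hc; under eq_fun do rewrite th0.
  exact: ex_derive.
have N0 l i : mu (N l i) = 0%E.
  apply: (gflow_null (gfield_flow (gd_field gd) l)) => // t.
  apply: measure_negligible.
    have := @measurable_flow _ _ _ mu _ _ (gfield_flow (gd_field gd) l) _ (measurableTypeR R) id (fun=> t).
    move=> /(_ (@measurable_id _ _ _) (measurable_cst t)) h.
    by rewrite -[X in measurable X]setTI; exact: h.
  have := @locally_lipschitz_ae_derivable R (fun s => psi (th l s t) i 0).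
  have lip M : 0 < M -> exists2 L, 0 < L & forall x z, `|x| <= M -> `|z| <= M ->
      `|psi (th l x t) i 0 - psi (th l z t) i 0| <= L * `|x - z|.
    move=> M0; have [L L0 hL] := cfg_line_lipschitz l t M0; exists L => // s r sM rM.
    have [_ h2] := hL s r sM rM; apply: le_trans h2.
    by have := enorm_coord (psi (th l s t) - psi (th l r t)) i; rewrite !cB.
  move=> /(_ lip); apply: negligibleS => x /= Nx hx.
  apply: Nx => k.
  have hd : is_derive (0 : R) 1 (fun s => psi (th l s (th l x t)) i 0) (derive1 (fun s => psi (th l s t) i 0) x).
    have fd : is_derive x 1 (fun s => psi (th l s t) i 0) (derive1 (fun s => psi (th l s t) i 0) x).
      by rewrite derive1E; exact: DeriveDef.
    apply/is_derive_epsP => e e0; have [r r0 hr] := (is_derive_epsP _ _ _).1 fd e e0.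
    exists r; [exact: r0|move=> s sr].
    have e1 : th l (0 + s) (th l x t) = th l (x + s) t.
      by rewrite (gflow_add (gfield_flow (gd_field gd) l)) add0r addrC.
    by rewrite e1 th0; exact: hr.
  have := is_derive_seq hd (x := altstep) (@altstep_neq0 R) (@cvg_altstep R).
rewrite th0 => /cvgrPdist_le /(_ (step k / 2)).
rewrite divr_gt0 ?step_gt0 // => /(_ erefl) [M' _ hM']; exists M' => -[m1 m2] /= /andP[h1 h2].
exact: (tri (hM' m1 h1) (hM' m2 h2)).
exists [set t | exists q : ('I_n * 'I_p) * 'I_n, N q.1 q.2 t]; split.
- exact: measurable_exists_count.
- apply: measure_negligible; first exact: measurable_exists_count.
  have neg k : mu.-negligible (if @unpickle (('I_n * 'I_p) * 'I_n)%type k is Some q then N q.1 q.2 else set0).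
    case: unpickle => [q|]; last exact: negligible_set0.
    by apply/negligibleP => //; exact: N0.
  apply: negligibleS (negligible_bigcup neg) => t [q Nq].
  by exists (pickle q) => //; rewrite pickleK.
- move=> t nN l i; apply: good => Nli; apply: nN; by exists (l, i).
Qed.

End Directional.

#[local] Transparent betahat psihat.
Lemma dirpsi_dirbeta (R : realType) (n p : nat) (w th : 'cV[R]_p) (r : R) (f : 'cV[R]_n)
    (A : 'M[R]_p) (D : 'M[R]_n) (X : 'M[R]_(n, p)) i j :
  D *m (dot (cfgq w j) th *: (r *: delta_mx i 0) + X *m dirbeta w r f th A D X i j) =
  - dirpsi w r f th A D X i j.
Proof.
rewrite /dirbeta /dirpsi scaleNr opprK scalerA [_ * r]mulrC -scalerA -scalemxAr -scalerDr.
rewrite -scalemxAr; congr (r *: _).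
rewrite mulmxDr -scalemxAr !mulmxBr -!scalemxAr !mulmxA mulmxBl scalerBr.
by rewrite addrA addrAC.
Qed.

#[local] Opaque betahat psihat.

(** * Derivatives of beta and psi *)

Section DirectionalDerivatives.
Context {R : realType} {d : measure_display} {T : measurableType d}.
Variables (n p : nat) (mu : probability T R).
Variables (th : 'I_n * 'I_p -> R -> T -> T) (H : T -> 'M[R]_(n, p)).
Variables (zeta y : T -> 'cV[R]_n) (w : 'cV[R]_p) (K : T -> R) (tau : R).
Variables (loss : R -> R -> R) (g : 'cV[R]_p -> R) (gs : 'I_p -> R -> R).
Hypothesis gd : gaussian_design mu th H zeta y w K tau.
Hypothesis er : estimator_regular n loss g gs tau.

Let n0 := gd_n0 gd.
Let nR0 : 0 < n%:R :> R. Proof. by rewrite ltr0n. Qed.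
Let sn0 : 0 < Num.sqrt n%:R :> R. Proof. by rewrite sqrtr_gt0. Qed.
Let sn2 : Num.sqrt n%:R ^+ 2 = n%:R :> R. Proof. by rewrite sqr_sqrtr. Qed.
Let tau0 := er_tau0 er.
Local Notation X := (cfgX H zeta w).
Local Notation psi := (cfgpsi H zeta y w loss g).
Local Notation beta := (cfgbeta H zeta y w loss g).
Local Notation f := (cfgf H zeta y w loss g).
Local Notation theta := (cfgth H zeta y w loss g).
Local Notation Q := (wproj w).

Let K0 t : 0 < K t. Proof. exact: (cfgK_gt0 gd). Qed.
Let th0 l t : th l 0 t = t.
Proof. exact: (gflow_0 (gfield_flow (gd_field gd) l)). Qed.
Let cB m (u v : 'cV[R]_m) i : (u - v) i 0 = u i 0 - v i 0. Proof. by rewrite !mxE. Qed.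
Local Notation dird := (dird th).

Variables (t : T) (A : 'M[R]_p).
Hypothesis smt : smooth_at th H zeta y w loss g t.
Hypothesis jac : jacobian_matrix loss g ((n%:R^-1)%:M) tau (y t) (X t) A.
Local Notation D := (Dhat loss g (y t) (X t)).
Local Notation r := ((Num.sqrt n%:R)^-1).
Local Notation dpsi := (dirpsi w r (f t) (theta t) A D (X t)).
Local Notation dbeta := (dirbeta w r (f t) (theta t) A D (X t)).

(** A shift of one entry of H moves the whole row i of the design along Q e_j. Total
    differentiability of betahat expresses this derivative by the partial ones. *)
Lemma dird_beta i j : dird beta (i, j) t (enorm (psi t) *: dbeta i j).
Proof.
pose E : 'M[R]_(n, p) := r *: ((delta_mx i 0 : 'cV[R]_n) *m (cfgq w j)^T).
have XE s : X (th (i, j) s t) = s *: E + X t.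
  by rewrite (cfgX_th gd) addrC /E scalerA.
have dB : differentiable (betahat loss g (y t)) (X t) := jac_differentiable jac.
have DE : 'D_E (betahat loss g (y t)) (X t) = enorm (psi t) *: dbeta i j.
  rewrite deriveE //.
  have -> : E = \sum_k (r * cfgq w j k 0) *: delta_mx i k.
    apply/matrixP => i' j'; rewrite summxE !mxE big_ord1 (bigD1 j') //= big1 ?addr0.
      rewrite !mxE !eqxx andbT /=.
      by case: (i' == i); rewrite ?mul1r ?mulr1 // mul0r !mulr0.
    by move=> k /negPf kj; rewrite !mxE [j' == _]eq_sym kj andbF mulr0.
  rewrite linear_sum /= (eq_bigr (fun k => (r * cfgq w j k 0) *: (A *m (psi t i 0 *: delta_mx k 0
      - beta t k 0 *: ((X t)^T *m D *m delta_mx i 0))))); last first.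
    by move=> k _; rewrite linearZ /=; congr (_ *: _); rewrite -deriveE //; exact: (jac_partial jac).
  rewrite /dirbeta scalerA [enorm _ * r]mulrC -scalerA.
  under eq_bigr do rewrite -scalerA scalemxAr.
  rewrite -scaler_sumr -mulmx_sumr; congr (_ *: _); rewrite scalemxAr; congr (_ *m _).
  rewrite scalerBr !scalerA (eq_bigr (fun k => psi t i 0 *: (cfgq w j k 0 *: delta_mx k 0) -
     (cfgq w j k 0 * beta t k 0) *: ((X t)^T *m D *m delta_mx i 0))); last first.
    by move=> k _; rewrite scalerBr !scalerA [_ * psi t i 0]mulrC.
  rewrite sumrB -scaler_sumr -scaler_suml; congr (_ *: _ - _ *: _).
  - by rewrite {1}(cfgpsiE gd er) mxE.
  - apply/matrixP => k z; rewrite ord1 summxE (bigD1 k) //= big1 ?addr0.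
      by rewrite !mxE !eqxx mulr1.
    by move=> l /negPf lk; rewrite !mxE eq_sym lk mulr0.
  - by rewrite -/(dot _ _) {1}(cfgbetaE gd er) dotZr.
have cv : (fun h : R => h^-1 *: (betahat loss g (y t) (h *: E + X t) - betahat loss g (y t) (X t)))
    @ (0 : R)^' --> enorm (psi t) *: dbeta i j.
  by rewrite -DE; exact: (@diff_derivable _ _ _ _ _ _ dB).
move=> k; set c := (_ *: dbeta i j) k 0.
have cvk : (fun h : R => h^-1 *: (beta (th (i, j) (h *: 1 + 0) t) k 0 - beta (th (i, j) 0 t) k 0))
    @ (0 : R)^' --> c.
  have cvk := cvg_comp _ _ cv (@coord_continuous R p 1 k 0 (enorm (psi t) *: dbeta i j)).
  refine (cvg_trans _ cvk); apply: near_eq_cvg; apply: nearW => h /=.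
  rewrite th0 addr0 [h *: 1]mulr1 /cfgbeta XE (gd_y gd).
  by rewrite [in LHS]mxE [in LHS]mxE [in LHS]mxE.
by split; [apply/cvg_ex; exists c | apply/cvg_lim].
Qed.

Lemma dird_Xu i j (u : T -> 'cV[R]_p) du : dird u (i, j) t du ->
  dird (fun t => X t *m u t) (i, j) t
    (dot (cfgq w j) (u t) *: (r *: delta_mx i 0) + X t *m du).
Proof.
apply: (dird_mul gd) => s; rewrite (cfgX_th gd); congr (_ + _).
by rewrite -scalemxAl scalerA.
Qed.

Lemma dird_XTu i j (u : T -> 'cV[R]_n) du : dird u (i, j) t du ->
  dird (fun t => (X t)^T *m u t) (i, j) t
    (u t i 0 *: (r *: cfgq w j) + (X t)^T *m du).
Proof.
rewrite -(dot_delta (u t) i); apply: (dird_mul gd (M := fun t => (X t)^T)) => s.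
rewrite (cfgX_th gd) [LHS]linearD; congr (_ + _).
by rewrite [LHS]linearZ /= trmx_mul trmxK -scalemxAl scalerA.
Qed.

Let diagE k (v : 'cV[R]_n) :
  (D *m v) k 0 = derive1 (dloss loss (y t k 0)) ((X t *m beta t) k 0) * v k 0.
Proof. by rewrite mul_diag_mx [LHS]mxE mxE. Qed.

(** [smt] supplies the derivative and [chain_rule_lipschitz] computes it, also at points where the
    second derivative of the loss does not exist and [Dhat] has a default entry. *)
Lemma dird_psi i j : dird psi (i, j) t (enorm (psi t) *: dpsi i j).
Proof.
move=> k; have hX := dird_Xu (dird_beta i j) k.
pose vv : 'cV[R]_n := dot (cfgq w j) (beta t) *: (r *: delta_mx i 0) + X t *m (enorm (psi t) *: dbeta i j).
set a : R := vv k 0; rewrite -/vv -/a in hX.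
have [L L0 hL] := cfg_line_lipschitz gd er (i, j) t (ltr0n R 2 : 0 < (2 : R)).
have chain : is_derive (0 : R) 1 (fun s => psi (th (i, j) s t) k 0)
    (derive1 (fun s => psi (th (i, j) s t) k 0) 0).
  by rewrite derive1E; apply: DeriveDef => //; exact: smt.
set c := derive1 _ 0 in chain.
have psE s : - psi (th (i, j) s t) k 0 =
    dloss loss (y t k 0) ((X (th (i, j) s t) *m beta (th (i, j) s t)) k 0).
  by rewrite /cfgbeta (gd_y gd) /cfgpsi psihatE /score mxE opprK (gd_y gd).
have hc : - c = derive1 (dloss loss (y t k 0)) ((X t *m beta t) k 0) * a.
  have := @chain_rule_lipschitz R (dloss loss (y t k 0))
    (fun s => (X (th (i, j) s t) *m beta (th (i, j) s t)) k 0) (- c) a 1 ltr01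
    (loss_lip (er_loss er) _).
  rewrite th0; apply; last first.
    rewrite (_ : _ \o _ = - (fun s => psi (th (i, j) s t) k 0)); first exact: is_deriveN.
    by apply/funext => s; rewrite /= -psE.
  move=> s s1; have -> : (fun s => (X (th (i, j) s t) *m beta (th (i, j) s t)) k 0) =
      (fun s => \sum_l X (th (i, j) s t) k l * beta (th (i, j) s t) l 0).
    by apply/funext => z; rewrite mxE.
  rewrite (_ : (fun s => \sum_l _) = \sum_l (fun s => X (th (i, j) s t) k l * beta (th (i, j) s t) l 0)); last first.
    by apply/funext => z; rewrite fct_sumE.
  apply: (big_ind (fun h : R -> R => {for s, continuous h})) => [|h1 h2 c1 c2|l _].
  - exact: cvg_cst.
  - exact: cvgD c1 c2.
  - apply: cvgM.
      have ent (M N : 'M[R]_(n, p)) c' : (M + c' *: N) k l = M k l + c' * N k l by rewrite !mxE.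
      have Xl z : X (th (i, j) z t) k l =
          X t k l + z * (r * ((delta_mx i 0 : 'cV[R]_n) *m (cfgq w j)^T) k l).
        by rewrite (cfgX_th gd) ent mulrA.
      rewrite (_ : (fun s => X (th (i, j) s t) k l) = (fun z =>
          X t k l + z * (r * ((delta_mx i 0 : 'cV[R]_n) *m (cfgq w j)^T) k l))); last first.
        by apply/funext => z; exact: Xl.
      rewrite Xl; apply: cvgD; first exact: cvg_cst.
      by apply: cvgM; [exact: cvg_id|exact: cvg_cst].
    apply/cvgrPdist_le => e e0; apply/nbhs_ballP; exists (Num.min 1 (e / L)) => /=.
      by rewrite lt_min ltr01 divr_gt0.
    move=> z; rewrite /ball /= lt_min => /andP[z1 z2].
    have zb : `|z| <= 2.
      by have := ler_normB s (s - z); rewrite opprB addrC subrK; lra.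
    have [h1 _] := hL s z (ltW (lt_trans s1 (ltr1n R 2 : _))) zb.
    apply: le_trans (_ : L * `|s - z| <= _); last by rewrite mulrC -ler_pdivlMr // ltW.
    apply: le_trans h1; have := enorm_coord (beta (th (i, j) s t) - beta (th (i, j) z t)) l.
    by rewrite !cB.
suff <- : c = (enorm (psi t) *: dpsi i j) k 0 by exact: chain.
rewrite -[c]opprK hc /a -diagE.
have -> : (enorm (psi t) *: dpsi i j) k 0 = - (- (enorm (psi t) *: dpsi i j)) k 0.
  by rewrite [X in - X]mxE opprK.
congr (- _); suff -> : D *m vv = - (enorm (psi t) *: dpsi i j) by [].
have -> : vv = enorm (psi t) *: (dot (cfgq w j) (theta t) *: (r *: delta_mx i 0) + X t *m dbeta i j).
  by rewrite /vv {1}(cfgbetaE gd er) dotZr -scalemxAr -scalerA -scalerDr.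
by rewrite -scalemxAr dirpsi_dirbeta scalerN.
Qed.

End DirectionalDerivatives.

#[local] Transparent betahat psihat.
#[local] Opaque cfgX cfgpsi cfgbeta enorm.

(** * Derivatives of the normalized vectors *)

Section DirectionalUnit.
Context {R : realType} {d : measure_display} {T : measurableType d}.
Variables (n p : nat) (mu : probability T R).
Variables (th : 'I_n * 'I_p -> R -> T -> T) (H : T -> 'M[R]_(n, p)).
Variables (zeta y : T -> 'cV[R]_n) (w : 'cV[R]_p) (K : T -> R) (tau : R).
Variables (loss : R -> R -> R) (g : 'cV[R]_p -> R) (gs : 'I_p -> R -> R).
Hypothesis gd : gaussian_design mu th H zeta y w K tau.
Hypothesis er : estimator_regular n loss g gs tau.

Let n0 := gd_n0 gd.
Let nR0 : 0 < n%:R :> R. Proof. by rewrite ltr0n. Qed.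
Let sn0 : 0 < Num.sqrt n%:R :> R. Proof. by rewrite sqrtr_gt0. Qed.
Let sn2 : Num.sqrt n%:R ^+ 2 = n%:R :> R. Proof. by rewrite sqr_sqrtr. Qed.
Let tau0 := er_tau0 er.
Local Notation X := (cfgX H zeta w).
Local Notation psi := (cfgpsi H zeta y w loss g).
Local Notation beta := (cfgbeta H zeta y w loss g).
Local Notation f := (cfgf H zeta y w loss g).
Local Notation theta := (cfgth H zeta y w loss g).
Local Notation Q := (wproj w).

Let th0 l t : th l 0 t = t.
Proof. exact: (gflow_0 (gfield_flow (gd_field gd) l)). Qed.
Local Notation dird := (dird th).
Variables (t : T) (A : 'M[R]_p).
Hypothesis smt : smooth_at th H zeta y w loss g t.
Hypothesis jac : jacobian_matrix loss g ((n%:R^-1)%:M) tau (y t) (X t) A.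
Local Notation D := (Dhat loss g (y t) (X t)).
Local Notation r := ((Num.sqrt n%:R)^-1).

Lemma dird_norm l dp z : enorm (psi t) = z -> psi t = z *: f t -> 0 < z ->
  dird psi l t (z *: dp) ->
  is_derive (0 : R) 1 (fun s => (enorm (psi (th l s t)))^-1) (- z^-1 * dot (f t) dp).
Proof.
move=> zE pE z0 hp.
have h1 : is_derive (0 : R) 1 (fun s => dot (psi (th l s t)) (psi (th l s t)))
    (2 * z ^+ 2 * dot (f t) dp).
  have -> : 2 * z ^+ 2 * dot (f t) dp =
     \sum_i ((z *: dp) i 0 * psi (th l 0 t) i 0 + psi (th l 0 t) i 0 * (z *: dp) i 0).
    rewrite mulr_sumr; apply: eq_bigr => i _; rewrite th0 pE.
    rewrite [(z *: dp) i 0]mxE [(z *: f t) i 0]mxE; ring.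
  by apply: is_derive_big => i; exact: is_derive_mul.
have dE : dot (psi t) (psi t) = z ^+ 2 by rewrite -enorm_sqr zE.
have h2 : is_derive (0 : R) 1 (fun s => enorm (psi (th l s t))) (z * dot (f t) dp).
  have pos : 0 < dot (psi (th l 0 t)) (psi (th l 0 t)) by rewrite th0 dE exprn_gt0.
  have hs := is_derive1_sqrt pos.
  have h := @is_derive1_comp R Num.sqrt (fun s => dot (psi (th l s t)) (psi (th l s t))) 0 _ _ hs h1.
  have E : z * dot (f t) dp = (2 * Num.sqrt (dot (psi (th l 0 t)) (psi (th l 0 t))))^-1 * (2 * z ^+ 2 * dot (f t) dp).
    rewrite th0 dE sqrtr_sqr (gtr0_norm z0); move: (dot (f t) dp) => c0; field; exact: lt0r_neq0.
  have F : (fun s => enorm (psi (th l s t))) = Num.sqrt \o (fun s => dot (psi (th l s t)) (psi (th l s t))).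
    by apply/funext => s; rewrite /= enormE.
  rewrite F E; exact: h.
have nz : enorm (psi (th l 0 t)) != 0 by rewrite th0 zE; exact: lt0r_neq0.
have h := @is_deriveV R (fun s => enorm (psi (th l s t))) 0 _ 1 nz h2.
have E : - z^-1 * dot (f t) dp = - (enorm (psi (th l 0 t))) ^- 2 *: (z * dot (f t) dp).
  rewrite th0 zE /GRing.scale /=; move: (dot (f t) dp) => c0; field; exact: lt0r_neq0.
rewrite E; exact: h.
Qed.

Lemma dird_unit m (u : T -> 'cV[R]_m) l dp du z : enorm (psi t) = z -> psi t = z *: f t -> 0 < z ->
  dird psi l t (z *: dp) -> dird u l t (z *: du) ->
  dird (fun t => (enorm (psi t))^-1 *: u t) l t (du - dot (f t) dp *: ((enorm (psi t))^-1 *: u t)).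
Proof.
move=> zE pE z0 hp hu k; have h1 := dird_norm zE pE z0 hp; have h2 := hu k.
have h3 := is_derive_mul h1 h2.
have E : (du - dot (f t) dp *: ((enorm (psi t))^-1 *: u t)) k 0 =
   - z^-1 * dot (f t) dp * u (th l 0 t) k 0 + (enorm (psi (th l 0 t)))^-1 * (z *: du) k 0.
  rewrite (th0 l t) zE; move: (f t) => ft; rewrite [(z *: du) k 0]mxE.
  have -> : (du - dot ft dp *: (z^-1 *: u t)) k 0 = du k 0 - dot ft dp * (z^-1 * u t k 0).
    by rewrite !mxE.
  move: (dot ft dp) (du k 0) (u t k 0) => c0 c1 c2; field; exact: lt0r_neq0.
have F : (fun s => ((enorm (psi (th l s t)))^-1 *: u (th l s t)) k 0) =
    (fun s => (enorm (psi (th l s t)))^-1 * u (th l s t) k 0) by apply/funext => s; rewrite mxE.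
rewrite F E; exact: h3.
Qed.

Lemma dird_f i j : dird f (i, j) t (dirf w r (f t) (theta t) A D (X t) i j).
Proof. exact: (dird_unit erefl (cfgpsiE gd er t) (enorm_cfgpsi_gt0 gd er t) (dird_psi gd er smt jac i j) (dird_psi gd er smt jac i j)). Qed.

Lemma dird_th i j : dird theta (i, j) t (dirth w r (f t) (theta t) A D (X t) i j).
Proof. exact: (dird_unit erefl (cfgpsiE gd er t) (enorm_cfgpsi_gt0 gd er t) (dird_psi gd er smt jac i j) (dird_beta gd er jac i j)). Qed.

End DirectionalUnit.

#[local] Transparent cfgX.
(** * The remainders R2 to R5 *)

#[local] Opaque cfgpsi cfgbeta cfgf cfgth betahat enorm.

Section ProductBounds.
Context {R : realType} {d : measure_display} {T : measurableType d}.
Variables (n p : nat) (mu : probability T R).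
Variables (th : 'I_n * 'I_p -> R -> T -> T) (H : T -> 'M[R]_(n, p)).
Variables (zeta y : T -> 'cV[R]_n) (w : 'cV[R]_p) (K : T -> R) (tau : R).
Variables (loss : R -> R -> R) (g : 'cV[R]_p -> R) (gs : 'I_p -> R -> R).
Hypothesis gd : gaussian_design mu th H zeta y w K tau.
Hypothesis er : estimator_regular n loss g gs tau.

Let n0 := gd_n0 gd.
Let nR0 : 0 < n%:R :> R. Proof. by rewrite ltr0n. Qed.
Let sn0 : 0 < Num.sqrt n%:R :> R. Proof. by rewrite sqrtr_gt0. Qed.
Let sn2 : Num.sqrt n%:R ^+ 2 = n%:R :> R. Proof. by rewrite sqr_sqrtr. Qed.
Let tau0 := er_tau0 er.
Local Notation X := (cfgX H zeta w).
Local Notation psi := (cfgpsi H zeta y w loss g).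
Local Notation beta := (cfgbeta H zeta y w loss g).
Local Notation f := (cfgf H zeta y w loss g).
Local Notation theta := (cfgth H zeta y w loss g).
Local Notation Q := (wproj w).

Let K0 t : 0 < K t. Proof. exact: (cfgK_gt0 gd). Qed.
Let K1 t : 1 <= K t. Proof. exact: (cfgK1 gd). Qed.
Let Kge0 t a : 0 <= K t ^+ a. Proof. by rewrite exprn_ge0 // ltW. Qed.
Let Kle t a b : (a <= b)%N -> K t ^+ a <= K t ^+ b. Proof. exact: (cfgK_le gd). Qed.
Local Notation r := ((Num.sqrt n%:R)^-1).
Local Notation sn := (Num.sqrt n%:R).

(** A calculus of exponents: products add them, and a sum costs one more power since [K] is at least
    2. *)
Definition sbound t (x : R) a : Prop := `|x| <= K t ^+ a.
Definition vbound t m (u : 'cV[R]_m) a : Prop := enorm u <= K t ^+ a.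
Definition mbound t m k (M : 'M[R]_(m, k)) a : Prop := forall u, enorm (M *m u) <= K t ^+ a * enorm u.

Lemma sbound_wk t x a b : (a <= b)%N -> sbound t x a -> sbound t x b.
Proof. by move=> ab h; apply: le_trans h _; exact: Kle. Qed.

Lemma sboundM t x z a b : sbound t x a -> sbound t z b -> sbound t (x * z) (a + b).
Proof. by move=> h1 h2; rewrite /sbound normrM exprD; apply: ler_pM. Qed.

Lemma sboundD t x z a b : sbound t x a -> sbound t z b -> sbound t (x + z) (maxn a b).+1.
Proof.
move=> h1 h2; apply: le_trans (ler_normD _ _) _.
have h3 : `|x| <= K t ^+ maxn a b by apply: le_trans h1 _; apply: Kle; exact: leq_maxl.
have h4 : `|z| <= K t ^+ maxn a b by apply: le_trans h2 _; apply: Kle; exact: leq_maxr.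
rewrite exprS; have := gd_K4 gd t; have := Kge0 t (maxn a b).
move: (K t) (K t ^+ _) h3 h4 => k c; nra.
Qed.

Lemma sboundN t x a : sbound t x a -> sbound t (- x) a.
Proof. by rewrite /sbound normrN. Qed.

Lemma sboundB t x z a b : sbound t x a -> sbound t z b -> sbound t (x - z) (maxn a b).+1.
Proof. by move=> h1 h2; apply: sboundD => //; exact: sboundN. Qed.

Lemma sbound1 t : sbound t 1 0.
Proof. by rewrite /sbound normr1. Qed.

Lemma sbound_dot t m (u v : 'cV[R]_m) a b : vbound t u a -> vbound t v b -> sbound t (dot u v) (a + b).
Proof.
move=> h1 h2; apply: le_trans (dot_le_enorm _ _) _.
by rewrite exprD; apply: ler_pM => //; exact: enorm_ge0.
Qed.

Lemma vbound_mul t m k (M : 'M[R]_(m, k)) u a b : mbound t M a -> vbound t u b -> vbound t (M *m u) (a + b).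
Proof.
move=> h1 h2; apply: le_trans (h1 u) _; rewrite exprD; exact: ler_wpM2l.
Qed.

Lemma mbound_mul t m k l (M : 'M[R]_(m, k)) (N : 'M[R]_(k, l)) a b :
  mbound t M a -> mbound t N b -> mbound t (M *m N) (a + b).
Proof.
move=> h1 h2 u; rewrite -mulmxA; apply: le_trans (h1 _) _.
by rewrite exprD -mulrA; apply: ler_wpM2l.
Qed.

Lemma sbound_mxtrace t m (M : 'M[R]_m) a : mbound t M a -> `|\tr M| <= m%:R * K t ^+ a.
Proof.
move=> h; apply: le_trans (ler_norm_sum _ _ _) _.
rewrite -[m in m%:R]card_ord mulr_natl -sumr_const; apply: ler_sum => i _.
have -> : M i i = dot (delta_mx i 0) (M *m delta_mx i 0) by rewrite dot_delta mulmx_delta.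
apply: le_trans (dot_le_enorm _ _) _; rewrite enorm_delta mul1r.
by apply: le_trans (h _) _; rewrite enorm_delta mulr1.
Qed.

Lemma vbound_w t : vbound t w 0.
Proof.
rewrite /vbound expr0; have -> : enorm w = 1; last exact: lexx.
by apply/eqP; rewrite -(@eqrXn2 _ 2) ?enorm_ge0 // enorm_sqr (gd_w gd) expr1n.
Qed.

Lemma vbound_f t : vbound t (f t) 0.
Proof. by rewrite /vbound (enorm_cfgf gd er) expr0. Qed.

Lemma vbound_th t : vbound t (theta t) 2.
Proof. exact: (enorm_cfgth gd er). Qed.

Lemma vbound_proj t (u : 'cV[R]_p) a : vbound t u a -> vbound t (Q *m u) a.
Proof. by move=> h; apply: le_trans (enorm_wproj gd _) h. Qed.

Lemma mbound_X t : mbound t (X t) 1.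
Proof. by move=> u; rewrite expr1; exact: (gd_KX gd). Qed.

Lemma mbound_XT t : mbound t (X t)^T 1.
Proof. by move=> u; rewrite expr1; exact: (cfgX_tr gd). Qed.

Lemma dot_cfgH_gen t u (v : 'cV[R]_p) : dot u (H t *m (Q *m v)) = sn * dot u (X t *m (Q *m v)).
Proof.
rewrite /cfgX /model_design -scalemxAl dotZr mulrA divff ?mul1r; last exact: lt0r_neq0.
rewrite mulmxDl -!mulmxA.
have -> : w^T *m (Q *m v) = 0.
  by rewrite mulmxA -[w^T *m _]trmxK trmx_mul trmxK (wproj_sym w) (wproj_w gd) trmx0 mul0mx.
by rewrite mulmx0 addr0 [Q *m (Q *m v)]mulmxA (wproj_idem gd).
Qed.

Section AtPoint.
Variables (t : T) (A : 'M[R]_p).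
Hypothesis jac : jacobian_matrix loss g ((n%:R^-1)%:M) tau (y t) (X t) A.
Local Notation D := (Dhat loss g (y t) (X t)).
Local Notation V := (Vhat loss g (y t) (X t) A).

(** For Sigma = I/n the bound on the Jacobian matrix reads |A| <= 1/tau, without n. *)
Lemma mbound_A : mbound t A 1.
Proof.
move=> u; rewrite expr1; have := jac_opnorm jac.
rewrite sqrtmx_scalar ?invr_gt0 // mul_scalar_mx mul_mx_scalar scalerA.
have -> : Num.sqrt n%:R^-1 * Num.sqrt n%:R^-1 = n%:R^-1 :> R.
  by rewrite -expr2 sqr_sqrtr // invr_ge0 ltW.
move=> h; have := le_opnorm (n%:R^-1 *: A) u.
rewrite -scalemxAl enormZ ger0_norm ?invr_ge0 ?ler0n // => h2.
have h3 : n%:R^-1 * enorm (A *m u) <= (n%:R * tau)^-1 * enorm u.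
  by apply: le_trans h2 _; rewrite ler_wpM2r ?enorm_ge0.
have h4 : enorm (A *m u) <= tau^-1 * enorm u.
  by move: h3; rewrite invfM -mulrA ler_pM2l // invr_gt0.
apply: le_trans h4 _; rewrite ler_wpM2r ?enorm_ge0 //; exact: (gd_Ktau gd).
Qed.

Lemma mbound_D : mbound t D 0.
Proof.
move=> u; rewrite mul1r -ler_sqr ?nnegrE ?enorm_ge0 // !enorm_sqr.
apply: ler_sum => i _; rewrite mul_diag_mx [(\matrix_(_, _) _) i 0]mxE [(\row_ _ _) 0 i]mxE.
have /andP[h0 h1] := derive1_derive1_01 (loss_convex (er_loss er) (y0 := y t i 0) I)
  (loss_derivable (er_loss er) (y0 := y t i 0) I) (loss_lip (er_loss er) (y t i 0))
  ((X t *m betahat loss g (y t) (X t)) i 0).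
move: (derive1 _ _) (u i 0) h0 h1 => a b a0 a1; rewrite -!expr2 exprMn ler_piMl ?sqr_ge0 //.
by rewrite expr_le1.
Qed.

Lemma mbound_B : mbound t (D *m X t *m A) 2.
Proof.
exact: (mbound_mul (mbound_mul mbound_D (mbound_X t)) mbound_A).
Qed.

Lemma mbound_V : mbound t V 4.
Proof.
move=> u; rewrite mulmxBl; apply: le_trans (enormB _ _) _.
have h1 := mbound_D u.
have h2 := mbound_mul (mbound_mul mbound_B (mbound_XT t)) mbound_D u.
apply: le_trans (lerD h1 h2) _; rewrite -mulrDl; apply: ler_wpM2r; first exact: enorm_ge0.
have h3 : K t ^+ 0 <= K t ^+ 3 by exact: Kle.
have : 2 * K t ^+ 3 <= K t ^+ 4 by apply: (cfgK_num gd) => //; lra.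
by rewrite /=; lra.
Qed.

Lemma vhat_bound : sbound t (vhat loss g (y t) (X t) A) 4.
Proof.
rewrite /sbound /vhat normrM ger0_norm ?invr_ge0 ?ler0n // ler_pdivrMl //.
exact: sbound_mxtrace mbound_V.
Qed.

Lemma dfhat_bound : sbound t (dfhat loss g (y t) (X t) A / n%:R) 3.
Proof.
rewrite /sbound /dfhat normrM [X in _ * X]ger0_norm ?invr_ge0 ?ler0n // ler_pdivrMr // mulrC.
apply: sbound_mxtrace.
exact: (mbound_mul (mbound_mul (mbound_mul (mbound_X t) mbound_A) (mbound_XT t)) mbound_D).
Qed.

Lemma trA_bound : sbound t (\tr A / n%:R) 2.
Proof.
rewrite /sbound normrM [X in _ * X]ger0_norm ?invr_ge0 ?ler0n // ler_pdivrMr //.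
apply: le_trans (sbound_mxtrace mbound_A) _; rewrite expr1 expr2 -mulrA [K t * n%:R]mulrC mulrA.
rewrite ler_wpM2r ?(ltW (K0 t)) //.
by have := gd_Kp gd t; rewrite ler_pdivrMr.
Qed.

End AtPoint.

(** Only |x| <= 1 + x^2 is used: [Xi] is a squared divergence with a bounded mean, so the mean of
    |R0| is of order 1/sqrt n. *)
Lemma remainder_bound t (x Xi R0 err : R) a : Xi = x ^+ 2 -> x = sn * R0 + r * err ->
  sbound t err a -> sn * `|R0| <= 1 + Xi + K t ^+ a.
Proof.
move=> -> xE he.
have n1 : 1 <= n%:R :> R by rewrite ler1n.
have s1 : 1 <= sn :> R by have := @ler_wsqrtr R _ _ n1; rewrite sqrtr1.
have r1 : (r : R) <= 1 by rewrite invf_le1.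
have r0 : 0 <= (r : R) by rewrite invr_ge0 ltW.
have -> : sn * `|R0| = `|x - r * err| by rewrite xE addrK normrM gtr0_norm.
apply: le_trans (ler_normB _ _) _; apply: lerD.
  have := sqr_ge0 (`|x| - 1); rewrite sqrrB1 real_normK ?num_real //.
  by have := normr_ge0 x; lra.
rewrite normrM (ger0_norm r0); apply: le_trans he; exact: ler_piMl.
Qed.


End ProductBounds.

#[local] Opaque cfgX cfgpsi cfgbeta cfgf cfgth betahat enorm.

(** * Remainders as divergences *)

Section Remainders.
Context {R : realType} {d : measure_display} {T : measurableType d}.
Variables (n p : nat) (mu : probability T R).
Variables (th : 'I_n * 'I_p -> R -> T -> T) (H : T -> 'M[R]_(n, p)).
Variables (zeta y : T -> 'cV[R]_n) (w : 'cV[R]_p) (K : T -> R) (tau : R).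
Variables (loss : R -> R -> R) (g : 'cV[R]_p -> R) (gs : 'I_p -> R -> R).
Hypothesis gd : gaussian_design mu th H zeta y w K tau.
Hypothesis er : estimator_regular n loss g gs tau.

Let n0 := gd_n0 gd.
Let nR0 : 0 < n%:R :> R. Proof. by rewrite ltr0n. Qed.
Let sn0 : 0 < Num.sqrt n%:R :> R. Proof. by rewrite sqrtr_gt0. Qed.
Let sn2 : Num.sqrt n%:R ^+ 2 = n%:R :> R. Proof. by rewrite sqr_sqrtr. Qed.
Let tau0 := er_tau0 er.
Local Notation X := (cfgX H zeta w).
Local Notation psi := (cfgpsi H zeta y w loss g).
Local Notation beta := (cfgbeta H zeta y w loss g).
Local Notation f := (cfgf H zeta y w loss g).
Local Notation theta := (cfgth H zeta y w loss g).
Local Notation Q := (wproj w).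

Local Notation r := ((Num.sqrt n%:R)^-1).
Local Notation sn := (Num.sqrt n%:R).
Local Notation sbound := (sbound K).
Local Notation vbound := (vbound K).
Local Notation mbound := (mbound K).

Variable cN : nat -> R.
Hypothesis EK : forall N, Ele mu (fun t => K t ^+ N) (cN N).
Local Notation smooth := (smooth_at th H zeta y w loss g).
Local Notation jacob t A := (jacobian_matrix loss g ((n%:R^-1)%:M) tau (y t) (X t) A).
Local Notation D t := (Dhat loss g (y t) (X t)).
Local Notation V t A := (Vhat loss g (y t) (X t) A).
Local Notation B t A := (D t *m X t *m A).
Local Notation tb t := (Q *m theta t).

Let rn : r * n%:R = sn :> R.
Proof.
by apply: (mulfI (lt0r_neq0 sn0)); rewrite mulrA mulfV ?lt0r_neq0 // mul1r -expr2 sn2.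
Qed.

Let scl x : sn * (x / n%:R) = r * x :> R.
Proof.
by apply: (mulIf (lt0r_neq0 nR0)); rewrite -mulrA mulfVK ?lt0r_neq0 // mulrAC rn.
Qed.

Let vr t A : r * \tr (V t A) = sn * vhat loss g (y t) (X t) A.
Proof.
rewrite /vhat mulrA; congr (_ * _); apply: (mulIf (lt0r_neq0 nR0)).
by rewrite mulfVK ?lt0r_neq0 // rn.
Qed.

Let dirs_f t A : smooth t -> jacob t A ->
  forall l, dirlim th f l t (dirf w r (f t) (theta t) A (D t) (X t) l.1 l.2).
Proof. by move=> st ja [i j]; apply: (dird_dirlim gd); exact (dird_f gd er st ja i j). Qed.

Let dirs_th t A : smooth t -> jacob t A ->
  forall l, dirlim th (fun t => tb t) l t (Q *m dirth w r (f t) (theta t) A (D t) (X t) l.1 l.2).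
Proof.
move=> st ja [i j]; apply: (dird_dirlim gd); apply: (dird_cstmul gd).
exact (dird_th gd er st ja i j).
Qed.

Let VE t A : D t - B t A *m (X t)^T *m D t = V t A. Proof. by []. Qed.

Let tbT t : Q *m tb t = tb t. Proof. by rewrite mulmxA (wproj_idem gd). Qed.

Let ff t : dot (f t) (f t) = 1. Proof. exact: dot_cfgf gd er t. Qed.

(** The design does not see H w, so the derivative part of the divergence vanishes: by [sum_dirf] it
    is a multiple of the inner product of Q theta and w. *)
Lemma index_noise : exists2 Xi, Ele mu Xi (steinc (cN 12) (cN 14)) &
  forall t A, smooth t -> jacob t A -> Xi t = dot (f t) (H t *m w) ^+ 2.
Proof.
have w1 : enorm w <= 1.
  have : enorm w ^+ 2 <= 1 by rewrite enorm_sqr (gd_w gd).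
  by rewrite expr_le1 ?enorm_ge0.
have [Xi EXi XiE] := stein_product gd EK (enlip_f gd er) (enlip_cst gd w1).
exists Xi => // t A st ja.
have d0 l : dirlim th (fun=> w) l t 0.
  by move=> i; under eq_fun do rewrite subrr mul0r; rewrite mxE; exact: cvg_cst.
rewrite (XiE t _ _ (dirs_f st ja) d0); congr (_ ^+ 2).
have -> : \sum_i \sum_j (dirf w r (f t) (theta t) A (D t) (X t) i j i 0 * w j 0 + f t i 0 * (0 : 'cV[R]_p) j 0) = 0.
  have c0 j : (0 : 'cV[R]_p) j 0 = 0 by rewrite mxE.
  under eq_bigr do under eq_bigr do rewrite c0 mulr0 addr0.
  rewrite (sum_dirf w r (theta t) (ff t)).
  have -> : dot (tb t) w = 0 by rewrite dot_wproj (wproj_w gd) dot0r.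
  by rewrite mulr0 mul0r.
by rewrite subr0.
Qed.

Let sb_th2 t : sbound t (dot (tb t) (tb t)) 4.
Proof. exact: sbound_dot (vbound_proj gd (vbound_th gd er t)) (vbound_proj gd (vbound_th gd er t)). Qed.

(* The names R2 -- R5 follow the order in which the remainders enter
   [that2_tstar_algebra]. *)
Lemma remainder_R2 : exists2 Xi, Ele mu Xi (steinc (cN 44) (cN 46)) &
  forall t A, smooth t -> jacob t A ->
  sn * `|dot (Q *m ((X t)^T *m f t)) (Q *m ((X t)^T *m f t)) +
         vhat loss g (y t) (X t) A * dot (f t) (X t *m tb t) -
         (p%:R / n%:R - dfhat loss g (y t) (X t) A / n%:R)| <= 1 + Xi t + K t ^+ 12.
Proof.
have [Xi EXi XiE] := stein_product gd EK (enlip_f gd er) (enlip_proj gd (enlip_XT gd (enlip_f gd er))).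
exists Xi => // t A st ja.
pose dv (l : 'I_n * 'I_p) : 'cV[R]_p := Q *m ((r * f t l.1 0) *: cfgq w l.2 +
  (X t)^T *m dirf w r (f t) (theta t) A (D t) (X t) l.1 l.2).
have hv l : dirlim th (fun t => Q *m ((X t)^T *m f t)) l t (dv l).
  case: l => i j; apply: (dird_dirlim gd); apply: (dird_cstmul gd).
  have := dird_XTu gd (dird_f gd er st ja i j).
  by rewrite scalerA [_ * r]mulrC.
have := XiE t _ _ (dirs_f st ja) hv.
under eq_bigr do rewrite big_split /=; rewrite big_split /=.
rewrite (sum_dirf w r (theta t) (ff t)) (sum_XT (gd_w gd) r (theta t) (ff t)).
(* The displayed scalar collects the terms of the divergence that carry a factor 1/sqrt n and are
   bounded by powers of [K]; the traces have gone into the remainder itself. *)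
rewrite (mxtrace_mul_wproj) => {}XiE; apply: (remainder_bound gd XiE) (_ : sbound t
   (1 + dot (tb t) ((X t)^T *m V t A *m f t) - dot w ((X t)^T *m B t A *m w) -
    (dot (tb t) ((X t)^T *m f t) * dot (f t) (V t A *m f t)) *+ 2 -
    dot (f t) (B t A *m Q *m ((X t)^T *m f t))) 12).
  rewrite (dot_cfgH_gen gd) !(VE t A).
  have -> : dot (f t) (X t *m (Q *m ((X t)^T *m f t))) =
      dot (Q *m ((X t)^T *m f t)) (Q *m ((X t)^T *m f t)).
    by rewrite [LHS]dot_mulmx [RHS]dot_wproj [in RHS]mulmxA (wproj_idem gd).
  have -> : dot (f t) (X t *m tb t) = dot (tb t) ((X t)^T *m f t) by rewrite dot_mulmx dotC.
  have -> : dot (tb t) (Q *m ((X t)^T *m f t)) = dot (tb t) ((X t)^T *m f t).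
    by rewrite -dot_wproj tbT.
  have -> : \tr ((X t)^T *m B t A) = dfhat loss g (y t) (X t) A.
    by rewrite /dfhat mxtrace_mulC -!mulmxA [LHS]mxtrace_mulC !mulmxA.
  move: (dot _ _) => N; move: (dot _ _) => M.
  have vr' := vr t A; move: (\tr _) (vhat _ _ _ _ _) vr' => tv v vr'.
  move: (dfhat _ _ _ _ _) (dot w _) (dot (tb t) _) (dot (f t) (B t A *m _ *m _)) (dot (f t) _) => df c b e a.
  have -> : sn * (N + v * M - (p%:R / n%:R - df / n%:R)) = sn * N + M * (r * tv) - r * (p%:R - df).
    rewrite vr' mulrBr [r * _]mulrBr -!scl; move: (n%:R^-1) (sn) => nn s; ring.
  move: (sn) (r) => sn' r'; ring.
have e1 : sbound t (dot (tb t) ((X t)^T *m V t A *m f t)) 7.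
  exact: sbound_dot (vbound_proj gd (vbound_th gd er t)) (vbound_mul gd (mbound_mul gd (mbound_XT gd t) (mbound_V gd er ja)) (vbound_f gd er t)).
have e2 : sbound t (dot w ((X t)^T *m B t A *m w)) 3.
  exact: sbound_dot (vbound_w gd t) (vbound_mul gd (mbound_mul gd (mbound_XT gd t) (mbound_B gd er ja)) (vbound_w gd t)).
have e3 : sbound t (dot (tb t) ((X t)^T *m f t) * dot (f t) (V t A *m f t)) 7.
  exact: sboundM (sbound_dot (vbound_proj gd (vbound_th gd er t)) (vbound_mul gd (mbound_XT gd t) (vbound_f gd er t)))
    (sbound_dot (vbound_f gd er t) (vbound_mul gd (mbound_V gd er ja) (vbound_f gd er t))).
have e4 : sbound t (dot (f t) (B t A *m Q *m ((X t)^T *m f t))) 3.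
  rewrite -[B t A *m Q *m _]mulmxA; apply: sbound_dot (vbound_f gd er t) (vbound_mul gd (mbound_B gd er ja) _).
  exact (vbound_proj gd (vbound_mul gd (mbound_XT gd t) (vbound_f gd er t))).
rewrite mulr2n.
apply: (sbound_wk gd _ (sboundB gd (sboundB gd (sboundB gd (sboundD gd (sbound1 K t) e1) e2) (sboundD gd e3 e3)) e4)).
by [].
Qed.

(** The field is the product of f and Q theta. The derivative of f produces the term in [vhat], that
    of theta the trace of A. *)
Lemma remainder_R3 : exists2 Xi, Ele mu Xi (steinc (cN 36) (cN 38)) &
  forall t A, smooth t -> jacob t A ->
  sn * `|dot (f t) (X t *m tb t) +
         vhat loss g (y t) (X t) A * dot (tb t) (tb t) - \tr A / n%:R| <= 1 + Xi t + K t ^+ 14.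
Proof.
have [Xi EXi XiE] := stein_product gd EK (enlip_f gd er) (enlip_proj gd (enlip_th gd er)).
exists Xi => // t A st ja.
have := XiE t _ _ (dirs_f st ja) (dirs_th st ja).
under eq_bigr do rewrite big_split /=; rewrite big_split /=.
rewrite (sum_dirf w r (theta t) (ff t)) (sum_dirth (gd_w gd)) ff.
rewrite mxtrace_mul_wproj => {}XiE; apply: (remainder_bound gd XiE) (_ : sbound t
   (dot w (A *m w) + dot (tb t) (A *m (X t)^T *m D t *m f t) -
    (dot (tb t) (tb t) * dot (f t) (V t A *m f t)) *+ 2 - dot (f t) (B t A *m tb t)) 14).
  rewrite (dot_cfgH_gen gd) !(VE t A).
  move: (dot (f t) (X t *m _)) => M.
  have vr' := vr t A; move: (\tr (V t A)) (vhat _ _ _ _ _) vr' => tv v vr'.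
  move: (\tr A) (dot (tb t) (tb t)) (dot (f t) (B t A *m _)) (dot w _) (dot (tb t) (A *m _ *m _ *m _)) (dot (f t) (V t A *m _)) => ta B2 e c b a.
  have -> : sn * (M + v * B2 - ta / n%:R) = sn * M + B2 * (r * tv) - r * ta.
    by rewrite vr' -scl; move: (n%:R^-1) (sn) => nn s; ring.
  move: (sn) (r) => sn' r'; ring.
have e1 : sbound t (dot w (A *m w)) 1.
  exact: sbound_dot (vbound_w gd t) (vbound_mul gd (mbound_A gd ja) (vbound_w gd t)).
have e2 : sbound t (dot (tb t) (A *m (X t)^T *m D t *m f t)) 4.
  exact: sbound_dot (vbound_proj gd (vbound_th gd er t)) (vbound_mul gd (mbound_mul gd (mbound_mul gd (mbound_A gd ja) (mbound_XT gd t)) (mbound_D H zeta y w K er t)) (vbound_f gd er t)).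
have e3 : sbound t (dot (tb t) (tb t) * dot (f t) (V t A *m f t)) 8.
  exact: sboundM (sb_th2 t) (sbound_dot (vbound_f gd er t) (vbound_mul gd (mbound_V gd er ja) (vbound_f gd er t))).
have e4 : sbound t (dot (f t) (B t A *m tb t)) 4.
  exact: sbound_dot (vbound_f gd er t) (vbound_mul gd (mbound_B gd er ja) (vbound_proj gd (vbound_th gd er t))).
rewrite mulr2n.
apply: (sbound_wk gd _ (sboundB gd (sboundB gd (sboundD gd e1 e2) (sboundD gd e3 e3)) e4)).
by [].
Qed.

(** The field is the product of X theta and Q theta. Shifting the design inside X theta contributes
    n |Q theta|^2, whence the 1 in the coefficient 1 - df/n. *)
Lemma remainder_R4 : exists2 Xi, Ele mu Xi (steinc (cN 80) (cN 82)) &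
  forall t A, smooth t -> jacob t A ->
  sn * `|dot (X t *m theta t) (X t *m tb t) - \tr A / n%:R * dot (f t) (X t *m theta t) -
         (1 - dfhat loss g (y t) (X t) A / n%:R) * dot (tb t) (tb t)| <= 1 + Xi t + K t ^+ 18.
Proof.
have [Xi EXi XiE] := stein_product gd EK (enlip_X gd (enlip_th gd er)) (enlip_proj gd (enlip_th gd er)).
exists Xi => // t A st ja.
pose du (l : 'I_n * 'I_p) : 'cV[R]_n := (r * tb t l.2 0) *: delta_mx l.1 0 +
  X t *m dirth w r (f t) (theta t) A (D t) (X t) l.1 l.2.
have hu l : dirlim th (fun t => X t *m theta t) l t (du l).
  case: l => i j; apply: (dird_dirlim gd).
  have := dird_Xu gd (dird_th gd er st ja i j).
  by rewrite scalerA [_ * r]mulrC dot_cfgq.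
have := XiE t _ _ hu (dirs_th st ja).
under eq_bigr do rewrite big_split /=; rewrite big_split /=.
rewrite (sum_X (gd_w gd)) (sum_dirth (gd_w gd)).
rewrite mxtrace_mul_wproj => {}XiE; apply: (remainder_bound gd XiE) (_ : sbound t
   (dot (f t) (X t *m theta t) * dot w (A *m w) + dot (tb t) (A *m (X t)^T *m D t *m (X t *m theta t)) -
    (dot (tb t) (tb t) * dot (f t) (V t A *m (X t *m theta t))) *+ 2 -
    (dot (f t) (X t *m theta t) * dot (f t) (B t A *m tb t)) *+ 2 -
    dot (f t) (X t *m A *m tb t)) 18).
  rewrite (dot_cfgH_gen gd) !(VE t A) -/(dfhat loss g (y t) (X t) A).
  move: (dot (X t *m theta t) _) => M.
  move: (dfhat _ _ _ _ _) (\tr A) (dot (tb t) (A *m _ *m _ *m _)) (dot (tb t) (tb t)) (dot w _)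
    (dot (f t) (X t *m theta t)) (dot (f t) (X t *m A *m _)) (dot (f t) (B t A *m _)) (dot (f t) (V t A *m _)) => df ta b B2 c Mf h e a.
  have -> : sn * (M - ta / n%:R * Mf - (1 - df / n%:R) * B2) = sn * M - r * (ta * Mf) - r * (n%:R - df) * B2.
    rewrite [r * (_ - _)]mulrBr rn -!scl; move: (n%:R^-1) (sn) => nn s; ring.
  move: (n%:R : R) (sn) (r) => n' sn' r'; ring.
have vX : vbound t (X t *m theta t) 3 by exact (vbound_mul gd (mbound_X gd t) (vbound_th gd er t)).
have e0 : sbound t (dot (f t) (X t *m theta t)) 3 by exact: sbound_dot (vbound_f gd er t) vX.
have e1 : sbound t (dot w (A *m w)) 1.
  exact: sbound_dot (vbound_w gd t) (vbound_mul gd (mbound_A gd ja) (vbound_w gd t)).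
have e2 : sbound t (dot (tb t) (A *m (X t)^T *m D t *m (X t *m theta t))) 7.
  exact: sbound_dot (vbound_proj gd (vbound_th gd er t)) (vbound_mul gd (mbound_mul gd (mbound_mul gd (mbound_A gd ja) (mbound_XT gd t)) (mbound_D H zeta y w K er t)) vX).
have e3 : sbound t (dot (tb t) (tb t) * dot (f t) (V t A *m (X t *m theta t))) 11.
  exact: sboundM (sb_th2 t) (sbound_dot (vbound_f gd er t) (vbound_mul gd (mbound_V gd er ja) vX)).
have e4 : sbound t (dot (f t) (B t A *m tb t)) 4.
  exact: sbound_dot (vbound_f gd er t) (vbound_mul gd (mbound_B gd er ja) (vbound_proj gd (vbound_th gd er t))).
have e5 : sbound t (dot (f t) (X t *m A *m tb t)) 4.
  exact: sbound_dot (vbound_f gd er t) (vbound_mul gd (mbound_mul gd (mbound_X gd t) (mbound_A gd ja)) (vbound_proj gd (vbound_th gd er t))).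
rewrite !mulr2n.
apply: (sbound_wk gd _ (sboundB gd (sboundB gd (sboundB gd (sboundD gd (sboundM e0 e1) e2) (sboundD gd e3 e3))
  (sboundD gd (sboundM e0 e4) (sboundM e0 e4))) e5)).
by [].
Qed.

(** The field is the product of X w and Q theta, whose first factor is constant along the shifts. *)
Lemma remainder_R5 : exists2 Xi, Ele mu Xi (steinc (cN 26) (cN 28)) &
  forall t A, smooth t -> jacob t A ->
  sn * `|dot (X t *m w) (X t *m tb t) - \tr A / n%:R * dot (f t) (X t *m w)| <= 1 + Xi t + K t ^+ 16.
Proof.
have [Xi EXi XiE] := stein_product gd EK (enlip_phi gd) (enlip_proj gd (enlip_th gd er)).
exists Xi => // t A st ja.
have d0 l : dirlim th (fun t => X t *m w) l t 0.
  move=> i; have E s : X (th l s t) *m w = X t *m w by rewrite !(cfgX_w gd) (gd_zeta gd).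
  by under eq_fun do rewrite E subrr mul0r; rewrite mxE; exact: cvg_cst.
have c0 i : (0 : 'cV[R]_n) i 0 = 0 by rewrite mxE.
have := XiE t _ _ d0 (dirs_th st ja).
under eq_bigr do under eq_bigr do rewrite [X in X * _]mxE mul0r add0r.
rewrite (sum_dirth (gd_w gd)).
rewrite mxtrace_mul_wproj => {}XiE; apply: (remainder_bound gd XiE) (_ : sbound t
   (dot (f t) (X t *m w) * dot w (A *m w) + dot (tb t) (A *m (X t)^T *m D t *m (X t *m w)) -
    dot (tb t) (tb t) * dot (f t) (V t A *m (X t *m w)) -
    dot (f t) (X t *m w) * dot (f t) (B t A *m tb t)) 16).
  rewrite (dot_cfgH_gen gd) !(VE t A).
  move: (dot (X t *m w) _) => M.
  move: (\tr A) (dot (tb t) (A *m _ *m _ *m _)) (dot (tb t) (tb t)) (dot w _)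
    (dot (f t) (X t *m w)) (dot (f t) (B t A *m _)) (dot (f t) (V t A *m _)) => ta b B2 c Mf e a.
  have -> : sn * (M - ta / n%:R * Mf) = sn * M - r * (ta * Mf).
    by rewrite -scl; move: (n%:R^-1) (sn) => nn s; ring.
  move: (sn) (r) => sn' r'; ring.
have vX : vbound t (X t *m w) 1 by exact (vbound_mul gd (mbound_X gd t) (vbound_w gd t)).
have e0 : sbound t (dot (f t) (X t *m w)) 1 by exact: sbound_dot (vbound_f gd er t) vX.
have e1 : sbound t (dot w (A *m w)) 1.
  exact: sbound_dot (vbound_w gd t) (vbound_mul gd (mbound_A gd ja) (vbound_w gd t)).
have e2 : sbound t (dot (tb t) (A *m (X t)^T *m D t *m (X t *m w))) 5.
  exact: sbound_dot (vbound_proj gd (vbound_th gd er t)) (vbound_mul gd (mbound_mul gd (mbound_mul gd (mbound_A gd ja) (mbound_XT gd t)) (mbound_D H zeta y w K er t)) vX).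
have e3 : sbound t (dot (tb t) (tb t) * dot (f t) (V t A *m (X t *m w))) 9.
  exact: sboundM (sb_th2 t) (sbound_dot (vbound_f gd er t) (vbound_mul gd (mbound_V gd er ja) vX)).
have e4 : sbound t (dot (f t) (B t A *m tb t)) 4.
  exact: sbound_dot (vbound_f gd er t) (vbound_mul gd (mbound_B gd er ja) (vbound_proj gd (vbound_th gd er t))).
apply: (sbound_wk gd _ (sboundB gd (sboundB gd (sboundD gd (sboundM e0 e1) e2) e3) (sboundM e0 e4))).
by [].
Qed.

End Remainders.

#[local] Transparent cfgpsi cfgbeta enorm cfgf cfgth betahat cfgX.
(** * Leave-one-column-out noise *)

Section Moments.
Context {R : realType} {d : measure_display} {T : measurableType d}.
Variable mu : probability T R.

(** Fourth power of z/4 <= exp(z/4). *)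
Lemma quartic_le_expR (z : R) : z ^+ 4 <= 256 * (expR z + expR (- z)).
Proof.
have pos (x : R) : 0 <= x -> x ^+ 4 <= 256 * expR x.
  move=> x0; have h : x / 4 <= expR (x / 4) by apply: le_trans (expR_ge1Dx _); lra.
  have -> : expR x = expR (x / 4) ^+ 4 by rewrite -expRM_natl; congr expR; field.
  have -> : x ^+ 4 = 256 * (x / 4) ^+ 4 by field.
  apply: ler_wpM2l; first exact: ler0n.
  have x4 : 0 <= x / 4 by lra.
  by rewrite lerXn2r ?nnegrE // expR_ge0.
have e1 := expR_ge0 z; have e2 := expR_ge0 (- z).
have [z0|z0] := leP 0 z; first by have := pos z z0; lra.
have := pos (- z); rewrite exprNn -signr_odd /= expr0 mul1r => /(_ _) h.
by have := h ltac:(lra); lra.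
Qed.

(** 256 times the two exponential moments exp(1/2) of a standard normal variable; a bound for its
    fourth moment. *)
Definition gaussc : R := 512 * expR 2^-1.

Lemma gaussc_ge0 : 0 <= gaussc. Proof. by apply: mulr_ge0; [exact: ler0n|exact: expR_ge0]. Qed.

Section Flow.
Variables (tau : R -> T -> T) (Z : T -> R).
Hypothesis flow : gflow mu tau Z.

Lemma gflow_exp (u : T -> R) (c s : R) : (forall t, u (tau s t) = u t) -> Ele mu u c ->
  Ele mu (fun t => u t * expR (s * Z t)) (expR (s ^+ 2 / 2) * c).
Proof.
move=> uinv [mf f0 fc].
have mE : measurable_fun setT (fun t => u t * expR (s * Z t)).
  apply: measurable_funM => //; apply: measurableT_comp => //.
  by apply: measurable_funM => //; exact: (gflow_measZ flow).
split => // [t|]; first by rewrite mulr_ge0 // expR_ge0.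
have mF : measurable_fun setT (fun t => (u t)%:E : \bar R) by exact/measurable_EFinP.
have := gflow_CM flow s mF (fun t => f0 t : (0 <= (u t)%:E)%E).
under eq_integral do rewrite uinv.
move=> E; rewrite (eq_integral (fun t => ((expR (s ^+ 2 / 2))%:E * ((u t)%:E * (expR (s * Z t - s ^+ 2 / 2))%:E))%E)); last first.
  by move=> t _; rewrite -!EFinM; congr EFin; rewrite mulrCA -expRD; congr (_ * expR _); lra.
rewrite ge0_integralZl //; last 2 first.
- apply: emeasurable_funM => //; apply/measurable_EFinP; apply: measurableT_comp => //.
  apply: measurable_funB => //; apply: measurable_funM => //; exact: (gflow_measZ flow).
- by move=> t _; rewrite mule_ge0 // lee_fin ?expR_ge0.
by rewrite -E EFinM lee_wpmul2l // lee_fin expR_ge0.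
Qed.

(** A weight that is constant along the flow acts like a factor independent of [Z]: the exponential
    tilts at s = 1 and s = -1 leave it unchanged. *)
Lemma gflow_moment (u : T -> R) (c : R) : (forall s t, u (tau s t) = u t) -> Ele mu u c ->
  Ele mu (fun t => u t * Z t ^+ 4) (gaussc * c).
Proof.
move=> uinv uc; have [mf f0 _] := uc.
have h1 := gflow_exp (uinv 1) uc; have h2 := gflow_exp (uinv (-1)) uc.
have := EleZ (ler0n R 256) (EleD h1 h2).
rewrite expr1n sqrrN expr1n div1r => h.
apply: (@Ele_wk _ _ _ _ _ _ _ _ (Ele_le _ _ h)).
- by rewrite /gaussc; lra.
- apply: measurable_funM => //; apply: measurable_funX; exact: (gflow_measZ flow).
- move=> t; rewrite mul1r mulN1r -mulrDr mulr_ge0 ?exprn_even_ge0 //=.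
  by have := ler_wpM2l (f0 t) (quartic_le_expR (Z t)); lra.
Qed.

Lemma gflow_moment2 (u : T -> R) (c : R) : (forall s t, u (tau s t) = u t) -> Ele mu u c ->
  Ele mu (fun t => u t * Z t ^+ 2) (c + gaussc * c).
Proof.
move=> uinv uc; have [mf f0 _] := uc.
apply: Ele_le (EleD uc (gflow_moment uinv uc)).
  by apply: measurable_funM => //; apply: measurable_funX; exact: (gflow_measZ flow).
move=> t; rewrite mulr_ge0 ?sqr_ge0 //= -{2}[u t]mulr1 -mulrDr ler_wpM2l //.
by have := sqr_ge0 (Z t ^+ 2 - 2^-1); 
have -> : Z t ^+ 4 = (Z t ^+ 2) ^+ 2; [by rewrite -exprM|nra].
Qed.

End Flow.

(** The constants are the expectations themselves, real numbers because their sum is finite. It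
    serves when only a total over entries is controlled. *)
Lemma Ele_split (J : finType) (f : J -> T -> R) (C : R) :
  (forall k, measurable_fun setT (f k)) -> (forall k t, 0 <= f k t) ->
  Ele mu (fun t => \sum_k f k t) C ->
  exists2 c : J -> R, forall k, Ele mu (f k) (c k) & \sum_k c k <= C.
Proof.
move=> mf f0 [mS S0 SC].
have I0 k : (0 <= \int[mu]_t (f k t)%:E)%E by apply: integral_ge0 => t _; rewrite lee_fin.
have SE : (\int[mu]_t (\sum_k f k t)%:E = \sum_k \int[mu]_t (f k t)%:E)%E.
  under eq_integral do rewrite -sumEFin.
  rewrite ge0_integral_sum //; first by move=> k; exact/measurable_EFinP.
  by move=> k t _; rewrite lee_fin.
have Ifin k : (\int[mu]_t (f k t)%:E \is a fin_num)%E.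
  rewrite ge0_fin_numE //; apply: le_lt_trans (ltry C); apply: le_trans SC.
  by rewrite SE (bigD1 k) //= leeDl // sume_ge0.
exists (fun k => fine (\int[mu]_t (f k t)%:E)%E).
  by move=> k; split => //; rewrite fineK.
rewrite -lee_fin; apply: le_trans SC; rewrite SE -sumEFin.
by rewrite le_eqVlt; apply/orP; left; apply/eqP; apply: eq_bigr => k _; rewrite fineK.
Qed.

End Moments.

(** * Removing a column *)

Section Columns.
Context {R : realType} {d : measure_display} {T : measurableType d}.
Variables (n p : nat) (mu : probability T R).
Variables (th : 'I_n * 'I_p -> R -> T -> T) (H : 'I_n * 'I_p -> T -> R).
Hypothesis field : gfield mu th H.

Definition column (j : 'I_p) : seq ('I_n * 'I_p) := [seq (i, j) | i <- index_enum 'I_n].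

Lemma column_uniq j : uniq (column j).
Proof. by rewrite map_inj_uniq ?index_enum_uniq // => i k []. Qed.

Lemma mem_column j k : (k \in column j) = (k.2 == j).
Proof.
apply/mapP/eqP => [[i _ ->] //|<-]; exists k.1; first exact: mem_index_enum.
by case: k.
Qed.

Lemma sum_column j (F : 'I_n * 'I_p -> R) : \sum_(k <- column j) F k = \sum_i F (i, j).
Proof. by rewrite big_map. Qed.

Lemma shiftv_ext (r : seq ('I_n * 'I_p)) u v t : {in r, u =1 v} -> shiftv th r u t = shiftv th r v t.
Proof.
elim: r => //= k r IH uv; rewrite uv ?mem_head // IH // => l lr.
by apply: uv; rewrite in_cons lr orbT.
Qed.

Lemma shiftv_delta (r : seq ('I_n * 'I_p)) k s t : k \in r -> uniq r ->
  shiftv th r (fun l => (l == k)%:R * s) t = th k s t.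
Proof.
have th0 (r' : seq ('I_n * 'I_p)) : k \notin r' -> shiftv th r' (fun l => (l == k)%:R * s) t = t.
  elim: r' => //= l r' IH; rewrite in_cons negb_or => /andP[kl kr].
  by rewrite eq_sym (negbTE kl) mul0r IH // (gflow_0 (gfield_flow field l)).
elim: r => //= l r IH; rewrite in_cons => /orP[/eqP <-|kr] /andP[lr ur].
  by rewrite th0 // eqxx mul1r.
have lk : l != k by apply: contraNneq lr => ->.
by rewrite (negbTE lk) mul0r IH // (gflow_0 (gfield_flow field l)).
Qed.

(** Built from shifts, so that invariance in column j and equivariance in the other columns follow
    from the identities of the field. *)
Definition zeroed j t : T := shiftv th (column j) (fun k => - H k t) t.

Lemma zeroed_H j t k : H k (zeroed j t) = (k.2 != j)%:R * H k t.
Proof.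
rewrite (shiftv_H field) ?column_uniq // mem_column.
by case: eqP => _ /=; rewrite ?mul0r ?mul1r ?addr0 ?subrr.
Qed.

Lemma zeroed_in j i s t : zeroed j (th (i, j) s t) = zeroed j t.
Proof.
have jc : (i, j) \in column j by rewrite mem_column.
rewrite /zeroed -(shiftv_delta s t jc (column_uniq j)) (shiftv_add field).
apply: shiftv_ext => k _; rewrite (shiftv_delta s t jc (column_uniq j)) (gfield_H field).
by rewrite opprD subrK.
Qed.

Lemma zeroed_out j k s t : k.2 != j -> zeroed j (th k s t) = th k s (zeroed j t).
Proof.
move=> kj; rewrite /zeroed (shiftv_th field); congr (th k s _).
apply: shiftv_ext => l; rewrite mem_column (gfield_H field) => /eqP lj.
have lk : l != k by apply: contraNneq kj => <-; rewrite lj.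
by rewrite (negbTE lk) mul0r addr0.
Qed.

Lemma zeroed_inv (X : Type) (h : T -> X) j t : (forall k s t, h (th k s t) = h t) ->
  h (zeroed j t) = h t.
Proof. by move=> hi; apply: shiftv_inv => k s t' _. Qed.

Lemma measurable_zeroed j : measurable_fun setT (zeroed j).
Proof.
apply: (@measurable_shiftv _ _ _ _ _ _ _ field _ _ (column j) (fun k t => - H k t)) => // k.
by apply: measurableT_comp => //; exact: (gflow_measZ (gfield_flow field k)).
Qed.

Lemma column_flow j (u : T -> 'cV[R]_n) : (forall i, measurable_fun setT (fun t => u t i 0)) ->
  (forall i s t, u (th (i, j) s t) = u t) -> (forall t, dot (u t) (u t) = 1) ->
  gflow mu (fun s t => shiftv th (column j) (fun k => s * u t k.1 0) t)
           (fun t => \sum_i u t i 0 * H (i, j) t).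
Proof.
move=> mu' uinv u1.
have -> : (fun t => \sum_i u t i 0 * H (i, j) t) = (fun t => \sum_(k <- column j) u t k.1 0 * H k t).
  by apply/funext => t; rewrite sum_column.
apply: (gfield_direction field) => //; first exact: column_uniq.
- by move=> [i j'] l s t; rewrite mem_column /= => /eqP ->; rewrite uinv.
- by move=> t; rewrite sum_column -[RHS](u1 t) /dot; apply: eq_bigr => i _; rewrite expr2.
Qed.

Lemma column_moment j (u : T -> 'cV[R]_n) (c : R) : (0 < n)%N ->
  (forall i, measurable_fun setT (fun t => u t i 0)) ->
  (forall i s t, u (th (i, j) s t) = u t) ->
  Ele mu (fun t => enorm (u t) ^+ 2) c ->
  Ele mu (fun t => (\sum_i u t i 0 * H (i, j) t) ^+ 2) (c + gaussc * c).
Proof.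
move=> n0 mu' uinv uc.
have mH k : measurable_fun setT (H k) := gflow_measZ (gfield_flow field k).
(* Where [u] vanishes a fixed unit vector is used, so that the direction has norm 1 everywhere. *)
pose e t : 'cV[R]_n := if enorm (u t) == 0 then delta_mx (Ordinal n0) 0 else (enorm (u t))^-1 *: u t.
have me i : measurable_fun setT (fun t => e t i 0).
  have -> : (fun t => e t i 0) = (fun t => if enorm (u t) == 0 then (delta_mx (Ordinal n0) 0 : 'cV[R]_n) i 0
      else (enorm (u t))^-1 * u t i 0).
    by apply/funext => t; rewrite /e; case: ifP => // _; rewrite mxE.
  have mE := measurable_enorm mu'.
  apply: measurable_fun_ifT => //; first by apply: (measurable_fun_eqr mE) => //; exact: measurable_cst.
  apply: measurable_funM => //; under eq_fun do rewrite -powR_inv1 ?enorm_ge0 //.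
  exact: (measurableT_comp (measurable_powR _)).
have einv i s t : e (th (i, j) s t) = e t by rewrite /e uinv.
have e1 t : dot (e t) (e t) = 1.
  rewrite /e; case: eqP => [_|/eqP u0]; first by rewrite dot_delta mxE !eqxx.
  by rewrite dotZl dotZr -enorm_sqr; field.
have := gflow_moment2 (column_flow me einv e1) (u := fun t => enorm (u t) ^+ 2) _ uc.
have uE t : u t = enorm (u t) *: e t.
  rewrite /e; case: eqP => [u0|/eqP u0]; last by rewrite scalerA divff // scale1r.
  by rewrite u0 scale0r; apply/eqP; rewrite -enorm_eq0 u0.
move=> h; apply: Ele_le (h _).
- by apply: measurable_funX; apply: measurable_sum => i; exact: measurable_funM.
- move=> t; rewrite sqr_ge0 /= -exprMn mulr_sumr le_eqVlt; apply/orP; left.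
  by apply/eqP; congr (_ ^+ 2); apply: eq_bigr => i _; rewrite {1}uE mxE mulrA.
- move=> s t; congr (enorm _ ^+ 2); apply: shiftv_inv => -[i j'] s' t'.
  by rewrite mem_column /= => /eqP ->; exact: uinv.
Qed.

End Columns.

#[local] Opaque cfgpsi cfgbeta cfgf cfgth betahat enorm zeroed column shiftv.

(** * The design without one column *)

Section LeaveOneOut.
Context {R : realType} {d : measure_display} {T : measurableType d}.
Variables (n p : nat) (mu : probability T R).
Variables (th : 'I_n * 'I_p -> R -> T -> T) (H : T -> 'M[R]_(n, p)).
Variables (zeta y : T -> 'cV[R]_n) (w : 'cV[R]_p) (K : T -> R) (tau : R).
Variables (loss : R -> R -> R) (g : 'cV[R]_p -> R) (gs : 'I_p -> R -> R).
Hypothesis gd : gaussian_design mu th H zeta y w K tau.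
Hypothesis er : estimator_regular n loss g gs tau.

Let n0 := gd_n0 gd.
Let nR0 : 0 < n%:R :> R. Proof. by rewrite ltr0n. Qed.
Let sn0 : 0 < Num.sqrt n%:R :> R. Proof. by rewrite sqrtr_gt0. Qed.
Let sn2 : Num.sqrt n%:R ^+ 2 = n%:R :> R. Proof. by rewrite sqr_sqrtr. Qed.
Local Notation X := (cfgX H zeta w).
Local Notation f := (cfgf H zeta y w loss g).
Local Notation theta := (cfgth H zeta y w loss g).
Local Notation Q := (wproj w).
Local Notation r := ((Num.sqrt n%:R)^-1).
Local Notation sn := (Num.sqrt n%:R).

Let K0 t : 0 < K t. Proof. exact: (cfgK_gt0 gd). Qed.
Let K1 t : 1 <= K t. Proof. exact: (cfgK1 gd). Qed.
Let Kge0 t a : 0 <= K t ^+ a. Proof. by rewrite exprn_ge0 // ltW. Qed.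
Let Kle t a b : (a <= b)%N -> K t ^+ a <= K t ^+ b. Proof. exact: (cfgK_le gd). Qed.

Definition Hentry (k : 'I_n * 'I_p) t : R := H t k.1 k.2.
Local Notation zr := (zeroed th Hentry).
Let field : gfield mu th Hentry := gd_field gd.
Definition Hcol j t : 'cV[R]_n := col j (H t).
(* The noise variable of coordinate j: the entries of column j of H projected on
   the direction computed without that column. *)
Definition noise j t : R := dot (f (zr j t)) (Hcol j t).

Let HcolE j t i : Hcol j t i 0 = H t i j. Proof. by rewrite mxE. Qed.

Lemma zeroed_design j t : X t = X (zr j t) + (1 / sn) *: (Hcol j t *m (cfgq w j)^T).
Proof.
have zz : zeta (zr j t) = zeta t by apply: zeroed_inv; exact: (gd_zeta gd).
rewrite /cfgX zz -design_shift; congr (model_design _ _ _).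
apply/matrixP => i l; have := zeroed_H field j t (i, l); rewrite /Hentry /= => hz.
rewrite [RHS]mxE hz scale1r [(_ *m _) i l]mxE big_ord1 HcolE [_^T 0 l]mxE [delta_mx _ _ _ _]mxE.
by case: eqVneq => [->|lj] /=; rewrite ?mul0r ?mul1r ?add0r ?mulr1 ?mulr0 ?addr0.
Qed.

#[local] Opaque cfgX.

Lemma enorm_Hcol j t : enorm (Hcol j t) <= sn * K t.
Proof.
rewrite /Hcol colE; apply: le_trans (gd_KH gd t _) _.
by rewrite enorm_delta mulr1.
Qed.

Let enormB_sum m (u v : 'cV[R]_m) : enorm (u - v) ^+ 2 = \sum_i (u i 0 - v i 0) ^+ 2.
Proof. by rewrite enorm_sqr; apply: eq_bigr => i _; rewrite [(u - v) i 0]mxE [(- v) i 0]mxE expr2. Qed.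

Let zy j t : y (zr j t) = y t.
Proof. by apply: zeroed_inv; exact: (gd_y gd). Qed.

Let rh j t : enorm ((1 / sn : R) *: Hcol j t) <= K t.
Proof.
rewrite enormZ ger0_norm ?divr_ge0 ?ler01 ?(ltW sn0) // div1r ler_pdivrMl //.
exact: enorm_Hcol.
Qed.

(** Removing the column is a rank-one change of norm at most [K t], so that the zeroed design is
    again controlled by [K t]. *)
Lemma zeroed_X j t u : enorm (X (zr j t) *m u) <= 2 * K t * enorm u.
Proof.
have -> : X (zr j t) *m u = X t *m u - dot (cfgq w j) u *: ((1 / sn) *: Hcol j t).
  have -> : X t *m u = (X (zr j t) + (1 / sn) *: (Hcol j t *m (cfgq w j)^T)) *m u.
    by rewrite -(zeroed_design j t).
  have E : ((1 / sn) *: (Hcol j t *m (cfgq w j)^T)) *m u = dot (cfgq w j) u *: ((1 / sn) *: Hcol j t).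
    rewrite -scalemxAl -mulmxA; have -> : (cfgq w j)^T *m u = (dot (cfgq w j) u)%:M.
      by apply/matrixP => a b; rewrite !ord1 dotE !mxE.
    by rewrite mul_mx_scalar !scalerA mulrC.
  by rewrite mulmxDl E addrK.
apply: le_trans (enormB _ _) _.
have -> : 2 * K t * enorm u = K t * enorm u + enorm u * K t by ring.
apply: lerD; first exact: (gd_KX gd).
rewrite enormZ; apply: ler_pM => //; first exact: enorm_ge0.
apply: le_trans (dot_le_enorm _ _) _.
by rewrite ler_piMl ?enorm_ge0 // (enorm_cfgq gd).
Qed.

Lemma zeroed_XT j t v : enorm ((X (zr j t))^T *m v) <= 2 * K t * enorm v.
Proof.
have -> : (X (zr j t))^T *m v = (X t)^T *m v - dot ((1 / sn) *: Hcol j t) v *: cfgq w j.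
  have -> : (X t)^T = (X (zr j t))^T + (1 / sn) *: (cfgq w j *m (Hcol j t)^T).
    rewrite [in LHS](zeroed_design j t) [LHS]linearD [X in _ + X = _]linearZ /=.
    by congr (_ + _ *: _); rewrite trmx_mul trmxK.
  rewrite mulmxDl -scalemxAl -mulmxA.
  have -> : (Hcol j t)^T *m v = (dot (Hcol j t) v)%:M.
    by apply/matrixP => a b; rewrite !ord1 dotE !mxE.
  by rewrite mul_mx_scalar scalerA dotZl addrK.
apply: le_trans (enormB _ _) _.
have -> : 2 * K t * enorm v = K t * enorm v + K t * enorm v * 1 by ring.
apply: lerD; first exact: (cfgX_tr gd).
rewrite enormZ; apply: ler_pM => //; first exact: enorm_ge0.
  apply: le_trans (dot_le_enorm _ _) _; apply: ler_wpM2r; first exact: enorm_ge0.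
  exact: rh.
exact: (enorm_cfgq gd).
Qed.

Lemma zeroed_th j t : enorm (theta (zr j t)) <= K t ^+ 3.
Proof.
apply: le_trans (enorm_cfgth_X gd er _) _; apply: le_trans (div_tau gd t (enorm_ge0 _)) _.
have := zeroed_XT j t (f (zr j t)); rewrite (enorm_cfgf gd er) mulr1 => h.
apply: (@le_trans _ _ (2 * K t ^+ 2)); last by apply: (cfgK_num gd) => //; lra.
by rewrite expr2 mulrA ler_wpM2r // ltW.
Qed.

Let w1 : enorm w = 1.
Proof. by apply/eqP; rewrite -(@eqrXn2 _ 2) ?enorm_ge0 // enorm_sqr (gd_w gd) expr1n. Qed.

Let wj1 j : `|w j 0| <= 1. Proof. by rewrite -w1 enorm_coord. Qed.

#[local] Transparent cfgX.

(** With column j of H removed, what is left of column j of the design comes from the components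
    along w and carries the factor w_j. *)
Lemma zeroed_X_delta j t :
  X (zr j t) *m (delta_mx j 0 : 'cV[R]_p) = w j 0 *: (X (zr j t) *m w - r *: (H (zr j t) *m w)).
Proof.
have H0 : H (zr j t) *m (delta_mx j 0 : 'cV[R]_p) = 0.
  apply/matrixP => i l; rewrite !ord1 mulmx_delta mxE.
  by have := zeroed_H field j t (i, j); rewrite /Hentry /= eqxx mul0r.
rewrite (cfgX_w gd); have -> : X (zr j t) *m (delta_mx j 0 : 'cV[R]_p) =
    r *: (H (zr j t) *m (Q *m delta_mx j 0) + zeta (zr j t) *m (w^T *m delta_mx j 0)).
  by rewrite /cfgX /model_design -scalemxAl mulmxDl -!mulmxA.
have -> : w^T *m (delta_mx j 0 : 'cV[R]_p) = (w j 0)%:M.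
  by apply/matrixP => a b; rewrite !ord1 dotE dotC dot_delta !mxE.
rewrite mul_mx_scalar wprojE [dot w _]dotC dot_delta mulmxBr H0 sub0r -scalemxAr.
by rewrite scalerDr scalerN !scalerA scalerBr !scalerA [_ * w j 0]mulrC addrC.
Qed.

#[local] Opaque cfgX.

(** Through [cfgth_coord] the coordinate theta_j inherits the factor w_j of the design column. The
    squares of the w_j sum to 1, whereas a bound without this factor would sum to p. *)
Lemma zeroed_q_th j t : `|dot (cfgq w j) (theta (zr j t))| <= `|w j 0| * K t ^+ 4.
Proof.
have Hw : r * enorm (H (zr j t) *m w) <= 2 * K t.
  have -> : H (zr j t) *m w = H t *m w - w j 0 *: Hcol j t.
    have -> : H t = H (zr j t) + Hcol j t *m (delta_mx j 0 : 'cV_p)^T.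
      apply/matrixP => i l; have := zeroed_H field j t (i, l); rewrite /Hentry /= => hz.
      rewrite [RHS]mxE hz [(_ *m _) i l]mxE big_ord1 HcolE [_^T 0 l]mxE [delta_mx _ _ _ _]mxE.
      by case: eqVneq => [->|lj] /=; rewrite ?mul0r ?mul1r ?add0r ?mulr1 ?mulr0 ?addr0.
    rewrite mulmxDl -mulmxA; have -> : (delta_mx j 0 : 'cV[R]_p)^T *m w = (w j 0)%:M.
      by apply/matrixP => a b; rewrite !ord1 dotE dot_delta !mxE.
    by rewrite mul_mx_scalar addrK.
  rewrite -ler_pdivlMl ?invr_gt0 // invrK; apply: le_trans (enormB _ _) _.
  have h1 := gd_KH gd t w; rewrite w1 mulr1 in h1.
  have h2 : enorm (w j 0 *: Hcol j t) <= sn * K t.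
    rewrite enormZ; apply: le_trans (enorm_Hcol j t).
    by rewrite ler_piMl ?enorm_ge0.
  have -> : sn * (2 * K t) = sn * K t + sn * K t by ring.
  exact: lerD.
have thj : `|theta (zr j t) j 0| <= `|w j 0| * (4 * K t ^+ 2).
  have := cfgth_coord gd er (zr j t) j.
  have -> : ((X (zr j t))^T *m f (zr j t)) j 0 = dot (X (zr j t) *m delta_mx j 0) (f (zr j t)).
    by rewrite [RHS]dotC dot_mulmx [RHS]dotC dot_delta.
  rewrite zeroed_X_delta dotZl normrM => h.
  have h3 : `|dot (X (zr j t) *m w - r *: (H (zr j t) *m w)) (f (zr j t))| <= 4 * K t.
    apply: le_trans (dot_le_enorm _ _) _; rewrite (enorm_cfgf gd er) mulr1.
    apply: le_trans (enormB _ _) _; rewrite enormZ ger0_norm ?invr_ge0 ?(ltW sn0) //.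
    have := zeroed_X j t w; rewrite w1 mulr1 => h4.
    by move: (enorm _) (_ * enorm _) h4 Hw => a b *; lra.
  have h5 : tau * `|theta (zr j t) j 0| <= `|w j 0| * (4 * K t).
    by apply: le_trans h _; rewrite ler_wpM2l.
  have tau0 := er_tau0 er.
  have : `|theta (zr j t) j 0| <= `|w j 0| * (4 * K t) / tau by rewrite ler_pdivlMr // mulrC.
  move=> /le_trans; apply; apply: le_trans (div_tau gd t _) _.
    by rewrite mulr_ge0 // mulr_ge0 // ltW.
  by rewrite expr2 !mulrA.
have wth : `|dot w (theta (zr j t))| <= K t ^+ 3.
  by apply: le_trans (dot_le_enorm _ _) _; rewrite w1 mul1r zeroed_th.
rewrite dot_cfgq wprojE.
have -> : (theta (zr j t) - dot w (theta (zr j t)) *: w) j 0 =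
    theta (zr j t) j 0 - dot w (theta (zr j t)) * w j 0 by rewrite !mxE.
apply: le_trans (ler_normB _ _) _; rewrite normrM.
have h6 : `|w j 0| * `|dot w (theta (zr j t))| <= `|w j 0| * K t ^+ 3 by rewrite ler_wpM2l.
have h7 : 4 * K t ^+ 2 <= K t ^+ 3 by apply: (cfgK_num gd) => //; lra.
have h8 : 2 * K t ^+ 3 <= K t ^+ 4 by apply: (cfgK_num gd) => //; lra.
have h9 : 4 * K t ^+ 2 + K t ^+ 3 <= K t ^+ 4 by lra.
have := ler_wpM2l (normr_ge0 (w j 0)) h9; rewrite mulrDr => h10.
by apply: (le_trans _ h10); rewrite [X in _ + X]mulrC; exact: lerD.
Qed.

Let mf0 j i : measurable_fun setT (fun t => f (zr j t) i 0).
Proof. exact: (measurableT_comp (measurable_cfgf gd er i) (measurable_zeroed field j)). Qed.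

Let f0_inv j i s t : f (zr j (th (i, j) s t)) = f (zr j t).
Proof. by rewrite (zeroed_in field). Qed.

Let noiseE j : noise j = fun t => \sum_i f (zr j t) i 0 * Hentry (i, j) t.
Proof. by apply/funext => t; rewrite /noise; apply: eq_bigr => i _; rewrite HcolE. Qed.

Lemma noise_flow j : gflow mu (fun s t => shiftv th (column n j) (fun k => s * f (zr j t) k.1 0) t) (noise j).
Proof.
rewrite noiseE; apply: (column_flow field) => //.
by move=> t; exact: (dot_cfgf gd er).
Qed.

Lemma noise_law j B : measurable B -> mu (noise j @^-1` B) = normal_prob 0 1 B.
Proof. exact: (gflow_law (noise_flow j)). Qed.

Lemma measurable_noise j : measurable_fun setT (noise j).
Proof. exact: (gflow_measZ (noise_flow j)). Qed.

Lemma noise_moment4 j : Ele mu (fun t => noise j t ^+ 4) (gaussc).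
Proof.
have := gflow_moment (noise_flow j) (u := fun=> 1) (fun _ _ => erefl) (Ele_cst mu ler01).
by under eq_fun do rewrite mul1r; rewrite mulr1.
Qed.

Lemma noise_moment2 j : Ele mu (fun t => noise j t ^+ 2) (1 + gaussc).
Proof.
have := gflow_moment2 (noise_flow j) (u := fun=> 1) (fun _ _ => erefl) (Ele_cst mu ler01).
by under eq_fun do rewrite mul1r; rewrite mulr1.
Qed.

(** Restoring the column is a rank-one shift. Its squared norm, of order n, cancels the 1/n of the
    step and multiplies only the small quantity of [zeroed_q_th], so both terms sum to order one
    over j. *)
Lemma leave_one_out j t : enorm (f t - f (zr j t)) ^+ 2 <=
  2 / n%:R * (noise j t ^+ 4 + K t ^+ 2) + 4 * (w j 0 ^+ 2 * K t ^+ 10).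
Proof.
have := cfgf_shift gd er (esym (zy j t)) (zeroed_design j t).
move=> /le_trans; apply.
have -> : dot (Hcol j t) (f (zr j t)) = noise j t by rewrite dotC.
rewrite exprMn expr1n mul1r exprVn sn2.
have h1 : dot (cfgq w j) (cfgq w j) * noise j t ^+ 2 / tau <= noise j t ^+ 2 * K t.
  apply: le_trans (div_tau gd t _) _; first by rewrite mulr_ge0 ?dot_ge0 ?sqr_ge0.
  rewrite ler_wpM2r ?(ltW (K0 t)) // ler_piMl ?sqr_ge0 // -enorm_sqr expr_le1 ?enorm_ge0 //.
  exact: (enorm_cfgq gd).
have h2 : dot (Hcol j t) (Hcol j t) * dot (cfgq w j) (theta (zr j t)) ^+ 2 <=
    n%:R * (w j 0 ^+ 2 * K t ^+ 10).
  apply: (@le_trans _ _ ((n%:R * K t ^+ 2) * (w j 0 ^+ 2 * K t ^+ 8))).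
    apply: ler_pM; [exact: dot_ge0 | exact: sqr_ge0 | |].
      rewrite -enorm_sqr -sn2 -exprMn ler_sqr ?nnegrE ?enorm_ge0 //; first exact: enorm_Hcol.
      by rewrite mulr_ge0 ?ltW.
    rewrite -(real_normK (num_real (dot _ _))) -(real_normK (num_real (w j 0))).
    have hk : 0 <= `|w j 0| * K t ^+ 4 := mulr_ge0 (normr_ge0 _) (Kge0 t 4).
    have -> : K t ^+ 8 = (K t ^+ 4) ^+ 2 by rewrite -exprM.
    by rewrite -exprMn ler_sqr ?nnegrE ?normr_ge0 //; exact: zeroed_q_th.
  have -> : K t ^+ 10 = K t ^+ 2 * K t ^+ 8 by rewrite -exprD.
  by move: (K t ^+ 2) (K t ^+ 8) => a b; rewrite le_eqVlt; apply/orP; left; apply/eqP; ring.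
have h3 : 2 * (noise j t ^+ 2 * K t) <= noise j t ^+ 4 + K t ^+ 2.
  have := sqr_ge0 (noise j t ^+ 2 - K t); have -> : noise j t ^+ 4 = (noise j t ^+ 2) ^+ 2 by rewrite -exprM.
  by nra.
have h4 : 4 * (n%:R^-1 * (noise j t ^+ 2 * K t + n%:R * (w j 0 ^+ 2 * K t ^+ 10))) <=
    2 / n%:R * (noise j t ^+ 4 + K t ^+ 2) + 4 * (w j 0 ^+ 2 * K t ^+ 10).
  rewrite mulrDr mulKf ?gt_eqF // mulrDr lerD2r.
  have ni : 0 <= n%:R^-1 :> R by rewrite invr_ge0.
  have := ler_wpM2l ni h3; move: (n%:R^-1) (_ * K t) (_ + _) => a b c; lra.
apply: le_trans h4; rewrite ler_wpM2l // ler_wpM2l ?invr_ge0 //; exact: lerD.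
Qed.

Variable cN : nat -> R.
Hypothesis EK : forall N, Ele mu (fun t => K t ^+ N) (cN N).

Lemma aspect_le : p%:R / n%:R <= cN 1.
Proof.
have [_ _ h] : Ele mu (fun=> p%:R / n%:R : R) (cN 1).
  apply: Ele_le (EK 1) => // t; rewrite divr_ge0 //=; exact: (gd_Kp gd).
by move: h; rewrite integral_cst // [X in (_ * X)%E]probability_setT mule1 lee_fin.
Qed.

(** The constants of [column_stein] summed over j, with p/n bounded by the first moment of [K]. *)
Definition column_const : R :=
  steinc (2 * cN 1 * (gaussc + cN 2) + 4 * cN 10) (4 * (cN 1 * cN 1 + cN 4)).

Local Notation smooth := (smooth_at th H zeta y w loss g).
Local Notation jacob t A := (jacobian_matrix loss g ((n%:R^-1)%:M) tau (y t) (X t) A).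
Local Notation D t := (Dhat loss g (y t) (X t)).

Let dotH u j t : dot u (Hcol j t) = \sum_i u i 0 * H t i j.
Proof. by apply: eq_bigr => i _; rewrite HcolE. Qed.

Let sum_difference (h a b e : 'I_n -> R) :
  \sum_i (h i * (a i - b i) - e i) = \sum_i a i * h i - \sum_i b i * h i - \sum_i e i.
Proof. by rewrite -!sumrB; apply: eq_bigr => i _; ring. Qed.

Let column_sum j t (e : 'I_n -> R) :
  \sum_(k <- column n j) (Hentry k t * (f t k.1 0 - f (zr j t) k.1 0) - e k.1) =
  dot (f t) (Hcol j t) - noise j t - \sum_i e i.
Proof.
have E1 := dotH (f t) j t.
have E2 : noise j t = \sum_i f (zr j t) i 0 * H t i j by exact (dotH (f (zr j t)) j t).
rewrite E1 E2 sum_column.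
exact (sum_difference (fun i => H t i j) (fun i => f t i 0) (fun i => f (zr j t) i 0) e).
Qed.

(** The Stein inequality in the entries of column j alone, for f minus its value without that
    column. The subtracted field is constant in the column and contributes exactly the noise;
    [leave_one_out] keeps the sum over j bounded. *)
Lemma column_stein : exists2 Xi : 'I_p -> T -> R,
  exists2 c : 'I_p -> R, (forall j, Ele mu (Xi j) (c j)) & \sum_j c j <= column_const &
  forall t A, smooth t -> jacob t A -> forall j,
    Xi j t = (dot (f t) (Hcol j t) - noise j t -
      \sum_i dirf w r (f t) (theta t) A (D t) (X t) i j i 0) ^+ 2.
Proof.
have mq j : measurable_fun setT (fun t => dot (cfgq w j) (theta t)).
  by apply: measurable_sum => i; apply: measurable_funM => //; exact: (measurable_cfgth gd er).
have [c Ec Sc] : exists2 c : 'I_p -> R, forall j, Ele mu (fun t => dot (cfgq w j) (theta t) ^+ 2) (c j) &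
    \sum_j c j <= cN 4.
  apply: Ele_split => [j|j t|]; [exact: measurable_funX | exact: sqr_ge0 |].
  apply: Ele_le (EK 4) => [|t].
    by apply: measurable_sum => j; exact: measurable_funX.
  rewrite sumr_ge0 => [|j _]; last exact: sqr_ge0.
  have -> : K t ^+ 4 = (K t ^+ 2) ^+ 2 by rewrite -exprM.
  rewrite /= (sum_cfgq_sqr w) -enorm_sqr ler_sqr ?nnegrE ?enorm_ge0 //.
  exact: le_trans (enorm_wproj gd _) (enorm_cfgth gd er t).
pose CF j := 2 / n%:R * (gaussc + cN 2) + 4 * (w j 0 ^+ 2 * cN 10).
pose CL j := 4 * (cN 1 / n%:R + c j).
have Xj j : exists Xi, Ele mu Xi (steinc (CF j) (CL j)) /\ forall t A, smooth t -> jacob t A ->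
    Xi t = (dot (f t) (Hcol j t) - noise j t -
      \sum_i dirf w r (f t) (theta t) A (D t) (X t) i j i 0) ^+ 2.
  have EF : Ele mu (fun t => 2 / n%:R * (noise j t ^+ 4 + K t ^+ 2) + 4 * (w j 0 ^+ 2 * K t ^+ 10)) (CF j).
    apply: EleD; first by apply: EleZ; [rewrite divr_ge0|apply: EleD; [exact: noise_moment4|exact: EK]].
    by apply: EleZ => //; apply: EleZ; [exact: sqr_ge0|exact: EK].
  have EL (s : R) : 0 < s <= 1 -> Ele mu (fun t => 4 * (K t ^+ 1 / n%:R + dot (cfgq w j) (theta t) ^+ 2)) (CL j).
    move=> _; apply: EleZ => //; apply: EleD; last exact: Ec.
    under eq_fun do rewrite mulrC; rewrite mulrC; apply: EleZ; [by rewrite invr_ge0|exact: EK].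
  have mF (k : 'I_n * 'I_p) : measurable_fun setT (fun t => f t k.1 0 - f (zr j t) k.1 0).
    by apply: measurable_funB; [exact: (measurable_cfgf gd er)|exact: mf0].
  have FE t : \sum_(k <- column n j) (f t k.1 0 - f (zr j t) k.1 0) ^+ 2 <=
      2 / n%:R * (noise j t ^+ 4 + K t ^+ 2) + 4 * (w j 0 ^+ 2 * K t ^+ 10).
    by rewrite sum_column -(enormB_sum (f t) (f (zr j t))); exact: leave_one_out.
  have LE t s : 0 < s <= 1 -> \sum_(k <- column n j) \sum_(l <- column n j)
      ((f (th l s t) k.1 0 - f (zr j (th l s t)) k.1 0) - (f t k.1 0 - f (zr j t) k.1 0)) ^+ 2 <=
      s ^+ 2 * (4 * (K t ^+ 1 / n%:R + dot (cfgq w j) (theta t) ^+ 2)).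
    move=> s01; rewrite exchange_big /= sum_column.
    apply: (@le_trans _ _ (\sum_i 4 * ((s / sn) ^+ 2 *
        (f t i 0 ^+ 2 * K t + dot (cfgq w j) (theta t) ^+ 2)))).
      apply: ler_sum => i _; rewrite sum_column /=.
      apply: (@le_trans _ _ (enorm (f (th (i, j) s t) - f t) ^+ 2)).
        rewrite (enormB_sum (f (th (i, j) s t)) (f t)); apply: ler_sum => l _; rewrite f0_inv.
        by rewrite opprB addrA subrK.
      apply: le_trans (cfgf_shift gd er (gd_y gd _ s t) (cfgX_th gd i j s t)) _.
      rewrite ler_wpM2l // ler_wpM2l ?sqr_ge0 // -[dot (delta_mx i 0) (delta_mx i 0)]enorm_sqr enorm_delta expr1n mul1r lerD2r dot_delta.
      apply: le_trans (div_tau gd t _) _; first by rewrite mulr_ge0 ?dot_ge0 ?sqr_ge0.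
      rewrite ler_wpM2r ?(ltW (K0 t)) // ler_piMl ?sqr_ge0 // -enorm_sqr expr_le1 ?enorm_ge0 //.
      exact: (enorm_cfgq gd).
    rewrite -mulr_sumr -mulr_sumr big_split /= sumr_const card_ord -mulr_suml.
    have -> : \sum_i f t i 0 ^+ 2 = 1 by rewrite -[RHS](dot_cfgf gd er t); apply: eq_bigr => i _; rewrite expr2.
    rewrite mul1r exprMn exprVn sn2 expr1 -mulr_natl le_eqVlt; apply/orP; left; apply/eqP.
    by move: (dot _ _) => qt; field; rewrite gt_eqF.
  have [Xi EXi XiE] := stein_bound field (column_uniq n j) mF EF EL FE LE.
  exists Xi; split => // t A st ja.
  pose e i := dirf w r (f t) (theta t) A (D t) (X t) i j i 0.
  rewrite (XiE t (fun k => e k.1)); last first.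
    move=> [i j']; rewrite mem_column /= => /eqP ->.
    have hd : dirlim th f (i, j) t (dirf w r (f t) (theta t) A (D t) (X t) i j).
      by apply: (dird_dirlim gd); exact (dird_f gd er st ja i j).
    have E : (fun m => (f (th (i, j) (- step m) t) i 0 - f (zr j (th (i, j) (- step m) t)) i 0 -
        (f t i 0 - f (zr j t) i 0)) / - step m) =
        (fun m => (f (th (i, j) (- step m) t) i 0 - f t i 0) / - step m).
      by apply/funext => m; rewrite f0_inv opprB addrA subrK.
    by rewrite E; exact: hd.
  by rewrite column_sum.
have [Xi XiP] := choice Xj.
exists Xi; last by move=> t A st ja j; have [_] := XiP j; apply.
exists (fun j => steinc (CF j) (CL j)); first by move=> j; have [] := XiP j.
have SF : \sum_j CF j <= 2 * cN 1 * (gaussc + cN 2) + 4 * cN 10.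
  rewrite /CF big_split /= sumr_const card_ord -mulr_sumr -mulr_suml.
  have -> : \sum_i w i 0 ^+ 2 = 1 by rewrite -[RHS](gd_w gd); apply: eq_bigr => i _; rewrite expr2.
  rewrite mul1r lerD2r -[leLHS]mulr_natl.
  have -> : p%:R * (2 / n%:R * (gaussc + cN 2)) = p%:R / n%:R * (2 * (gaussc + cN 2)) by ring.
  have -> : 2 * cN 1 * (gaussc + cN 2) = cN 1 * (2 * (gaussc + cN 2)) by ring.
  rewrite ler_wpM2r ?aspect_le // mulr_ge0 // addr_ge0 ?gaussc_ge0 //; exact: Ele_ge0 (EK 2).
have SL : \sum_j CL j <= 4 * (cN 1 * cN 1 + cN 4).
  rewrite /CL -mulr_sumr ler_wpM2l // big_split /= sumr_const card_ord; apply: lerD => //.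
  rewrite -[leLHS]mulr_natl mulrCA ler_wpM2l ?aspect_le //; exact: Ele_ge0 (EK 1).
rewrite /steinc /column_const /steinc big_split /= -mulr_sumr; apply: lerD => //.
apply: ler_wpM2l; first exact: expR_ge0.
have -> : \sum_j (2 * CF j + 2 * CL j) = 2 * \sum_j CF j + 2 * \sum_j CL j by rewrite !mulr_sumr -big_split.
by move: SF SL; move: (\sum_j CF j) (\sum_j CL j) => a b; lra.
Qed.

End LeaveOneOut.

#[local] Opaque cfgX cfgpsi cfgbeta cfgf cfgth betahat enorm zeroed column shiftv Hcol.

(** * Concentration of the norm of the noise *)

Section NoiseNorm.
Context {R : realType} {d : measure_display} {T : measurableType d}.
Variables (n p : nat) (mu : probability T R).
Variables (th : 'I_n * 'I_p -> R -> T -> T) (H : T -> 'M[R]_(n, p)).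
Variables (zeta y : T -> 'cV[R]_n) (w : 'cV[R]_p) (K : T -> R) (tau : R).
Variables (loss : R -> R -> R) (g : 'cV[R]_p -> R) (gs : 'I_p -> R -> R).
Hypothesis gd : gaussian_design mu th H zeta y w K tau.
Hypothesis er : estimator_regular n loss g gs tau.

Let n0 := gd_n0 gd.
Let nR0 : 0 < n%:R :> R. Proof. by rewrite ltr0n. Qed.
Let sn0 : 0 < Num.sqrt n%:R :> R. Proof. by rewrite sqrtr_gt0. Qed.
Let sn2 : Num.sqrt n%:R ^+ 2 = n%:R :> R. Proof. by rewrite sqr_sqrtr. Qed.
Local Notation X := (cfgX H zeta w).
Local Notation f := (cfgf H zeta y w loss g).
Local Notation theta := (cfgth H zeta y w loss g).
Local Notation Q := (wproj w).
Local Notation r := ((Num.sqrt n%:R)^-1).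
Local Notation sn := (Num.sqrt n%:R).

Let K0 t : 0 < K t. Proof. exact: (cfgK_gt0 gd). Qed.
Let K1 t : 1 <= K t. Proof. exact: (cfgK1 gd). Qed.
Let Kge0 t a : 0 <= K t ^+ a. Proof. by rewrite exprn_ge0 // ltW. Qed.
Let Kle t a b : (a <= b)%N -> K t ^+ a <= K t ^+ b. Proof. exact: (cfgK_le gd). Qed.

Local Notation zr := (zeroed th (Hentry H)).
Local Notation Hcol := (Hcol H).
Local Notation noise := (noise th H zeta y w loss g).
Let field : gfield mu th (Hentry H) := gd_field gd.

Let HcolE j t i : Hcol j t i 0 = H t i j. Proof. by rewrite mxE. Qed.

Let addE m (u v : 'cV[R]_m) i : (u + v) i 0 = u i 0 + v i 0. Proof. by rewrite mxE. Qed.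
Let subE m (u v : 'cV[R]_m) i : (u - v) i 0 = u i 0 - v i 0. Proof. by rewrite !mxE. Qed.
Let sclE m a (u : 'cV[R]_m) i : (a *: u) i 0 = a * u i 0. Proof. by rewrite mxE. Qed.

Let enormB_sum m (u v : 'cV[R]_m) : enorm (u - v) ^+ 2 = \sum_i (u i 0 - v i 0) ^+ 2.
Proof. by rewrite enorm_sqr; apply: eq_bigr => i _; rewrite [(u - v) i 0]mxE [(- v) i 0]mxE expr2. Qed.

Let dotH u j t : dot u (Hcol j t) = \sum_i u i 0 * H t i j.
Proof. by apply: eq_bigr => i _; rewrite HcolE. Qed.

Let noiseE j t : noise j t = dot (f (zr j t)) (Hcol j t). Proof. by []. Qed.

Let mf0 j i : measurable_fun setT (fun t => f (zr j t) i 0).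
Proof. exact: (measurableT_comp (measurable_cfgf gd er i) (measurable_zeroed field j)). Qed.

Let f0_inv j i s t : f (zr j (th (i, j) s t)) = f (zr j t).
Proof. by rewrite (zeroed_in field). Qed.

Let sum_f0 j t : \sum_i f (zr j t) i 0 ^+ 2 = 1.
Proof. by rewrite -[RHS](dot_cfgf gd er (zr j t)); apply: eq_bigr => i _; rewrite expr2. Qed.

Variable cN : nat -> R.
Hypothesis EK : forall N, Ele mu (fun t => K t ^+ N) (cN N).

Definition noise_const : R := steinc (1 + gaussc) (1 + (gaussc + cN 16) + 2 * (cN 8 + gaussc * cN 8)).

Let noise_out j l s t : l.2 != j -> noise j (th l s t) = dot (f (th l s (zr j t))) (Hcol j t).
Proof.
move=> lj; rewrite noiseE (zeroed_out field) //; apply: eq_bigr => i _; congr (_ * _).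
rewrite !HcolE; have := gfield_H field l (i, j) s t; rewrite /Hentry /= => ->.
have -> : ((i, j) == l) = false by apply: contraNF lj => /eqP <-; rewrite eqxx.
by rewrite mul0r addr0.
Qed.

Let noise_in j i s t : noise j (th (i, j) s t) = noise j t + s * f (zr j t) i 0.
Proof.
rewrite !noiseE f0_inv; set v := f (zr j t).
have -> : Hcol j (th (i, j) s t) = Hcol j t + s *: delta_mx i 0.
  apply/matrixP => a b; rewrite !ord1 HcolE; have := gfield_H field (i, j) (a, j) s t.
  rewrite /Hentry /= => ->; rewrite addE sclE HcolE [delta_mx _ _ _ _]mxE eqxx andbT.
  by rewrite -pair_eqE /pair_eq /= eqxx andbT mulrC.
by rewrite dotDr dotZr [dot v (delta_mx i 0)]dotC dot_delta.
Qed.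

Let sqr_split m (a b v : 'cV[R]_m) (Z e : R) : enorm v = 1 ->
  enorm ((Z + e) *: v - Z *: a) ^+ 2 <= 2 * (Z ^+ 2 * enorm (v - a) ^+ 2) + 2 * e ^+ 2.
Proof.
move=> v1; have -> : (Z + e) *: v - Z *: a = Z *: (v - a) + e *: v.
  by rewrite scalerDl scalerBr addrAC.
have h := enormD (Z *: (v - a)) (e *: v); rewrite !enormZ v1 mulr1 in h.
have h0 := enorm_ge0 (Z *: (v - a) + e *: v).
rewrite -(real_normK (num_real Z)) -(real_normK (num_real e)) -exprMn.
have := normr_ge0 e; have : 0 <= `|Z| * enorm (v - a) by rewrite mulr_ge0 ?enorm_ge0.
move: (enorm _) (`|Z| * _) `|e| h h0 => x a' b' h h0 a0 b0.
have : x ^+ 2 <= (a' + b') ^+ 2 by rewrite ler_sqr ?nnegrE // addr_ge0.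
by have := sqr_ge0 (a' - b'); nra.
Qed.

Let shift_at_zeroed j t s : 0 < s <= 1 ->
  \sum_l enorm (f (th l s (zr j t)) - f (zr j t)) ^+ 2 <= s ^+ 2 * K t ^+ 8.
Proof.
move=> s01; rewrite sum_pair.
apply: (@le_trans _ _ (4 * (s ^+ 2 * (p%:R / n%:R / tau +
    dot (Q *m theta (zr j t)) (Q *m theta (zr j t)))))).
  refine (le_trans _ (ler_wpM2l (ler0n R 4) (sum_shift_le gd er (zr j t) s))).
  rewrite mulr_sumr; apply: ler_sum => i _; rewrite mulr_sumr; apply: ler_sum => l _.
  exact: (cfgf_shift gd er (gd_y gd _ s _) (cfgX_th gd i l s _)).
have h0 : p%:R / n%:R / tau <= p%:R / n%:R * K t by apply: (div_tau gd); rewrite divr_ge0.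
have h1 : p%:R / n%:R * K t <= K t ^+ 2 by rewrite expr2 ler_wpM2r ?(ltW (K0 t)) // (gd_Kp gd).
have h2 : dot (Q *m theta (zr j t)) (Q *m theta (zr j t)) <= K t ^+ 6.
  have -> : K t ^+ 6 = (K t ^+ 3) ^+ 2 by rewrite -exprM.
  rewrite -enorm_sqr ler_sqr ?nnegrE ?enorm_ge0 //.
  exact: le_trans (enorm_wproj gd _) (zeroed_th gd er j t).
have h3 : K t ^+ 2 <= K t ^+ 6 by exact: Kle.
have h4 : 4 * K t ^+ 6 <= K t ^+ 7 by apply: (cfgK_num gd) => //; lra.
have h5 : 2 * K t ^+ 7 <= K t ^+ 8 by apply: (cfgK_num gd) => //; lra.
rewrite mulrCA ler_wpM2l ?sqr_ge0 //.
by move: h0 h1 h2 h3 h4 h5; move: (dot _ _) (_ / _ / _) (_ * K t) (K t ^+ 8) (K t ^+ 7) (K t ^+ 6) (K t ^+ 2) => *; lra.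
Qed.

Let G (k : 'I_n * 'I_p) t := f (zr k.2 t) k.1 0 * noise k.2 t.

(** Increment of the direction of noise j under a shift outside column j. It does not involve column
    j, so [column_moment] bounds its product with that column. *)
Let Dl j l s t : 'cV[R]_n := if l.2 == j then 0 else f (th l s (zr j t)) - f (zr j t).

Let mG k : measurable_fun setT (G k).
Proof.
by apply: measurable_funM => //; exact: (measurable_noise gd er).
Qed.

Let EF : Ele mu (fun t => \sum_j noise j t ^+ 2) (\sum_(j < p) (1 + gaussc)).
Proof.
by apply: Ele_sum => j; exact: (noise_moment2 gd er).
Qed.

Let mth l s : measurable_fun setT (th l s).
Proof.
by exact: (measurable_flow (gfield_flow field l)).
Qed.

Let mD j l s i : measurable_fun setT (fun t => Dl j l s t i 0).
Proof.
rewrite /Dl; case: (l.2 == j); first exact: measurable_cst.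
under eq_fun do rewrite subE; apply: measurable_funB => //.
exact: (measurableT_comp (measurable_cfgf gd er i) (measurableT_comp (mth l s) (measurable_zeroed field j))).
Qed.

Let D_inv j l s i s' t : Dl j l s (th (i, j) s' t) = Dl j l s t.
Proof.
by rewrite /Dl (zeroed_in field).
Qed.

Let L s t := \sum_j (1 + 2 * (noise j t ^+ 2 * K t ^+ 8) + 2 * (s ^- 2 * \sum_l (dot (Dl j l s t) (Hcol j t)) ^+ 2)).

Let EL (s : R) : 0 < s <= 1 -> Ele mu (L s) (\sum_(j < p) (1 + (gaussc + cN 16) + 2 * (cN 8 + gaussc * cN 8))).
Proof.
move=> s01; apply: Ele_sum => j; apply: EleD; first apply: EleD.
- exact: Ele_cst.
- apply: Ele_le (EleD (noise_moment4 gd er j) (EK 16)) => [|t].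
    apply: measurable_funM => //; apply: measurable_funM; first exact: (measurable_funX 2 (measurable_noise gd er j)).
    by case: (EK 8).
  rewrite (mulr_ge0 (ler0n R 2) (mulr_ge0 (sqr_ge0 (noise j t)) (Kge0 t 8))) /=.
  have -> : noise j t ^+ 4 = (noise j t ^+ 2) ^+ 2 by rewrite -exprM.
  have -> : K t ^+ 16 = (K t ^+ 8) ^+ 2 by rewrite -exprM.
  by have := sqr_ge0 (noise j t ^+ 2 - K t ^+ 8); nra.
have s0 : 0 < s by case/andP: s01.
have [c Ec Sc] : exists2 c : 'I_n * 'I_p -> R, forall l, Ele mu (fun t => enorm (Dl j l s t) ^+ 2) (c l) &
    \sum_l c l <= s ^+ 2 * cN 8.
  have mE l : measurable_fun setT (fun t => enorm (Dl j l s t) ^+ 2).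
    by apply: (measurable_funX 2); exact: (measurable_enorm (mD j l s)).
  apply: Ele_split => [l|l t|]; [exact: mE | exact: sqr_ge0 |].
  apply: Ele_le (EleZ (sqr_ge0 s) (EK 8)) => [|t]; first exact: measurable_sum.
  rewrite sumr_ge0 => [|l _]; last exact: sqr_ge0.
  apply: le_trans (shift_at_zeroed j t s01); apply: ler_sum => l _; rewrite /Dl; case: ifP => _ //.
  by rewrite enorm0 expr0n sqr_ge0.
have EH l : Ele mu (fun t => dot (Dl j l s t) (Hcol j t) ^+ 2) (c l + gaussc * c l).
  have := column_moment field n0 (mD j l s) (D_inv j l s) (Ec l).
  have E : (fun t => dot (Dl j l s t) (Hcol j t) ^+ 2) =
      (fun t => (\sum_i Dl j l s t i 0 * Hentry H (i, j) t) ^+ 2).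
    by apply/funext => t; rewrite dotH.
  by rewrite E.
apply: EleZ => //; apply: Ele_wk (EleZ _ (Ele_sum (index_enum _) EH)).
  rewrite big_split /= -mulr_sumr ler_pdivrMl ?exprn_gt0 // mulrDr; apply: lerD => //.
  by rewrite mulrCA ler_wpM2l ?gaussc_ge0.
by rewrite invr_ge0 sqr_ge0.
Qed.

Let FE t : \sum_k G k t ^+ 2 <= \sum_j noise j t ^+ 2.
Proof.
rewrite sum_pair exchange_big /=; apply: ler_sum => j _; rewrite /G /=.
under eq_bigr do rewrite exprMn; rewrite -mulr_suml.
rewrite sum_f0.
by rewrite mul1r.
Qed.

Let LE t s : 0 < s <= 1 -> \sum_k \sum_l (G k (th l s t) - G k t) ^+ 2 <= s ^+ 2 * L s t.
Proof.
move=> s01; have s0 : 0 < s by case/andP: s01.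
rewrite sum_pair exchange_big /= mulr_sumr; apply: ler_sum => j _.
rewrite exchange_big /=.
(* A shift inside column j keeps the direction and moves the noise linearly; a shift outside acts
   through the increment [Dl] only. *)
pose in_ l : R := if l.2 == j then s ^+ 2 * f (zr j t) l.1 0 ^+ 2 else 0.
apply: (@le_trans _ _ (\sum_l (in_ l + 2 * (noise j t ^+ 2 * enorm (Dl j l s t) ^+ 2) +
    2 * dot (Dl j l s t) (Hcol j t) ^+ 2))).
  apply: ler_sum => -[i l] _; rewrite /G /in_ /Dl /=; case: eqP => [->|/eqP lj].
    rewrite enorm0 dot0l expr0n /= !mulr0 !addr0.
    under eq_bigr => a _.
      rewrite f0_inv noise_in; have -> : f (zr j t) a 0 * (noise j t + s * f (zr j t) i 0) - f (zr j t) a 0 * noise j t =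
        s * f (zr j t) i 0 * f (zr j t) a 0 by move: (f _ a 0) (f _ i 0) (noise j t) => x z e; ring.
      rewrite exprMn; over.
    rewrite -mulr_sumr.
    rewrite sum_f0.
    by rewrite mulr1 exprMn.
  rewrite add0r; have v1 := enorm_cfgf gd er (th (i, l) s (zr j t)).
  have nE : noise j (th (i, l) s t) = noise j t + dot (f (th (i, l) s (zr j t)) - f (zr j t)) (Hcol j t).
    by rewrite noise_out // dotBl noiseE addrC subrK.
  refine (le_trans _ (@sqr_split n (f (zr j t)) 0 _ (noise j t) _ v1)).
  rewrite -nE (enormB_sum (noise j (th (i, l) s t) *: _) (noise j t *: _)); apply: ler_sum => a _.
  rewrite (zeroed_out field) //; move: (f (th _ s _)) (f (zr j t)) (noise j _) (noise j t) => v u Z Z'.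
  by rewrite !sclE [v a 0 * _]mulrC [u a 0 * _]mulrC.
rewrite big_split /= big_split /= -!mulr_sumr.
have h1 : \sum_l in_ l <= s ^+ 2.
  rewrite sum_pair exchange_big /= (bigD1 j) //= [X in _ + X]big1 ?addr0 => [|l lj]; last first.
    by apply: big1 => i _; rewrite /in_ /= (negbTE lj).
  rewrite /in_ /= eqxx -mulr_sumr.
  rewrite sum_f0.
  by rewrite mulr1.
have h2 : \sum_l enorm (Dl j l s t) ^+ 2 <= s ^+ 2 * K t ^+ 8.
  apply: le_trans (shift_at_zeroed j t s01); apply: ler_sum => l _; rewrite /Dl; case: ifP => _ //.
  by rewrite enorm0 expr0n sqr_ge0.
have h3 := ler_wpM2l (sqr_ge0 (noise j t)) h2.
rewrite !mulrDr mulr1 [s ^+ 2 * (2 * (s ^- 2 * _))]mulrCA mulrA [s ^+ 2 * (s ^- 2 * _)]mulrA mulfV ?mul1r; last first.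
  by rewrite expf_neq0 // gt_eqF.
by move: h1 h3; move: (\sum_l in_ l) (\sum_l enorm _ ^+ 2) (\sum_l dot _ _ ^+ 2) (noise j t ^+ 2) (K t ^+ 8) (s ^+ 2) => *; lra.
Qed.

(** The noises of different columns are dependent. The field whose column j is Z_j times the
    direction of that noise has divergence sum Z_j^2 - p, because Z_j is linear in its own column
    with a unit direction. *)
Lemma noise_norm : exists2 Xi : T -> R, Ele mu Xi (p%:R * noise_const) &
  forall t, Xi t = (\sum_j noise j t ^+ 2 - p%:R) ^+ 2.
Proof.
have [Xi EXi XiE] := stein_bound field (index_enum_uniq _) mG EF EL FE LE.
exists Xi.
  apply: Ele_wk EXi; have sc (x : R) : \sum_(j < p) x = p%:R * x by rewrite sumr_const card_ord mulr_natl.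
  rewrite !sc /noise_const /steinc.
  by move: (expR 1) (gaussc) (cN 16) (cN 8) (p%:R : R) => *; rewrite le_eqVlt; apply/orP; left; apply/eqP; ring.
move=> t; rewrite (XiE t (fun k => f (zr k.2 t) k.1 0 ^+ 2)); last first.
  move=> [i j] _; have E : (fun m => (G (i, j) (th (i, j) (- step m) t) - G (i, j) t) / - step m) =
      (fun=> f (zr j t) i 0 ^+ 2).
    apply/funext => m; rewrite /G /= f0_inv noise_in.
    have s0 : (step m : R) != 0 by rewrite gt_eqF // step_gt0.
    by move: (step m : R) (f _ i 0) (noise j t) s0 => s x e s0; field.
  by rewrite E; exact: cvg_cst.
congr (_ ^+ 2); have -> : p%:R = \sum_(j < p) 1 :> R by rewrite sumr_const card_ord.
rewrite sum_pair exchange_big /= -sumrB.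
apply: eq_bigr => j _; rewrite sumrB; congr (_ - _); last first.
  by rewrite -[RHS](dot_cfgf gd er (zr j t)); apply: eq_bigr => i _; rewrite expr2.
rewrite /G /= expr2 {2}noiseE /dot mulr_suml; apply: eq_bigr => i _; rewrite HcolE /Hentry /=.
by move: (f _ i 0) (noise j t) (H t i j) => *; ring.
Qed.

End NoiseNorm.

#[local] Transparent cfgpsi cfgbeta cfgf cfgth zeroed column shiftv cfgX Hcol.
(** * Coordinate errors *)

#[local] Opaque betahat psihat enorm Dhat prox.

(** Giving the root the sign of [a] reduces to nonnegative numbers, where the squared distance is at
    most the difference of squares; truncating [b] at 0 only brings it closer to a^2. At a = 0 the
    sign is 0. Hence a comparison of squares suffices for the theorem. *)
Lemma sign_sqrt_gap (R : realType) (a b : R) :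
  (a - Num.sg a * Num.sqrt (Num.max 0 b)) ^+ 2 <= `|a ^+ 2 - b|.
Proof.
have m0 : 0 <= Num.max 0 b by rewrite le_max lexx.
set q := Num.sqrt _; have q0 : 0 <= q by exact: sqrtr_ge0.
have q2 : q ^+ 2 = Num.max 0 b by rewrite sqr_sqrtr.
have h1 : (a - Num.sg a * q) ^+ 2 <= (`|a| - q) ^+ 2.
  have [->|a0] := eqVneq a 0; first by rewrite sgr0 mul0r subrr expr0n sqr_ge0.
  rewrite {1}[a]numEsg -mulrBr exprMn sqr_sg a0 mul1r.
  exact: lexx.
apply: le_trans h1 _; have h2 : (`|a| - q) ^+ 2 <= `|a ^+ 2 - q ^+ 2|.
  rewrite -[a ^+ 2]real_normK ?num_real // subr_sqr normrM [`|_ + q|]ger0_norm ?addr_ge0 //.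
  rewrite -[X in X <= _]real_normK ?num_real // expr2 ler_wpM2l //.
  rewrite ler_norml; have := normr_ge0 a; move: (`|a|) => x x0; apply/andP; split; lra.
apply: le_trans h2 _; rewrite q2 /Num.max; case: ifP => // /negbT; rewrite -leNgt => b0.
by rewrite subr0 !ger0_norm ?sqr_ge0 //; [lra | have := sqr_ge0 a; lra].
Qed.

(** * The observable quantities after normalization *)

Section Observable.
Context {R : realType} {n p : nat}.
Variables (loss : R -> R -> R) (g : 'cV[R]_p -> R).
Variables (y : 'cV[R]_n) (X : 'M[R]_(n, p)) (A : 'M[R]_p) (f : 'cV[R]_n) (th w : 'cV[R]_p) (z : R).
Hypothesis n0 : (0 < n)%N.
Hypothesis z0 : 0 < z.
Hypothesis psiE : psihat loss g y X = z *: f.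
Hypothesis betaE : betahat loss g y X = z *: th.
Hypothesis f1 : dot f f = 1.

Let nR0 : 0 < n%:R :> R. Proof. by rewrite ltr0n. Qed.
Let sn0 : 0 < Num.sqrt n%:R :> R. Proof. by rewrite sqrtr_gt0. Qed.
Let sn2 : Num.sqrt n%:R ^+ 2 = n%:R :> R. Proof. by rewrite sqr_sqrtr. Qed.
Local Notation sn := (Num.sqrt n%:R).
Local Notation Sig := ((n%:R^-1)%:M : 'M[R]_p).
Local Notation v := (vhat loss g y X A).
Local Notation c := (dfhat loss g y X A / n%:R).

Lemma rhat_normalized : rhat loss g y X = z / sn.
Proof.
rewrite /rhat psiE enorm_sqr dotZl dotZr f1 mulr1 -expr2 mulrC sqrtrM ?sqr_ge0 // sqrtr_sqr gtr0_norm //.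
by rewrite sqrtrV // ltW.
Qed.

Lemma invmx_sqrtmx : invmx (sqrtmx Sig) = sn%:M.
Proof. by rewrite sqrtmx_scalar ?invr_gt0 // invmx_scalar sqrtrV ?invrK // ltW. Qed.

(** n that^2 / |psi|^2 with the square containing gamma expanded, which clears the division by
    [vhat]. *)
Definition that2_ratio : R := dot (X^T *m f) (X^T *m f) + 2 * v * dot f (X *m th) +
  v ^+ 2 * dot (X *m th) (X *m th) - 2 * v * c * dot f (X *m th) + c ^+ 2 - p%:R / n%:R.

Lemma that2_normalized : v != 0 -> n%:R * that2 loss g Sig y X A = z ^+ 2 * that2_ratio.
Proof.
move=> v0; rewrite /that2 rhat_normalized invmx_sqrtmx psiE betaE /gammahat /that2_ratio.
have -> : enorm (sn%:M *m X^T *m (z *: f)) ^+ 2 = n%:R * z ^+ 2 * dot (X^T *m f) (X^T *m f).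
  rewrite enorm_sqr mul_scalar_mx -scalemxAr -scalemxAl !dotZl !dotZr.
  by move: (dot _ _) (sn) sn2 => d s <-; ring.
have -> : ((z *: f)^T *m X *m (z *: th)) 0 0 = z ^+ 2 * dot f (X *m th).
  by rewrite -mulmxA dotE -scalemxAr dotZl dotZr expr2 mulrA.
have -> : enorm (X *m (z *: th) - dfhat loss g y X A / (n%:R * v) *: (z *: f)) ^+ 2 =
    z ^+ 2 * (dot (X *m th) (X *m th) - 2 * (c / v) * dot f (X *m th) + (c / v) ^+ 2).
  rewrite enorm_sqr -scalemxAr scalerA !(dotBl, dotBr, dotZl, dotZr) f1 [dot (X *m th) f]dotC.
  move: (dot _ _) (dot f _) (dfhat _ _ _ _ _) => xx mf df; field.
  by rewrite v0 gt_eqF.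
have -> : (z / sn) ^+ 2 = z ^+ 2 / n%:R by rewrite exprMn exprVn sn2.
move: (dot (X^T *m f) _) (dot f _) (dot (X *m th) _) => a b e.
move: (vhat _ _ _ _ _) v0 (dfhat _ _ _ _ _) => v v0 df.
have nn : n%:R != 0 :> R by rewrite gt_eqF.
by move: (p%:R : R) (n%:R : R) nn => pp n' nn; field; rewrite nn v0.
Qed.

Definition tstar_ratio : R := v * dot w th + dot f (X *m w).

Lemma tstar_normalized : tstar loss g Sig (sn *: w) y X A = z / sn * tstar_ratio.
Proof.
rewrite /tstar psiE betaE dotE mul_scalar_mx -scalemxAr dotZl dotDr !dotZr /tstar_ratio /vhat.
have -> : dot w (X^T *m f) = dot f (X *m w) by rewrite dot_mulmx trmxK dotC.
move: (\tr _) (dot w th) (dot f _) (sn) sn0 sn2 => a b c s s0 <-; field.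
by rewrite gt_eqF.
Qed.

Variables (gs : 'I_p -> R -> R) (tau : R).
Hypothesis tau0 : 0 < tau.
Hypothesis lossR : loss_regular loss setT.
Hypothesis cgs : forall j, convexT (gs j : R^o -> R).
Hypothesis gE : forall b, g b = n%:R^-1 * \sum_j gs j (b j 0).
Hypothesis penR : penalty_regular g Sig tau.

Definition coordinate_error (Z : R) j : R :=
  v ^+ 2 / rhat loss g y X ^+ 2 *
  `|betahat loss g y X j 0 - prox (fun u => v^-1 * gs j u)
      (rhat loss g y X / v * Z +
       Num.sg (tstar loss g Sig (sn *: w) y X A) * that loss g Sig y X A / v * (sn *: w) j 0)| ^+ 2.

Let sclE m a (u : 'cV[R]_m) i : (a *: u) i 0 = a * u i 0. Proof. by rewrite mxE. Qed.

(** Three sources of error: the residual of the noise, a component along w, and the choice of sign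
    with the square root. The scalar [e] is free; it will be the inner product of f and H w, which
    the noise contains but the projection Q removes. *)
Lemma coordinate_error_pos Z e j : 0 < v ->
  coordinate_error Z j <= 3 * ((sn * (v * (wproj w *m th) j 0 + (wproj w *m (X^T *m f)) j 0) + 
      e * w j 0 - Z) ^+ 2 +
    e ^+ 2 * w j 0 ^+ 2 + w j 0 ^+ 2 * (n%:R * `|that2_ratio - tstar_ratio ^+ 2|)).
Proof.
move=> v0; rewrite /coordinate_error; set t := Num.sg _ * _; set x := _ + t / v * _.
have h := prox_spec (cgs j) tau0 v0 (@gs_mono _ _ _ g gs tau n0 gE penR j) (gs_min n0 gE penR j)
  (betahat_kkt n0 tau0 lossR cgs gE penR y X j) x.
have r0 : 0 < rhat loss g y X by rewrite rhat_normalized divr_gt0.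
apply: (@le_trans _ _ ((v / rhat loss g y X * (betahat loss g y X j 0 +
    (X^T *m psihat loss g y X) j 0 / v - x)) ^+ 2)).
  have -> : v ^+ 2 / rhat loss g y X ^+ 2 = (v / rhat loss g y X) ^+ 2 by rewrite [RHS]exprMn exprVn.
  rewrite [leRHS]exprMn ler_wpM2l ?sqr_ge0 //.
  by rewrite -[leRHS]real_normK ?num_real // ler_sqr ?nnegrE.
have dq : (n%:R / z * (tstar loss g Sig (sn *: w) y X A - t)) ^+ 2 <= n%:R * `|that2_ratio - tstar_ratio ^+ 2|.
  have := sign_sqrt_gap (tstar loss g Sig (sn *: w) y X A) (that2 loss g Sig y X A).
  rewrite -/(that loss g Sig y X A) -/t => hg.
  have E : that2 loss g Sig y X A = z ^+ 2 * that2_ratio / n%:R.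
    by rewrite -that2_normalized ?gt_eqF // mulrAC divff ?mul1r // gt_eqF.
  rewrite exprMn; apply: le_trans (ler_wpM2l _ hg) _; first exact: sqr_ge0.
  rewrite E tstar_normalized distrC.
  have -> : (z / sn * tstar_ratio) ^+ 2 = z ^+ 2 / n%:R * tstar_ratio ^+ 2.
    by rewrite exprMn exprMn exprVn sn2.
  have -> : z ^+ 2 * that2_ratio / n%:R - z ^+ 2 / n%:R * tstar_ratio ^+ 2 =
     z ^+ 2 / n%:R * (that2_ratio - tstar_ratio ^+ 2) by ring.
  rewrite normrM ger0_norm ?divr_ge0 ?sqr_ge0 // le_eqVlt; apply/orP; left; apply/eqP.
  by move: `|_| => q; field; rewrite !gt_eqF.
have -> : v / rhat loss g y X * (betahat loss g y X j 0 + (X^T *m psihat loss g y X) j 0 / v - x) =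
  (sn * (v * (wproj w *m th) j 0 + (wproj w *m (X^T *m f)) j 0) + e * w j 0 - Z)
  - e * w j 0 + w j 0 * (n%:R / z * (tstar loss g Sig (sn *: w) y X A - t)).
  rewrite tstar_normalized /tstar_ratio /x psiE betaE -scalemxAr !sclE rhat_normalized !wprojE.
  have -> : dot w (X^T *m f) = dot f (X *m w) by rewrite dot_mulmx trmxK dotC.
  have -> : (th - dot w th *: w) j 0 = th j 0 - dot w th * w j 0 by rewrite !mxE.
  have subE (a b : 'cV[R]_p) : (a - b) j 0 = a j 0 - b j 0 by rewrite !mxE.
  rewrite subE sclE; move: ((X^T *m f) j 0) (th j 0) (w j 0) (dot w th) (dot f _) => a b h' k l.
  move: (vhat _ _ _ _ _) v0 => v' v0; move: (t) (sn) sn0 sn2 => tt s s0 <-.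
  by field; rewrite !gt_eqF.
move: dq; set a := _ - Z; set b := e * w j 0; set q := n%:R / z * _ => dq.
have -> : e ^+ 2 * w j 0 ^+ 2 = b ^+ 2 by rewrite /b exprMn.
have : w j 0 ^+ 2 * q ^+ 2 <= w j 0 ^+ 2 * (n%:R * `|that2_ratio - tstar_ratio ^+ 2|).
  by rewrite ler_wpM2l // sqr_ge0.
rewrite -exprMn; move: (w j 0 * q) (_ * (n%:R * _)) => h' m em.
have h1 := sqr_ge0 (a + b); have h2 := sqr_ge0 (a - h'); have h3 := sqr_ge0 (b + h').
by clearbody a b; nra.
Qed.

Lemma coordinate_error_neg Z j : v < 0 -> coordinate_error Z j = v ^+ 2 * n%:R * th j 0 ^+ 2.
Proof.
move=> v0; rewrite /coordinate_error.
rewrite (prox_neg _ tau0 v0 (cgs j) (@gs_mono _ _ _ g gs tau n0 gE penR j)) subr0.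
rewrite real_normK ?num_real // rhat_normalized betaE sclE.
by move: (th j 0) (vhat _ _ _ _ _) (sn) sn0 sn2 => a v' s s0 <-; field; rewrite !gt_eqF.
Qed.

(** The inverse of 0 being 0 causes no harm, since the prefactor v^2 vanishes. *)
Lemma coordinate_error0 Z j : v = 0 -> coordinate_error Z j = 0.
Proof. by move=> v0; rewrite /coordinate_error v0 expr0n /= !mul0r. Qed.

(* With E = R1 - R2 - v R3 = v al - c. *)
Lemma ratio_remainders (w1 : dot w w = 1) (al : R) :
  let tb := wproj w *m th in let a := dot w th in let s := dot f (X *m w) in
  let N := dot (wproj w *m (X^T *m f)) (wproj w *m (X^T *m f)) in
  let M := dot f (X *m tb) in let B2 := dot tb tb in
  let R1 := N + 2 * v * M + v ^+ 2 * B2 - p%:R / n%:R in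
  let R2 := N + v * M - (p%:R / n%:R - c) in
  let R3 := M + v * B2 - al in
  let R4 := dot (X *m th) (X *m tb) - al * dot f (X *m th) - (1 - c) * B2 in
  let R5 := dot (X *m w) (X *m tb) - al * dot f (X *m w) in
  let R6 := dot (X *m w) (X *m w) - 1 in
  that2_ratio - tstar_ratio ^+ 2 =
    (1 - c) * R1 + c * R2 + v ^+ 2 * (R4 + a * R5 + a ^+ 2 * R6) +
    v * (R1 - R2 - v * R3) * (dot f (X *m th) + a * s).
Proof.
move=> tb a s N M B2 R1 R2 R3 R4 R5 R6.
have thE : X *m th = X *m tb + a *: (X *m w).
  rewrite scalemxAr -mulmxDr /tb wprojE subrK; exact: erefl.
have NE : dot (X^T *m f) (X^T *m f) = N + s ^+ 2.
  have q : wproj w *m (X^T *m f) = X^T *m f - s *: w.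
    by rewrite wprojE; congr (_ - _ *: _); rewrite /s dot_mulmx trmxK dotC.
  rewrite /N q !(dotBl, dotBr, dotZl, dotZr) w1 [dot w (X^T *m f)]dotC.
  have -> : dot (X^T *m f) w = s by rewrite /s dot_mulmx dotC.
  by move: (dot _ _) (s) => *; ring.
rewrite /that2_ratio /tstar_ratio NE -/a -/s /R1 /R2 /R3 /R4 /R5 /R6 thE.
rewrite !(dotDl, dotDr, dotZl, dotZr) -/s -/M [dot (X *m tb) (X *m w)]dotC.
by move: (dot (X *m tb) _) (dot (X *m w) (X *m tb)) (dot (X *m w) _) (vhat _ _ _ _ _) (dfhat _ _ _ _ _ / _) (N) (M) (B2) (s) (a) (p%:R / n%:R) => *; ring.
Qed.

End Observable.

#[local] Transparent psihat Dhat.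
#[local] Opaque cfgX cfgpsi cfgbeta cfgf cfgth betahat enorm zeroed column shiftv Hcol prox.

(** * Summing the coordinate errors *)

Section Conclusion.
Context {R : realType} {d : measure_display} {T : measurableType d}.
Variables (n p : nat) (mu : probability T R).
Variables (th : 'I_n * 'I_p -> R -> T -> T) (H : T -> 'M[R]_(n, p)).
Variables (zeta y : T -> 'cV[R]_n) (w : 'cV[R]_p) (K : T -> R) (tau : R).
Variables (loss : R -> R -> R) (g : 'cV[R]_p -> R) (gs : 'I_p -> R -> R).
Hypothesis gd : gaussian_design mu th H zeta y w K tau.
Hypothesis er : estimator_regular n loss g gs tau.

Let n0 := gd_n0 gd.
Let nR0 : 0 < n%:R :> R. Proof. by rewrite ltr0n. Qed.
Let sn0 : 0 < Num.sqrt n%:R :> R. Proof. by rewrite sqrtr_gt0. Qed.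
Let sn2 : Num.sqrt n%:R ^+ 2 = n%:R :> R. Proof. by rewrite sqr_sqrtr. Qed.
Let tau0 := er_tau0 er.
Local Notation X := (cfgX H zeta w).
Local Notation psi := (cfgpsi H zeta y w loss g).
Local Notation beta := (cfgbeta H zeta y w loss g).
Local Notation f := (cfgf H zeta y w loss g).
Local Notation theta := (cfgth H zeta y w loss g).
Local Notation Q := (wproj w).

Let K0 t : 0 < K t. Proof. exact: (cfgK_gt0 gd). Qed.
Let K1 t : 1 <= K t. Proof. exact: (cfgK1 gd). Qed.
Let Kge0 t a : 0 <= K t ^+ a. Proof. by rewrite exprn_ge0 // ltW. Qed.
Let Kle t a b : (a <= b)%N -> K t ^+ a <= K t ^+ b. Proof. exact: (cfgK_le gd). Qed.
Local Notation r := ((Num.sqrt n%:R)^-1).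
Local Notation sn := (Num.sqrt n%:R).

Local Notation sbound := (sbound K).
Local Notation vbound := (vbound K).
Local Notation noise := (noise th H zeta y w loss g).
Local Notation Hcol := (Hcol H).
Local Notation smooth := (smooth_at th H zeta y w loss g).
Local Notation jacob t A := (jacobian_matrix loss g ((n%:R^-1)%:M) tau (y t) (X t) A).
Local Notation D t := (Dhat loss g (y t) (X t)).
Local Notation V t A := (Vhat loss g (y t) (X t) A).
Local Notation tb t := (Q *m theta t).
Local Notation v t A := (vhat loss g (y t) (X t) A).
Local Notation c t A := (dfhat loss g (y t) (X t) A / n%:R).
Local Notation al A := (\tr A / n%:R).

Let sn1 : 1 <= sn :> R.
Proof. by have := @ler_wsqrtr R 1 n%:R; rewrite sqrtr1 ler1n; apply. Qed.

Let ninv1 : n%:R^-1 <= 1 :> R. Proof. by rewrite invf_le1 // ler1n. Qed.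
Let ninv0 : 0 <= n%:R^-1 :> R. Proof. by rewrite invr_ge0 ltW. Qed.

Definition Rem1 t (A : 'M[R]_p) : R := dot (Q *m ((X t)^T *m f t)) (Q *m ((X t)^T *m f t)) +
  2 * v t A * dot (f t) (X t *m tb t) + v t A ^+ 2 * dot (tb t) (tb t) - p%:R / n%:R.
Definition Rem2 t (A : 'M[R]_p) : R := dot (Q *m ((X t)^T *m f t)) (Q *m ((X t)^T *m f t)) +
  v t A * dot (f t) (X t *m tb t) - (p%:R / n%:R - c t A).
Definition Rem3 t (A : 'M[R]_p) : R := dot (f t) (X t *m tb t) + v t A * dot (tb t) (tb t) - al A.
Definition Rem4 t (A : 'M[R]_p) : R := dot (X t *m theta t) (X t *m tb t) - al A * dot (f t) (X t *m theta t) -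
  (1 - c t A) * dot (tb t) (tb t).
Definition Rem5 t (A : 'M[R]_p) : R := dot (X t *m w) (X t *m tb t) - al A * dot (f t) (X t *m w).
Definition Rem6 t : R := dot (X t *m w) (X t *m w) - 1.
Definition gap t (A : 'M[R]_p) : R := that2_ratio loss g (y t) (X t) A (f t) (theta t) -
  tstar_ratio loss g (y t) (X t) A (f t) (theta t) w ^+ 2.

Section AtPoint.
Variables (t : T) (A : 'M[R]_p).
Hypothesis ja : jacob t A.

Let bf := vbound_f gd er t.
Let bw := vbound_w gd t.
Let bth := vbound_th gd er t.
Let btb : vbound t (tb t) 2 := vbound_proj gd bth.
Let bXth : vbound t (X t *m theta t) 3. Proof. exact (vbound_mul gd (mbound_X gd t) bth). Qed.
Let bXtb : vbound t (X t *m tb t) 3. Proof. exact (vbound_mul gd (mbound_X gd t) btb). Qed.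
Let bXw : vbound t (X t *m w) 1. Proof. exact (vbound_mul gd (mbound_X gd t) bw). Qed.
Let bg : vbound t (Q *m ((X t)^T *m f t)) 1.
Proof. exact (vbound_proj gd (vbound_mul gd (mbound_XT gd t) bf)). Qed.
Let bN : sbound t (dot (Q *m ((X t)^T *m f t)) (Q *m ((X t)^T *m f t))) 2. Proof. exact (sbound_dot bg bg). Qed.
Let bM : sbound t (dot (f t) (X t *m tb t)) 3. Proof. exact (sbound_dot bf bXtb). Qed.
Let bB : sbound t (dot (tb t) (tb t)) 4. Proof. exact (sbound_dot btb btb). Qed.
Let bv : sbound t (v t A) 4 := vhat_bound gd er ja.
Let bc : sbound t (c t A) 3 := dfhat_bound gd er ja.
Let bal : sbound t (al A) 2 := trA_bound gd ja.
Let bP : sbound t (p%:R / n%:R) 1.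
Proof.
have h : `|p%:R / n%:R| <= K t ^+ 1 :> R by rewrite ger0_norm ?divr_ge0 // expr1; exact: (gd_Kp gd).
exact h.
Qed.
Let bMf : sbound t (dot (f t) (X t *m theta t)) 3. Proof. exact (sbound_dot bf bXth). Qed.
Let bs : sbound t (dot (f t) (X t *m w)) 1. Proof. exact (sbound_dot bf bXw). Qed.
Let ba : sbound t (dot w (theta t)) 2. Proof. exact (sbound_dot bw bth). Qed.

Let b1c : sbound t (1 - c t A) 4. Proof. exact (sboundB gd (sbound1 K t) bc). Qed.
Let bvM : sbound t (v t A * dot (f t) (X t *m tb t)) 7. Proof. exact (sboundM bv bM). Qed.
Let bv2 : sbound t (v t A ^+ 2) 8. Proof. rewrite expr2; exact (sboundM bv bv). Qed.

Let bound14 x a : sbound t x a -> (a <= 14)%N -> sbound t x 14.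
Proof. by move=> h ha; exact: (sbound_wk gd ha h). Qed.

Lemma Rem_bound14 : [/\ sbound t (Rem1 t A) 14, sbound t (Rem2 t A) 14, sbound t (Rem3 t A) 14,
  sbound t (Rem4 t A) 14 & sbound t (Rem5 t A) 14 /\ sbound t (Rem6 t) 14].
Proof.
split; last split.
- rewrite /Rem1 -mulrA mulr_natl mulr2n.
  exact: (bound14 (sboundB gd (sboundD gd (sboundD gd bN (sboundD gd bvM bvM)) (sboundM bv2 bB)) bP)).
- exact: (bound14 (sboundB gd (sboundD gd bN bvM) (sboundB gd bP bc))).
- exact: (bound14 (sboundB gd (sboundD gd bM (sboundM bv bB)) bal)).
- exact: (bound14 (sboundB gd (sboundB gd (sbound_dot bXth bXtb) (sboundM bal bMf)) (sboundM b1c bB))).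
- exact: (bound14 (sboundB gd (sbound_dot bXw bXtb) (sboundM bal bs))).
- exact: (bound14 (sboundB gd (sbound_dot bXw bXw) (sbound1 K t))).
Qed.

Let coef_le x b a : sbound t x a -> (a <= 12)%N -> `|x * b| <= K t ^+ 12 * `|b|.
Proof. by move=> h ha; rewrite normrM ler_wpM2r //; exact: (sbound_wk gd ha h). Qed.

Lemma gap_le : `|gap t A| <= K t ^+ 12 *
  (`|Rem1 t A| + `|Rem2 t A| + `|Rem3 t A| + `|Rem4 t A| + `|Rem5 t A| + `|Rem6 t|).
Proof.
have := ratio_remainders loss g (y t) (X t) A (f t) (theta t) (gd_w gd) (al A).
cbv zeta; rewrite -/(gap t A) -/(Rem1 t A) -/(Rem2 t A) -/(Rem3 t A) -/(Rem4 t A) -/(Rem5 t A) -/(Rem6 t) => ->.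
pose m := dot (f t) (X t *m theta t) + dot w (theta t) * dot (f t) (X t *m w).
have bm : sbound t m 4 by exact: (sboundD gd bMf (sboundM ba bs)).
have h1 := coef_le (Rem1 t A) (sboundD gd b1c (sboundM bv bm)) isT.
have h2 := coef_le (Rem2 t A) (sboundB gd bc (sboundM bv bm)) isT.
have h3 := coef_le (Rem3 t A) (sboundN (sboundM bv2 bm)) isT.
have h4 := coef_le (Rem4 t A) bv2 isT.
have h5 := coef_le (Rem5 t A) (sboundM bv2 ba) isT.
have h6 := coef_le (Rem6 t) (sboundM bv2 (sboundM ba ba)) isT.
have -> : (1 - c t A) * Rem1 t A + c t A * Rem2 t A +
    v t A ^+ 2 * (Rem4 t A + dot w (theta t) * Rem5 t A + dot w (theta t) ^+ 2 * Rem6 t) +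
    v t A * (Rem1 t A - Rem2 t A - v t A * Rem3 t A) *
      (dot (f t) (X t *m theta t) + dot w (theta t) * dot (f t) (X t *m w)) =
  (1 - c t A + v t A * m) * Rem1 t A + (c t A - v t A * m) * Rem2 t A + (- (v t A ^+ 2 * m)) * Rem3 t A +
  v t A ^+ 2 * Rem4 t A + v t A ^+ 2 * dot w (theta t) * Rem5 t A +
  v t A ^+ 2 * (dot w (theta t) * dot w (theta t)) * Rem6 t.
  rewrite -/m; move: (Rem1 _ _) (Rem2 _ _) (Rem3 _ _) (Rem4 _ _) (Rem5 _ _) (Rem6 _) (m) (v t A) (c t A) (dot w _).
  by move=> *; ring.
have nD (a b a' b' : R) : `|a| <= a' -> `|b| <= b' -> `|a + b| <= a' + b'.
  by move=> ha hb; apply: le_trans (ler_normD _ _) _; exact: lerD.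
apply: (le_trans (nD _ _ _ _ (nD _ _ _ _ (nD _ _ _ _ (nD _ _ _ _ (nD _ _ _ _ h1 h2) h3) h4) h5) h6)).
rewrite le_eqVlt; apply/orP; left; apply/eqP.
by move: `|Rem1 _ _| `|Rem2 _ _| `|Rem3 _ _| `|Rem4 _ _| `|Rem5 _ _| `|Rem6 _| (K t ^+ 12) => *; ring.
Qed.

(** A bound without any smallness, for the event where [K] is large. *)
Lemma gap_le28 : `|gap t A| <= K t ^+ 28.
Proof.
apply: le_trans gap_le _; have [b1 b2 b3 b4 [b5 b6]] := Rem_bound14.
have -> : K t ^+ 28 = K t ^+ 12 * K t ^+ 16 by rewrite -exprD.
rewrite ler_wpM2l //.
have sb x a : sbound t x a -> `|x| <= K t ^+ a by [].
have h1 : 4 * K t ^+ 14 <= K t ^+ 15 by apply: (cfgK_num gd) => //; lra.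
have h2 : 4 * K t ^+ 15 <= K t ^+ 16 by apply: (cfgK_num gd) => //; lra.
have := Kge0 t 14; move: (sb _ _ b1) (sb _ _ b2) (sb _ _ b3) (sb _ _ b4) (sb _ _ b5) (sb _ _ b6) h1 h2; move: `|Rem1 _ _| `|Rem2 _ _| `|Rem3 _ _| `|Rem4 _ _| `|Rem5 _ _| `|Rem6 _| (K t ^+ 14) (K t ^+ 15) (K t ^+ 16) => *; lra.
Qed.

Lemma chat_bound : 0 <= chat loss g ((n%:R^-1)%:M) tau (y t) (X t) <= K t ^+ 3.
Proof.
rewrite /chat; have nt0 : 0 <= (n%:R * tau)^-1 by rewrite invr_ge0 mulr_ge0 ?ltW.
rewrite mulr_ge0 ?sqr_ge0 //= (invmx_sqrtmx n0).
have h : opnorm (sqrtmx (D t) *m X t *m sn%:M) <= K t * sn.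
  apply: opnorm_le; first by rewrite mulr_ge0 ?ltW.
  move=> u; rewrite mul_mx_scalar -scalemxAl enormZ ger0_norm ?(ltW sn0) //.
  rewrite [K t * sn]mulrC -mulrA ler_wpM2l ?(ltW sn0) //.
  rewrite -mulmxA; apply: le_trans (gd_KX gd t u).
  by apply: sqrtmx_le1 => u'; have := mbound_D H zeta y w K er t u'; rewrite expr0 mul1r.
have o0 : 0 <= opnorm (sqrtmx (D t) *m X t *m sn%:M) by exact: opnorm_ge0.
apply: (@le_trans _ _ ((n%:R * tau)^-1 * (K t * sn) ^+ 2)).
  by rewrite ler_wpM2l // ler_sqr ?nnegrE // mulr_ge0 ?ltW.
rewrite exprMn sn2 invfM.
have -> : n%:R^-1 / tau * (K t ^+ 2 * n%:R) = K t ^+ 2 / tau by field; rewrite !gt_eqF.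
have -> : K t ^+ 3 = K t ^+ 2 * K t by rewrite -exprSr.
by apply: (div_tau gd).
Qed.

(** tr V can be negative only in the degenerate case, where it is at least -4 chat, and chat is
    bounded by a power of [K]; finally tr V = n v. *)
Lemma vhat_neg_le : v t A < 0 -> v t A ^+ 2 * n%:R <= n%:R^-1 * K t ^+ 8.
Proof.
move=> v0; have /andP[ch0 ch1] := chat_bound.
have trD : 0 <= \tr (D t).
  rewrite /mxtrace; apply: sumr_ge0 => i _; rewrite /Dhat mxE eqxx mulr1n mxE.
  have /andP[h0 _] := derive1_derive1_01 (loss_convex (er_loss er) (y0 := y t i 0) I)
    (loss_derivable (er_loss er) (y0 := y t i 0) I) (loss_lip (er_loss er) (y t i 0))
    ((X t *m betahat loss g (y t) (X t)) i 0).
  exact h0.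
have q0 : 0 <= \tr (D t) / (1 + chat loss g ((n%:R^-1)%:M) tau (y t) (X t)) by rewrite divr_ge0 ?addr_ge0.
have nv : n%:R * v t A = \tr (V t A) by rewrite /vhat mulrA mulfV ?mul1r // gt_eqF.
have trV : \tr (V t A) < 0 by rewrite -nv pmulr_rlt0.
have lo : - 4 * chat loss g ((n%:R^-1)%:M) tau (y t) (X t) <= \tr (V t A).
  have [e|e] := eqVneq (D t *m X t *m betahat loss g (y t) (X t)) (psihat loss g (y t) (X t)).
    by have [_ _ h _] := jac_degenerate ja e; apply: le_trans h; rewrite lerDl.
  by have [_ _ h _] := jac_generic ja e; have := le_trans q0 h; rewrite leNgt trV.
have h4 : 4 * K t ^+ 3 <= K t ^+ 4 by apply: (cfgK_num gd) => //; lra.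
have h5 : `|\tr (V t A)| <= K t ^+ 4.
  rewrite ltr0_norm //; move: lo ch1 h4; move: (chat _ _ _ _ _ _) (\tr _) (K t ^+ 3) (K t ^+ 4) => *; lra.
have -> : v t A ^+ 2 * n%:R = n%:R^-1 * (n%:R * v t A) ^+ 2.
  by move: (vhat _ _ _ _ _) => x; field; rewrite gt_eqF.
rewrite ler_wpM2l // nv -real_normK ?num_real // (_ : K t ^+ 8 = K t ^+ 4 ^+ 2) ?ler_sqr ?nnegrE //.
by rewrite -exprM.
Qed.

End AtPoint.

Variable cN : nat -> R.
Hypothesis EK : forall N, Ele mu (fun t => K t ^+ N) (cN N).

Definition eta_const : R := steinc (cN 12) (cN 14).
Definition residual_const : R := 2 * column_const cN + 2 * cN 12.
Definition Rem1_const : R := 1 + cN 1 * noise_const cN + cN 1 * (1 + gaussc) + 2 * residual_const + eta_const.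

Let cN0 N : 0 <= cN N. Proof. exact: Ele_ge0 (EK N). Qed.

Let aspect (x : R) : 0 <= x -> n%:R^-1 * (p%:R * x) <= cN 1 * x.
Proof. by move=> x0; rewrite mulrA [_ * p%:R]mulrC ler_wpM2r // (aspect_le gd EK). Qed.

(** R_1 does not come from a single field: n R_1 + p is, up to the square of the index component,
    the squared norm of the noise plus its residuals, and [noise_norm] compares the noise with p. *)
Lemma error_terms : exists W : 'I_p -> T -> R, exists eta : T -> R, exists G1 : T -> R,
  [/\ forall j, measurable_fun setT (W j) /\ forall t, 0 <= W j t,
      Ele mu (fun t => \sum_j W j t) residual_const, Ele mu eta eta_const, Ele mu G1 Rem1_const &
   forall t A, smooth t -> jacob t A ->
     [/\ eta t = dot (f t) (H t *m w) ^+ 2, sn * `|Rem1 t A| <= G1 t &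
       forall j, (sn * (v t A * tb t j 0 + (Q *m ((X t)^T *m f t)) j 0) +
         dot (f t) (H t *m w) * w j 0 - noise j t) ^+ 2 <= W j t]].
Proof.
have [Xi [cx EXi Scx] XiE] := column_stein gd er EK.
have [eta Eeta etaE] := index_noise gd er EK.
have [Xz EXz XzE] := noise_norm gd er EK.
have mq j : measurable_fun setT (fun t => dot (cfgq w j) (theta t)).
  by apply: measurable_sum => i; apply: measurable_funM => //; exact: (measurable_cfgth gd er).
have mK N : measurable_fun setT (fun t => K t ^+ N) by case: (EK N).
pose W j t := 2 * Xi j t + 2 * (n%:R^-1 * (dot (cfgq w j) (theta t) ^+ 2 * K t ^+ 8)).
have W0 j t : 0 <= W j t.
  have [_ x0 _] := EXi j; rewrite addr_ge0 // mulr_ge0 // mulr_ge0 // mulr_ge0 //; exact: sqr_ge0.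
have mW j : measurable_fun setT (W j).
  have [mx _ _] := EXi j; apply: measurable_funD; first exact: measurable_funM.
  do 2 (apply: measurable_funM => //); apply: measurable_funM => //.
  exact: (measurable_funX 2 (mq j)).
have EW : Ele mu (fun t => \sum_j W j t) residual_const.
  have h := EleD (EleZ (ler0n R 2) (Ele_sum (index_enum 'I_p) EXi)) (EleZ (ler0n R 2) (EK 12)).
  apply: Ele_wk (Ele_le _ _ h).
  - rewrite /residual_const lerD2r ler_wpM2l //.
  - exact: measurable_sum.
  move=> t; rewrite sumr_ge0 //= /W big_split /= -!mulr_sumr lerD2l ler_wpM2l //.
  rewrite -mulr_suml (sum_cfgq_sqr w).
  have b1 : dot (tb t) (tb t) <= K t ^+ 4.
    have := sbound_dot (vbound_proj gd (vbound_th gd er t)) (vbound_proj gd (vbound_th gd er t)).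
    by apply: le_trans; exact: ler_norm.
  have b2 : dot (tb t) (tb t) * K t ^+ 8 <= K t ^+ 12.
    have -> : K t ^+ 12 = K t ^+ 4 * K t ^+ 8 by rewrite -exprD.
    by rewrite ler_wpM2r.
  apply: le_trans b2; apply: ler_piMl => //; rewrite mulr_ge0 //; exact: dot_ge0.
pose z t := \sum_j noise j t ^+ 2.
have Ez : Ele mu z (p%:R * (1 + gaussc)).
  have := Ele_sum (index_enum 'I_p) (fun j => noise_moment2 gd er j).
  by have -> : \sum_(j < p) (1 + gaussc) = p%:R * (1 + gaussc) :> R by rewrite sumr_const card_ord mulr_natl.
pose G1 t := 1 + n%:R^-1 * Xz t + n%:R^-1 * z t + 2 * (\sum_j W j t) + eta t.
have EG1 : Ele mu G1 Rem1_const.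
  have h := EleD (EleD (EleD (EleD (Ele_cst mu ler01) (EleZ ninv0 EXz)) (EleZ ninv0 Ez))
    (EleZ (ler0n R 2) EW)) Eeta.
  apply: Ele_wk h; rewrite /Rem1_const lerD2r lerD2r -!addrA lerD2l; apply: lerD; apply: aspect.
    have c16 := cN0 16; have c8 := cN0 8; have m0 := @gaussc_ge0 R; have e0 := expR_ge0 (1 : R).
    have mc : 0 <= gaussc * cN 8 :> R by rewrite mulr_ge0.
    rewrite /noise_const /steinc addr_ge0 ?mulr_ge0 //; lra.
  by rewrite addr_ge0 // gaussc_ge0.
exists W, eta, G1; split => // t A st ja.
have eE := etaE t A st ja.
pose u j := sn * (v t A * tb t j 0 + (Q *m ((X t)^T *m f t)) j 0).
pose eh := dot (f t) (H t *m w).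
have addE (a b : 'cV[R]_p) j : (a + b) j 0 = a j 0 + b j 0 by rewrite mxE.
have sclE (a : R) (b : 'cV[R]_p) j : (a *: b) j 0 = a * b j 0 by rewrite mxE.
have QXf : sn *: (Q *m ((X t)^T *m f t)) = Q *m ((H t)^T *m f t).
  apply/matrixP => j k; rewrite !ord1 sclE -!dot_delta -[dot _ (Q *m _)]dot_wproj -[RHS]dot_wproj.
  have tr (M : 'M[R]_(n, p)) a b : dot a (M^T *m b) = dot b (M *m a) by rewrite dot_mulmx trmxK dotC.
  by rewrite !tr (dot_cfgH_gen gd).
have hj j : (sn *: (Q *m ((X t)^T *m f t))) j 0 = dot (f t) (Hcol j t) - eh * w j 0.
  rewrite QXf wprojE.
  have -> : ((H t)^T *m f t - dot w ((H t)^T *m f t) *: w) j 0 =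
    ((H t)^T *m f t) j 0 - dot w ((H t)^T *m f t) * w j 0 by rewrite !mxE.
  congr (_ - _ * _); last by rewrite dot_mulmx trmxK dotC.
  rewrite -dot_delta dot_mulmx trmxK dotC; congr dot; apply/matrixP => i k.
  by rewrite !ord1 mulmx_delta mxE.
have res j : (u j + eh * w j 0 - noise j t) ^+ 2 <= W j t.
  have := XiE t A st ja j.
  rewrite (sum_dirf_col w r (theta t) (dot_cfgf gd er t)).
  have ve : vhat loss g (y t) (X t) A * n%:R = \tr (V t A) by rewrite /vhat mulrC mulrA mulfV ?mul1r // gt_eqF.
  have -> : \tr (D t - D t *m X t *m A *m (X t)^T *m D t) = v t A * n%:R by rewrite ve.
  have -> : D t - D t *m X t *m A *m (X t)^T *m D t = V t A by [].
  have bV : `|dot (f t) (V t A *m f t)| <= K t ^+ 4.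
    exact: (sbound_dot (vbound_f gd er t) (vbound_mul gd (mbound_V gd er ja) (vbound_f gd er t))).
  have -> : u j + eh * w j 0 = dot (f t) (Hcol j t) + sn * v t A * tb t j 0.
    have := hj j; rewrite sclE /u mulrDr => ->; move: (dot _ _) (v t A) (tb t j 0) => a b e.
    by rewrite mulrA; move: (eh * _) => q; ring.
  rewrite /W dot_cfgq; have -> : n%:R^-1 = r ^+ 2 :> R by rewrite exprVn sn2.
  have nr : r * n%:R = sn :> R.
    by apply: (mulfI (lt0r_neq0 sn0)); rewrite mulrA mulfV ?lt0r_neq0 // mul1r -expr2 sn2.
  move=> ->; have -> : K t ^+ 8 = (K t ^+ 4) ^+ 2 by rewrite -exprM.
  have bV2 : dot (f t) (V t A *m f t) ^+ 2 <= (K t ^+ 4) ^+ 2.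
    by rewrite -(real_normK (num_real (dot _ _))) ler_sqr ?nnegrE.
  rewrite -[in X in (X <= _)]nr.
  move: (dot (f t) (Hcol j t)) (noise j t) (dot (f t) (V t A *m f t)) (v t A) (tb t j 0) (K t ^+ 4) (n%:R : R) (r) bV2.
  move=> a b e vv tt k nn rr bV2.
  have h1 : (rr * tt) ^+ 2 * e ^+ 2 <= (rr * tt) ^+ 2 * k ^+ 2 by rewrite ler_wpM2l ?sqr_ge0.
  have := sqr_ge0 (a - b - - rr * tt * (vv * nn - e) - rr * tt * e).
  by rewrite !exprMn in h1 *; nra.
split => //.
(* The vector u is orthogonal to w, so adding [eh] times w changes its squared norm by [eh]^2. *)
have nR1 : n%:R * Rem1 t A = \sum_j (u j + eh * w j 0) ^+ 2 - eh ^+ 2 - p%:R.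
  have wu : \sum_j u j * w j 0 = 0.
    have -> : \sum_j u j * w j 0 = sn * dot (Q *m (v t A *: theta t + (X t)^T *m f t)) w.
      rewrite /dot mulr_sumr; apply: eq_bigr => j _; rewrite mulmxDr -scalemxAr addE sclE /u.
      by rewrite mulrA.
    by rewrite dot_wproj (wproj_w gd) dot0r mulr0.
  have w2 : \sum_j w j 0 ^+ 2 = 1 by rewrite -[RHS](gd_w gd); apply: eq_bigr => i _; rewrite expr2.
  have u2 : \sum_j u j ^+ 2 = n%:R * (dot (Q *m ((X t)^T *m f t)) (Q *m ((X t)^T *m f t)) +
      2 * v t A * dot (f t) (X t *m tb t) + v t A ^+ 2 * dot (tb t) (tb t)).
    have -> : \sum_j u j ^+ 2 = n%:R * dot (v t A *: tb t + Q *m ((X t)^T *m f t)) (v t A *: tb t + Q *m ((X t)^T *m f t)).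
      rewrite /dot mulr_sumr; apply: eq_bigr => j _; rewrite addE sclE /u exprMn sn2 expr2.
      by [].
    have -> : dot (f t) (X t *m tb t) = dot (tb t) (Q *m ((X t)^T *m f t)).
      by rewrite -[RHS]dot_wproj [Q *m tb t]mulmxA (wproj_idem gd) [RHS]dot_mulmx trmxK dotC.
    rewrite !(dotDl, dotDr, dotZl, dotZr) [dot (Q *m (_ *m _)) (tb t)]dotC.
    by move: (dot (tb t) (tb t)) (dot (tb t) _) (dot _ _) (v t A) (n%:R : R) => *; ring.
  have -> : \sum_j (u j + eh * w j 0) ^+ 2 = \sum_j u j ^+ 2 + eh ^+ 2.
    have sq e0 : \sum_j (u j + e0 * w j 0) ^+ 2 =
        \sum_j u j ^+ 2 + 2 * e0 * (\sum_j u j * w j 0) + e0 ^+ 2 * \sum_j w j 0 ^+ 2.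
      rewrite !mulr_sumr -!big_split /=; apply: eq_bigr => j _.
      by move: (u j) (w j 0) => *; ring.
    rewrite (sq eh).
    by rewrite wu w2 mulr0 addr0 mulr1.
  rewrite u2 addrK /Rem1 mulrBr; congr (_ - _).
  by rewrite mulrC mulfVK // gt_eqF.
pose xi j := u j + eh * w j 0 - noise j t.
have E1 : \sum_j (u j + eh * w j 0) ^+ 2 = z t + 2 * (\sum_j noise j t * xi j) + \sum_j xi j ^+ 2.
  rewrite /z mulr_sumr -!big_split /=; apply: eq_bigr => j _; rewrite /xi.
  by move: (u j) (eh * _) (noise j t) => *; ring.
have xW : \sum_j xi j ^+ 2 <= \sum_j W j t by apply: ler_sum => j _; exact: res.
(* The weight sqrt n balances the two sides: the noise has squared norm of order p, the residuals of
   order one. *)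
have cross : 2 * `|\sum_j noise j t * xi j| <= z t / sn + sn * \sum_j xi j ^+ 2.
  have h0 : `|\sum_j noise j t * xi j| <= \sum_j `|noise j t * xi j| by exact: ler_norm_sum.
  apply: (@le_trans _ _ (2 * \sum_j `|noise j t * xi j|)); first by rewrite ler_wpM2l.
  rewrite /z mulr_suml !mulr_sumr -big_split /=; apply: ler_sum => j _.
  rewrite normrM -(real_normK (num_real (noise j t))) -(real_normK (num_real (xi j))).
  move: `|noise j t| `|xi j| => a b; have := sqr_ge0 (a - sn * b).
  move: (sn) sn0 => s s0 h; rewrite -(ler_pM2l s0).
  have -> : s * (a ^+ 2 / s + s * b ^+ 2) = a ^+ 2 + s ^+ 2 * b ^+ 2 by field; rewrite gt_eqF.
  by nra.
have zp : r * `|z t - p%:R| <= 1 + n%:R^-1 * Xz t.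
  rewrite XzE -/(z t) -[X in _ <= _ + _ * X]real_normK ?num_real //.
  have -> : n%:R^-1 = r ^+ 2 :> R by rewrite exprVn sn2.
  by move: `|_| (r) => a s; have := sqr_ge0 (s * a - 2^-1); nra.
have e1 : sn * `|Rem1 t A| = r * `|n%:R * Rem1 t A|.
  rewrite normrM gtr0_norm // mulrA; congr (_ * _).
  by apply: (mulfI (lt0r_neq0 sn0)); rewrite mulrA mulfV ?lt0r_neq0 // mul1r -expr2 sn2.
rewrite e1 nR1 E1.
have tri : `|z t + 2 * (\sum_j noise j t * xi j) + \sum_j xi j ^+ 2 - eh ^+ 2 - p%:R| <=
    `|z t - p%:R| + (z t / sn + sn * \sum_j xi j ^+ 2) + \sum_j xi j ^+ 2 + eh ^+ 2.
  have x0 : 0 <= \sum_j xi j ^+ 2 by apply: sumr_ge0 => j _; exact: sqr_ge0.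
  have h0 := sqr_ge0 eh; move: cross x0 h0; move: (\sum_j noise j t * xi j) (\sum_j xi j ^+ 2) (eh ^+ 2) (z t / sn + _) => a b e q.
  have := ler_norm a; have := ler_norm (- a); rewrite normrN.
  have := ler_norm (z t - p%:R); have := ler_norm (- (z t - p%:R)); rewrite normrN.
  by move: `|_| `|_| => n1 n2 *; rewrite ler_norml; apply/andP; split; lra.
have r0 : 0 <= (r : R) by rewrite invr_ge0 ltW.
apply: le_trans (ler_wpM2l r0 tri) _; rewrite /G1 eE -/eh.
have r1 : (r : R) <= 1 by rewrite invf_le1.
have x0 : 0 <= \sum_j xi j ^+ 2 by apply: sumr_ge0 => j _; exact: sqr_ge0.
have z0 : 0 <= z t by apply: sumr_ge0 => j _; exact: sqr_ge0.
have rs : r * sn = 1 :> R by rewrite mulVf // gt_eqF.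
have rr : n%:R^-1 = r * r :> R by rewrite -expr2 exprVn sn2.
rewrite !mulrDr [r * (sn * _)]mulrA rs mul1r; rewrite rr in zp *.
have t1 : r * (\sum_j xi j ^+ 2) <= \sum_j xi j ^+ 2 by exact: ler_piMl.
have t2 : r * eh ^+ 2 <= eh ^+ 2 by apply: ler_piMl => //; exact: sqr_ge0.
have -> : r * (z t / sn) = r * r * z t by ring.
by lra.
Qed.

Variables (k0 cz : R).
Hypothesis k0K : forall t, k0 <= K t.
Hypothesis k00 : 0 <= k0.
Hypothesis EKk : forall N, Ele mu (fun t => K t ^+ N * (K t - k0)) (cN N / n%:R).
Hypothesis Ez : Ele mu (fun t => (dot (zeta t) (zeta t) - n%:R) ^+ 2) (n%:R * cz).

Definition remainders_const : R :=
  Rem1_const + (1 + steinc (cN 44) (cN 46) + cN 12) + (1 + steinc (cN 36) (cN 38) + cN 14) +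
  (1 + steinc (cN 80) (cN 82) + cN 18) + (1 + steinc (cN 26) (cN 28) + cN 16) + (1 + cz).

Definition majorant_const : R :=
  3 * (residual_const + eta_const + (k0 + 1) ^+ 12 * remainders_const + cN 28) + cN 12.

Let Rem6_le t : sn * `|Rem6 t| <= 1 + n%:R^-1 * (dot (zeta t) (zeta t) - n%:R) ^+ 2.
Proof.
have nr : n%:R^-1 = r ^+ 2 :> R by rewrite exprVn sn2.
have -> : Rem6 t = r ^+ 2 * (dot (zeta t) (zeta t) - n%:R).
  rewrite /Rem6 (cfgX_w gd) dotZl dotZr -nr mulrBr mulVf ?gt_eqF //.
  by rewrite mulrA -expr2 nr.
rewrite normrM ger0_norm ?sqr_ge0 // mulrA; have -> : sn * r ^+ 2 = r :> R.
  by rewrite expr2 mulrA mulfV ?mul1r // gt_eqF.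
rewrite nr -[X in _ <= _ + _ * X]real_normK ?num_real //.
by move: `|_| (r) => a s; have := sqr_ge0 (s * a - 2^-1); nra.
Qed.

(** The majorant is the same for all admissible matrices A and is measurable by construction. Its
    total is of order sqrt n, which the division by p turns into the rate. *)
Theorem coordinate_majorant : exists2 maj : 'I_p -> T -> R,
  [/\ forall j, measurable_fun setT (maj j), forall j t, 0 <= maj j t &
      Ele mu (fun t => \sum_j maj j t) (sn * majorant_const)] &
  exists N, [/\ measurable N, mu N = 0%E & forall t, ~ N t -> forall A, jacob t A ->
    forall j, coordinate_error loss g (y t) (X t) A w gs (noise j t) j <= maj j t].
Proof.
have [W [eta [G1 [WP EW Eeta EG1 PE]]]] := error_terms.
have [X2 E2 P2] := remainder_R2 gd er EK.
have [X3 E3 P3] := remainder_R3 gd er EK.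
have [X4 E4 P4] := remainder_R4 gd er EK.
have [X5 E5 P5] := remainder_R5 gd er EK.
pose G t := G1 t + (1 + X2 t + K t ^+ 12) + (1 + X3 t + K t ^+ 14) + (1 + X4 t + K t ^+ 18) +
  (1 + X5 t + K t ^+ 16) + (1 + n%:R^-1 * (dot (zeta t) (zeta t) - n%:R) ^+ 2).
have e1 : Ele mu (fun=> 1) 1 := Ele_cst mu ler01.
have Ez' : Ele mu (fun t => n%:R^-1 * (dot (zeta t) (zeta t) - n%:R) ^+ 2) cz.
  by have := EleZ ninv0 Ez; rewrite mulKf // gt_eqF.
have EG : Ele mu G remainders_const.
  exact: (EleD (EleD (EleD (EleD (EleD EG1 (EleD (EleD e1 E2) (EK 12))) (EleD (EleD e1 E3) (EK 14)))
    (EleD (EleD e1 E4) (EK 18))) (EleD (EleD e1 E5) (EK 16))) (EleD e1 Ez')).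
have k1 : 0 <= (k0 + 1) ^+ 12 by rewrite exprn_ge0 // addr_ge0.
(* The first term serves where K <= k0 + 1. The second serves elsewhere, where K - k0 is at least 1;
   its mean is bounded because [EKk] gains the factor 1/n. *)
pose B t := sn * ((k0 + 1) ^+ 12 * G t) + n%:R * (K t ^+ 28 * (K t - k0)).
have EB : Ele mu B (sn * ((k0 + 1) ^+ 12 * remainders_const) + cN 28).
  have := EleD (EleZ (ltW sn0) (EleZ k1 EG)) (EleZ (ltW nR0) (EKk 28)).
  by rewrite [n%:R * (_ / _)]mulrC mulfVK // gt_eqF.
have [mB B0 _] := EB; have [mE E0 _] := Eeta.
have mth j : measurable_fun setT (fun t => theta t j 0) := measurable_cfgth gd er j.
pose maj j t := 3 * (W j t + eta t * w j 0 ^+ 2 + w j 0 ^+ 2 * B t) +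
  n%:R^-1 * (theta t j 0 ^+ 2 * K t ^+ 8).
have maj0 j t : 0 <= maj j t.
  have [_ w0] := WP j; rewrite addr_ge0 // mulr_ge0 // ?addr_ge0 // mulr_ge0 //; exact: sqr_ge0.
have mmaj j : measurable_fun setT (maj j).
  have [mw _] := WP j; have [mk _ _] := EK 8; apply: measurable_funD; last first.
    by apply: measurable_funM => //; apply: measurable_funM => //; exact: (measurable_funX 2 (mth j)).
  apply: measurable_funM => //; apply: measurable_funD; last exact: measurable_funM.
  by apply: measurable_funD => //; exact: measurable_funM.
have w2 : \sum_j w j 0 ^+ 2 = 1 by rewrite -[RHS](gd_w gd); apply: eq_bigr => i _; rewrite expr2.
exists maj; first split => //.
  have h := EleD (EleZ (ler0n R 3) (EleD (EleD EW Eeta) EB)) (EK 12).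
  apply: Ele_wk (Ele_le _ _ h).
  - have c1 := Ele_ge0 EW; have c2 := Ele_ge0 Eeta; have c3 := cN0 28; have c4 := cN0 12.
    rewrite /majorant_const; move: sn1 c1 c2 c3 c4; move: residual_const eta_const ((k0 + 1) ^+ 12 * _) (cN 28) (cN 12) (sn) => a b e f1 f2 s *.
    by nra.
  - exact: measurable_sum.
  move=> t; rewrite sumr_ge0 //= /maj big_split /= -mulr_sumr !big_split /= -!mulr_sumr -!mulr_suml w2 mulr1 mul1r lerD2l.
  have -> : \sum_i theta t i 0 ^+ 2 = enorm (theta t) ^+ 2.
    by rewrite enorm_sqr; apply: eq_bigr => i _; rewrite expr2.
  have b1 : enorm (theta t) ^+ 2 <= K t ^+ 4.
    have -> : K t ^+ 4 = (K t ^+ 2) ^+ 2 by rewrite -exprM.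
    by rewrite ler_sqr ?nnegrE ?enorm_ge0 //; exact: (enorm_cfgth gd er).
  have b2 : enorm (theta t) ^+ 2 * K t ^+ 8 <= K t ^+ 12.
    have -> : K t ^+ 12 = K t ^+ 4 * K t ^+ 8 by rewrite -exprD.
    by rewrite ler_wpM2r.
  by apply: le_trans b2; apply: ler_piMl => //; rewrite mulr_ge0 // sqr_ge0.
have [N [mN N0 Nsm]] := smooth_ae gd er.
exists N; split => // t Nt A ja j; have st := Nsm t Nt.
have [etaE R1G Wres] := PE t A st ja.
have z0 := enorm_cfgpsi_gt0 gd er t.
have pE : psihat loss g (y t) (X t) = enorm (cfgpsi H zeta y w loss g t) *: f t := cfgpsiE gd er t.
have bE : betahat loss g (y t) (X t) = enorm (cfgpsi H zeta y w loss g t) *: theta t := cfgbetaE gd er t.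
have f1 := dot_cfgf gd er t.
have [v0|v0|v0] := ltgtP (v t A) 0; last first.
- by rewrite (coordinate_error0 _ _ _ _ v0).
- apply: le_trans (coordinate_error_pos w n0 z0 pE bE f1 tau0 (er_loss er) (er_cgs er) (er_gE er) (er_pen er)
    (noise j t) (dot (f t) (H t *m w)) j v0) _.
  rewrite -/(gap t A) -etaE; apply: (@le_trans _ _ (3 * (W j t + eta t * w j 0 ^+ 2 + w j 0 ^+ 2 * B t))); last first.
    by rewrite lerDl mulr_ge0 // mulr_ge0 // sqr_ge0.
  rewrite ler_wpM2l //; apply: lerD; first by apply: lerD => //; exact: Wres.
  rewrite ler_wpM2l ?sqr_ge0 // /B.
  have G0 : 0 <= G t by have [_ g0 _] := EG.
  have KG : sn * `|gap t A| <= K t ^+ 12 * G t.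
    apply: (@le_trans _ _ (sn * (K t ^+ 12 * (`|Rem1 t A| + `|Rem2 t A| + `|Rem3 t A| + `|Rem4 t A| + `|Rem5 t A| + `|Rem6 t|)))).
      by rewrite ler_pM2l //; exact: gap_le.
    rewrite mulrCA ler_wpM2l // !mulrDr /G.
    by do 5 (apply: lerD; last by [exact: P2 st ja|exact: P3 st ja|exact: P4 st ja|exact: P5 st ja|exact: Rem6_le]).
  have kk : 0 <= K t - k0 by rewrite subr_ge0.
  have [le1|gt1] := leP (K t) (k0 + 1).
    apply: (@le_trans _ _ (sn * ((k0 + 1) ^+ 12 * G t))); last by (rewrite lerDl; apply: mulr_ge0; [exact: ltW|exact: mulr_ge0]).
    have -> : n%:R * `|gap t A| = sn * (sn * `|gap t A|) by rewrite mulrA -expr2 sn2.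
    rewrite ler_pM2l //; apply: le_trans KG _.
    by rewrite ler_wpM2r // lerXn2r ?nnegrE // ?addr_ge0 // ltW.
  apply: (@le_trans _ _ (n%:R * (K t ^+ 28 * (K t - k0)))); last by (rewrite lerDr; apply: mulr_ge0; [exact: ltW|exact: mulr_ge0]).
  rewrite ler_pM2l //; apply: le_trans (gap_le28 ja) _.
  by rewrite ler_peMr //; lra.
- rewrite (coordinate_error_neg w n0 z0 pE bE f1 tau0 (er_cgs er) (er_gE er) (er_pen er) _ _ v0).
  apply: (@le_trans _ _ (n%:R^-1 * (theta t j 0 ^+ 2 * K t ^+ 8))); last first.
    have [_ w0] := WP j; rewrite lerDr mulr_ge0 // !addr_ge0 // mulr_ge0 //; exact: sqr_ge0.
  have h := ler_wpM2r (sqr_ge0 (theta t j 0)) (vhat_neg_le ja v0).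
  by apply: (le_trans h); rewrite -mulrA [K t ^+ 8 * _]mulrC.
Qed.

End Conclusion.

#[local] Transparent betahat enorm prox cfgX cfgpsi cfgbeta cfgf cfgth zeroed column shiftv Hcol.
(** * The law of the sample *)

Section NormalIntegral.
Context {R : realType}.
Local Notation leb := (@lebesgue_measure R).
Local Notation phi := (normal_pdf 0 1 : R -> R).

Import HBNNSimple.

Let mphi : measurable_fun setT phi. Proof. exact: measurable_normal_pdf. Qed.
Let phi0 x : 0 <= phi x. Proof. exact: normal_pdf_ge0. Qed.

Let integral_normal_nnsfun (f : {nnsfun measurableTypeR R >-> R}) :
  (\int[normal_prob 0 1]_x (f x)%:E = \int[leb]_x ((f x)%:E * (phi x)%:E))%E.
Proof.
under [LHS]eq_integral do rewrite fimfunE -fsumEFin//.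
rewrite [LHS]ge0_integral_fsum//; last 2 first.
  - by move=> r; exact/measurable_EFinP/measurableT_comp.
  - by move=> n x _; rewrite EFinM nnfun_muleindic_ge0.
under [RHS]eq_integral.
  move=> x xD; rewrite fimfunE -fsumEFin// muleC ge0_mule_fsumr; last first.
    by move=> r; rewrite EFinM nnfun_muleindic_ge0.
  over.
rewrite [RHS]ge0_integral_fsum//; last 2 first.
  - move=> r; apply: emeasurable_funM; first exact/measurable_EFinP.
    exact/measurable_EFinP/measurableT_comp.
  - move=> n x _; apply: mule_ge0; first by rewrite lee_fin.
    by rewrite EFinM nnfun_muleindic_ge0.
apply: eq_fsbigr => r _.
have mE : measurable (f @^-1` [set r]) by exact: measurable_sfunP.
have [r0|r0] := leP 0 r; last first.
  have -> : f @^-1` [set r] = set0.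
    by rewrite preimage_nnfun0 // lt_eqF.
  rewrite !integral0_eq // => x _; rewrite indicE in_set0 mulr0 ?mule0 //.
under eq_integral do rewrite EFinM.
rewrite ge0_integralZl //; last exact/measurable_EFinP/measurable_indic.
under [RHS]eq_integral do rewrite EFinM muleCA.
rewrite [RHS]ge0_integralZl //; last 2 first.
- by apply: emeasurable_funM; [exact/measurable_EFinP|exact/measurable_EFinP/measurable_indic].
- by move=> x _; rewrite mule_ge0 // lee_fin.
congr (_ * _)%E; rewrite integral_indic // setIT.
transitivity (\int[leb]_(x in f @^-1` [set r]) (phi x)%:E)%E; first by [].
rewrite [LHS]integral_mkcond.
apply: eq_integral => x _; rewrite patchE indicE.
by case: (x \in _); rewrite ?mule1 ?mule0.
Qed.

Lemma integral_normal (f : measurableTypeR R -> \bar R) :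
  measurable_fun setT f -> (forall x, 0 <= f x)%E ->
  (\int[normal_prob 0 1]_x f x = \int[leb]_x (f x * (phi x)%:E))%E.
Proof.
move=> mf f0; pose f_ := nnsfun_approx measurableT mf.
have nd x : nondecreasing_seq (fun n => (f_ n x)%:E).
  by move=> a b ab; rewrite lee_fin; exact/lefP/nd_nnsfun_approx.
have cv x : (fun n => (f_ n x)%:E) @ \oo --> f x.
  by apply: cvg_nnsfun_approx => //.
transitivity (limn (fun n => \int[normal_prob 0 1]_x (f_ n x)%:E)%E).
  rewrite -monotone_convergence//=.
  - by apply: eq_integral => x _; apply/esym/cvg_lim => //; exact: cv.
  - by move=> n; exact/measurable_EFinP/measurable_funTS.
  - by move=> n x _; rewrite lee_fin.
under eq_fun do rewrite integral_normal_nnsfun.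
rewrite -monotone_convergence//=.
- apply: eq_integral => x _; apply/cvg_lim => //.
  by apply: cvgeZr => //; exact: cv.
- move=> n; apply: emeasurable_funM; last exact/measurable_EFinP.
  exact/measurable_EFinP/measurable_funTS.
- by move=> n x _; rewrite mule_ge0 ?lee_fin.
- by move=> x _ a b ab; rewrite lee_wpmul2r ?lee_fin //; exact/lefP/nd_nnsfun_approx.
Qed.

End NormalIntegral.

(** * A space of real coordinates *)

Section BoxSpace.
Context {R : realType} (I L : finType).
Local Notation J := (I + L)%type.
Local Notation leb := (@lebesgue_measure R).
Local Notation phi := (normal_pdf 0 1 : R -> R).

Definition box (C : J -> set R) : set (J -> R) := [set t | forall l, C l (t l)].

Definition boxes : set (set (J -> R)) :=
  [set B | exists2 C : J -> set R, (forall l, measurable (C l)) & B = box C].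

(** [I] indexes the Gaussian coordinates and [L] the remaining ones. Boxes are stable under
    intersection, so measures are determined by their values on boxes. *)
Definition bspace := g_sigma_algebraType boxes.

Lemma measurable_box (C : J -> set R) : (forall l, measurable (C l)) ->
  measurable (box C : set bspace).
Proof. by move=> mC; apply: sub_sigma_algebra; exists C. Qed.

Lemma measurable_coord l : measurable_fun setT (fun t : bspace => t l).
Proof.
move=> _ B mB; rewrite setTI; pose C k := if k == l then B else setT.
have -> : (fun t : bspace => t l) @^-1` B = box C.
  apply/seteqP; split => t; rewrite /box /C /=.
    by move=> tB k; case: eqP => [->|].
  by move=> /(_ l); rewrite eqxx.
by apply: measurable_box => k; rewrite /C; case: eqP.
Qed.

Lemma measurable_to_bspace d (T : measurableType d) (h : T -> bspace) :
  (forall l, measurable_fun setT (fun t => h t l)) -> measurable_fun setT h.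
Proof.
move=> mh; apply: (@measurability _ _ _ _ setT h boxes) => // _ [_ [C mC ->] <-].
have -> : setT `&` h @^-1` box C = \bigcap_(l in [set: J]) ((fun t => h t l) @^-1` C l).
  by rewrite setTI; apply/seteqP; split => t /= ht l; [move=> _; exact: ht|exact: ht].
apply: fin_bigcap_measurable => [|l _]; first exact: finite_finset.
by rewrite -[X in measurable X]setTI; exact: mh.
Qed.

Lemma boxes_setI : setI_closed boxes.
Proof.
move=> _ _ [C mC ->] [D mD ->]; exists (fun l => C l `&` D l); first by move=> l; exact: measurableI.
apply/seteqP; split => t; rewrite /box /=; first by move=> [h1 h2] l; split; [exact: h1|exact: h2].
by move=> h; split => l; have [] := h l.
Qed.

Lemma bspace_measure_unique (m1 m2 : {measure set bspace -> \bar R}) :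
  (forall C, (forall l, measurable (C l)) -> m1 (box C) = m2 (box C)) -> (m1 setT < +oo)%E ->
  forall B, measurable B -> m1 B = m2 B.
Proof.
move=> m12 m1oo; have bT : boxes setT.
  by exists (fun=> setT) => //; apply/seteqP; split.
apply: (@measure_unique _ R bspace boxes (fun=> setT)) => //.
- exact: boxes_setI.
- by rewrite bigcup_const.
- by move=> _ [C mC ->]; exact: m12.
Qed.

Definition bshift (u : J -> R) (t : bspace) : bspace := fun l => t l + u l.
Definition bdirac (k : I) (s : R) (l : J) : R := (l == inl k)%:R * s.
Definition bth (k : I) (s : R) (t : bspace) : bspace := bshift (bdirac k s) t.
Definition bset (k : J) (x : R) (t : bspace) : bspace := fun l => if l == k then x else t l.

Lemma measurable_bset k : measurable_fun setT (fun z : measurableTypeR R * bspace => bset k z.1 z.2).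
Proof.
apply: measurable_to_bspace => l; rewrite /bset; case: eqP => _; first exact: measurable_fst.
exact: (measurableT_comp (measurable_coord l) measurable_snd).
Qed.

Lemma measurable_bset1 k t : measurable_fun setT (fun x : measurableTypeR R => bset k x t).
Proof.
by apply: measurable_to_bspace => l; rewrite /bset; case: eqP => _ //; exact: measurable_cst.
Qed.

Variable mu : probability bspace R.
Hypothesis mu_box : forall C, (forall l, measurable (C l)) ->
  mu (box C) = (\prod_l mu [set t | C l (t l)])%E.
Hypothesis mu_normal : forall k B, measurable B -> mu [set t | B (t (inl k))] = normal_prob 0 1 B.

Let resample_law k C : (forall l, measurable (C l)) ->
  (normal_prob 0 1 \x mu)%E ((fun z : measurableTypeR R * bspace => bset (inl k) z.1 z.2) @^-1` box C) = mu (box C).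
Proof.
move=> mC; pose D l := if l == inl k then setT else C l.
have mD l : measurable (D l) by rewrite /D; case: eqP.
have -> : (fun z : measurableTypeR R * bspace => bset (inl k) z.1 z.2) @^-1` box C = C (inl k) `*` box D.
  apply/seteqP; split => -[x t]; rewrite /box /bset /D /=.
    move=> h; split; first by have := h (inl k); rewrite eqxx.
    by move=> l; have := h l; case: eqP.
  by move=> [hx ht] l; have := ht l; case: eqP => [->|].
rewrite product_measure1E; [|exact: mC|exact: measurable_box].
transitivity (normal_prob 0 1 (C (inl k)) * \prod_l mu [set t | D l (t l)])%E.
  by congr (_ * _)%E; exact: mu_box.
apply: esym; apply: (etrans (mu_box mC)); apply: esym.
rewrite [in LHS](bigD1 (inl k)) //= [in RHS](bigD1 (inl k)) //= {1}/D eqxx.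
have -> : [set t : bspace | setT (t (inl k))] = setT by [].
rewrite probability_setT mul1e mu_normal //; congr (_ * _)%E.
by apply: eq_bigr => l /negPf lk; rewrite /D lk.
Qed.

(** Independence in the form of an invariance: replacing a Gaussian coordinate by a fresh N(0, 1)
    variable preserves the law. On boxes this is the product rule. *)
Lemma bspace_resample k (f : bspace -> \bar R) : measurable_fun setT f -> (forall t, 0 <= f t)%E ->
  (\int[mu]_t f t = \int[mu]_t \int[leb]_x (f (bset (inl k) x t) * (phi x)%:E))%E.
Proof.
move=> mf f0; have mb := measurable_bset (inl k).
have mfb : measurable_fun setT (fun z : measurableTypeR R * bspace => f (bset (inl k) z.1 z.2)).
  exact: (measurableT_comp mf mb).
pose nu := pushforward (normal_prob 0 1 \x mu)%E (fun z : measurableTypeR R * bspace => bset (inl k) z.1 z.2).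
transitivity (\int[nu]_t f t)%E.
  apply: eq_measure_integral => A mA _.
  apply: (bspace_measure_unique _ _ mA) => [C mC|]; first exact/esym/resample_law.
  by apply: (le_lt_trans (probability_le1 mu measurableT)); rewrite ltry.
rewrite /nu ge0_integral_pushforward //; rewrite preimage_setT.
rewrite fubini_tonelli2 //; last by move=> z; exact: f0.
apply: eq_integral => t _; rewrite /fubini_G /= integral_normal //.
exact: (measurableT_comp mf (measurable_bset1 (inl k) t)).
Qed.

(** Once coordinate k is resampled, its shift is a translation of Lebesgue measure, and the quotient
    of the Gaussian densities is the Cameron-Martin weight. *)
Lemma bspace_field : gfield mu bth (fun k t => t (inl k)).
Proof.
have mth k : measurable_fun setT (fun z : R * bspace => bth k z.1 z.2).
  apply: measurable_to_bspace => l; rewrite /bth /bshift /bdirac.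
  apply: measurable_funD; first exact: (measurableT_comp (measurable_coord l) measurable_snd).
  by apply: measurable_funM.
split; last 2 first.
- by move=> k l s t.
- by move=> k l s r t; apply/funext => m; rewrite /bth /bshift addrAC.
move=> k; split => //.
- exact: measurable_coord.
- by move=> s t; rewrite /bth /bshift /bdirac eqxx mul1r.
- by move=> t; apply/funext => l; rewrite /bth /bshift /bdirac mulr0 addr0.
- by move=> s r t; apply/funext => l; rewrite /bth /bshift /bdirac -addrA -mulrDr [r + s]addrC.
move=> s f mf f0.
have mfs : measurable_fun setT (fun t => f (bth k s t)).
  apply: (measurableT_comp mf); apply: measurable_to_bspace => l.
  by apply: measurable_funD => //; exact: measurable_coord.
have mW : measurable_fun setT (fun t : bspace => (expR (s * t (inl k) - s ^+ 2 / 2))%:E : \bar R).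
  apply/measurable_EFinP; apply: measurableT_comp => //; apply: measurable_funB => //.
  by apply: measurable_funM => //; exact: measurable_coord.
rewrite (bspace_resample k mfs) //.
rewrite [RHS](bspace_resample k) //; last 2 first.
- exact: emeasurable_funM.
- by move=> t; rewrite mule_ge0 // lee_fin expR_ge0.
apply: eq_integral => t _.
have mb := measurable_bset1 (inl k) t.
have mphi : measurable_fun setT (fun x => (phi x)%:E : \bar R).
  by apply/measurable_EFinP; exact: measurable_normal_pdf.
have E x : bth k s (bset (inl k) x t) = bset (inl k) (x + s) t.
  apply/funext => l; rewrite /bth /bshift /bset /bdirac; case: eqP => _; first by rewrite mul1r.
  by rewrite mul0r addr0.
under eq_integral do rewrite E.
pose F x := (f (bset (inl k) x t) * (phi (x - s))%:E)%E.
have mF : measurable_fun setT F.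
  apply: emeasurable_funM; first exact: (measurableT_comp mf mb).
  apply/measurable_EFinP; apply: (measurableT_comp (measurable_normal_pdf 0 1)).
  exact: measurable_funB.
have F0 x : (0 <= F x)%E by rewrite mule_ge0 // lee_fin normal_pdf_ge0.
transitivity (\int[leb]_x F (x + s)%R)%E.
  by apply: eq_integral => x _; rewrite /F addrK.
rewrite lebesgue_integral_shift // /F.
have bE x : bset (inl k) x t (inl k) = x by rewrite /bset eqxx.
apply: eq_integral => x _; rewrite bE -muleA -EFinM; congr (_ * _%:E)%E.
by rewrite !normal_pdf01E mulrCA -expRD; congr (_ * expR _); lra.
Qed.

End BoxSpace.

(** * Law of the design and the latent variables *)

Section ModelLaw.
Context {R : realType} {n p : nat} {d : measure_display} {Omega : measurableType d}.
Variable P : probability Omega R.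
Variables (x : 'I_n -> {RV P >-> p.-tuple R}) (U y : 'I_n -> {RV P >-> R}).
Variables (F : R -> R -> R) (w : 'cV[R]_p) (Y : set R).
Hypothesis n0 : (0 < n)%N.
Hypothesis model : single_index_model x U y F w ((n%:R^-1)%:M) Y.

Local Notation sn := (Num.sqrt n%:R).
Let nR0 : 0 < n%:R :> R. Proof. by rewrite ltr0n. Qed.
Let sn0 : 0 < sn :> R. Proof. by rewrite sqrtr_gt0. Qed.

(** The factor sqrt n makes the entries standard normal. The responses are functions of these
    coordinates and need no coordinate of their own. *)
Definition model_coords omega : bspace ('I_n * 'I_p)%type 'I_n :=
  fun l => match l with
           | inl k => sn * tnth (x k.1 omega) k.2
           | inr i => U i omega
           end.

Lemma measurable_model_coords : measurable_fun setT model_coords.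
Proof.
apply: measurable_to_bspace => -[[i j]|i] //=.
apply: measurable_funM => //.
exact: (measurableT_comp (measurable_tnth j) (measurable_funPT (x i))).
Qed.

Let gaussE i (z : 'I_p -> {RV P >-> R}) :
  (forall omega, tuple_col (x i omega) = sqrtmx ((n%:R^-1)%:M) *m (\col_k z k omega)) ->
  forall omega j, model_coords omega (inl (i, j)) = z j omega.
Proof.
move=> zE omega j; rewrite /model_coords /=.
have -> : tnth (x i omega) j = (tuple_col (x i omega)) j 0 by rewrite mxE.
have sE (a : R) (v : 'cV[R]_p) : (a *: v) j 0 = a * v j 0 by rewrite mxE.
rewrite zE sqrtmx_scalar ?invr_gt0 // mul_scalar_mx sE [(\col__ _) j 0]mxE.
by rewrite sqrtrV ?ltW // mulrA mulfV ?mul1r // gt_eqF.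
Qed.

Lemma model_coords_normal k B : measurable B ->
  P [set omega | B (model_coords omega (inl k))] = normal_prob 0 1 B.
Proof.
case: k => i j mB; have [z [_ zn zE]] := sim_gaussian model i.
have -> : [set omega | B (model_coords omega (inl (i, j)))] = z j @^-1` B.
  by apply/funext => omega; rewrite /preimage /mkset (gaussE zE).
exact: zn.
Qed.

(** Independence is used on three levels: between observations, between a row and its latent
    variable, and between the entries of a row. *)
Lemma model_coords_box C : (forall l, measurable (C l)) ->
  P (model_coords @^-1` box C) = (\prod_l P [set omega | C l (model_coords omega l)])%E.
Proof.
move=> mC; have [mi _] := sim_iid model.
pose Bx i : set (p.-tuple R) := [set a | forall j, C (inl (i, j)) (sn * tnth a j)].
have mBx i : measurable (Bx i).
  have -> : Bx i = \bigcap_(j in [set: 'I_p]) ((fun a : p.-tuple R => sn * tnth a j) @^-1` C (inl (i, j))).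
    by apply/seteqP; split => a /= h j; [move=> _; exact: h|exact: h].
  apply: fin_bigcap_measurable => [|j _]; first exact: finite_finset.
  rewrite -[X in measurable X]setTI; apply: (_ : measurable_fun setT (fun a : p.-tuple R => sn * tnth a j)) => //.
  by apply: measurable_funM => //; exact: measurable_tnth.
pose B i : set (p.-tuple R * R * R) := [set a | Bx i a.1.1 /\ C (inr i) a.1.2].
have mB i : measurable (B i).
  have -> : B i = (fst \o fst) @^-1` Bx i `&` (snd \o fst) @^-1` C (inr i) by [].
  apply: measurableI; rewrite -[X in measurable X]setTI.
    by apply: (measurableT_comp measurable_fst measurable_fst).
  by apply: (measurableT_comp measurable_snd measurable_fst).
have := mi B mB.
have -> : \bigcap_i ((fun omega => (x i omega, U i omega, y i omega)) @^-1` B i) = model_coords @^-1` box C.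
  apply/seteqP; split => omega.
    by move=> h [[i j]|i]; have [h1 h2] := h i I; [exact: h1|exact: h2].
  by move=> h i _; split => [j|]; [exact: (h (inl (i, j)))|exact: (h (inr i))].
move=> ->; have PE i : P ((fun omega => (x i omega, U i omega, y i omega)) @^-1` B i) =
    (\prod_j P [set omega | C (inl (i, j)) (model_coords omega (inl (i, j)))] *
     P [set omega | C (inr i) (model_coords omega (inr i))])%E.
  have -> : (fun omega => (x i omega, U i omega, y i omega)) @^-1` B i = x i @^-1` Bx i `&` U i @^-1` C (inr i) by [].
  rewrite (sim_latent model i) //; congr (_ * _)%E.
  have [z [zi _ zE]] := sim_gaussian model i.
  have -> : x i @^-1` Bx i = \bigcap_j (z j @^-1` C (inl (i, j))).
    apply/seteqP; split => omega.
      by move=> h j _; rewrite /preimage /mkset -(gaussE zE); exact: h.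
    by move=> h j; have := h j I; rewrite /preimage /mkset -(gaussE zE).
  rewrite zi //; apply: eq_bigr => j _; congr (P _).
  by apply/funext => omega; rewrite /preimage /mkset (gaussE zE).
under eq_bigr do rewrite PE.
rewrite big_split /= [RHS]big_sumType /=; congr (_ * _)%E.
by rewrite pair_big /=; apply: eq_bigr => -[i j].
Qed.

Definition model_rv : {mfun Omega >-> bspace ('I_n * 'I_p)%type 'I_n} :=
  mfun_Sub (mem_set measurable_model_coords).

Definition model_law : probability (bspace ('I_n * 'I_p)%type 'I_n) R := distribution P model_rv.

Lemma model_field : gfield model_law (@bth R ('I_n * 'I_p)%type 'I_n) (fun k t => t (inl k)).
Proof.
apply: bspace_field.
- by move=> C mC; exact: model_coords_box.
- by move=> k B mB; exact: model_coords_normal.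
Qed.

Lemma integral_model_law (f : bspace ('I_n * 'I_p)%type 'I_n -> \bar R) : measurable_fun setT f ->
  (forall t, 0 <= f t)%E -> (\int[model_law]_t f t = \int[P]_omega f (model_coords omega))%E.
Proof.
move=> mf f0; rewrite /model_law /distribution.
by rewrite (ge0_integral_pushforward measurable_model_coords) // preimage_setT.
Qed.

End ModelLaw.

(** * The Gaussian matrix on the doubled space *)

Section ProductSpace.
Context {R : realType} {n p : nat}.
Local Notation T0 := (@bspace R ('I_n * 'I_p)%type 'I_n).
Local Notation T := (T0 * T0)%type.
Variable mu0 : probability T0 R.
Hypothesis field0 : gfield mu0 (@bth R ('I_n * 'I_p)%type 'I_n) (fun k t => t (inl k)).
Variable w : 'cV[R]_p.
Hypothesis w1 : dot w w = 1.
Hypothesis n0 : (0 < n)%N.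
Local Notation Q := (wproj w).
Local Notation sn := (Num.sqrt n%:R).
Let nR0 : 0 < n%:R :> R. Proof. by rewrite ltr0n. Qed.
Let sn0 : 0 < sn :> R. Proof. by rewrite sqrtr_gt0. Qed.

Definition prod_law : probability T R := (mu0 \x mu0)%E.

Definition gmat (t : T0) : 'M[R]_(n, p) := \matrix_(i, j) t (inl (i, j)).
(* The component of the first matrix along w is replaced by that of the second,
   which makes all entries of Hmat independent of the index values. *)
Definition Hmat (t : T) : 'M[R]_(n, p) := gmat t.1 *m Q + gmat t.2 *m (1%:M - Q).
Definition zvec (t : T) : 'cV[R]_n := gmat t.1 *m w.

Definition ushift (u : 'I_n * 'I_p -> R) (t : T0) : T0 :=
  bshift (fun l => match l with inl k => u k | inr _ => 0 end) t.
Definition rowdir (M : 'M[R]_p) (k : 'I_n * 'I_p) (s : R) (l : 'I_n * 'I_p) : R :=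
  (l.1 == k.1)%:R * (s * M k.2 l.2).
(** A shift of one entry of [Hmat] is split between the two matrices along rows of Q and of I - Q.
    The first part leaves [zvec] fixed because Q w = 0. *)
Definition pth (k : 'I_n * 'I_p) (s : R) (t : T) : T :=
  (ushift (rowdir Q k s) t.1, ushift (rowdir (1%:M - Q) k s) t.2).

Lemma integral_prod_law (f : T -> \bar R) : measurable_fun setT f -> (forall t, 0 <= f t)%E ->
  (\int[prod_law]_t f t = \int[mu0]_t1 \int[mu0]_t2 f (t1, t2))%E.
Proof. by move=> mf f0; rewrite /prod_law fubini_tonelli1. Qed.

Lemma integral_prod_law2 (f : T -> \bar R) : measurable_fun setT f -> (forall t, 0 <= f t)%E ->
  (\int[prod_law]_t f t = \int[mu0]_t2 \int[mu0]_t1 f (t1, t2))%E.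
Proof. by move=> mf f0; rewrite /prod_law fubini_tonelli2. Qed.

Let bshift_shiftv (u : 'I_n * 'I_p -> R) t :
  shiftv (@bth R ('I_n * 'I_p)%type 'I_n) (index_enum _) u t =
  ushift u t.
Proof.
apply/funext => -[l|i].
  rewrite (shiftv_H field0 _ _ _ (index_enum_uniq _)) mem_index_enum mul1r.
  by [].
rewrite /ushift /bshift addr0; elim: index_enum => //= k r IH.
by rewrite {1}/bth /bshift /bdirac /= mul0r addr0.
Qed.

Lemma ushift_CM (u : 'I_n * 'I_p -> R) (f : T0 -> \bar R) : measurable_fun setT f -> (forall t, 0 <= f t)%E ->
  (\int[mu0]_t f (ushift u t) =
   \int[mu0]_t (f t * (expR (\sum_k (u k * t (inl k) - u k ^+ 2 / 2)))%:E))%E.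
Proof.
move=> mf f0.
have <- := @gfield_random_shift _ _ _ _ _ _ _ field0 (index_enum _) (fun k _ => u k) f (index_enum_uniq _)
  (fun k => measurable_cst _) (fun k l s t _ => erefl) mf f0.
by apply: eq_integral => t _; rewrite bshift_shiftv.
Qed.

Lemma measurable_gmat i j : measurable_fun setT (fun t : T0 => gmat t i j).
Proof.
have -> : (fun t : T0 => gmat t i j) = (fun t : T0 => t (inl (i, j))) by apply/funext => t; rewrite mxE.
exact: measurable_coord.
Qed.

Lemma measurable_Hmat i j : measurable_fun setT (fun t : T => Hmat t i j).
Proof.
have -> : (fun t : T => Hmat t i j) = (fun t : T => \sum_l gmat t.1 i l * Q l j + \sum_l gmat t.2 i l * (1%:M - Q) l j).
  by apply/funext => t; rewrite /Hmat mxE [(_ *m Q) i j]mxE [(_ *m (1%:M - Q)) i j]mxE.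
apply: measurable_funD; apply: measurable_sum => l; apply: measurable_funM => //.
  exact: (measurableT_comp (measurable_gmat i l) measurable_fst).
exact: (measurableT_comp (measurable_gmat i l) measurable_snd).
Qed.

Lemma measurable_zvec i : measurable_fun setT (fun t : T => zvec t i 0).
Proof.
have -> : (fun t : T => zvec t i 0) = (fun t : T => \sum_l gmat t.1 i l * w l 0).
  by apply/funext => t; rewrite /zvec mxE.
apply: measurable_sum => l; apply: measurable_funM => //.
exact: (measurableT_comp (measurable_gmat i l) measurable_fst).
Qed.

Lemma gmat_ushift M k s (t : T0) :
  gmat (ushift (rowdir M k s) t) = gmat t + s *: (delta_mx k.1 0 *m (row k.2 M)).
Proof.
apply/matrixP => i j; rewrite [RHS]mxE [gmat t i j]mxE [gmat _ i j]mxE /bshift /=; congr (_ + _).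
by rewrite mxE [(_ *m _) i j]mxE big_ord1 [delta_mx _ _ _ _]mxE eqxx andbT [row _ _ _ _]mxE mulrCA.
Qed.

Let QQ : Q *m Q = Q.
Proof.
have Qw : Q *m w = 0.
  rewrite mulmxBl mul1mx -mulmxA; have -> : w^T *m w = 1%:M.
    by apply/matrixP => i j; rewrite !ord1 dotE w1 mxE.
  by rewrite mulmx1 subrr.
by rewrite {2}/wproj mulmxBr mulmx1 mulmxA Qw mul0mx subr0.
Qed.

Let Qw : Q *m w = 0.
Proof.
rewrite mulmxBl mul1mx -mulmxA; have -> : w^T *m w = 1%:M.
  by apply/matrixP => i j; rewrite !ord1 dotE w1 mxE.
by rewrite mulmx1 subrr.
Qed.

Let PP : (1%:M - Q) *m (1%:M - Q) = 1%:M - Q.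
Proof. by rewrite mulmxBl mul1mx mulmxBr mulmx1 QQ subrr subr0. Qed.

Let QT : Q^T = Q. Proof. exact: wproj_sym. Qed.
Let PT : (1%:M - Q)^T = 1%:M - Q. Proof. by rewrite linearB /= trmx1 QT. Qed.

Lemma Hmat_pth k s t l : Hmat (pth k s t) l.1 l.2 = Hmat t l.1 l.2 + (l == k)%:R * s.
Proof.
rewrite /Hmat /pth /= !gmat_ushift !mulmxDl -!scalemxAl -!mulmxA -!row_mul QQ PP.
rewrite addrACA -scalerDr -mulmxDr -linearD /= addrCA subrr addr0.
rewrite [LHS]mxE; congr (_ + _); rewrite mxE [(_ *m _) _ _]mxE big_ord1 [delta_mx _ _ _ _]mxE eqxx andbT.
rewrite [row _ _ _ _]mxE [1%:M _ _]mxE mulrC; congr (_ * _).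
by rewrite -natrM mulnb -pair_eqE /pair_eq /= [k.2 == _]eq_sym.
Qed.

Lemma zvec_pth k s t : zvec (pth k s t) = zvec t.
Proof.
rewrite /zvec /pth /= gmat_ushift mulmxDl -scalemxAl -mulmxA -row_mul Qw.
by rewrite raddf0 mulmx0 scaler0 addr0.
Qed.

Let row_exponent (M : 'M[R]_p) k s (t : T0) : M^T = M -> M *m M = M ->
  \sum_l (rowdir M k s l * t (inl l) - rowdir M k s l ^+ 2 / 2) =
  s * (gmat t *m M) k.1 k.2 - s ^+ 2 / 2 * M k.2 k.2.
Proof.
have T1 b : true%:R * b = b :> R by rewrite mul1r.
move=> MT MM; have mE j : M j k.2 = M k.2 j by rewrite -{1}MT mxE.
have gE j : gmat t k.1 j = t (inl (k.1, j)) by rewrite mxE.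
have -> : \sum_l (rowdir M k s l * t (inl l) - rowdir M k s l ^+ 2 / 2) =
    \sum_i \sum_j (rowdir M k s (i, j) * t (inl (i, j)) - rowdir M k s (i, j) ^+ 2 / 2).
  by rewrite pair_big /=; apply: eq_bigr => -[].
rewrite (bigD1 k.1) //= [X in _ + X]big1 ?addr0 => [|i /negPf ik]; last first.
  by apply: big1 => j _; rewrite /rowdir /= ik !mul0r expr0n /= mul0r subr0.
rewrite sumrB; congr (_ - _).
  rewrite [(gmat t *m M) _ _]mxE mulr_sumr; apply: eq_bigr => j _.
  by rewrite /rowdir /= eqxx T1 gE mE; ring.
have -> : M k.2 k.2 = \sum_j M k.2 j * M j k.2 by rewrite -{1}MM mxE.
rewrite mulr_sumr; apply: eq_bigr => j _.
by rewrite /rowdir /= eqxx T1 mE; field.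
Qed.

(** By [row_exponent] the two matrices contribute s (G Q)_ij - s^2 Q_jj / 2 and the same expression
    with I - Q; the diagonal entries add up to 1 and the linear terms to s times the entry of
    [Hmat]. *)
Lemma pth_field : gfield prod_law pth (fun k t => Hmat t k.1 k.2).
Proof.
have mth k : measurable_fun setT (fun z : R * T => pth k z.1 z.2).
  apply: measurable_fun_pair; apply: measurable_to_bspace => -[l|l]; apply: measurable_funD.
  - exact: (measurableT_comp (measurableT_comp (measurable_coord (inl l)) measurable_fst) measurable_snd).
  - by do 2 (apply: measurable_funM => //).
  - exact: (measurableT_comp (measurableT_comp (measurable_coord (inr l)) measurable_fst) measurable_snd).
  - exact: measurable_cst.
  - exact: (measurableT_comp (measurableT_comp (measurable_coord (inl l)) measurable_snd) measurable_snd).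
  - by do 2 (apply: measurable_funM => //).
  - exact: (measurableT_comp (measurableT_comp (measurable_coord (inr l)) measurable_snd) measurable_snd).
  - exact: measurable_cst.
have add M k s r (t : T0) : ushift (rowdir M k s) (ushift (rowdir M k r) t) = ushift (rowdir M k (s + r)) t.
  by apply/funext => -[l|i]; rewrite /ushift /bshift /rowdir /= ?addr0 //; ring.
split; last 2 first.
- by move=> k l s t; exact: Hmat_pth.
- move=> k l s r t; rewrite /pth /=; congr pair; apply/funext => m; rewrite /ushift /bshift addrAC //.
move=> k; split.
- exact: mth.
- exact: measurable_Hmat.
- by move=> s t; rewrite Hmat_pth eqxx mul1r.
- move=> [t1 t2]; rewrite /pth; congr pair; apply/funext => -[l|i]; rewrite /ushift /bshift /rowdir /= ?addr0 // mul0r mulr0 addr0 //.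
- by move=> s r t; rewrite /pth /= !add.
move=> s f mf f0.
have mps : measurable_fun setT (pth k s).
  exact: (measurableT_comp (mth k) (measurable_fun_pair (measurable_cst s) (@measurable_id _ T setT))).
have mfp : measurable_fun setT (fun t => f (pth k s t)) by exact: (measurableT_comp mf mps).
pose P := 1%:M - Q.
pose Wt (M : 'M[R]_p) (t : T0) : R := expR (\sum_l (rowdir M k s l * t (inl l) - rowdir M k s l ^+ 2 / 2)).
have mWt M : measurable_fun setT (Wt M).
  apply: measurableT_comp => //; apply: measurable_sum => l; apply: measurable_funB => //.
  by apply: measurable_funM => //; exact: measurable_coord.
have W0 M t : (0 <= (Wt M t)%:E)%E by rewrite lee_fin expR_ge0.
pose f2 (z : T) : \bar R := (f z * (Wt P z.2)%:E)%E.
have mf2 : measurable_fun setT f2.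
  apply: emeasurable_funM => //; apply/measurable_EFinP; exact: (measurableT_comp (mWt P) measurable_snd).
have f20 z : (0 <= f2 z)%E by rewrite mule_ge0.
pose g t1 : \bar R := (\int[mu0]_t2 f2 (t1, t2))%E.
have mg : measurable_fun setT g by exact: measurable_fun_fubini_tonelli_F.
have g0 t : (0 <= g t)%E by apply: integral_ge0.
rewrite (integral_prod_law mfp) //.
transitivity (\int[mu0]_t1 g (ushift (rowdir Q k s) t1))%E.
  apply: eq_integral => t1 _; rewrite /g /f2 /pth /=.
  have mf1 : measurable_fun setT (fun t2 => f (ushift (rowdir Q k s) t1, t2)).
    exact: (measurableT_comp mf (measurable_pair1 _)).
  exact: (ushift_CM (rowdir P k s) mf1).
rewrite (ushift_CM _ mg g0) [RHS]integral_prod_law; last 2 first.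
- apply: emeasurable_funM => //; apply/measurable_EFinP; apply: measurableT_comp => //.
  by apply: measurable_funB => //; apply: measurable_funM => //; exact: measurable_Hmat.
- by move=> t; rewrite mule_ge0 // lee_fin expR_ge0.
apply: eq_integral => t1 _; rewrite -/(Wt Q t1) muleC /g -ge0_integralZl //; last exact: (measurableT_comp mf2 (measurable_pair1 _)).
apply: eq_integral => t2 _; rewrite /f2 /= muleCA; congr (_ * _)%E.
rewrite -EFinM; congr EFin; rewrite /Wt -expRD (row_exponent _ _ _ QT QQ) (row_exponent _ _ _ PT PP).
have addE (M N : 'M[R]_(n, p)) i j : (M + N) i j = M i j + N i j by rewrite mxE.
have subE (M N : 'M[R]_p) i j : (M - N) i j = M i j - N i j by rewrite !mxE.
have hE : Hmat (t1, t2) k.1 k.2 = (gmat t1 *m Q) k.1 k.2 + (gmat t2 *m P) k.1 k.2 by exact: addE.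
have PE : P k.2 k.2 = 1 - Q k.2 k.2.
  by rewrite (_ : P = 1%:M - Q) // subE [1%:M _ _]mxE eqxx.
congr expR; rewrite hE PE.
by move: (Q k.2 k.2) ((gmat t1 *m Q) _ _) ((gmat t2 *m _) _ _) => *; ring.
Qed.

End ProductSpace.

(** An inequality of Chebyshev type: the larger power goes with the larger excess, so the mixed
    products are dominated by the pure ones. *)
Lemma sum_power_tail (R : realType) (N : nat) (a b k : R) : 0 <= a -> 0 <= b -> k <= a -> k <= b ->
  0 <= (a + b) ^+ N * (a + b - 2 * k) <= 2 ^+ N.+1 * (a ^+ N * (a - k) + b ^+ N * (b - k)).
Proof.
move=> a0 b0 ka kb; have mono : 0 <= (a ^+ N - b ^+ N) * (a - b).
  have [le|/ltW le] := leP a b.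
    by rewrite mulr_le0 ?subr_le0 // lerXn2r ?nnegrE.
  by rewrite mulr_ge0 ?subr_ge0 // lerXn2r ?nnegrE.
have c0 : 0 <= a + b - 2 * k by lra.
apply/andP; split; first by apply: mulr_ge0 => //; exact: exprn_ge0 (addr_ge0 a0 b0).
apply: (le_trans (ler_wpM2r c0 (exprD_le2 N a0 b0))); rewrite exprS.
have : 0 <= 2 ^+ N :> R by rewrite exprn_ge0.
move: (a ^+ N) (b ^+ N) (2 ^+ N) mono => x z e mono e0.
rewrite -subr_ge0; have -> : 2 * e * (x * (a - k) + z * (b - k)) - e * (x + z) * (a + b - 2 * k) =
  e * ((x - z) * (a - b)) by ring.
exact: mulr_ge0.
Qed.

(** The Cameron-Martin formula applied to the constant function 1. *)
Lemma gfield_laplace (R : realType) (d : measure_display) (T : measurableType d) (n p : nat)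
    (mu : probability T R) (th : 'I_n * 'I_p -> R -> T -> T) (H : T -> 'M[R]_(n, p)) (u : 'M[R]_(n, p)) :
  gfield mu th (fun k t => H t k.1 k.2) ->
  (\int[mu]_t (expR (\sum_i \sum_j u i j * H t i j))%:E = (expR (\sum_i \sum_j u i j ^+ 2 / 2))%:E)%E.
Proof.
move=> field; have mH k : measurable_fun setT (fun t => H t k.1 k.2) := gflow_measZ (gfield_flow field k).
have := @gfield_random_shift _ _ _ _ _ _ _ field (index_enum _) (fun k _ => u k.1 k.2) (fun=> 1%E)
  (index_enum_uniq _) (fun k => measurable_cst _) (fun k l s t _ => erefl) (measurable_cst _) (fun=> lee01).
rewrite integral_cst // mul1e [X in X = _ -> _]probability_setT => E.
pose c := \sum_i \sum_j u i j ^+ 2 / 2.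
have sp (a : 'I_n * 'I_p -> R) : \sum_k a k = \sum_i \sum_j a (i, j).
  by rewrite pair_big /=; apply: eq_bigr => -[].
have mS : measurable_fun setT (fun t => \sum_i \sum_j u i j * H t i j).
  by apply: measurable_sum => i; apply: measurable_sum => j; apply: measurable_funM => //; exact: (mH (i, j)).
have F t : (1 * (expR (\sum_(k : 'I_n * 'I_p) (u k.1 k.2 * H t k.1 k.2 - u k.1 k.2 ^+ 2 / 2)))%:E)%E =
    ((expR (- c))%:E * (expR (\sum_i \sum_j u i j * H t i j))%:E)%E.
  by rewrite mul1e -EFinM -expRD sumrB !sp /= addrC.
move: E; under eq_integral do rewrite F.
have mE : measurable_fun setT (fun t => (expR (\sum_i \sum_j u i j * H t i j))%:E).
  by apply/measurable_EFinP; apply: measurableT_comp.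
have E0 t : setT t -> (0 <= (expR (\sum_i \sum_j u i j * H t i j))%:E)%E by rewrite lee_fin expR_ge0.
have c0 : (0 <= (expR (- c))%:E)%E by rewrite lee_fin expR_ge0.
rewrite ge0_integralZl //; move=> E; rewrite -[LHS]mul1e -[1%E](_ : (expR c)%:E * (expR (- c))%:E = 1)%E; last first.
  by rewrite -EFinM expRxMexpNx_1.
by rewrite -muleA -E mule1.
Qed.

(** * The Gaussian design built from two copies *)

Section ProductDesign.
Context {R : realType} {n p : nat}.
Local Notation T0 := (@bspace R ('I_n * 'I_p)%type 'I_n).
Local Notation T := (T0 * T0)%type.
Variable mu0 : probability T0 R.
Hypothesis field0 : gfield mu0 (@bth R ('I_n * 'I_p)%type 'I_n) (fun k t => t (inl k)).
Variables (w : 'cV[R]_p) (F : R -> R -> R) (tau kap : R).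
Hypothesis w1 : dot w w = 1.
Hypotheses (n0 : (0 < n)%N) (p0 : (0 < p)%N).
Hypothesis mF : measurable_fun setT (fun z : R * R => F z.1 z.2).
Hypothesis kap4 : 4 <= kap.
Hypothesis kap_tau : tau^-1 <= kap.
Hypothesis kap_p : 1 + 12 * (1 + p%:R / n%:R) <= kap.
Local Notation Q := (wproj w).
Local Notation sn := (Num.sqrt n%:R).
Local Notation mu := (prod_law mu0).
Local Notation H := (@Hmat R n p w).
Local Notation zeta := (@zvec R n p w).
Let nR0 : 0 < n%:R :> R. Proof. by rewrite ltr0n. Qed.
Let sn0 : 0 < sn :> R. Proof. by rewrite sqrtr_gt0. Qed.

Let field0' : gfield mu0 (@bth R ('I_n * 'I_p)%type 'I_n) (fun k t => gmat t k.1 k.2).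
Proof.
have -> // : (fun k t => gmat t k.1 k.2) = (fun (k : 'I_n * 'I_p) (t : T0) => t (inl k)).
by apply/funext => -[i j]; apply/funext => t; rewrite mxE.
Qed.

Lemma Ele_fst (h : T0 -> R) c : Ele mu0 h c -> Ele mu (fun t : T => h t.1) c.
Proof.
move=> [mh h0 hc]; have mE : measurable_fun setT (fun t : T => (h t.1)%:E : \bar R).
  by apply/measurable_EFinP; exact: (measurableT_comp mh measurable_fst).
split => //; first exact: (measurableT_comp mh measurable_fst).
rewrite integral_prod_law2 //; last by move=> t; rewrite lee_fin.
rewrite (_ : (\int[mu0]_t2 _)%E = (\int[mu0]_(t2 in setT) cst (\int[mu0]_t1 (h t1)%:E)%E t2)%E) //.
by rewrite integral_cst // [X in (_ * X)%E]probability_setT mule1.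
Qed.

Let mG i j : measurable_fun setT (fun t : T => gmat t.1 i j).
Proof. exact: (measurableT_comp (measurable_gmat i j) measurable_fst). Qed.

Let lapG (u : 'M[R]_(n, p)) : (\int[mu]_t (expR (\sum_i \sum_j u i j * gmat t.1 i j))%:E <=
   (expR (\sum_i \sum_j u i j ^+ 2 / 2))%:E)%E.
Proof.
have m0 : measurable_fun setT (fun t : T0 => expR (\sum_i \sum_j u i j * gmat t i j)).
  apply: measurableT_comp => //; apply: measurable_sum => i; apply: measurable_sum => j.
  by apply: measurable_funM => //; exact: measurable_gmat.
have h : Ele mu0 (fun t : T0 => expR (\sum_i \sum_j u i j * gmat t i j)) (expR (\sum_i \sum_j u i j ^+ 2 / 2)).
  by split => //; rewrite (gfield_laplace u field0').
by have [] := Ele_fst h.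
Qed.

Let lapH (u : 'M[R]_(n, p)) : (\int[mu]_t (expR (\sum_i \sum_j u i j * H t i j))%:E <=
   (expR (\sum_i \sum_j u i j ^+ 2 / 2))%:E)%E.
Proof. by rewrite (gfield_laplace u (pth_field field0 w1)). Qed.

Definition yvec (t : T) : 'cV[R]_n := \col_i F (zeta t i 0) (t.1 (inr i)).
(** The first summand bounds the design, the second the auxiliary matrix [Hmat]. Each is at least
    [kap], so the threshold k0 is 2 [kap]. *)
Definition Kbound (t : T) : R :=
  opbound (fun t : T => gmat t.1) kap t + opbound H kap t.

Let a t := opbound (fun t : T => gmat t.1) kap t.
Let b t := opbound H kap t.
Let ka t : kap <= a t. Proof. exact: (opbound_ge mG lapG). Qed.
Let kb t : kap <= b t. Proof. exact: (opbound_ge (measurable_Hmat w) lapH). Qed.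
Let k1 : 1 <= kap. Proof. by move: kap4; lra. Qed.

(** Restoring the component along w of the first matrix recovers that matrix, so the estimator sees
    the original design. *)
Lemma model_designE t : model_design w (H t) (zeta t) = (sn^-1) *: gmat t.1.
Proof.
rewrite /model_design; congr (_ *: _); have QE : 1%:M - Q = w *m w^T by rewrite /wproj opprB addrC subrK.
have Qw : w^T *m Q = 0.
  rewrite mulmxBr mulmx1 mulmxA; have -> : w^T *m w = 1%:M.
    by apply/matrixP => i j; rewrite !ord1 dotE w1 mxE.
  by rewrite mul1mx subrr.
have QQ : Q *m Q = Q by rewrite {1}/wproj mulmxBl mul1mx -mulmxA Qw mulmx0 subr0.
rewrite /Hmat /zvec mulmxDl -!mulmxA QQ QE -mulmxA Qw !mulmx0 addr0 -QE -mulmxDr.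
by rewrite addrCA subrr addr0 mulmx1.
Qed.

Lemma product_design : gaussian_design mu (pth w) H zeta yvec w Kbound tau.
Proof.
have mu_i i : measurable_fun setT (fun t : T => t.1 (inr i) : R).
  exact: (measurableT_comp (measurable_coord (inr i)) measurable_fst).
have ab t : kap <= a t /\ kap <= b t by split.
have k4 := kap4; have kt := kap_tau.
split => //.
- exact: pth_field.
- by move=> k s t; exact: zvec_pth.
- move=> k s t; apply/matrixP => i j; rewrite [LHS]mxE [RHS]mxE zvec_pth //.
  by rewrite /pth /ushift /bshift /= addr0.
- by move=> i; exact: measurable_zvec.
- move=> i; have -> : (fun t => yvec t i 0) = (fun t => F (zeta t i 0) (t.1 (inr i))).
    by apply/funext => t; rewrite mxE.
  exact: (measurableT_comp mF (measurable_fun_pair (measurable_zvec w i) (mu_i i))).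
- apply: measurable_funD; first exact: (measurable_opbound mG lapG).
  exact: (measurable_opbound (measurable_Hmat w) lapH).
- by move=> t; have [h1 h2] := ab t; rewrite /Kbound -/(a t) -/(b t); lra.
- by move=> t; have [h1 h2] := ab t; rewrite /Kbound -/(a t) -/(b t); lra.
- move=> t; have [h1 h2] := ab t; rewrite /Kbound -/(a t) -/(b t).
  have : 0 <= p%:R / n%:R :> R by rewrite divr_ge0.
  by move: (p%:R / n%:R) kap_p => q; lra.
- move=> t u; rewrite model_designE -scalemxAl enormZ ger0_norm ?invr_ge0 ?(ltW sn0) // ler_pdivrMl //.
  have := opbound_opnorm mG lapG t u n0 p0 kap_p; rewrite -/(a t) => h; apply: (le_trans h).
  rewrite mulrA ler_wpM2r ?enorm_ge0 // ler_wpM2l ?(ltW sn0) //.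
  by have [_ h2] := ab t; rewrite /Kbound -/(a t) -/(b t); lra.
move=> t u; have := opbound_opnorm (measurable_Hmat w) lapH t u n0 p0 kap_p; rewrite -/(b t) => h.
apply: (le_trans h); rewrite ler_wpM2r ?enorm_ge0 // ler_wpM2l ?(ltW sn0) //.
by have [h2 _] := ab t; rewrite /Kbound -/(a t) -/(b t); lra.
Qed.

Definition Kmoment (N : nat) : R := 2 ^+ N.+2 * momc kap N.

Let mc0 N : 0 <= momc kap N. Proof. exact: Ele_ge0 (Ele_opbound mG lapG N n0 k1). Qed.

Lemma Kbound_moment N : Ele mu (fun t => Kbound t ^+ N) (Kmoment N).
Proof.
have h := EleZ (exprn_ge0 N (ler0n R 2)) (EleD (Ele_opbound mG lapG N n0 k1) (Ele_opbound (measurable_Hmat w) lapH N n0 k1)).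
apply: Ele_wk (Ele_le _ _ h).
- rewrite /Kmoment !exprS; have := mc0 N; have : 0 <= 2 ^+ N :> R by rewrite exprn_ge0.
  by move: (momc kap N) (2 ^+ N) => x z *; nra.
- exact: (measurable_funX N (gd_mK product_design)).
move=> t; have h1 := ka t; have h2 := kb t; rewrite /Kbound -/(a t) -/(b t).
have k4 := kap4; have a0 : 0 <= a t by apply: le_trans h1; lra.
have b0 : 0 <= b t by apply: le_trans h2; lra.
by apply/andP; split; [exact: exprn_ge0 (addr_ge0 a0 b0)|exact: exprD_le2].
Qed.

Lemma Kbound_tail N : Ele mu (fun t => Kbound t ^+ N * (Kbound t - 2 * kap)) (Kmoment N / n%:R).
Proof.
have h := EleZ (exprn_ge0 N.+1 (ler0n R 2)) (EleD (Ele_opbound_tail mG lapG N n0 k1) (Ele_opbound_tail (measurable_Hmat w) lapH N n0 k1)).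
apply: Ele_wk (Ele_le _ _ h).
- by rewrite /Kmoment !exprS le_eqVlt; apply/orP; left; apply/eqP; field; rewrite gt_eqF.
- apply: measurable_funM; last apply: measurable_funB => //.
    exact: (measurable_funX N (gd_mK product_design)).
  exact: (gd_mK product_design).
move=> t; have h1 := ka t; have h2 := kb t; rewrite /Kbound -/(a t) -/(b t).
have k4 := kap4; have a0 : 0 <= a t by apply: le_trans h1; lra.
have b0 : 0 <= b t by apply: le_trans h2; lra.
exact: (sum_power_tail N a0 b0 h1 h2).
Qed.

Lemma Kbound_ge t : 2 * kap <= Kbound t.
Proof. by have := ka t; have := kb t; rewrite /Kbound -/(a t) -/(b t); lra. Qed.

Definition zeta_const : R := steinc (1 + gaussc) 1.

(** The Stein inequality on one copy, for the field z_i w_j, whose divergence is |z|^2 - n. It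
    controls R_6. *)
Lemma zeta_norm : Ele mu (fun t => (dot (zeta t) (zeta t) - n%:R) ^+ 2) (n%:R * zeta_const).
Proof.
pose z (t : T0) : 'cV[R]_n := gmat t *m w.
suff h : Ele mu0 (fun t => (dot (z t) (z t) - n%:R) ^+ 2) (n%:R * zeta_const) by exact: (Ele_fst h).
have w2 : \sum_j w j 0 ^+ 2 = 1 by rewrite -[RHS]w1; apply: eq_bigr => i _; rewrite expr2.
have zE t i : z t i 0 = \sum_j gmat t i j * w j 0 by rewrite mxE.
have mz i : measurable_fun setT (fun t => z t i 0).
  have -> : (fun t => z t i 0) = (fun t => \sum_j gmat t i j * w j 0) by apply/funext => t; rewrite zE.
  by apply: measurable_sum => j; apply: measurable_funM => //; exact: measurable_gmat.
have sp (e : 'I_n * 'I_p -> R) : \sum_k e k = \sum_i \sum_j e (i, j).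
  by rewrite pair_big /=; apply: eq_bigr => -[].
have zth k s t i : z (bth k s t) i 0 = z t i 0 + (i == k.1)%:R * (s * w k.2 0).
  rewrite !zE; have gE j : gmat (bth k s t) i j = gmat t i j + ((i, j) == k)%:R * s.
    exact: (gfield_H field0' k (i, j) s t).
  under eq_bigr do rewrite gE mulrDl; rewrite big_split /=; congr (_ + _).
  rewrite (bigD1 k.2) //= big1 ?addr0 => [|j /negPf jk]; last first.
    by rewrite -pair_eqE /pair_eq /= jk andbF !mul0r.
  by rewrite -pair_eqE /pair_eq /= eqxx andbT mulrA.
have Ez i : Ele mu0 (fun t => z t i 0 ^+ 2) (1 + gaussc).
  pose e (k : 'I_n * 'I_p) (t : T0) : R := (k.1 == i)%:R * w k.2 0.
  have e1 t : \sum_k e k t ^+ 2 = 1.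
    rewrite sp /= /e (bigD1 i) //= [X in _ + X]big1 ?addr0 => [|i' /negPf ii].
      by under eq_bigr do rewrite eqxx mul1r; exact: w2.
    by apply: big1 => j _; rewrite ii mul0r expr0n.
  have fl := gfield_direction field0' (index_enum_uniq _) (fun k => measurable_cst _) (fun k l s t _ => erefl) e1.
  have := gflow_moment2 fl (u := fun=> 1) (fun _ _ => erefl) (Ele_cst mu0 ler01).
  rewrite mulr1.
  have -> // : (fun t => 1 * (\sum_k e k t * gmat t k.1 k.2) ^+ 2) = (fun t => z t i 0 ^+ 2).
  apply/funext => t; rewrite mul1r; congr (_ ^+ 2); rewrite sp /= /e zE (bigD1 i) //= [X in _ + X]big1 ?addr0 => [|i' /negPf ii].
    by apply: eq_bigr => j _; rewrite eqxx mul1r mulrC.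
  by apply: big1 => j _; rewrite ii !mul0r.
pose f (k : 'I_n * 'I_p) t : R := w k.2 0 * z t k.1 0.
have mf k : measurable_fun setT (f k) by apply: measurable_funM.
have EF : Ele mu0 (fun t => \sum_i z t i 0 ^+ 2) (\sum_(i < n) (1 + gaussc)) by exact: Ele_sum.
have EL (s : R) : 0 < s <= 1 -> Ele mu0 (fun=> n%:R) n%:R by move=> _; exact: Ele_cst.
have FE t : \sum_k f k t ^+ 2 <= \sum_i z t i 0 ^+ 2.
  rewrite sp /= /f; apply: ler_sum => i _; under eq_bigr do rewrite /= exprMn.
  by rewrite -mulr_suml w2 mul1r.
have LE t s : 0 < s <= 1 -> \sum_k \sum_l (f k (bth l s t) - f k t) ^+ 2 <= s ^+ 2 * n%:R.
  move=> _; have E k l : (f k (bth l s t) - f k t) ^+ 2 = w k.2 0 ^+ 2 * ((k.1 == l.1)%:R * (s ^+ 2 * w l.2 0 ^+ 2)).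
    by rewrite /f zth; case: (k.1 == l.1); rewrite ?mulr1n ?mulr0n; ring.
  under eq_bigr => k _ do under eq_bigr => l _ do rewrite E.
  rewrite sp /= le_eqVlt; apply/orP; left; apply/eqP.
  transitivity (\sum_(i < n) s ^+ 2); last by rewrite sumr_const card_ord mulr_natr.
  apply: eq_bigr => i _; under eq_bigr => j _ do rewrite -mulr_sumr.
  rewrite -mulr_suml w2 mul1r sp /= (bigD1 i) //= [X in _ + X]big1 ?addr0 => [|i' /negPf ii]; last first.
    by apply: big1 => j _; rewrite eq_sym ii mul0r.
  by under eq_bigr do rewrite eqxx mul1r; rewrite -mulr_sumr w2 mulr1.
have [Xi EXi XiE] := stein_bound field0' (index_enum_uniq _) mf EF EL FE LE.
apply: Ele_wk (Ele_le _ _ EXi).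
- have -> : \sum_(i < n) (1 + gaussc) = n%:R * (1 + gaussc) :> R by rewrite sumr_const card_ord mulr_natl.
  rewrite /zeta_const /steinc; move: (expR 1) gaussc (n%:R : R) => *.
  by rewrite le_eqVlt; apply/orP; left; apply/eqP; ring.
- apply: (measurable_funX 2); apply: measurable_funB => //; apply: measurable_sum => i; exact: measurable_funM.
move=> t; rewrite sqr_ge0 /= (XiE t (fun k => w k.2 0 ^+ 2)); last first.
  move=> k _; have E : (fun m => (f k (bth k (- step m) t) - f k t) / - step m) = (fun=> w k.2 0 ^+ 2).
    apply/funext => m; rewrite /f zth eqxx mul1r.
    have s0 : (step m : R) != 0 by rewrite gt_eqF // step_gt0.
    by move: (step m : R) (z t _ _) (w _ _) s0 => s x e s0; field.
  by rewrite E; exact: cvg_cst.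
rewrite le_eqVlt; apply/orP; left; apply/eqP; congr (_ ^+ 2).
rewrite sumrB !sp /=; congr (_ - _); last by under eq_bigr do rewrite w2; rewrite sumr_const card_ord.
apply: eq_bigr => i _; rewrite {2}zE mulr_sumr; apply: eq_bigr => j _.
by rewrite /f /=; ring.
Qed.

End ProductDesign.

(** * Conclusion *)

Section RegularLoss.
Context {R : realType}.
Variables (Y : set R) (loss : R -> R -> R).
Hypothesis mY : measurable Y.
Hypothesis lossY : loss_regular loss Y.

(** A substitute loss; for a = 1 its derivative at 0 is different from 0. *)
Definition quad (a u : R) : R := (u - a) ^+ 2 / 2.

Let quad_derive (a u : R) : is_derive u (1 : R) (quad a) (u - a).
Proof.
have -> : quad a = 2^-1 \*: ((@id R - cst a) ^+ 2).
  by apply/funext => v; rewrite /quad mulrC.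
apply: is_derive_eq; rewrite subr0 /GRing.scale /= expr1.
by have -> : (@id R - cst a) u = u - a by []; field.
Qed.

Let derive_quad a : derive1 (quad a) = (fun u => u - a).
Proof. by apply/funext => u; rewrite derive1E; have [_ ->] := quad_derive a u. Qed.

Let convex_quad a : convexT (quad a : R^o -> R).
Proof.
move=> t x z _ _; have t0 : 0 <= t%:num :> R by [].
have t1 : t%:num <= 1 :> R by [].
change (quad a (t%:num * x + (1 - t%:num) * z) <= t%:num * quad a x + (1 - t%:num) * quad a z).
move: (t%:num) t0 t1 => s s0 s1; rewrite -subr_ge0 /quad.
rewrite (_ : _ - _ = s * (1 - s) * ((x - z) ^+ 2 / 2)); last by field.
by apply: mulr_ge0; [apply: mulr_ge0; lra|apply: divr_ge0 => //; exact: sqr_ge0].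
Qed.

Let regular_fun (f : R -> R) := [/\ convexT (f : R^o -> R), forall u, derivable f u 1,
  continuous (derive1 f) & 1.-lipschitz (derive1 f)].

Let regular_quad a : regular_fun (quad a).
Proof.
split; first exact: convex_quad.
- by move=> u; have [] := quad_derive a u.
- by rewrite derive_quad => u; apply: cvgB; [exact: cvg_id|exact: cvg_cst].
by rewrite derive_quad => -[u v] _ /=; rewrite mul1r opprB addrA subrK.
Qed.

Let regular_intro (l : R -> R -> R) : (forall u, measurable_fun setT (fun y0 => l y0 u)) ->
  (forall y0, regular_fun (l y0)) -> loss_regular l setT.
Proof. by move=> ml rl; split => // y0 _; have [] := rl y0. Qed.

Let extended (y0 : R) : R -> R := if y0 \in Y then loss y0 else quad 0.

Let regular_extended : loss_regular extended setT.
Proof.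
apply: regular_intro => [u|y0]; last first.
  rewrite /extended; case: ifPn => [/set_mem yY|_]; last exact: regular_quad.
  split; [exact: (loss_convex lossY)|exact: (loss_derivable lossY)|exact: (loss_C1 lossY)|exact: (loss_lipschitz lossY)].
have -> : (fun y0 => extended y0 u) = (fun y0 => if y0 \in Y then loss y0 u else quad 0 u).
  by apply/funext => y0; rewrite /extended; case: ifP.
have E : [set: R] `&` (fun y0 => y0 \in Y) @^-1` [set true] = Y.
  rewrite setTI; apply/funext => y0; apply/propext; rewrite /preimage /mkset.
  by split => [h|h]; [exact: (set_mem h)|exact: (mem_set h)].
apply: measurable_fun_if => //.
- by apply: (measurable_fun_bool true); rewrite E.
by rewrite E; exact: (loss_measurable lossY).
Qed.

(* The loss is changed outside Y and where its derivative vanishes at 0, that is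
   on a null event, so that it is regular everywhere. *)
Definition regularized (y0 : R) : R -> R :=
  if dloss extended y0 0 == 0 then quad 1 else extended y0.

Lemma regularized_regular : loss_regular regularized setT.
Proof.
apply: regular_intro => [u|y0]; last first.
  rewrite /regularized; case: ifPn => [_|_]; first exact: regular_quad.
  by split; [exact: (loss_convex regular_extended)|exact: (loss_derivable regular_extended)|
    exact: (loss_C1 regular_extended)|exact: (loss_lipschitz regular_extended)].
have -> : (fun y0 => regularized y0 u) = (fun y0 => if dloss extended y0 0 == 0 then quad 1 u else extended y0 u).
  by apply/funext => y0; rewrite /regularized; case: ifP.
apply: measurable_fun_ifT => //; last exact: (loss_measurable regular_extended).
by apply: measurable_fun_eqr => //; exact: (measurable_dloss regular_extended).
Qed.

Lemma regularized_nondeg y0 : dloss regularized y0 0 != 0.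
Proof.
rewrite /dloss /regularized; case: ifPn => // _.
by rewrite derive_quad sub0r oppr_eq0 oner_eq0.
Qed.

Lemma regularizedE y0 : Y y0 -> derive1 (loss y0) 0 != 0 -> regularized y0 = loss y0.
Proof.
move=> yY h; have E : extended y0 = loss y0 by rewrite /extended mem_set.
by rewrite /regularized /dloss E (negPf h).
Qed.

End RegularLoss.

(** * Dependence on the loss through the observed responses only *)

Section LossAgreement.
Context {R : realType} {n p : nat}.
Variables (loss loss' : R -> R -> R) (g : 'cV[R]_p -> R) (y : 'cV[R]_n).
Hypothesis agree : forall i, loss' (y i 0) = loss (y i 0).

Lemma betahat_agree : betahat loss' g y = betahat loss g y.
Proof.
apply/funext => X; rewrite /betahat; congr argmin; apply/funext => b.
by congr (_ * _ + _); apply: eq_bigr => i _; rewrite agree.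
Qed.

Lemma psihat_agree : psihat loss' g y = psihat loss g y.
Proof.
apply/funext => X; rewrite /psihat betahat_agree.
by apply/matrixP => i j; rewrite !mxE agree.
Qed.

Lemma Dhat_agree : Dhat loss' g y = Dhat loss g y.
Proof.
apply/funext => X; rewrite /Dhat betahat_agree; apply: (congr1 (@diag_mx R n)).
apply/rowP => i; rewrite [LHS]mxE [RHS]mxE.
exact: (congr1 (fun l => derive1 (derive1 l) ((X *m betahat loss g y X) i 0)) (agree i)).
Qed.

Lemma Vhat_agree : Vhat loss' g y = Vhat loss g y.
Proof. by apply/funext => X; rewrite /Vhat Dhat_agree. Qed.

Lemma jacobian_agree Sig tau X A : jacobian_matrix loss g Sig tau y X A ->
  jacobian_matrix loss' g Sig tau y X A.
Proof.
by case=> h1 h2 h3 h4 h5; split; rewrite /chat /dfhat ?Vhat_agree ?Dhat_agree ?psihat_agree ?betahat_agree.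
Qed.

Lemma coordinate_error_agree X A w gs Z j :
  coordinate_error loss' g y X A w gs Z j = coordinate_error loss g y X A w gs Z j.
Proof.
rewrite /coordinate_error /tstar /that /that2 /gammahat /dfhat /rhat /vhat.
by rewrite Vhat_agree Dhat_agree psihat_agree betahat_agree.
Qed.

End LossAgreement.

Section OffNull.
Import HBNNSimple.

(** The integral of a nonnegative function is a supremum over simple functions below it, and each of
    these is compared with [m] almost everywhere; [f] can be any nonnegative function. *)
Lemma le_integral_off_null (d : measure_display) (T : measurableType d) (R : realType)
    (mu : {measure set T -> \bar R}) (f m : T -> R) (N : set T) :
  mu.-negligible N -> (forall t, 0 <= f t) -> measurable_fun setT m -> (forall t, 0 <= m t) ->
  (forall t, ~ N t -> f t <= m t) -> (\int[mu]_t (f t)%:E <= \int[mu]_t (m t)%:E)%E.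
Proof.
move=> nN f0 mm m0 fm; rewrite ge0_integralTE; last by move=> t; rewrite lee_fin.
apply: ge_ereal_sup => _ [h hf <-]; rewrite -integralT_nnsfun.
apply: ae_ge0_le_integral => //.
- by move=> t _; rewrite lee_fin; exact: fun_ge0.
- by apply/measurable_EFinP; exact: measurable_funPT.
- by move=> t _; rewrite lee_fin.
- exact/measurable_EFinP.
apply: negligibleS nN => t /= ht; apply: contrapT => Nt; apply: ht => _.
by apply: (le_trans (hf t)); rewrite lee_fin fm.
Qed.

End OffNull.

(** * The doubled probability space *)

Section Doubling.
Context {R : realType} {n p : nat} {d : measure_display} {Omega : measurableType d}.
Variable P : probability Omega R.
Variables (x : 'I_n -> {RV P >-> p.-tuple R}) (U y : 'I_n -> {RV P >-> R}).
Variables (F : R -> R -> R) (w : 'cV[R]_p) (Y : set R).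
Hypothesis n0 : (0 < n)%N.
Hypothesis model : single_index_model x U y F w ((n%:R^-1)%:M) Y.
Local Notation sn := (Num.sqrt n%:R).
Local Notation wh := (sn^-1 *: w).
Local Notation mc := (model_coords x U).
Local Notation T0 := (@bspace R ('I_n * 'I_p)%type 'I_n).
Let nR0 : 0 < n%:R :> R. Proof. by rewrite ltr0n. Qed.
Let sn0 : 0 < sn :> R. Proof. by rewrite sqrtr_gt0. Qed.
Let sn2 : sn ^+ 2 = n%:R :> R. Proof. by rewrite sqr_sqrtr. Qed.

Definition double_law : probability (Omega * Omega)%type R := (P \x P)%E.
Definition double_coords (z : Omega * Omega) : (T0 * T0)%type := (mc z.1, mc z.2).
Local Notation law := (prod_law (model_law x U)).

Lemma measurable_double_coords : measurable_fun setT double_coords.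
Proof.
apply: measurable_fun_pair.
  exact: (measurableT_comp (measurable_model_coords x U) measurable_fst).
exact: (measurableT_comp (measurable_model_coords x U) measurable_snd).
Qed.

Lemma integral_double_law (f : T0 * T0 -> \bar R) : measurable_fun setT f ->
  (forall t, 0 <= f t)%E -> (\int[law]_t f t = \int[double_law]_z f (double_coords z))%E.
Proof.
move=> mf f0; rewrite integral_prod_law // /double_law fubini_tonelli1 //; last first.
  exact: (measurableT_comp mf measurable_double_coords).
rewrite (@integral_model_law _ _ _ _ _ _ x U (fun t1 => \int[model_law x U]_t2 f (t1, t2))%E); last 2 first.
- exact: (measurable_fun_fubini_tonelli_F (m2 := model_law x U) f mf f0).
- by move=> t; exact: integral_ge0.
apply: eq_integral => z1 _; rewrite /fubini_F integral_model_law //.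
exact: (measurableT_comp mf (measurable_pair1 _)).
Qed.

Lemma double_law_preimage B : measurable B -> double_law (double_coords @^-1` B) = law B.
Proof.
move=> mB; rewrite -[in RHS](setIT B) -(integral_indic _ measurableT mB).
rewrite integral_double_law; last 2 first.
- by apply/measurable_EFinP; exact: measurable_indic.
- by move=> t; rewrite lee_fin.
have mp : measurable (double_coords @^-1` B).
  by rewrite -[X in measurable X]setTI; exact: measurable_double_coords.
by rewrite -[in LHS](setIT (_ @^-1` _)) -(integral_indic _ measurableT mp).
Qed.

Lemma double_law_fst B : measurable B -> double_law (fst @^-1` B) = P B.
Proof.
move=> mB; have -> : fst @^-1` B = B `*` [set: Omega].
  by apply/seteqP; split => z //= [].
transitivity (P B * P setT)%E; first exact: product_measure1E.
by rewrite [X in (_ * X)%E]probability_setT mule1.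
Qed.

Lemma negligible_double_fst N : P.-negligible N -> double_law.-negligible (fst @^-1` N).
Proof.
move=> [B [mB B0 NB]]; exists (fst @^-1` B); split.
- by rewrite -[X in measurable X]setTI; exact: measurable_fst.
- by rewrite double_law_fst.
by move=> z /NB.
Qed.

Lemma negligible_double_coords N : law.-negligible N -> double_law.-negligible (double_coords @^-1` N).
Proof.
move=> [B [mB B0 NB]]; exists (double_coords @^-1` B); split.
- by rewrite -[X in measurable X]setTI; exact: measurable_double_coords.
- by rewrite double_law_preimage.
by move=> z /NB.
Qed.

Lemma whK : sn *: wh = w.
Proof. by rewrite scalerA mulfV ?scale1r // gt_eqF. Qed.

Lemma wh1 : dot wh wh = 1.
Proof.
have sE (M : 'M[R]_1) (a : R) : (a *: M) 0 0 = a * M 0 0 by rewrite mxE.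
have := sim_index model; rewrite mul_mx_scalar -scalemxAl sE dotE dotZl dotZr => h.
by rewrite mulrA -expr2 exprVn sn2.
Qed.

Let gmatE omega : gmat (mc omega) = sn *: design x omega.
Proof. by apply/matrixP => i j; rewrite !mxE. Qed.

Lemma double_design z : cfgX (@Hmat R n p wh) (@zvec R n p wh) wh (double_coords z) = design x z.1.
Proof.
by rewrite /cfgX (model_designE wh1) gmatE scalerA mulVf ?scale1r // gt_eqF.
Qed.

Lemma double_response z : yvec wh F (double_coords z) = response y z.1.
Proof.
apply/matrixP => i j; rewrite [LHS]mxE [RHS]mxE (sim_response model); congr F.
rewrite /zvec gmatE -scalemxAl -scalemxAr scalerA mulfV ?gt_eqF // scale1r mxE [RHS]mxE.
by apply: eq_bigr => k _; rewrite !mxE.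
Qed.

End Doubling.

(** * The bound for a separable penalty *)

Section MainBound.
Context {R : realType} {n p : nat} {d : measure_display} {Omega : measurableType d}.
Variable P : probability Omega R.
Variables (x : 'I_n -> {RV P >-> p.-tuple R}) (U y : 'I_n -> {RV P >-> R}).
Variables (F : R -> R -> R) (w : 'cV[R]_p) (Y : set R).
Variables (loss : R -> R -> R) (g : 'cV[R]_p -> R) (gs : 'I_p -> R -> R).
Variables (A : 'cV[R]_n -> 'M[R]_(n, p) -> 'M[R]_p) (delta tau : R).
Local Notation Sig := ((n%:R^-1)%:M : 'M[R]_p).
Local Notation sn := (Num.sqrt n%:R).
Local Notation wh := (sn^-1 *: w).
Hypotheses (n0 : (0 < n)%N) (p0 : (0 < p)%N) (delta0 : 0 < delta) (tau0 : 0 < tau).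
Hypothesis model : single_index_model x U y F w Sig Y.
Hypothesis ratio : (2 * delta)^-1 <= p%:R / n%:R <= delta^-1.
Hypothesis lossY : loss_regular loss Y.
Hypothesis pen : penalty_regular g Sig tau.
Hypothesis nondeg : forall i, {ae P, forall omega, derive1 (loss (y i omega)) 0 != 0}.
Hypothesis cgs : forall j, convexT (gs j : R^o -> R).
Hypothesis gE : forall b, g b = n%:R^-1 * \sum_j gs j (b j 0).
Hypothesis jac : {ae P, forall omega, jacobian_matrix loss g Sig tau (response y omega) (design x omega)
  (A (response y omega) (design x omega))}.
Let nR0 : 0 < n%:R :> R. Proof. by rewrite ltr0n. Qed.
Let pR0 : 0 < p%:R :> R. Proof. by rewrite ltr0n. Qed.
Let sn0 : 0 < sn :> R. Proof. by rewrite sqrtr_gt0. Qed.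

(** 13 + 12/delta dominates 1 + 12(1 + p/n), and 17 = 13 + 4; the summand 1/tau makes the stability
    constant at most [K]. *)
Definition radius (a b : R) : R := 17 + b^-1 + 12 / a.
Local Notation kap := (radius delta tau).
Local Notation rloss := (regularized Y loss).
Local Notation P2 := (double_law P).
Local Notation dc := (double_coords x U).

Let radius4 : 4 <= kap.
Proof.
have a0 : 0 < tau^-1 by rewrite invr_gt0.
have b0 : 0 < 12 / delta by rewrite divr_gt0.
by rewrite /radius; lra.
Qed.

Let radius_tau : tau^-1 <= kap.
Proof. by have b0 : 0 < 12 / delta by [rewrite divr_gt0|]; rewrite /radius; lra. Qed.

Let radius_p : 1 + 12 * (1 + p%:R / n%:R) <= kap.
Proof.
have a0 : 0 < tau^-1 by rewrite invr_gt0.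
by case/andP: ratio => _; rewrite /radius; move: (p%:R / n%:R) => q; lra.
Qed.

Let er : estimator_regular n rloss g gs tau.
Proof.
split => //.
- exact: regularized_regular (sim_range_measurable model) lossY.
- by move=> y0; exact: regularized_nondeg.
Qed.

Let bad : set Omega := [set omega | ~ ((forall i, Y (y i omega)) /\
  (forall i, derive1 (loss (y i omega)) 0 != 0) /\
  jacobian_matrix loss g Sig tau (response y omega) (design x omega)
    (A (response y omega) (design x omega)))].

Let negligible_bad : P.-negligible bad.
Proof.
have rangeY i : {ae P, forall omega, Y (y i omega)}.
  have mYi : measurable (y i @^-1` Y).
    by rewrite -[X in measurable X]setTI; apply: measurable_funPT => //; exact: (sim_range_measurable model).
  exists (~` (y i @^-1` Y)); split => //; first exact: measurableC.
  by rewrite probability_setC // (sim_range model) subee.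
have h1 : {ae P, forall omega, forall i, Y (y i omega)} by exact: filter_forall.
have h2 : {ae P, forall omega, forall i, derive1 (loss (y i omega)) 0 != 0} by exact: filter_forall.
have h := filterI h1 (filterI h2 jac).
exact: h.
Qed.

Definition bound_const (a b : R) : R :=
  majorant_const (Kmoment (radius a b)) (2 * radius a b) zeta_const.

Theorem separable_bound : exists Z : 'I_p -> {RV P2 >-> R},
  (forall j, std_normal P2 (Z j)) /\
  ((p%:R^-1)%:E * \sum_(j < p) 'E_P2[(fun z =>
     coordinate_error loss g (response y z.1) (design x z.1)
       (A (response y z.1) (design x z.1)) wh gs (Z j z) j)]
   <= (Num.sqrt (2 * delta) * bound_const delta tau / Num.sqrt p%:R)%:E)%E.
Proof.
have field0 := model_field n0 model.
have w1 := wh1 model.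
have mF := sim_link_measurable model.
have gd := product_design field0 w1 n0 p0 mF radius4 radius_tau radius_p.
have EK := Kbound_moment field0 w1 n0 p0 mF radius4 radius_tau radius_p.
have EKk := Kbound_tail field0 w1 n0 p0 mF radius4 radius_tau radius_p.
have kK := Kbound_ge field0 kap w1.
have Ez := zeta_norm field0 w1.
have k00 : 0 <= 2 * kap by have := radius4; move: (kap) => k; lra.
have [maj [mmaj maj0 [_ _ Emaj]] [N [mN N0 PN]]] := coordinate_majorant gd er EK kK k00 EKk Ez.
pose nz j := noise (pth wh) (@Hmat R n p wh) (@zvec R n p wh) (yvec wh F) wh rloss g j.
have mdc := measurable_double_coords x U.
have mZ j : measurable_fun setT (fun z => nz j (dc z)).
  exact: (measurableT_comp (measurable_noise gd er j) mdc).
pose Z j : {RV P2 >-> R} := mfun_Sub (mem_set (mZ j)).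
exists Z; split=> [j B mB|].
  have mpre : measurable (nz j @^-1` B).
    by rewrite -[X in measurable X]setTI; apply: (measurable_noise gd er j).
  rewrite -(noise_law gd er j mB) -(double_law_preimage x U mpre).
  by [].
have nN : (prod_law (model_law x U)).-negligible N by exists N; split.
(* Outside this set the regularized loss agrees with the given one at the responses, A is a Jacobian
   matrix there, and the majorant applies. *)
have nbad : P2.-negligible (fst @^-1` bad `|` dc @^-1` N).
  by apply: negligibleU; [exact: negligible_double_fst|exact: negligible_double_coords].
have mmaj' j : measurable_fun setT (fun z => maj j (dc z)).
  exact: (measurableT_comp (mmaj j) mdc).
have bound j : ('E_P2[(fun z => coordinate_error loss g (response y z.1) (design x z.1)
       (A (response y z.1) (design x z.1)) wh gs (Z j z) j)] <= \int[P2]_z (maj j (dc z))%:E)%E.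
  rewrite unlock; apply: (le_integral_off_null nbad) => // [z|z hz].
    by rewrite /coordinate_error mulr_ge0 ?divr_ge0 ?sqr_ge0 ?exprn_ge0.
  have hN : ~ N (dc z) by move=> h; apply: hz; right.
  have [yY [yn jz]] : (forall i, Y (y i z.1)) /\ (forall i, derive1 (loss (y i z.1)) 0 != 0) /\
      jacobian_matrix loss g Sig tau (response y z.1) (design x z.1)
        (A (response y z.1) (design x z.1)).
    by apply: contrapT => h; apply: hz; left.
  have ag i : rloss (response y z.1 i 0) = loss (response y z.1 i 0).
    by rewrite [response y z.1 i 0]mxE; exact: regularizedE.
  rewrite -(coordinate_error_agree g ag).
  have := PN _ hN (A (response y z.1) (design x z.1)).
  rewrite (double_design n0 model) (double_response n0 model) => /(_ (jacobian_agree ag jz) j).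
  exact.
have total : (\sum_(j < p) 'E_P2[(fun z => coordinate_error loss g (response y z.1) (design x z.1)
       (A (response y z.1) (design x z.1)) wh gs (Z j z) j)] <= (sn * bound_const delta tau)%:E)%E.
  apply: (@le_trans _ _ (\sum_(j < p) \int[P2]_z (maj j (dc z))%:E)%E); first exact: lee_sum.
  rewrite -ge0_integral_sum //; last 2 first.
  - by move=> j; apply/measurable_EFinP.
  - by move=> j z _; rewrite lee_fin.
  apply: le_trans Emaj; rewrite integral_double_law; last 2 first.
  - by apply/measurable_EFinP; apply: measurable_sum.
  - by move=> t; rewrite lee_fin sumr_ge0.
  rewrite le_eqVlt; apply/orP; left; apply/eqP; apply: eq_integral => z _.
  by rewrite sumEFin.
have c0 : 0 <= sn * bound_const delta tau.
  rewrite -lee_fin; apply: le_trans Emaj; apply: integral_ge0 => t _; rewrite lee_fin.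
  exact: sumr_ge0.
have pinv0 : (0 <= (p%:R^-1)%:E :> \bar R)%E by rewrite lee_fin invr_ge0 ltW.
apply: (le_trans (lee_wpmul2l pinv0 total)); rewrite -EFinM lee_fin.
move: (bound_const delta tau) c0 => b c0; have b0 : 0 <= b by move: c0; rewrite pmulr_rge0.
have sp0 : 0 < Num.sqrt p%:R :> R by rewrite sqrtr_gt0.
(* The lower bound on p/n gives n <= 2 delta p, which converts sqrt n / p into the rate 1/sqrt p. *)
have snp : sn <= Num.sqrt (2 * delta) * Num.sqrt p%:R.
  have d2 : 0 < 2 * delta by rewrite mulr_gt0.
  rewrite -sqrtrM ?(ltW d2) //; apply: ler_wsqrtr.
  case/andP: ratio => h _; move: h; rewrite ler_pdivlMr // mulrC ler_pdivrMr //.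
  by rewrite mulrC.
have sp2 : Num.sqrt p%:R ^+ 2 = p%:R :> R by rewrite sqr_sqrtr // ltW.
rewrite ler_pdivlMr // -{1}sp2.
move: (Num.sqrt p%:R) sp0 snp => s s0 snp.
have -> : (s ^+ 2)^-1 * (sn * b) * s = sn / s * b.
  by field; rewrite gt_eqF.
by apply: ler_wpM2r => //; rewrite ler_pdivrMr.
Qed.

End MainBound.

Theorem corollary4p2 (R : realType) :
  exists C : R -> R -> R -> R,
  forall (delta tau kappa : R), 0 < delta -> 0 < tau -> 1 <= kappa ->
  forall (n p : nat) (d : measure_display) (Omega : measurableType d)
    (P : probability Omega R)
    (x : 'I_n -> {RV P >-> p.-tuple R}) (U y : 'I_n -> {RV P >-> R})
    (F : R -> R -> R) (w : 'cV[R]_p) (Sigma : 'M[R]_p) (Y : set R)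
    (loss : R -> R -> R) (g : 'cV[R]_p -> R) (gs : 'I_p -> R -> R)
    (A : 'cV[R]_n -> 'M[R]_(n, p) -> 'M[R]_p),
  Sigma = (n%:R^-1)%:M ->
  single_index_model x U y F w Sigma Y ->
  (2 * delta)^-1 <= p%:R / n%:R <= delta^-1 ->
  opnorm Sigma * opnorm (invmx Sigma) <= kappa ->
  loss_regular loss Y ->
  penalty_regular g Sigma tau ->
  (forall i, {ae P, forall omega, derive1 (loss (y i omega)) 0 != 0}) ->
  (forall j, convexT (gs j : R^o -> R)) ->
  (forall b, g b = n%:R^-1 * \sum_j gs j (b j 0)) ->
  (forall j k, measurable_fun setT
    (fun omega => A (response y omega) (design x omega) j k)) ->
  {ae P, forall omega,
    jacobian_matrix loss g Sigma tau (response y omega) (design x omega)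
      (A (response y omega) (design x omega))} ->
  (* Z lives on an extension of (Omega, P), along proj. *)
  exists (d' : measure_display) (Omega' : measurableType d')
    (P' : probability Omega' R) (proj : {RV P' >-> Omega})
    (Z : 'I_p -> {RV P' >-> R}),
  [/\ has_law P' proj P,
      (forall j, std_normal P' (Z j)) &
      ((p%:R^-1)%:E * \sum_(j < p) 'E_P'[(fun omega' => (
          let y' := response y (proj omega') in
          let X' := design x (proj omega') in
          let A' := A y' X' in
          let v := vhat loss g y' X' A' in
          let r := rhat loss g y' X' in
          let t := Num.sg (tstar loss g Sigma w y' X' A') *
                   that loss g Sigma y' X' A' in
          v ^+ 2 / r ^+ 2 *
          `|betahat loss g y' X' j 0
            - prox (fun u => v^-1 * gs j u)
                (r / v * Z j omega' + t / v * w j 0)| ^+ 2)%R)]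
       <= (C delta tau kappa / Num.sqrt p%:R)%:E)%E].
Proof.
exists (fun delta tau _ => Num.sqrt (2 * delta) * bound_const delta tau).
move=> delta tau kappa delta0 tau0 _ n p d Omega P x U y F w Sigma Y loss g gs A -> model ratio _
  lossY pen nondeg cgs gE _ jac.
(* Both n = 0 and p = 0 would make this quotient 0, against the lower bound on it. *)
have q0 : 0 < p%:R / n%:R :> R.
  by case/andP: ratio => h _; apply: lt_le_trans h; rewrite invr_gt0 mulr_gt0.
have n0 : (0 < n)%N by rewrite lt0n; apply: contraTneq q0 => ->; rewrite invr0 mulr0 ltxx.
have p0 : (0 < p)%N by rewrite lt0n; apply: contraTneq q0 => ->; rewrite mul0r ltxx.
have [Z [nZ bZ]] := separable_bound n0 p0 delta0 tau0 model ratio lossY pen nondeg cgs gE jac.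
exists _, (Omega * Omega)%type, (double_law P), (mfun_Sub (mem_set measurable_fst)), Z; split => //.
  by move=> B mB; exact: double_law_fst.
move: bZ; rewrite /coordinate_error (whK w n0); exact.
Qed.
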